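(* Assume (A1)–(A5) as stated in the context. Let $\widehat S_n(\lambda)$, $\lambda\in\Lambda_n=\{0,1,\dots,k_n\}$, be the sets of covariates selected by forward stepwise regression on $\mathcal D_1$, with $k_n=A\log n$ for some constant $A>0$, and let $\widehat S_n$, $\widehat D_n$ be the resulting multi-stage selectors (all defined in the context). Then: 1. $\mathbb P(D\subset\widehat S_n(\lambda_* ))\to1$, where $\lambda_*=\arg\min_{\lambda\in\Lambda_n}L(\lambda)$. 2. $\mathbb P(D\subset\widehat S_n(\widehat\lambda))\to1$, where $\widehat\lambda=\arg\min_{\lambda\in\Lambda_n}\widehat L(\lambda)$. 3. For fixed level $\alpha\in(0,1)$, $\limsup_{n\to\infty}\mathbb P(D^c\cap\widehat D_n\neq\varnothing)\le\alpha$. 4. If the level is $\alpha=\alpha_n$ with $\alpha_n\to0$ and $\sqrt n\,\alpha_n\to\infty$, then $\mathbb P(\widehat D_n=D)\to1$. 5. For fixed level $\alpha\in(0,1)$, $\liminf_{n\to\infty}\mathbb P(\widehat D_n\subset D\subset\widehat S_n)\ge1-\alpha$.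
   Context: **Model and standing assumptions.** We observe i.i.d. pairs $(X_i,Y_i)$ with $X_i=(X_{i1},\dots,X_{ip})^T\in\mathbb R^p$, where $p=p_n>n$ and $\beta\in\mathbb R^p$. There are $3n$ observations, split randomly into three groups $\mathcal D_1,\mathcal D_2,\mathcal D_3$ of size $n$ each. $D=\{j:\beta_j\neq0\}$, taken to be $\{1,\dots,s\}$; $S=\{1,\dots,p\}$; $D^c=S\setminus D$; $\psi=\min_{j\in D}|\beta_j|$. The symbol $\subset$ denotes non-strict inclusion. For an $n\times p$ design matrix $X$ (rows $X_i^T$ of one group) and $M\subset S$, $X_M$ is the submatrix of columns indexed by $M$, and $X_{\bullet j}$ is the $j$th column. For a square matrix $C$, $\phi(C)$ and $\Phi(C)$ are its smallest and largest eigenvalues, and $\phi_n(k)=\min_{|M|=k}\phi(\frac1nX_M^TX_M)$, $\Phi_n(k)=\max_{|M|=k}\Phi(\frac1nX_M^TX_M)$. (A1) $Y_i=X_i^T\beta+\varepsilon_i$ with $\varepsilon_i\sim N(0,\sigma^2)$ i.i.d., independent of the covariates. (A2) $p_n\to\infty$ and $p_n\le c_1e^{n^{c_2}}$ for some $c_1>0$, $0\le c_2<1$. (A3) $s=|D|=O(1)$ and $\psi>0$. (Only $p_n$ varies with $n$: $s$, the nonzero coefficients and $\sigma^2$ do not depend on $n$.) (A4) There are positive constants $C_0,C_1,\kappa$ with $\mathbb P(\limsup_{n\to\infty}\Phi_n(n)\le C_0)=1$ and $\mathbb P(\liminf_{n\to\infty}\phi_n(C_1\log n)\ge\kappa)=1$;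 also $\mathbb P(\phi_n(n)>0)=1$ for all $n$. (This is for the design matrix of each group.) (A5) $\mathbb E(X_{ij})=0$, $\mathbb E(X_{ij}^2)=1$, and for some $0<B<\infty$, $\mathbb P(|X_{jk}|\le B)=1$. **Forward stepwise screening (stage I, with $X,Y$ the design matrix and response vector of $\mathcal D_1$).** $k_n=A\log n$ (read as an integer, by rounding). (i) Initialize $\mathrm{Res}=Y$, $\lambda=0$, $\widehat Y=0$, $\widehat S_n(0)=\varnothing$. (ii) Let $\lambda\leftarrow\lambda+1$ and compute $\widehat\mu_j=n^{-1}\langle X_{\bullet j},\mathrm{Res}\rangle$ for $j=1,\dots,p$. (iii) Let $J=\arg\max_j|\widehat\mu_j|$, $\widehat S_n(\lambda)=\widehat S_n(\lambda-1)\cup\{J\}$, $\widehat Y=X_\lambda\widehat\beta(\lambda)$ with $X_\lambda=X_{\widehat S_n(\lambda)}$ and $\widehat\beta(\lambda)=(X_\lambda^TX_\lambda)^{-1}X_\lambda^TY$, and $\mathrm{Res}=Y-\widehat Y$. (iv) If $\lambda=k_n$ stop; otherwise go to (ii). The vector $\widehat\beta(\lambda)$ is extended by $0$ to $\mathbb R^p$. For technical reasons the final estimator $x^T\widehat\beta$ is assumed truncated to be no larger than $B$. The true loss is $L(\lambda)=\frac1n(\widehat\beta(\lambda)-\beta)^TX^TX(\widehat\beta(\lambda)-\beta)$. **Cross-validation (stage II, data $\mathcal D_2$).** $\widehat L(\lambda)=\frac1n\sum_{i\in\mathcal D_2}(Y_i-X_i^T\widehat\beta(\lambda))^2$; $\widehat\lambda$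 minimizes $\widehat L$ over $\Lambda_n$; $\widehat S_n=\widehat S_n(\widehat\lambda)$. **Cleaning (stage III, data $\mathcal D_3$).** Let $M=\widehat S_n$, $m=|\widehat S_n|$, and (now with $X,Y$ from $\mathcal D_3$) $\widehat\beta_M=(X_M^TX_M)^{-1}X_M^TY$. For $j\in M$, $T_j=\widehat\beta_{M,j}/\big(\widehat\sigma\sqrt{e_j^T(X_M^TX_M)^{-1}e_j}\big)$ is the usual $t$-statistic, where $e_j$ is the unit vector for coordinate $j$ and $\widehat\sigma^2$ is the usual residual variance estimate with $n-m$ degrees of freedom. For level $\alpha$, $\widehat D_n=\{j\in\widehat S_n:|T_j|>c_n\}$ with $c_n=z_{\alpha/(2m)}$, where $z_u$ is the upper $u$-quantile of $N(0,1)$: $\mathbb P(Z>z_u)=u$. *)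

(* Defs.v *)
From HB Require Import structures.
From mathcomp Require Import all_boot all_order all_algebra.
From mathcomp Require Import all_classical all_reals all_analysis.

Set Implicit Arguments.
Unset Strict Implicit.
Unset Printing Implicit Defensive.

Import Order.TTheory GRing.Theory Num.Theory.
Import numFieldNormedType.Exports.

Local Open Scope classical_set_scope.
Local Open Scope ring_scope.

Section Regression.
Context {R : realType} {n p : nat}.
Implicit Types (X : 'M[R]_(n, p)) (Y : 'cV[R]_n) (beta : 'cV[R]_p)
  (M : {set 'I_p}).

Definition supp beta : {set 'I_p} := [set j | beta j 0 != 0]%SET.

(** In \bar R, so that the minimum over an empty support is +oo. *)
Definition min_signal beta : \bar R :=
  \big[Order.min/+oo%E]_(j in supp beta) (`|beta j 0|)%:E.

Definition cols X M : 'M[R]_(n, #|M|) := colsub (fun i : 'I_#|M| => enum_val i) X.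

Definition gram X M : 'M[R]_#|M| := (cols X M)^T *m cols X M.

Definition min_eig (m : nat) (C : 'M[R]_m) : R := inf [set a : R | eigenvalue C a].
Definition max_eig (m : nat) (C : 'M[R]_m) : R := sup [set a : R | eigenvalue C a].

Definition sparse_min_eig X (k : nat) : R :=
  inf [set min_eig (n%:R^-1 *: gram X M) | M in [set M : {set 'I_p} | #|M| = k]].
Definition sparse_max_eig X (k : nat) : R :=
  sup [set max_eig (n%:R^-1 *: gram X M) | M in [set M : {set 'I_p} | #|M| = k]].

Definition ols X Y M : 'cV[R]_#|M| := invmx (gram X M) *m ((cols X M)^T *m Y).

Definition residual X Y M : 'cV[R]_n := Y - cols X M *m ols X Y M.

(** The least squares coefficients, extended by 0 outside M. *)
Definition ols_ext X Y M : 'cV[R]_p :=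
  \sum_(i < #|M|) ols X Y M i 0 *: delta_mx (enum_val i) 0.

Definition score X Y M (j : 'I_p) : R :=
  n%:R^-1 * \sum_(i < n) X i j * residual X Y M i 0.

(** [pick] returns the first index in the enumeration, so that ties in the
    argmax are broken by the smallest index. *)
Definition fs_step X Y M : {set 'I_p} :=
  if [pick J | [forall j, `|score X Y M j| <= `|score X Y M J|]] is Some J
  then (J |: M)%SET else M.

(** For M = set0 the residual is Y, so this is the initialization Res = Y. *)
Definition fs_set X Y (l : nat) : {set 'I_p} := iter l (fs_step X Y) finset.set0.

Definition fs_coef X Y (l : nat) : 'cV[R]_p := ols_ext X Y (fs_set X Y l).

Definition true_loss X Y beta (l : nat) : R :=
  let v := fs_coef X Y l - beta in n%:R^-1 * (v^T *m X^T *m X *m v) 0 0.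

(** (X, Y) is the screening sample and (X', Y') the validation sample. *)
Definition cv_loss X Y (X' : 'M[R]_(n, p)) (Y' : 'cV[R]_n) (l : nat) : R :=
  n%:R^-1 * \sum_(i < n) (Y' i 0 - (X' *m fs_coef X Y l) i 0) ^+ 2.

Definition oracle_lambda X Y beta (k : nat) : 'I_k.+1 :=
  [arg min_(l < ord0 : 'I_k.+1) true_loss X Y beta l]%O.

Definition cv_lambda X Y (X' : 'M[R]_(n, p)) (Y' : 'cV[R]_n) (k : nat) : 'I_k.+1 :=
  [arg min_(l < ord0 : 'I_k.+1) cv_loss X Y X' Y' l]%O.

Definition sigma2_hat X Y M : R :=
  (\sum_(i < n) residual X Y M i 0 ^+ 2) / (n - #|M|)%N%:R.

(** The index i : 'I_#|M| stands for the covariate enum_val i of M. *)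
Definition t_stat X Y M (i : 'I_#|M|) : R :=
  ols X Y M i 0 / (Num.sqrt (sigma2_hat X Y M) * Num.sqrt (invmx (gram X M) i i)).

(** The upper u-quantile z_u of N(0, 1); for 0 < u < 1 it exists and is unique. *)
Definition z_quantile (u : R) : R :=
  xget 0 [set z : R | normal_prob 0 1 [set x : R | z < x] = u%:E].

Definition clean X Y M (alpha : R) : {set 'I_p} :=
  [set enum_val i | i : 'I_#|M| &
     (z_quantile (alpha / (2 * #|M|%:R)) < `|t_stat X Y i|)%R]%SET.

End Regression.

Section Independence.
Context {d} {T : measurableType d} {R : realType} (P : probability T R).

Definition indep2 d1 d2 (E1 : measurableType d1) (E2 : measurableType d2)
    (U : T -> E1) (V : T -> E2) : Prop :=
  forall A B, measurable A -> measurable B ->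
    P (U @^-1` A `&` V @^-1` B) = (P (U @^-1` A) * P (V @^-1` B))%E.

(** Taking some of the sets A i to be setT gives the product rule for
    subfamilies. *)
Definition mutually_indep (I : finType) d1 (E : measurableType d1)
    (V : I -> T -> E) : Prop :=
  forall A : I -> set E, (forall i, measurable (A i)) ->
    P (\bigcap_(i in setT) (V i @^-1` A i)) = (\prod_(i : I) P (V i @^-1` A i))%E.

Definition identically_distributed (I : finType) d1 (E : measurableType d1)
    (V : I -> T -> E) : Prop :=
  forall i j A, measurable A -> P (V i @^-1` A) = P (V j @^-1` A).

Definition iid (I : finType) d1 (E : measurableType d1) (V : I -> T -> E) : Prop :=
  mutually_indep V /\ identically_distributed V.

End Independence.

(** [k] is the real number [x] rounded to an integer (up, down or nearest). *)
Definition rounds {R : realType} (k : nat) (x : R) : Prop := `|k%:R - x| < 1.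

Section Model.
Context {d} {T : measurableType d} {R : realType} (P : probability T R).

(** For each n, a sample of 3 n observations in dimension p n.
    [split_map n w (g, r)] is the observation that forms row r of group g. *)
Record sample (p : nat -> nat) := Sample {
  covariates : forall n, 'I_(3 * n) -> {RV P >-> (p n).-tuple R};
  response : forall n, 'I_(3 * n) -> {RV P >-> R};
  noise : forall n, 'I_(3 * n) -> {RV P >-> R};
  split_map : forall n, T -> {ffun 'I_3 * 'I_n -> 'I_(3 * n)} }.

Section Assumptions.
Context (p : nat -> nat) (S : sample p).

Definition observation n (i : 'I_(3 * n)) (w : T) : (p n).-tuple R * R :=
  (covariates S i w, response S i w).

Definition all_observations n (w : T) : (3 * n).-tuple ((p n).-tuple R * R) :=
  [tuple observation i w | i < 3 * n].
Definition all_covariates n (w : T) : (3 * n).-tuple ((p n).-tuple R) :=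
  [tuple covariates S i w | i < 3 * n].
Definition all_noise n (w : T) : (3 * n).-tuple R :=
  [tuple noise S i w | i < 3 * n].

Definition design n (g : 'I_3) (w : T) : 'M[R]_(n, p n) :=
  \matrix_(r, j) tnth (covariates S (split_map S n w (g, r)) w) j.
Definition resp n (g : 'I_3) (w : T) : 'cV[R]_n :=
  \col_r response S (split_map S n w (g, r)) w.

Definition iid_observations : Prop := forall n, iid P (@observation n).

(** There are (3 n)! injective maps from 'I_3 * 'I_n to 'I_(3 n), and the
    assignment of observations to groups is uniform among them. *)
Definition random_split : Prop :=
  forall n,
    [/\ forall f, measurable (split_map S n @^-1` [set f]),
        forall f : {ffun 'I_3 * 'I_n -> 'I_(3 * n)}, injective f ->
          P (split_map S n @^-1` [set f]) = (((3 * n)`!)%:R^-1)%:E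
      & forall f A, measurable A ->
          P (split_map S n @^-1` [set f] `&` @all_observations n @^-1` A) =
          (P (split_map S n @^-1` [set f]) * P (@all_observations n @^-1` A))%E].

Definition assumption_A1 (beta : forall n, 'cV[R]_(p n)) (sigma : R) : Prop :=
  forall n,
    [/\ forall (i : 'I_(3 * n)) w,
          response S i w =
          \sum_(j < p n) tnth (covariates S i w) j * beta n j 0 + noise S i w,
        forall (i : 'I_(3 * n)) A, measurable A ->
          distribution P (noise S i) A = normal_prob 0 sigma A,
        iid P (fun i : 'I_(3 * n) => noise S i : T -> R)
      & indep2 P (@all_noise n) (@all_covariates n)].

Definition assumption_A4 : Prop :=
  exists C0 C1 kappa : R, exists q : nat -> nat,
    [/\ [/\ 0 < C0, 0 < C1 & 0 < kappa],
        forall n, rounds (q n) (C1 * ln n%:R)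
      & forall g : 'I_3,
        [/\ {ae P, forall w,
              (limn_esup (fun n => (sparse_max_eig (design n g w) n)%:E) <= C0%:E)%E},
            {ae P, forall w,
              (kappa%:E <= limn_einf (fun n =>
                 (sparse_min_eig (design n g w) (q n))%:E))%E}
          & forall n, (0 < n)%N ->
              {ae P, forall w, 0 < sparse_min_eig (design n g w) n}]].

Definition assumption_A5 : Prop :=
  exists B : R, 0 < B /\
    forall n (i : 'I_(3 * n)) (j : 'I_(p n)),
      [/\ ('E_P[fun w => tnth (covariates S i w) j] = 0)%E,
          ('E_P[fun w => (tnth (covariates S i w) j ^+ 2)%R] = 1)%E
        & P [set w | `|tnth (covariates S i w) j| <= B] = 1%E].

End Assumptions.

Definition assumption_A2 (p : nat -> nat) : Prop :=
  p n @[n --> \oo] --> \oo /\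
  exists c1 c2 : R, [/\ 0 < c1, 0 <= c2 < 1 &
    forall n, (0 < n)%N -> (p n)%:R <= c1 * expR (n%:R `^ c2)].

(** [s] and the nonzero coefficients [b 0, ..., b (s - 1)] do not depend on n. *)
Definition assumption_A3 (p : nat -> nat) (beta : forall n, 'cV[R]_(p n))
    (s : nat) (b : nat -> R) : Prop :=
  forall n, (0 < n)%N ->
    [/\ supp (beta n) = [set j : 'I_(p n) | (j < s)%N]%SET,
        #|supp (beta n)| = s,
        (forall j : 'I_(p n), j \in supp (beta n) -> beta n j 0 = b j)
      & (0 < min_signal (beta n))%E].

(** Groups 0, 1, 2 are used in stages I, II, III *)

Section Selectors.
Context (p : nat -> nat) (S : sample p).

Definition gI : 'I_3 := inord 0.
Definition gII : 'I_3 := inord 1.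
Definition gIII : 'I_3 := inord 2.

Definition Shat_at n (l : nat) (w : T) : {set 'I_(p n)} :=
  fs_set (design S n gI w) (resp S n gI w) l.

Definition lambda_star (beta : forall n, 'cV[R]_(p n)) n (k : nat) (w : T) : nat :=
  oracle_lambda (design S n gI w) (resp S n gI w) (beta n) k.

Definition lambda_hat n (k : nat) (w : T) : nat :=
  cv_lambda (design S n gI w) (resp S n gI w)
            (design S n gII w) (resp S n gII w) k.

Definition Shat n (k : nat) (w : T) : {set 'I_(p n)} := Shat_at n (lambda_hat n k w) w.

Definition Dhat n (k : nat) (alpha : R) (w : T) : {set 'I_(p n)} :=
  clean (design S n gIII w) (resp S n gIII w) (Shat n k w) alpha.

End Selectors.

End Model.

(* Main.v *)
(** Screening.  As long as a signal is missing, the lower bound on sparse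
    eigenvalues forces every forward step to decrease the residual sum of squares
    by a fixed multiple of [n]; since [|Y|^2 = O(n)], all of [D] is selected after
    a number [K0] of steps which does not depend on [n].  At step [K0] the excess
    true and validation losses, multiplied by [n], are [O(log p)], whereas a set
    that misses a signal costs a multiple of [n].  As [log p = o(n)], both
    minimizers select all of [D].

    Cleaning.  Given the first two groups, each null [t]-statistic is a standard
    normal linear form of the noise up to the ratio of [sigma] to its estimate,
    which is within [1 + O(n^(-1/4))]; a union bound over the selected covariates
    gives level [alpha + o(1)].  As [z_(alpha/2m) = O(sqrt (log n))], every signal
    exceeds the threshold.

    Size of the selected set.  Sparse eigenvalues are controlled only up to
    [q = C1 log n], which may be smaller than [k], so one must show that at most
    [q] covariates are retained.  A second moment bound on a sum of Gaussian
    likelihood ratios shows that, with high probability, many columns satisfy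
    [|<X_j, eps>| >= omega sqrt n], for [omega] arbitrarily large.  At most a few
    of them are explained by the first [q] covariates, because of the upper
    eigenvalue bound; hence each step beyond [K0] lowers the training loss by
    [omega^2 / (4 B^2)] through overfitting.  If more than [q] covariates were
    retained, their validation loss, hence their fitted error on the second
    design, would be small; the two designs are comparable because their rows may
    be exchanged at random without changing their joint law, which makes the
    difference of the inner products a Rademacher sum.  For large [omega] this is
    a contradiction. *)

Require Import Defs.
From HB Require Import structures.
From mathcomp Require Import all_boot all_order all_algebra.
From mathcomp Require Import all_classical all_reals all_analysis.
From mathcomp Require Import measurable_realfun gauss_integral.
From mathcomp Require Import ring lra.

Set Implicit Arguments.
Unset Strict Implicit.
Unset Printing Implicit Defensive.

Import Order.TTheory GRing.Theory Num.Theory.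
Import numFieldNormedType.Exports.

Local Open Scope classical_set_scope.
Local Open Scope ring_scope.

(** * Sparse vectors and least squares *)

(** The rate [log p <= 2 log n] ([log_p_le]) turns every error term into a power of [log n]. It
    comes from counting large noise scores twice: the second moment bound yields at least [sqrt p]
    of them, whereas the upper eigenvalue bound, valid for [n] columns, allows fewer than [n]. The
    excess validation loss at the minimizer is then [O(log n)], the same order as the overfitting
    gain of [q - K0] steps, so only constants decide the contradiction. This is why [omega] must be
    arbitrarily large: it is fixed after [K0] and the constant [ca], and [tau], the tilt of the
    likelihood ratios, after [omega]. Conditional probabilities are avoided. Independence allows
    some coordinates to be redrawn on a product space, so a statement given part of the data becomes
    a bound for each frozen value of that part. Events must then be measurable for arbitrary designs
    and noises, whence [mevent], the finite comparison tables for the selectors and the rational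
    test vectors for eigenvalue bounds. *)

Section InnerProduct.
Context {R : realType}.

Definition dot {n} (u v : 'cV[R]_n) : R := \sum_i u i 0 * v i 0.

Definition suppin {p} (v : 'cV[R]_p) (M : {set 'I_p}) : Prop :=
  forall j, j \notin M -> v j 0 = 0.

Context {n : nat}.
Implicit Types u v w : 'cV[R]_n.

Lemma dotC u v : dot u v = dot v u.
Proof. by apply: eq_bigr => i _; rewrite mulrC. Qed.

Lemma dotDl u v w : dot (u + v) w = dot u w + dot v w.
Proof. by rewrite -big_split; apply: eq_bigr => i _; rewrite !mxE mulrDl. Qed.

Lemma dotZl a u w : dot (a *: u) w = a * dot u w.
Proof. by rewrite /dot mulr_sumr; apply: eq_bigr => i _; rewrite !mxE mulrA. Qed.

Lemma dotNl u w : dot (- u) w = - dot u w.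
Proof. by rewrite -scaleN1r dotZl mulN1r. Qed.

Lemma dotBl u v w : dot (u - v) w = dot u w - dot v w.
Proof. by rewrite dotDl dotNl. Qed.

Lemma dotDr u v w : dot w (u + v) = dot w u + dot w v.
Proof. by rewrite dotC dotDl !(dotC w). Qed.

Lemma dotZr a u w : dot w (a *: u) = a * dot w u.
Proof. by rewrite dotC dotZl dotC. Qed.

Lemma dotNr u w : dot w (- u) = - dot w u.
Proof. by rewrite dotC dotNl dotC. Qed.

Lemma dotBr u v w : dot w (u - v) = dot w u - dot w v.
Proof. by rewrite dotDr dotNr. Qed.

Lemma dot0l w : dot 0 w = 0.
Proof. by rewrite /dot big1 // => i _; rewrite mxE mul0r. Qed.

Lemma dot_ge0 u : 0 <= dot u u.
Proof. by apply: sumr_ge0 => i _; rewrite -expr2 sqr_ge0. Qed.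

Lemma dot_eq0 u : dot u u = 0 -> u = 0.
Proof.
move/eqP; rewrite psumr_eq0; last by move=> i _; rewrite -expr2 sqr_ge0.
move=> /allP h; apply/colP => i; have := h i (mem_index_enum i).
by rewrite mxE mulf_eq0 orbb => /eqP.
Qed.

Lemma sqr_coord_le u i : u i 0 ^+ 2 <= dot u u.
Proof.
rewrite /dot (bigD1 i) //= -expr2 lerDl; apply: sumr_ge0 => k _.
by rewrite -expr2 sqr_ge0.
Qed.

Lemma cauchy_schwarz u v : dot u v ^+ 2 <= dot u u * dot v v.
Proof.
have [/dot_eq0 -> | /eqP u0] := eqVneq (dot u u) 0.
  by rewrite !dot0l expr0n mul0r.
have upos : 0 < dot u u by rewrite lt0r dot_ge0 andbT; apply/eqP.
have := dot_ge0 (v - (dot u v / dot u u) *: u).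
rewrite !(dotBl, dotBr, dotZl, dotZr) (dotC v u).
move: upos u0; move: (dot u u) (dot u v) (dot v v) => a b c a0 /eqP aN.
have -> : c - b / a * b - (b / a) * (b - b / a * a) = c - b ^+ 2 / a by field.
by rewrite subr_ge0 ler_pdivrMr // mulrC.
Qed.

Lemma dotE u v : dot u v = (u^T *m v) 0 0.
Proof. by rewrite mxE; apply: eq_bigr => i _; rewrite mxE. Qed.

End InnerProduct.

Section SparseVectors.
Context {R : realType} {n p : nat}.
Implicit Types (X : 'M[R]_(n, p)) (v u : 'cV[R]_p) (M N : {set 'I_p}) (y : 'cV[R]_n).

Lemma suppinS v M N : M \subset N -> suppin v M -> suppin v N.
Proof. by move=> /fintype.subsetP MN vM j jN; apply: vM; apply: contra jN; apply: MN. Qed.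

Lemma suppinD u v M : suppin u M -> suppin v M -> suppin (u + v) M.
Proof. by move=> hu hv j jM; rewrite mxE hu ?hv // addr0. Qed.

Lemma suppinN v M : suppin v M -> suppin (- v) M.
Proof. by move=> hv j jM; rewrite mxE hv // oppr0. Qed.

Lemma suppinB u v M : suppin u M -> suppin v M -> suppin (u - v) M.
Proof. by move=> hu hv; apply: suppinD => //; exact: suppinN. Qed.

Lemma suppinZ a v M : suppin v M -> suppin (a *: v) M.
Proof. by move=> hv j jM; rewrite mxE hv // mulr0. Qed.

Lemma suppin_supp v : suppin v (supp v).
Proof. by move=> j; rewrite inE negbK => /eqP. Qed.

Lemma suppin_delta j M : j \in M -> suppin (delta_mx j 0 : 'cV[R]_p) M.
Proof.
move=> jM i iM; rewrite mxE; case: eqP => //= ij.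
by rewrite ij jM in iM.
Qed.

Lemma dot_mulmx X v y : dot (X *m v) y = \sum_j v j 0 * dot (col j X) y.
Proof.
rewrite /dot.
under eq_bigr => i _ do rewrite mxE mulr_suml.
rewrite exchange_big /=; apply: eq_bigr => j _; rewrite mulr_sumr.
by apply: eq_bigr => i _; rewrite mxE; ring.
Qed.

Lemma mulmx_delta X j : X *m delta_mx j 0 = col j X :> 'cV[R]_n.
Proof. by rewrite colE. Qed.

(** The variance of [f] over [A] is nonnegative. *)
Lemma sqr_sum_le (I : finType) (A : {set I}) (f : I -> R) :
  (\sum_(i in A) f i) ^+ 2 <= #|A|%:R * \sum_(i in A) f i ^+ 2.
Proof.
have [A0|A0] := eqVneq #|A| 0%N.
  have -> : \sum_(i in A) f i = 0.
    by apply: big1 => i iA; move: A0 => /eqP; rewrite cards_eq0 => /eqP A0; rewrite A0 inE in iA.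
  by rewrite expr0n /= mulr_ge0 // sumr_ge0 // => i _; rewrite sqr_ge0.
set N : R := #|A|%:R; have N0 : 0 < N by rewrite ltr0n lt0n.
set t := \sum_(i in A) f i.
have : 0 <= \sum_(i in A) (f i - t / N) ^+ 2 by apply: sumr_ge0 => i _; exact: sqr_ge0.
under eq_bigr => i _ do rewrite sqrrB.
rewrite big_split sumrB /= sumr_const sumrMnl -big_distrl /= -/t -(mulr_natl _ #|A|) -/N.
set q := \sum_(i in A) f i ^+ 2.
have -> : q - t * (t / N) *+ 2 + N * (t / N) ^+ 2 = (N * q - t ^+ 2) / N.
  by field; rewrite gt_eqF.
by rewrite pmulr_lge0 ?invr_gt0 // subr_ge0.
Qed.

Lemma l1_l2 v M : suppin v M ->
  (\sum_j `|v j 0|) ^+ 2 <= #|M|%:R * dot v v.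
Proof.
move=> vM.
have h (g : R -> R) : g 0 = 0 -> \sum_j g (v j 0) = \sum_(j in M) g (v j 0).
  move=> g0; rewrite [RHS]big_mkcond /=; apply: eq_bigr => j _.
  by case: ifPn => // /vM ->.
rewrite (h (fun x => `|x|)) ?normr0 // /dot.
rewrite (h (fun x => x * x)) ?mul0r //.
apply: (le_trans (sqr_sum_le _ _)); apply: ler_wpM2l => //.
by apply: ler_sum => j _; rewrite -normrX ger0_norm ?sqr_ge0 // expr2.
Qed.

Lemma dot_mulmx_le X v y t : (forall j, `|dot (col j X) y| <= t) ->
  `|dot (X *m v) y| <= t * \sum_j `|v j 0|.
Proof.
move=> h; rewrite dot_mulmx mulr_sumr; apply: (le_trans (ler_norm_sum _ _ _)).
by apply: ler_sum => j _; rewrite normrM mulrC ler_wpM2r.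
Qed.

Lemma mulmx_sqnorm_le X v B : 0 <= B -> (forall i j, `|X i j| <= B) ->
  dot (X *m v) (X *m v) <= n%:R * (B * \sum_j `|v j 0|) ^+ 2.
Proof.
move=> B0 h; rewrite /dot.
have -> : n%:R * (B * \sum_j `|v j 0|) ^+ 2 =
   \sum_(i < n) (B * \sum_j `|v j 0|) ^+ 2.
  by rewrite sumr_const card_ord mulr_natl.
apply: ler_sum => i _; rewrite -expr2 -[leLHS]ger0_norm ?sqr_ge0 // normrX.
rewrite lerXn2r ?nnegrE ?mulr_ge0 ?sumr_ge0 // mxE mulr_sumr.
apply: (le_trans (ler_norm_sum _ _ _)); apply: ler_sum => j _.
by rewrite normrM ler_wpM2r.
Qed.

Lemma col_sqnorm_le X j B : 0 <= B -> (forall i j, `|X i j| <= B) ->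
  dot (col j X) (col j X) <= n%:R * B ^+ 2.
Proof.
move=> B0 h; rewrite /dot.
have -> : n%:R * B ^+ 2 = \sum_(i < n) B ^+ 2.
  by rewrite sumr_const card_ord mulr_natl.
apply: ler_sum => i _; rewrite -expr2 -[leLHS]ger0_norm ?sqr_ge0 // normrX mxE.
by rewrite lerXn2r ?nnegrE.
Qed.

End SparseVectors.

Section LeastSquares.
Context {R : realType} {n p : nat}.
Implicit Types (X : 'M[R]_(n, p)) (Y y : 'cV[R]_n) (v u : 'cV[R]_p) (M N : {set 'I_p}).

(** [ols_ext X Y M] is convertible to [ext (ols X Y M)], so facts about [ext] apply to least squares
    directly. Vectors of ['cV_p] with a support set keep the dependent dimension [#|M|] out of
    comparisons between different sets. *)
Definition ext {M} (u : 'cV[R]_#|M|) : 'cV[R]_p :=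
  \sum_(i < #|M|) u i 0 *: delta_mx (enum_val i) 0.

Lemma ext_enum M (u : 'cV[R]_#|M|) i : ext u (enum_val i) 0 = u i 0.
Proof.
rewrite /ext summxE (bigD1 i) //= big1 ?addr0; last first.
  by move=> k ki; rewrite !mxE (inj_eq enum_val_inj) eq_sym (negbTE ki) mulr0.
by rewrite !mxE !eqxx mulr1.
Qed.

Lemma suppin_ext M (u : 'cV[R]_#|M|) : suppin (ext u) M.
Proof.
move=> j jM; rewrite /ext summxE big1 // => i _; rewrite !mxE.
case: eqP => [ji|_]; last by rewrite mulr0.
by rewrite ji enum_valP in jM.
Qed.

Lemma mulmx_ext X M (u : 'cV[R]_#|M|) : X *m ext u = cols X M *m u.
Proof.
apply/colP => i; rewrite mulmx_sumr summxE mxE; apply: eq_bigr => k _.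
by rewrite -scalemxAr mulmx_delta !mxE mulrC.
Qed.

Lemma extK v M : suppin v M -> ext (\col_(i < #|M|) v (enum_val i) 0) = v.
Proof.
move=> vM; apply/colP => j; case: (boolP (j \in M)) => jM; last first.
  by rewrite vM // suppin_ext.
by rewrite -(enum_rankK_in jM jM) ext_enum mxE.
Qed.

Lemma residualE X Y M : residual X Y M = Y - X *m ols_ext X Y M.
Proof. by rewrite -[ols_ext _ _ _]/(ext _) mulmx_ext. Qed.

Lemma suppin_ols X Y M : suppin (ols_ext X Y M) M.
Proof. exact: suppin_ext. Qed.

(** Linear independence of the columns in [M], phrased on supported vectors: restricted eigenvalues
    and almost sure positivity both deliver it in this form. *)
Definition inj_on X M := forall v, suppin v M -> X *m v = 0 -> v = 0.

(** A vector [u] in the kernel of the Gram matrix [G] gives a combination of columns of squared norm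
    [u G u^T = 0]; conversely an inverse of [G] recovers the coefficients from [X v]. *)
Lemma gram_unitP X M : inj_on X M <-> gram X M \in unitmx.
Proof.
split=> h.
  rewrite -row_free_unit; apply: inj_row_free => u hu.
  have : X *m ext u^T = 0.
    rewrite mulmx_ext; apply: dot_eq0; rewrite dotE trmx_mul trmxK.
    by rewrite -mulmxA (mulmxA _^T) mulmxA hu mul0mx mxE.
  move=> /(h _ (@suppin_ext M _)) e0.
  by apply/rowP => i; rewrite -[u]trmxK mxE -ext_enum e0 !mxE.
move=> v vM Xv; have := extK vM; set u := (\col_i _) => uv.
have u0 : u = 0.
  rewrite -(mulKmx h u) -mulmxA -mulmx_ext uv Xv mulmx0 mulmx0 //.
by rewrite -uv u0 /ext big1 // => i _; rewrite mxE scale0r.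
Qed.

Lemma normal_eq X Y M j : gram X M \in unitmx -> j \in M ->
  dot (col j X) (residual X Y M) = 0.
Proof.
move=> gU jM.
have e : (cols X M)^T *m residual X Y M = 0.
  rewrite /residual mulmxBr mulmxA -/(gram X M) /ols mulKVmx // subrr //.
have := congr1 (fun Z : 'cV[R]_#|M| => Z (enum_rank_in jM j) 0) e; rewrite !mxE => <-.
by apply: eq_bigr => i _; rewrite !mxE enum_rankK_in.
Qed.

Lemma residual_orth X Y M u : inj_on X M -> suppin u M ->
  dot (X *m u) (residual X Y M) = 0.
Proof.
move=> /gram_unitP gU uM; rewrite dot_mulmx big1 // => j _.
case: (boolP (j \in M)) => jM; last by rewrite uM // mul0r.
by rewrite normal_eq // mulr0.
Qed.

(** Pythagoras: the residual is orthogonal to the difference of the two fits. *)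
Lemma residual_min X Y M u : inj_on X M -> suppin u M ->
  dot (residual X Y M) (residual X Y M) <= dot (Y - X *m u) (Y - X *m u).
Proof.
move=> iM uM.
have -> : Y - X *m u = residual X Y M + X *m (ols_ext X Y M - u).
  by rewrite residualE mulmxBr addrA subrK.
set r := residual X Y M; set z := X *m _.
have zr : dot z r = 0 by apply: residual_orth => //; apply: suppinB => //; exact: suppin_ols.
clearbody r z.
by rewrite dotDl !dotDr (dotC r z) zr addr0 add0r lerDl; exact: dot_ge0.
Qed.

(** Orthogonalizing the columns of M one at a time, each new direction is a
    least squares residual, so that the bound on residuals adds up over M. *)
Lemma dot_span_le X y L (k : nat) :
  (forall M, (#|M| <= k)%N -> inj_on X M) ->
  (forall M j, (#|M| <= k)%N ->
     dot (residual X (col j X) M) y ^+ 2 <=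
     L * dot (residual X (col j X) M) (residual X (col j X) M)) ->
  0 <= L ->
  forall M v, (#|M| <= k)%N -> suppin v M ->
  dot (X *m v) y ^+ 2 <= #|M|%:R * L * dot (X *m v) (X *m v).
Proof.
move=> iX rX L0 M v; move: {2}#|M| (erefl #|M|) => m; elim: m M v => [|m IH] M v Mm Mk vM.
  have -> : v = 0 by apply/colP => j; rewrite mxE vM // (cards0_eq Mm) inE.
  by rewrite mulmx0 !dot0l expr0n mulr0.
have /card_gt0P [j jM] : (0 < #|M|)%N by rewrite Mm.
pose N := (M :\ j)%SET.
have Nm : #|N| = m by move: Mm; rewrite (cardsD1 j) jM add1n => -[].
have Nk : (#|N| <= k)%N by rewrite Nm; apply: leq_trans Mk; rewrite Mm.
pose r := residual X (col j X) N.
(* Column [j] is replaced by its residual [r] on the others: [X v = X h + v_j r], with [h] supported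
   on [N] and [X h] orthogonal to [r]. *)
pose h := v - v j 0 *: (delta_mx j 0 - ols_ext X (col j X) N).
have hN : suppin h N.
  move=> i iN; have bi : ols_ext X (col j X) N i 0 = 0 by exact: suppin_ols.
  rewrite !mxE bi subr0; move: iN; rewrite !inE negb_and negbK => /orP [/eqP ->|iM].
    by rewrite !eqxx mulr1 subrr.
  have ij : i != j by apply: contraNneq iM => ->.
  by rewrite (vM i iM) (negbTE ij) /= mulr0 subrr //.
have Xv : X *m v = X *m h + v j 0 *: r.
  rewrite /h mulmxBr -scalemxAr mulmxBr mulmx_delta -residualE -/r subrK //.
have orth : dot (X *m h) r = 0 by apply: residual_orth => //; exact: iX.
have := IH N h Nm Nk hN; rewrite Nm => IHh.
have := rX N j Nk; rewrite -/r => rb.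
clearbody r h.
rewrite Xv dotDl (dotDl (X *m h)) !dotDr !dotZl !dotZr (dotC r (X *m h)) orth !mulr0 addr0 add0r.
have c0 := dot_ge0 (X *m h); have d0 := dot_ge0 r.
move: (dot (X *m h) y) (dot r y) (dot (X *m h) (X *m h)) (dot r r) (v j 0) IHh rb c0 d0 => a b c e t H1 H2 c0 d0.
rewrite Mm -natr1.
have mp : 0 <= m%:R :> R by [].
move: (m%:R) mp H1 => x x0 H1.
have H2' : (t * b) ^+ 2 <= L * (t * (t * e)).
  by rewrite exprMn; apply: (le_trans (ler_wpM2l (sqr_ge0 t) H2)); rewrite expr2; lra.
have [xz|xN] := eqVneq x 0.
  rewrite xz !mul0r in H1; rewrite xz.
  have a0 : a = 0 by apply/eqP; rewrite -sqrf_eq0 eq_le sqr_ge0 andbT.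
  by rewrite a0 !add0r mul1r mulrDr; apply: (le_trans H2'); rewrite lerDr mulr_ge0.
have xp : 0 < x by rewrite lt0r xN.
(* Young's inequality with weight [x = m]: since [(1 + 1/m) m = m + 1], both parts receive the same
   factor and the bounds add with constant exactly [m + 1]. *)
have : (a + t * b) ^+ 2 <= (1 + x^-1) * a ^+ 2 + (1 + x) * (t * b) ^+ 2.
  rewrite -subr_ge0.
  have -> : (1 + x^-1) * a ^+ 2 + (1 + x) * (t * b) ^+ 2 - (a + t * b) ^+ 2 =
     x^-1 * (a - x * (t * b)) ^+ 2 by field.
  by rewrite mulr_ge0 ?invr_ge0 ?sqr_ge0.
move=> /le_trans; apply.
have A1 : (1 + x^-1) * a ^+ 2 <= (1 + x^-1) * (x * L * c).
  by apply: ler_wpM2l => //; rewrite addr_ge0 ?invr_ge0.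
have A2 : (1 + x) * (t * b) ^+ 2 <= (1 + x) * (L * (t * (t * e))).
  by apply: ler_wpM2l => //; lra.
apply: (le_trans (lerD A1 A2)).
have -> : (1 + x^-1) * (x * L * c) = (x + 1) * L * c by field.
by rewrite mulrDr lerD2l; lra.
Qed.

(** The least squares coordinate is the truth plus a fixed linear form of the noise, in the
    direction of the vector dual to column [i] in the span of [M]. Its squared norm is the diagonal
    entry that scales the [t]-statistic; the last identity shows it in the span, where eigenvalue
    bounds apply. *)
Lemma ols_coord X (beta : 'cV[R]_p) (eps : 'cV[R]_n) M (i : 'I_#|M|) :
  inj_on X M -> suppin beta M ->
  let a := cols X M *m col i (invmx (gram X M)) in
  [/\ ols X (X *m beta + eps) M i 0 = beta (enum_val i) 0 + dot a eps,
      dot a a = invmx (gram X M) i i &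
      a = X *m ext (col i (invmx (gram X M))) ].
Proof.
move=> /gram_unitP gU bM a.
have gT : (gram X M)^T = gram X M by rewrite /gram trmx_mul trmxK.
have iT : (invmx (gram X M))^T = invmx (gram X M) by rewrite trmx_inv gT.
have aT : a^T = row i (invmx (gram X M)) *m (cols X M)^T.
  by rewrite /a trmx_mul tr_col iT.
split.
- have -> : ols X (X *m beta + eps) M = \col_(i < #|M|) beta (enum_val i) 0
     + invmx (gram X M) *m ((cols X M)^T *m eps).
    rewrite -{1}(extK bM) mulmx_ext /ols 2!mulmxDr; congr (_ + _).
    by rewrite mulmxA mulmxA -/(gram X M) mulVmx // mul1mx.
  rewrite mxE mxE; congr (_ + _).
  by rewrite dotE aT -mulmxA -row_mul [RHS]mxE.
- rewrite dotE aT {1}/a mulmxA -(mulmxA (row _ _)) -/(gram X M) -row_mul mulVmx //.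
  by rewrite row1 -rowE !mxE.
- by rewrite /a mulmx_ext.
Qed.

End LeastSquares.

(** * Forward selection and its validation loss *)

Section ForwardSelection.
Context {R : realType} {n p : nat}.
Implicit Types (X : 'M[R]_(n, p)) (Y y : 'cV[R]_n) (v u : 'cV[R]_p) (M N : {set 'I_p}).

Lemma scoreE X Y M j : score X Y M j = n%:R^-1 * dot (col j X) (residual X Y M).
Proof. by rewrite /score /dot; congr (_ * _); apply: eq_bigr => i _; rewrite [col j X i 0]mxE. Qed.

Lemma fs_step_spec X Y M : (0 < p)%N -> exists2 J, fs_step X Y M = (J |: M)%SET &
  forall j, `|score X Y M j| <= `|score X Y M J|.
Proof.
move=> p0; rewrite /fs_step; case: pickP => [J /forallP hJ|no]; first by exists J.
have [J _ hJ] := @arg_maxP _ _ _ (Ordinal p0) predT (fun j => `|score X Y M j|) isT.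
by case/negP: (negbT (no J)); apply/forallP => j; exact: hJ.
Qed.

Lemma fs_step_sub X Y M : M \subset fs_step X Y M.
Proof. by rewrite /fs_step; case: pickP => [J _|_] //; exact: subsetU1. Qed.

Lemma fs_setS X Y l : fs_set X Y l.+1 = fs_step X Y (fs_set X Y l).
Proof. by []. Qed.

Lemma fs_set_mono X Y l l' : (l <= l')%N -> fs_set X Y l \subset fs_set X Y l'.
Proof.
move=> /subnK <-; elim: (l' - l)%N => [|m IH] //.
by rewrite addSn fs_setS; apply: (fintype.subset_trans IH); exact: fs_step_sub.
Qed.

Lemma card_fs_step X Y M : (#|fs_step X Y M| <= #|M|.+1)%N.
Proof.
rewrite /fs_step; case: pickP => [J _|_]; last exact: leqnSn.
by rewrite cardsU1; case: (J \notin M); rewrite ?leqnn ?leqnSn.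
Qed.

Lemma card_fs_set X Y l : (#|fs_set X Y l| <= l)%N.
Proof.
elim: l => [|l IH]; first by rewrite cards0.
by rewrite fs_setS; apply: (leq_trans (card_fs_step _ _ _)); rewrite ltnS.
Qed.

(** The new fit does at least as well as a step of length [t] along the selected column from the old
    fit. The greedy choice then lets any column [j] stand for the selected one. *)
Lemma fs_step_decrease X Y M B j : (0 < n)%N -> (0 < p)%N -> 0 < B ->
  (forall i k, `|X i k| <= B) -> inj_on X (fs_step X Y M) ->
  dot (residual X Y (fs_step X Y M)) (residual X Y (fs_step X Y M)) <=
  dot (residual X Y M) (residual X Y M)
    - dot (col j X) (residual X Y M) ^+ 2 / (n%:R * B ^+ 2).
Proof.
move=> n0 p0 B0 hB iM; set r := residual X Y M; set r' := residual X Y (fs_step _ _ _).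
have [J sJ hJ] := fs_step_spec X Y M p0.
have nn : 0 < n%:R :> R by rewrite ltr0n.
have d0 : 0 < n%:R * B ^+ 2 by rewrite mulr_gt0 ?exprn_gt0.
have hj : dot (col j X) r ^+ 2 <= dot (col J X) r ^+ 2.
  have := hJ j; rewrite !scoreE !normrM ler_pM2l ?normr_gt0 ?invr_neq0 ?gt_eqF //.
  by move=> h; rewrite -[leLHS]real_normK ?num_real // -[leRHS]real_normK ?num_real // lerXn2r ?nnegrE.
(* Dividing by the bound [n * B^2] instead of [|x_J|^2] shortens the optimal step but still
   decreases the sum of squares by [<x_J, r>^2 / (n B^2)]. *)
pose t := dot (col J X) r / (n%:R * B ^+ 2).
have su : suppin (ols_ext X Y M + t *: delta_mx J 0) (fs_step X Y M).
  apply: suppinD; first by apply: suppinS (fs_step_sub X Y M) _; exact: suppin_ols.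
  by apply/suppinZ/suppin_delta; rewrite sJ setU11.
have := residual_min Y iM su.
rewrite mulmxDr -scalemxAr mulmx_delta opprD addrA -residualE -/r -/r'.
move=> /le_trans; apply.
have := col_sqnorm_le J (ltW B0) hB; rewrite /t.
have rr := dot_ge0 r; clearbody r; clear -hj d0 rr.
rewrite !(dotBl, dotBr, dotZl, dotZr) (dotC r).
move: (dot (col J X) r) (dot (col J X) (col J X)) (dot r r) (dot (col j X) r) (n%:R * B ^+ 2) hj d0 => a b c e f hj d0 hb.
have -> : c - a / f * a - (a / f * a - a / f * (a / f * b)) =
  c - a ^+ 2 / f - a ^+ 2 / f * (1 - b / f) by field; rewrite gt_eqF.
have h1 : e ^+ 2 / f <= a ^+ 2 / f by rewrite ler_pM2r ?invr_gt0.
have h2 : 0 <= a ^+ 2 / f * (1 - b / f).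
  by rewrite mulr_ge0 ?divr_ge0 ?sqr_ge0 ?subr_ge0 ?ler_pdivrMr ?mul1r // ltW.
by lra.
Qed.

(** Sparse eigenvalue bounds as quadratic inequalities. Taking all supports of size at most [Q],
    rather than exactly [Q], makes both notions monotone in [Q]; [sparse_min_RE] and [sparse_max_UP]
    link them to the eigenvalues. *)
Definition RE X (Q : nat) (kap : R) := forall M v, (#|M| <= Q)%N -> suppin v M ->
  kap * n%:R * dot v v <= dot (X *m v) (X *m v).

Definition UP X (Q : nat) (C : R) := forall M v, (#|M| <= Q)%N -> suppin v M ->
  dot (X *m v) (X *m v) <= C * n%:R * dot v v.

Lemma RE_inj X Q kap M : (0 < n)%N -> 0 < kap -> RE X Q kap -> (#|M| <= Q)%N -> inj_on X M.
Proof.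
move=> n0 k0 h MQ v vM Xv; apply: dot_eq0; apply/eqP; rewrite eq_le dot_ge0 andbT.
have := h M v MQ vM; rewrite Xv dot0l pmulr_rle0 // mulr_gt0 ?ltr0n //.
Qed.

(** Hölder between the largest score and the [l1] norm of [v], then [l1 <= sqrt Q * l2], then the
    restricted eigenvalue. The noise enters through single columns only, so the cost is a factor [Q]
    and not a union over supports. *)
Lemma dot_noise_le X Q kap M v y th : 0 < kap -> RE X Q kap -> (#|M| <= Q)%N -> suppin v M ->
  (forall j, `|dot (col j X) y| <= th * n%:R) ->
  dot (X *m v) y ^+ 2 <= th ^+ 2 * n%:R * Q%:R / kap * dot (X *m v) (X *m v).
Proof.
move=> k0 re MQ vM hy.
have h1 := dot_mulmx_le v hy.
have h2 := l1_l2 vM.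
have h3 := re M v MQ vM.
set E := dot _ _ in h3 *; set l1 := \sum_j _ in h1 h2.
have -> : dot (X *m v) y ^+ 2 = `|dot (X *m v) y| ^+ 2 by rewrite real_normK ?num_real.
apply: (le_trans (_ : _ <= (th * n%:R * l1) ^+ 2)).
  by rewrite lerXn2r ?nnegrE // (le_trans _ h1).
rewrite exprMn.
have dv := dot_ge0 v.
have h4 : l1 ^+ 2 <= Q%:R * dot v v.
  by apply: (le_trans h2); rewrite ler_wpM2r // ler_nat.
apply: (le_trans (ler_wpM2l (sqr_ge0 _) h4)).
have -> : (th * n%:R) ^+ 2 * (Q%:R * dot v v) =
  th ^+ 2 * n%:R * Q%:R / kap * (kap * n%:R * dot v v) by field; rewrite gt_eqF.
apply: ler_wpM2l => //; apply: divr_ge0; last exact: ltW.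
by apply: mulr_ge0 => //; apply: mulr_ge0 => //; exact: sqr_ge0.
Qed.

(** When [v] has norm at least [psi], [|X v|^2] is at least of order [n] and absorbs the cross term.
    The factor [16] in the smallness of [th] produces the quarter. *)
Lemma dot_noise_quarter X Q kap M v y th psi : 0 < kap -> RE X Q kap -> (#|M| <= Q)%N ->
  suppin v M -> (forall j, `|dot (col j X) y| <= th * n%:R) ->
  16 * Q%:R * th ^+ 2 <= kap ^+ 2 * psi ^+ 2 -> psi ^+ 2 <= dot v v ->
  `|dot (X *m v) y| <= dot (X *m v) (X *m v) / 4.
Proof.
move=> k0 re MQ vM hy ths pv.
have h1 := dot_noise_le k0 re MQ vM hy.
have h2 : kap * n%:R * psi ^+ 2 <= dot (X *m v) (X *m v).
  by apply: le_trans (re M v MQ vM); rewrite ler_wpM2l // mulr_ge0 // ltW.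
have l0 := dot_ge0 (X *m v); set E := dot (X *m v) (X *m v) in h1 h2 l0 *.
rewrite -(@ler_pXn2r _ 2) ?nnegrE ?divr_ge0 // real_normK ?num_real //.
apply: (le_trans h1).
have h3 : 16 * (th ^+ 2 * n%:R * Q%:R / kap) <= E.
  apply: le_trans h2.
  have -> : 16 * (th ^+ 2 * n%:R * Q%:R / kap) = n%:R / kap * (16 * Q%:R * th ^+ 2) by ring.
  have -> : kap * n%:R * psi ^+ 2 = n%:R / kap * (kap ^+ 2 * psi ^+ 2) by field; rewrite gt_eqF.
  by rewrite ler_wpM2l // divr_ge0 // ltW.
have := ler_wpM2r l0 h3; rewrite expr_div_n expr2.
by move: (th ^+ 2 * n%:R * Q%:R / kap) (E) => c e; lra.
Qed.

End ForwardSelection.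

(** * Screening: all signals enter within a bounded number of steps *)

Section Screening.
Context {R : realType} {n p : nat} (X : 'M[R]_(n, p)) (beta : 'cV[R]_p) (eps : 'cV[R]_n).
Context (Q : nat) (kap psi B th b1 : R).
Hypotheses (n0 : (0 < n)%N) (p0 : (0 < p)%N) (kap0 : 0 < kap) (psi0 : 0 < psi) (B0 : 0 < B).
Hypothesis hB : forall i j, `|X i j| <= B.
Hypothesis hpsi : forall j, j \in supp beta -> psi <= `|beta j 0|.
Hypothesis hb1 : \sum_j `|beta j 0| = b1.
Hypothesis hRE : RE X Q kap.
Hypothesis hth : forall j, `|dot (col j X) eps| <= th * n%:R.
Hypothesis th_small : 16 * Q%:R * th ^+ 2 <= kap ^+ 2 * psi ^+ 2.
Hypothesis th1 : 0 <= th <= 1.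

Let Y := X *m beta + eps.
Implicit Types M : {set 'I_p}.
Local Notation D := (supp beta).
Local Notation err M := (beta - ols_ext X Y M).
Local Notation loss M := (dot (X *m err M) (X *m err M)).

Lemma residual_err M : residual X Y M = eps + X *m err M.
Proof. by rewrite residualE mulmxBr addrA (addrC eps). Qed.

Lemma suppin_err M : suppin (err M) (M :|: D).
Proof.
apply: suppinB; first by apply: suppinS (finset.subsetUr _ _) _; exact: suppin_supp.
by apply: suppinS (finset.subsetUl _ _) _; exact: suppin_ols.
Qed.

Lemma err_missing_ge M : ~~ (D \subset M) -> psi ^+ 2 <= dot (err M) (err M).
Proof.
move=> /subsetPn [j jD jM].
apply: (le_trans _ (sqr_coord_le _ j)).
rewrite !mxE (suppin_ols _ _ jM) subr0 -[leRHS]real_normK ?num_real //.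
by rewrite lerXn2r ?nnegrE ?(ltW psi0) // hpsi.
Qed.

Lemma loss_missing_ge M : ~~ (D \subset M) -> (#|M :|: D| <= Q)%N ->
  kap * n%:R * psi ^+ 2 <= loss M.
Proof.
move=> DM MQ; apply: le_trans (hRE MQ (@suppin_err M)).
by rewrite ler_wpM2l ?mulr_ge0 ?(ltW kap0) // err_missing_ge.
Qed.

Lemma loss_noise_le M : (#|M :|: D| <= Q)%N ->
  dot (X *m err M) eps ^+ 2 <= th ^+ 2 * n%:R * Q%:R / kap * loss M.
Proof. by move=> MQ; exact: (dot_noise_le kap0 hRE MQ (@suppin_err M) hth). Qed.

Lemma loss_noise_missing_le M : ~~ (D \subset M) -> (#|M :|: D| <= Q)%N ->
  `|dot (X *m err M) eps| <= loss M / 4.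
Proof.
move=> DM MQ.
exact: (dot_noise_quarter kap0 hRE MQ (@suppin_err M) hth th_small (err_missing_ge DM)).
Qed.

(** The residual is orthogonal to the fit, so [|X err|^2 + <X err, eps> = <X beta, residual>], which
    is at most [m * b1]. A large loss thus forces a large score. *)
Lemma score_missing_ge M m : ~~ (D \subset M) -> (#|M :|: D| <= Q)%N ->
  (forall j, `|dot (col j X) (residual X Y M)| <= m) -> 3 * loss M <= 4 * m * b1.
Proof.
move=> DM MQ hm; have h1 := loss_noise_missing_le DM MQ.
have iM : inj_on X M.
  by apply: RE_inj n0 kap0 hRE _; apply: leq_trans MQ; exact: subset_leq_card (finset.subsetUl _ _).
have h2 := dot_mulmx_le beta hm; rewrite hb1 in h2.
have h3 : dot (X *m err M) (residual X Y M) = dot (X *m beta) (residual X Y M).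
  by rewrite mulmxBr dotBl (residual_orth _ iM (@suppin_ols _ _ _ X Y M)) subr0.
have h4 : dot (X *m err M) (residual X Y M) = dot (X *m err M) eps + loss M.
  by rewrite residual_err dotDr.
rewrite -h3 h4 in h2; move: h1 h2; rewrite !ler_norml => /andP[h1 _] /andP[_ h2]; lra.
Qed.

(** The cross term costs at most half of the loss while a signal is missing, so the residual sum of
    squares stays above the noise level. This floor limits the number of steps. *)
Lemma residual_missing_ge M : ~~ (D \subset M) -> (#|M :|: D| <= Q)%N ->
  dot eps eps <= dot (residual X Y M) (residual X Y M).
Proof.
move=> DM MQ; have h1 := loss_noise_missing_le DM MQ; have l0 := dot_ge0 (X *m err M).
rewrite residual_err dotDl !dotDr (dotC eps); move: h1; rewrite ler_norml => /andP[h1 _]; lra.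
Qed.

Lemma residual0 : residual X Y finset.set0 = Y.
Proof.
rewrite residualE; have -> : ols_ext X Y finset.set0 = 0.
  by apply/colP => j; rewrite mxE; apply: suppin_ols; rewrite inE.
by rewrite mulmx0 subr0.
Qed.

(** The term [|eps|^2] is kept explicit because it is also the floor of [residual_missing_ge]: it
    cancels and leaves a budget that is a fixed multiple of [n]. *)
Lemma response_sqnorm_le : dot Y Y <= dot eps eps + n%:R * (2 * b1 + B ^+ 2 * b1 ^+ 2).
Proof.
have h1 := dot_mulmx_le beta hth; have h2 := mulmx_sqnorm_le beta (ltW B0) hB.
rewrite hb1 in h1 h2; rewrite /Y dotDl !dotDr (dotC eps).
have b10 : 0 <= b1 by rewrite -hb1 sumr_ge0.
have h3 : th * n%:R * b1 <= n%:R * b1.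
  by rewrite ler_wpM2r // ler_piMl //; case/andP: th1.
move: h1; rewrite ler_norml => /andP[_ h1].
rewrite exprMn in h2; lra.
Qed.

(** While a signal is missing, restricted eigenvalues force a score of at least
    [B * sqrt drop_rate], hence a decrease of the residual sum of squares by at
    least [n * drop_rate]. *)
Definition drop_rate : R := (3 * kap * psi ^+ 2 / (4 * b1 * B)) ^+ 2.

Lemma supp_sub_fs_set (K0 : nat) : (K0 + #|D| <= Q)%N ->
  2 * b1 + B ^+ 2 * b1 ^+ 2 < K0%:R * drop_rate ->
  D \subset fs_set X Y K0.
Proof.
move=> KQ hK; apply/negPn/negP => nD.
(* The sets are nested, so a signal missing at step [K0] is missing at every earlier step. *)
have nDl l : (l <= K0)%N -> ~~ (D \subset fs_set X Y l).
  by move=> lK; apply: contra nD => h; exact: fintype.subset_trans h (fs_set_mono X Y lK).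
have cQ l : (l <= K0)%N -> (#|fs_set X Y l :|: D| <= Q)%N.
  move=> lK; apply: leq_trans KQ; apply: (leq_trans (leq_card_setU _ _)).
  by rewrite leq_add2r (leq_trans (card_fs_set _ _ _)).
have b1p : 0 < b1.
  have /subsetPn [j jD _] := nD.
  rewrite -hb1 (bigD1 j) //= ltr_pwDl ?sumr_ge0 // (lt_le_trans psi0) //; exact: hpsi.
have nn : 0 < n%:R :> R by rewrite ltr0n.
have dec l : (l <= K0)%N -> dot (residual X Y (fs_set X Y l)) (residual X Y (fs_set X Y l)) <=
    dot Y Y - l%:R * (n%:R * drop_rate).
  elim: l => [_|l IH lK]; first by rewrite residual0 mul0r subr0.
  have lK' := ltnW lK.
  have iM : inj_on X (fs_set X Y l.+1).
    apply: RE_inj n0 kap0 hRE _; apply: leq_trans (cQ _ lK); exact: subset_leq_card (finset.subsetUl _ _).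
  have [J _ hJ] := fs_step_spec X Y (fs_set X Y l) p0.
  have := fs_step_decrease J n0 p0 B0 hB iM => /=; move/le_trans; apply.
  have := IH lK'; set r := residual X Y (fs_set X Y l) => IHl.
  have hm j : `|dot (col j X) r| <= `|dot (col J X) r|.
    by have := hJ j; rewrite !scoreE !normrM ler_pM2l // normr_gt0 invr_neq0 // gt_eqF.
  have h1 := score_missing_ge (nDl _ lK') (cQ _ lK') hm.
  have h2 := loss_missing_ge (nDl _ lK') (cQ _ lK').
  have h3 : n%:R * drop_rate <= dot (col J X) r ^+ 2 / (n%:R * B ^+ 2).
    have -> : dot (col J X) r ^+ 2 = `|dot (col J X) r| ^+ 2 by rewrite real_normK ?num_real.
    rewrite ler_pdivlMr ?mulr_gt0 ?exprn_gt0 // /drop_rate.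
    have -> : n%:R * (3 * kap * psi ^+ 2 / (4 * b1 * B)) ^+ 2 * (n%:R * B ^+ 2) =
      (3 * (kap * n%:R * psi ^+ 2) / (4 * b1)) ^+ 2 by field; rewrite !gt_eqF.
    have c0 : 0 <= 3 * (kap * n%:R * psi ^+ 2) / (4 * b1).
      apply: divr_ge0; last by rewrite mulr_ge0 // ltW.
      by apply: mulr_ge0 => //; apply: mulr_ge0; rewrite ?sqr_ge0 // mulr_ge0 // ltW.
    rewrite ler_pXn2r ?nnegrE // ler_pdivrMr ?mulr_gt0 //; lra.
  rewrite -natr1 mulrDl mul1r; lra.
have h1 := dec K0 (leqnn _); have h2 := residual_missing_ge (nDl K0 (leqnn _)) (cQ K0 (leqnn _)).
have h3 := response_sqnorm_le.
have h4 : n%:R * (2 * b1 + B ^+ 2 * b1 ^+ 2) < n%:R * (K0%:R * drop_rate) by rewrite ltr_pM2l.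
rewrite (mulrCA K0%:R) in h1.
have h5 := le_trans h2 h1.
move: (dot Y Y) (dot eps eps) (n%:R * (2 * b1 + B ^+ 2 * b1 ^+ 2)) (n%:R * (K0%:R * drop_rate)) h3 h4 h5 => a b c d; lra.
Qed.

(** Once [M] contains the support, [X err] lies in the span of [M] and the normal equations give
    [<X err, eps> = - loss]. Hence [loss^2] is at most a constant times [loss]. *)
Lemma loss_selected_le M : D \subset M -> (#|M| <= Q)%N ->
  loss M <= th ^+ 2 * n%:R * Q%:R / kap.
Proof.
move=> DM MQ; have MD : M :|: D = M by apply/finset.setUidPl.
have iM : inj_on X M by exact: RE_inj n0 kap0 hRE MQ.
have h1 := @loss_noise_le M; rewrite MD in h1; have {}h1 := h1 MQ.
have eM : suppin (err M) M by rewrite -{2}MD; exact: suppin_err.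
have : dot (X *m err M) eps = - loss M.
  have := residual_orth Y iM eM; rewrite residual_err dotDr => /eqP.
  by rewrite addr_eq0 => /eqP.
move=> e; rewrite e sqrrN expr2 in h1.
have := dot_ge0 (X *m err M); rewrite le0r => /orP [/eqP ->|lp].
  apply: divr_ge0; last exact: ltW.
  by apply: mulr_ge0 => //; apply: mulr_ge0 => //; exact: sqr_ge0.
by rewrite ler_pM2r in h1.
Qed.

Lemma err_selected_le M : D \subset M -> (#|M| <= Q)%N ->
  dot (err M) (err M) <= th ^+ 2 * Q%:R / kap ^+ 2.
Proof.
move=> DM MQ; have h1 := loss_selected_le DM MQ.
have nn : 0 < n%:R :> R by rewrite ltr0n.
have MD : M :|: D = M by apply/finset.setUidPl.
have eM : suppin (err M) M by rewrite -{2}MD; exact: suppin_err.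
have h2 := le_trans (hRE MQ eM) h1.
have kn : 0 < kap * n%:R by rewrite mulr_gt0.
rewrite -(ler_pM2l kn); apply: (le_trans h2).
by rewrite le_eqVlt; apply/orP; left; apply/eqP; field; rewrite gt_eqF.
Qed.

Lemma true_lossE l : true_loss X Y beta l = n%:R^-1 * loss (fs_set X Y l).
Proof.
rewrite /true_loss; congr (_ * _); rewrite /fs_coef dotE.
by rewrite -opprB mulmxN linearN /= !mulNmx opprK trmx_mul !mulmxA.
Qed.

End Screening.

Section ArgMin.
Context {R : realType} {k : nat}.
Lemma arg_min_le (F : 'I_k.+1 -> R) (l : 'I_k.+1) :
  F [arg min_(i < ord0 : 'I_k.+1) F i]%O <= F l.
Proof.
by case: (@Order.TotalTheory.arg_minP _ _ _ (ord0 : 'I_k.+1) predT F isT) => i _; apply.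
Qed.
End ArgMin.

(** * The oracle and the cross-validated steps contain the support *)

Section OracleAndValidation.
Context {R : realType} {n p : nat} (X X' : 'M[R]_(n, p)) (beta : 'cV[R]_p) (eps eps' : 'cV[R]_n).
Context (Q : nat) (kap psi B th : R) (K0 k : nat).
Hypotheses (n0 : (0 < n)%N) (kap0 : 0 < kap) (psi0 : 0 < psi) (B0 : 0 < B).
Hypothesis hB' : forall i j, `|X' i j| <= B.
Hypothesis hpsi : forall j, j \in supp beta -> psi <= `|beta j 0|.
Hypotheses (hRE : RE X Q kap) (hRE' : RE X' Q kap).
Hypothesis hth : forall j, `|dot (col j X) eps| <= th * n%:R.
Hypothesis hth' : forall j, `|dot (col j X') eps'| <= th * n%:R.
Hypothesis th0 : 0 <= th.
Hypothesis th_small : 16 * Q%:R * th ^+ 2 <= kap ^+ 2 * psi ^+ 2.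
Let Y := X *m beta + eps.
Let Y' := X' *m beta + eps'.
Implicit Types M : {set 'I_p}.
Local Notation D := (supp beta).
Local Notation err M := (beta - ols_ext X Y M).
Local Notation loss M := (dot (X *m err M) (X *m err M)).
Local Notation S l := (fs_set X Y l).

Hypotheses (K0k : (K0 <= k)%N) (K0Q : (K0 + #|D| <= Q)%N) (DK0 : D \subset S K0).

Let cardS l : (l <= K0)%N -> (#|S l :|: D| <= Q)%N.
Proof.
move=> lK; apply: leq_trans K0Q; apply: (leq_trans (leq_card_setU _ _)).
by rewrite leq_add2r (leq_trans (card_fs_set _ _ _)).
Qed.

Let cardSK0 : (#|S K0| <= Q)%N.
Proof. by apply: leq_trans (cardS (leqnn _)); exact: subset_leq_card (finset.subsetUl _ _). Qed.

Let nn : 0 < n%:R :> R. Proof. by rewrite ltr0n. Qed.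

(** Every step from [K0] on contains the support. An earlier step that misses a signal has loss at
    least [kap n psi^2], whereas [th_small] makes the loss at [K0] at most a sixteenth of that. *)
Lemma oracle_contains : D \subset S (oracle_lambda X Y beta k).
Proof.
set la := oracle_lambda X Y beta k.
have [laK|laK] := leqP K0 la; first exact: fintype.subset_trans DK0 (fs_set_mono X Y laK).
apply/negPn/negP => nD.
have h1 := loss_missing_ge eps kap0 psi0 hpsi hRE nD (cardS (ltnW laK)).
have h2 := loss_selected_le n0 kap0 hRE hth DK0 cardSK0.
have := arg_min_le (fun l : 'I_k.+1 => true_loss X Y beta l) (Ordinal (K0k : (K0 < k.+1)%N)).
rewrite -/(oracle_lambda X Y beta k) -/la !true_lossE ler_pM2l ?invr_gt0 // => h3.
have {h2 h3}h4 := le_trans (le_trans h1 h3) h2.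
have h5 : 16 * (th ^+ 2 * n%:R * Q%:R / kap) <= kap * n%:R * psi ^+ 2.
  have -> : 16 * (th ^+ 2 * n%:R * Q%:R / kap) = n%:R / kap * (16 * Q%:R * th ^+ 2) by ring.
  have -> : kap * n%:R * psi ^+ 2 = n%:R / kap * (kap ^+ 2 * psi ^+ 2) by field; rewrite gt_eqF.
  by rewrite ler_wpM2l // divr_ge0 // ltW.
have h6 : 0 < kap * n%:R * psi ^+ 2 by rewrite !mulr_gt0.
lra.
Qed.

(** [n] times the validation loss, minus [|eps'|^2]: the part that depends on the step. *)
Definition cv_excess l : R :=
  dot (X' *m err (S l)) (X' *m err (S l)) + 2 * dot (X' *m err (S l)) eps'.

Lemma cv_lossE l : cv_loss X Y X' Y' l = n%:R^-1 * (dot eps' eps' + cv_excess l).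
Proof.
rewrite /cv_loss; congr (_ * _).
have -> : \sum_(i < n) (Y' i 0 - (X' *m fs_coef X Y l) i 0) ^+ 2 =
   dot (eps' + X' *m err (S l)) (eps' + X' *m err (S l)).
  have -> : eps' + X' *m err (S l) = Y' - X' *m fs_coef X Y l.
    by rewrite mulmxBr addrA (addrC eps').
  by apply: eq_bigr => i _; rewrite expr2 [(Y' - _) i 0]mxE [(- _ : 'cV_n) i 0]mxE.
by rewrite dotDl !dotDr (dotC eps') /cv_excess; ring.
Qed.

Lemma cv_min_le l : (l <= k)%N -> cv_excess (cv_lambda X Y X' Y' k) <= cv_excess l.
Proof.
move=> lk; have := arg_min_le (fun l : 'I_k.+1 => cv_loss X Y X' Y' l) (Ordinal (lk : (l < k.+1)%N)).
by rewrite -/(cv_lambda X Y X' Y' k) !cv_lossE ler_pM2l ?invr_gt0 // lerD2l.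
Qed.

Definition cv_const : R := B ^+ 2 * Q%:R ^+ 2 / kap ^+ 2 + 2 * Q%:R / kap.

(** The first design bounds the [l1] norm of the coefficient error at [K0] by a multiple of [th].
    Boundedness of [X'] and the score bound for [eps'] convert this into the two terms of
    [cv_const], one for the fitted error and one for the cross term. *)
Lemma cv_excess_K0 : cv_excess K0 <= n%:R * th ^+ 2 * cv_const.
Proof.
have h1 := err_selected_le n0 kap0 hRE hth DK0 cardSK0.
have eS : suppin (err (S K0)) (S K0).
  have SE : (S K0 :|: D)%SET = S K0 by apply/finset.setUidPl.
  by rewrite -{2}SE; exact: suppin_err.
have h2 := l1_l2 eS.
set l1 := \sum_j `|_| in h2.
have l10 : 0 <= l1 by exact: sumr_ge0.
have l1b : l1 <= th * Q%:R / kap.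
  have c0 : 0 <= th * Q%:R / kap by rewrite divr_ge0 ?(ltW kap0) // mulr_ge0.
  rewrite -(@ler_pXn2r _ 2) ?nnegrE //; apply: (le_trans h2).
  have -> : (th * Q%:R / kap) ^+ 2 = Q%:R * (th ^+ 2 * Q%:R / kap ^+ 2) by field; rewrite gt_eqF.
  by rewrite ler_pM // ?dot_ge0 // ler_nat.
have h3 := mulmx_sqnorm_le (err (S K0)) (ltW B0) hB'; rewrite -/l1 in h3.
have h4 := dot_mulmx_le (err (S K0)) hth'; rewrite -/l1 in h4.
have h5 : n%:R * (B * l1) ^+ 2 <= n%:R * (B * (th * Q%:R / kap)) ^+ 2.
  rewrite ler_pM2l // ler_pXn2r ?nnegrE ?ler_pM2l //; first by rewrite mulr_ge0 // ltW.
  by rewrite mulr_ge0 ?(ltW B0) // (le_trans l10).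
have h6 : th * n%:R * l1 <= th * n%:R * (th * Q%:R / kap) by rewrite ler_wpM2l // mulr_ge0.
have -> : n%:R * th ^+ 2 * cv_const =
  n%:R * (B * (th * Q%:R / kap)) ^+ 2 + 2 * (th * n%:R * (th * Q%:R / kap)).
  by rewrite /cv_const; field; rewrite gt_eqF.
move: h4; rewrite ler_norml /cv_excess => /andP[_ h4]; lra.
Qed.

Hypothesis th_small2 : 2 * cv_const * th ^+ 2 < kap * psi ^+ 2.

(** A missing signal leaves a validation excess of at least half of [|X' err|^2], hence of
    [kap n psi^2 / 2]; [th_small2] puts the excess at [K0] strictly below. *)
Lemma cv_contains : D \subset S (cv_lambda X Y X' Y' k).
Proof.
set la := cv_lambda X Y X' Y' k.
have [laK|laK] := leqP K0 la; first exact: fintype.subset_trans DK0 (fs_set_mono X Y laK).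
apply/negPn/negP => nD.
have h1 := le_trans (cv_min_le K0k) cv_excess_K0.
have c1 := cardS (ltnW laK).
have e2 := err_missing_ge X eps psi0 hpsi nD.
have h2 := dot_noise_quarter kap0 hRE' c1 (@suppin_err _ _ _ X beta eps _) hth' th_small e2.
have h3 := hRE' c1 (@suppin_err _ _ _ X beta eps _).
have h4 : kap * n%:R * psi ^+ 2 <= kap * n%:R * dot (err (S la)) (err (S la)).
  by rewrite ler_wpM2l // mulr_ge0 // ltW.
have h5 : n%:R * (2 * cv_const * th ^+ 2) < n%:R * (kap * psi ^+ 2) by rewrite ltr_pM2l.
move: h1 h2; rewrite ler_norml /cv_excess -/la => h1 /andP[h2 _]; rewrite -/Y in h2 h3 h4.
lra.
Qed.

End OracleAndValidation.

(** * Size of the validated model *)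

(** If [x] exceeded [2 a], then [x / 2 <= - 2 d], hence [x^2 / 4 <= 4 z x]. It is applied to
    [x = |X' err|^2], whose validation excess is [x + 2 d]. *)
Lemma excess_bound (R : realType) (x d a z : R) : 0 <= x -> 0 <= a -> 0 <= z ->
  x + 2 * d <= a -> d ^+ 2 <= z * x -> x <= 2 * a + 16 * z.
Proof.
move=> x0 a0 z0 h1 h2; rewrite leNgt; apply/negP => h3.
have h4 : x / 2 <= - (2 * d) by lra.
have h5 : (x / 2) ^+ 2 <= 4 * d ^+ 2.
  have -> : 4 * d ^+ 2 = (- (2 * d)) ^+ 2 by ring.
  by rewrite ler_pXn2r ?nnegrE ?divr_ge0 // (le_trans _ h4) ?divr_ge0.
have h6 : x * x <= 16 * z * x by rewrite exprMn expr2 in h5; lra.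
have xp : 0 < x by lra.
by rewrite ler_pM2r // in h6; lra.
Qed.

Section DualBound.
Context {R : realType} {n p : nat} (X : 'M[R]_(n, p)).

(** Duality: test the upper eigenvalue bound on the vector [u] of inner products itself, then apply
    Cauchy-Schwarz and divide by [|u|^2]. *)
Lemma col_dots_le Q C (S : {set 'I_p}) (y : 'cV[R]_n) : 0 <= C -> UP X Q C -> (#|S| <= Q)%N ->
  \sum_(j in S) dot (col j X) y ^+ 2 <= C * n%:R * dot y y.
Proof.
move=> C0 up SQ.
pose u : 'cV[R]_p := \col_j (if j \in S then dot (col j X) y else 0).
have uS : suppin u S by move=> j jS; rewrite mxE (negbTE jS).
have uu : dot u u = \sum_(j in S) dot (col j X) y ^+ 2.
  rewrite [RHS]big_mkcond; apply: eq_bigr => j _; rewrite mxE.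
  by case: ifP => _; rewrite ?mul0r // expr2.
have uy : dot (X *m u) y = dot u u.
  rewrite dot_mulmx; apply: eq_bigr => j _; rewrite mxE.
  by case: ifP => _; rewrite ?mul0r.
rewrite -uu; have := cauchy_schwarz (X *m u) y; rewrite uy => h1.
have h2 := up S u SQ uS.
have := dot_ge0 u; rewrite le0r => /orP [/eqP ->|u0].
  by rewrite !mulr_ge0 // dot_ge0.
rewrite -(ler_pM2l u0) -expr2; apply: (le_trans h1).
apply: (le_trans (ler_wpM2r (dot_ge0 y) h2)); rewrite le_eqVlt; apply/orP; left; apply/eqP; ring.
Qed.

End DualBound.

Section SelectedSize.
Context {R : realType} {n p : nat} (X X' : 'M[R]_(n, p)) (beta : 'cV[R]_p) (eps eps' : 'cV[R]_n).
Context (Q : nat) (kap B th om C0 zeta2 L1 L2 a : R) (K0 k q' : nat) (A : {set 'I_p}).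
Hypotheses (n0 : (0 < n)%N) (p0 : (0 < p)%N) (kap0 : 0 < kap) (B0 : 0 < B) (om0 : 0 < om) (C00 : 0 < C0).
Hypothesis hB : forall i j, `|X i j| <= B.
Hypotheses (hRE : RE X Q kap) (hRE' : RE X' Q kap).
Hypotheses (hUP : UP X n C0) (hUP' : UP X' n C0).
Hypothesis hth : forall j, `|dot (col j X) eps| <= th * n%:R.
Hypotheses (An : (#|A| <= n)%N) (hA : forall j, j \in A -> om ^+ 2 * n%:R <= dot (col j X) eps ^+ 2).
(** Cancelling the scores of [A] would take a larger loss than [Q] covariates containing the support
    can have; see [big_score]. *)
Hypothesis Abig : 4 * C0 * (th ^+ 2 * n%:R * Q%:R / kap) < #|A|%:R * om ^+ 2.
Hypothesis hinj : forall M : {set 'I_p}, (#|M| <= k)%N -> inj_on X M.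
Hypothesis hL1 : forall (M : {set 'I_p}) j, (#|M| <= k)%N ->
  dot (residual X (col j X) M) eps ^+ 2 <=
  L1 * dot (residual X (col j X) M) (residual X (col j X) M).
Let XX : 'M[R]_(n + n, p) := col_mx X X'.
Let yy j : 'cV[R]_(n + n) := col_mx (col j X) (- col j X').
Hypothesis hL2 : forall (M : {set 'I_p}) i j, (#|M| <= k)%N ->
  dot (residual XX (col i XX) M) (yy j) ^+ 2 <=
  L2 * dot (residual XX (col i XX) M) (residual XX (col i XX) M).
Hypotheses (L10 : 0 <= L1) (L20 : 0 <= L2) (zeta0 : 0 <= zeta2) (a0 : 0 <= a).
Let Y := X *m beta + eps.
Let Y' := X' *m beta + eps'.
Implicit Types M : {set 'I_p}.
Local Notation D := (supp beta).
Local Notation err M := (beta - ols_ext X Y M).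
Local Notation loss M := (dot (X *m err M) (X *m err M)).
Local Notation S l := (fs_set X Y l).
Hypothesis hzeta : forall l, (l <= k)%N ->
  dot (X' *m err (S l)) eps' ^+ 2 <= zeta2 * dot (X' *m err (S l)) (X' *m err (S l)).
Hypotheses (K0q : (K0 <= q')%N) (qQ : (q' <= Q)%N) (qn : (q' <= n)%N) (DK0 : D \subset S K0).
Hypothesis hcv : cv_excess X X' beta eps eps' (cv_lambda X Y X' Y' k) <= a.

Let nn : 0 < n%:R :> R. Proof. by rewrite ltr0n. Qed.

Let DS l : (K0 <= l)%N -> D \subset S l.
Proof. by move=> Kl; exact: fintype.subset_trans DK0 (fs_set_mono X Y Kl). Qed.

Let supp_err l : (K0 <= l)%N -> suppin (err (S l)) (S l).
Proof.
move=> /DS /finset.setUidPl SE.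
by rewrite -{2}SE; exact: suppin_err.
Qed.

Let cardSQ l : (l <= q')%N -> (#|S l| <= Q)%N.
Proof. by move=> lq; apply: leq_trans (card_fs_set _ _ _) (leq_trans lq qQ). Qed.

Let loss_err l : (K0 <= l)%N -> inj_on X (S l) ->
  dot (X *m err (S l)) eps = - loss (S l).
Proof.
move=> Kl iM; have := residual_orth Y iM (supp_err Kl); rewrite residual_err dotDr => /eqP.
by rewrite addr_eq0 => /eqP.
Qed.

(** From [K0] on the loss is pure overfitting: a decrease of the residual sum of squares is an equal
    increase of the loss. *)
Let res_loss l : (K0 <= l)%N -> inj_on X (S l) ->
  dot (residual X Y (S l)) (residual X Y (S l)) = dot eps eps - loss (S l).
Proof.
move=> Kl iM; rewrite residual_err dotDl !dotDr (dotC eps) (loss_err Kl iM); ring.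
Qed.

(** If all residual scores were below [om sqrt n / 2], every column of [A] would have an inner
    product of at least that size with [X err]. By [col_dots_le] the squares sum to at most [C0 n]
    times the loss, against [Abig]. *)
Let big_score l : (K0 <= l)%N -> (l <= q')%N ->
  exists j, om ^+ 2 * n%:R / 4 <= dot (col j X) (residual X Y (S l)) ^+ 2.
Proof.
move=> Kl lq; apply: contrapT => no.
have small j : dot (col j X) (residual X Y (S l)) ^+ 2 < om ^+ 2 * n%:R / 4.
  by rewrite ltNge; apply/negP => h; apply: no; exists j.
have h1 := loss_selected_le n0 kap0 hRE hth (DS Kl) (cardSQ lq).
have h2 := col_dots_le (X *m err (S l)) (ltW C00) hUP An.
have h3 : #|A|%:R * (om ^+ 2 * n%:R / 4) <= \sum_(j in A) dot (col j X) (X *m err (S l)) ^+ 2.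
  rewrite mulr_natl -sumr_const; apply: ler_sum => j jA.
  have := hA jA; have := small j; rewrite residual_err dotDr.
  set x := dot (col j X) eps; set y := dot (col j X) (X *m _).
  move: (om ^+ 2 * n%:R) x y => w x y h4 h5.
  have h6 : x ^+ 2 <= 2 * (x + y) ^+ 2 + 2 * y ^+ 2.
    rewrite -subr_ge0; have -> : 2 * (x + y) ^+ 2 + 2 * y ^+ 2 - x ^+ 2 = (x + 2 * y) ^+ 2 by ring.
    exact: sqr_ge0.
  lra.
have h4 : C0 * n%:R * loss (S l) <= C0 * n%:R * (th ^+ 2 * n%:R * Q%:R / kap).
  by rewrite ler_wpM2l // mulr_ge0 // ltW.
have h5 : n%:R / 4 * (4 * C0 * (th ^+ 2 * n%:R * Q%:R / kap)) < n%:R / 4 * (#|A|%:R * om ^+ 2).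
  by rewrite ltr_pM2l // divr_gt0.
have := le_trans h3 (le_trans h2 h4).
have -> : C0 * n%:R * (th ^+ 2 * n%:R * Q%:R / kap) =
   n%:R / 4 * (4 * C0 * (th ^+ 2 * n%:R * Q%:R / kap)) by field; rewrite gt_eqF.
have -> : #|A|%:R * (om ^+ 2 * n%:R / 4) = n%:R / 4 * (#|A|%:R * om ^+ 2) by field.
by move=> /le_lt_trans /(_ h5); rewrite ltxx.
Qed.

Let inj_small l : (l <= q')%N -> inj_on X (S l).
Proof. by move=> lq; exact: RE_inj n0 kap0 hRE (cardSQ lq). Qed.

Let loss_gain l : (K0 <= l)%N -> (l < q')%N ->
  loss (S l) + om ^+ 2 / (4 * B ^+ 2) <= loss (S l.+1).
Proof.
move=> Kl lq; have [j hj] := big_score Kl (ltnW lq).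
have := fs_step_decrease j n0 p0 B0 hB (inj_small lq).
rewrite -/(S l.+1) (res_loss (leqW Kl) (inj_small lq)) (res_loss Kl (inj_small (ltnW lq))) => h.
have h1 : om ^+ 2 / (4 * B ^+ 2) <= dot (col j X) (residual X Y (S l)) ^+ 2 / (n%:R * B ^+ 2).
  rewrite ler_pdivlMr ?mulr_gt0 ?exprn_gt0 //; apply: le_trans hj.
  by rewrite le_eqVlt; apply/orP; left; apply/eqP; field; rewrite gt_eqF.
lra.
Qed.

Lemma loss_ge : (q' - K0)%N%:R * (om ^+ 2 / (4 * B ^+ 2)) <= loss (S q').
Proof.
have h m : (K0 + m <= q')%N -> m%:R * (om ^+ 2 / (4 * B ^+ 2)) <= loss (S (K0 + m)).
  elim: m => [|m IH] Km; first by rewrite mul0r dot_ge0.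
  rewrite addnS in Km *.
  have h1 := loss_gain (leq_addr m K0) Km; have h2 := IH (ltnW Km).
  by rewrite -natr1 mulrDl mul1r; apply: le_trans h1; rewrite lerD2r.
by have := h (q' - K0)%N; rewrite subnKC //; apply.
Qed.

Hypothesis final :
  let Amax := 2 * a + 16 * zeta2 in
  2 * Q%:R * (k%:R * L2 * (k%:R * L1 + Amax)) / (kap * n%:R) + 2 * Amax * C0 / kap
   < (q' - K0)%N%:R * (om ^+ 2 / (4 * B ^+ 2)).

(** Let [h] and [w] be the estimation errors at [cv_lambda] and at [q']. If
    [q' < cv_lambda] then [<X h, X w> = |X w|^2] because the residual at [cv_lambda]
    is orthogonal to [X w], and [|X w|^2] is large by overfitting. But [<X' h, X' w>]
    is small since the validation loss bounds [|X' h|], and [L2] bounds the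
    difference of the two inner products. *)
Lemma cv_lambda_le : (cv_lambda X Y X' Y' k <= q')%N.
Proof.
move: final => /=; set Amax := 2 * a + 16 * zeta2 => fin.
rewrite leqNgt; apply/negP; set la := cv_lambda X Y X' Y' k => qla.
have lak : (la <= k)%N by rewrite -ltnS.
have Kla : (K0 <= la)%N by apply: leq_trans K0q (ltnW qla).
have cardla : (#|S la| <= k)%N by apply: leq_trans (card_fs_set _ _ _) lak.
have ila := hinj cardla.
set h := err (S la); set w := err (S q'); set Z := dot (X *m w) (X *m w).
set A' := dot (X' *m h) (X' *m h).
have Z0 : 0 <= Z := dot_ge0 _.
have A'0 : 0 <= A' := dot_ge0 _.
have wS : suppin w (S la) by apply: suppinS (fs_set_mono X Y (ltnW qla)) _; exact: supp_err.
have eqZ : dot (X *m h) (X *m w) = Z.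
  have := residual_orth Y ila wS; rewrite residual_err dotDr (loss_err K0q (inj_small (leqnn _))).
  by rewrite -/w -/Z -/h => /eqP; rewrite addr_eq0 eqr_opp dotC => /eqP.
have A'le : A' <= Amax.
  have := hcv; rewrite -/la /cv_excess -/Y -/h -/A' => h1.
  have := hzeta lak; rewrite -/h -/A' => h2.
  exact: excess_bound A'0 a0 zeta0 h1 h2.
(* [dot_span_le] bounds [loss^2] by [k L1 loss]: each of at most [k] orthogonalized directions has
   normalized squared noise correlation at most [L1]. *)
have lossla : loss (S la) <= k%:R * L1.
  have hk := dot_span_le hinj hL1 L10 cardla (supp_err Kla).
  rewrite (loss_err Kla ila) sqrrN expr2 in hk.
  have := dot_ge0 (X *m err (S la)); rewrite le0r => /orP [/eqP ->|lp].
    by rewrite mulr_ge0.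
  rewrite ler_pM2r // in hk; apply: (le_trans hk); rewrite ler_wpM2r // ler_nat //.
have XXinj M : (#|M| <= k)%N -> inj_on XX M.
  move=> Mk v vM; rewrite /XX mul_col_mx => e.
  apply: (hinj Mk vM); have := congr1 usubmx e; rewrite col_mxKu => ->.
  by apply/matrixP => i j; rewrite !mxE.
have dotcol (u1 u2 v1 v2 : 'cV[R]_n) : dot (col_mx u1 u2) (col_mx v1 v2) = dot u1 v1 + dot u2 v2.
  by rewrite /dot big_split_ord; congr (_ + _); apply: eq_bigr => i _; rewrite ?col_mxEu ?col_mxEd.
pose Pi := k%:R * L2 * (k%:R * L1 + Amax).
(* The inner product of the stacked vector [(X h, X' h)] with [yy j = (x_j, - x'_j)] is the
   difference to be bounded. *)
have hj j : `|dot (X *m h) (col j X) - dot (X' *m h) (col j X')| <= Num.sqrt Pi.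
  have := dot_span_le XXinj (fun M i => @hL2 M i j) L20 cardla (supp_err Kla).
  rewrite /XX mul_col_mx !dotcol dotNr -/h => h1.
  rewrite -[leLHS]sqrtr_sqr ler_sqrt //; last first.
    by rewrite /Pi !mulr_ge0 // addr_ge0 ?mulr_ge0 // (le_trans A'0).
  apply: (le_trans h1); rewrite /Pi ler_pM ?mulr_ge0 //.
  - by rewrite addr_ge0 ?dot_ge0.
  - by rewrite ler_wpM2r // ler_nat.
  - exact: lerD.
set l1 := \sum_j `|w j 0|.
(* Expanding [w] over its coordinates leaves inner products of [X h] and [X' h] with single columns.
   The price is the [l1] norm of [w], controlled by the restricted eigenvalue since [w] is supported
   on at most [Q] covariates. *)
have diff : `|Z - dot (X' *m h) (X' *m w)| <= Num.sqrt Pi * l1.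
  rewrite -eqZ (dotC _ (X *m w)) (dotC _ (X' *m w)) !dot_mulmx -sumrB /l1 mulr_sumr.
  apply: (le_trans (ler_norm_sum _ _ _)); apply: ler_sum => j _.
  by rewrite -mulrBr normrM mulrC ler_wpM2r // !(dotC (col j _)).
have ww : kap * n%:R * dot w w <= Z by apply: hRE (supp_err K0q); exact: cardSQ.
have kn : 0 < kap * n%:R by rewrite mulr_gt0.
have ww' : dot w w <= Z / (kap * n%:R) by rewrite ler_pdivlMr // mulrC.
have l1b : l1 ^+ 2 <= Q%:R * (Z / (kap * n%:R)).
  apply: (le_trans (l1_l2 (supp_err K0q))); rewrite ler_pM ?dot_ge0 // ler_nat.
  exact: cardSQ.
have Pi0 : 0 <= Pi by rewrite /Pi !mulr_ge0 // addr_ge0 ?mulr_ge0 // (le_trans A'0).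
have s1 : (Z - dot (X' *m h) (X' *m w)) ^+ 2 <= Pi * (Q%:R * (Z / (kap * n%:R))).
  rewrite -[leLHS]ger0_norm ?sqr_ge0 // normrX.
  apply: (le_trans (_ : _ <= (Num.sqrt Pi * l1) ^+ 2)).
    by rewrite ler_pXn2r ?nnegrE // mulr_ge0 ?sqrtr_ge0 // sumr_ge0.
  by rewrite exprMn sqr_sqrtr // ler_wpM2l.
have s2 : dot (X' *m h) (X' *m w) ^+ 2 <= Amax * (C0 * n%:R * (Z / (kap * n%:R))).
  apply: (le_trans (cauchy_schwarz _ _)); rewrite -/A' ler_pM ?dot_ge0 //.
  apply: (le_trans (hUP' (leq_trans (card_fs_set X Y q') qn) (supp_err K0q))).
  by rewrite ler_wpM2l // mulr_ge0 // ltW.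
have s3 : Z ^+ 2 <= 2 * (Z - dot (X' *m h) (X' *m w)) ^+ 2 + 2 * dot (X' *m h) (X' *m w) ^+ 2.
  rewrite -subr_ge0; move: (dot _ _) => x.
  have -> : 2 * (Z - x) ^+ 2 + 2 * x ^+ 2 - Z ^+ 2 = (Z - 2 * x) ^+ 2 by ring.
  exact: sqr_ge0.
have := loss_ge; rewrite -/w -/Z => Zge.
have Zp : 0 < Z.
  apply: lt_le_trans Zge; apply: le_lt_trans fin.
  have Am0 : 0 <= Amax := le_trans A'0 A'le.
  by rewrite addr_ge0 ?divr_ge0 ?(ltW kn) ?(ltW kap0) // !mulr_ge0 // ?addr_ge0 ?mulr_ge0 // ltW.
(* The two terms of [final] are the bounds [s1] and [s2], doubled by [s3] and divided by [Z]. *)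
have := lt_le_trans fin Zge; rewrite -(ltr_pM2r Zp) ltNge => /negP; apply.
rewrite -expr2; apply: (le_trans s3).
have -> : (2 * Q%:R * (k%:R * L2 * (k%:R * L1 + Amax)) / (kap * n%:R) + 2 * Amax * C0 / kap) * Z =
  2 * (Pi * (Q%:R * (Z / (kap * n%:R)))) + 2 * (Amax * (C0 * n%:R * (Z / (kap * n%:R)))).
  by rewrite /Pi; field; rewrite !gt_eqF.
lra.
Qed.

End SelectedSize.

(** * Conditioning on independent observations *)

Section TupleLaws.
Context {d} {E : measurableType d} {R : realType} {N : nat}.

Definition rectangle (A : 'I_N -> set E) : set (N.-tuple E) :=
  [set t | forall i, A i (tnth t i)].

Lemma rectangleE A : rectangle A = \bigcap_(i in [set: 'I_N]) ((fun t => tnth t i) @^-1` A i).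
Proof. by apply/seteqP; split => t h i; [move=> _; exact: h|exact: (h i I)]. Qed.

Lemma measurable_rectangle A : (forall i, measurable (A i)) -> measurable (rectangle A).
Proof.
move=> mA; rewrite rectangleE; apply: fin_bigcap_measurable; first exact: finite_finset.
by move=> i _; rewrite -[X in measurable X]setTI; exact: (measurable_tnth i) (mA i).
Qed.

(** Rectangles form a pi-system generating the tuple sigma-algebra, so finite measures are
    determined by them. *)
Lemma tuple_law_ext (m1 m2 : {measure set (N.-tuple E) -> \bar R}) :
  (forall A, (forall i, measurable (A i)) -> m1 (rectangle A) = m2 (rectangle A)) ->
  (m1 setT < +oo)%E ->
  forall X, measurable X -> m1 X = m2 X.
Proof.
move=> h fin X mX.
pose G := [set X | exists2 A : 'I_N -> set E, (forall i, measurable (A i)) & X = rectangle A].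
have GT : G setT by exists (fun=> setT) => //; apply/seteqP; split.
apply: (measure_unique G (fun=> setT)) => //.
- apply/seteqP; split.
  + apply: smallest_sub; first exact: smallest_sigma_algebra.
    rewrite -bigcup_seq => Z [i _] [A mA <-].
    apply: sub_sigma_algebra; exists (fun j => if j == i then A else setT).
      by move=> j; case: ifP.
    apply/seteqP; split => t /=.
      by move=> [_ Ai] j; case: eqP => [->|].
    by move=> /(_ i); rewrite eqxx.
  + apply: smallest_sub; first exact: sigma_algebra_measurable.
    by move=> Z [A mA ->]; exact: measurable_rectangle.
- move=> _ _ [A mA ->] [A' mA' ->]; exists (fun i => A i `&` A' i).
    by move=> i; exact: measurableI.
  by apply/seteqP; split => t /=; [move=> [h1 h2] i|move=> h1; split => i; have [] := h1 i].
- by rewrite bigcup_const //; exists 0%N.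
- by move=> _ [A mA ->]; exact: h.
Qed.

End TupleLaws.

Section Decoupling.
Context {d} {T : measurableType d} {R : realType} (P : probability T R).

Lemma integral_same_law d' (E : measurableType d') d2 (T2 : measurableType d2)
    (P2 : {measure set T2 -> \bar R}) (f : T -> E) (g : T2 -> E) (F : E -> \bar R) :
  measurable_fun setT f -> measurable_fun setT g -> measurable_fun setT F ->
  (forall x, (0 <= F x)%E) ->
  (forall X, measurable X -> P (f @^-1` X) = P2 (g @^-1` X)) ->
  (\int[P]_w F (f w) = \int[P2]_w F (g w))%E.
Proof.
move=> mf mg mF F0 h.
rewrite -[LHS](_ : \int[pushforward P f]_y F y = _)%E; last first.
  by rewrite ge0_integral_pushforward // => y _.
rewrite -[RHS](_ : \int[pushforward P2 g]_y F y = _)%E; last first.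
  by rewrite ge0_integral_pushforward // => y _.
by apply: eq_measure_integral => /= X mX _; exact: h.
Qed.

Lemma prob_decouple (Psi : set (T * T)) : measurable Psi ->
  (P \x P)%E Psi = (\int[P]_w P [set w' | Psi (w, w')])%E.
Proof.
move=> mPsi; rewrite /product_measure1; apply: eq_integral => w _ /=.
by congr (P _); apply/seteqP; split => w'; rewrite /xsection /= inE.
Qed.

Section Pairs.
Context d1 d2 (E1 : measurableType d1) (E2 : measurableType d2) (U : T -> E1) (V : T -> E2).
Hypotheses (mU : measurable_fun setT U) (mV : measurable_fun setT V).
Hypothesis UV : indep2 P U V.

(** Independence as an identity of laws: [V] may be evaluated at an independent second outcome. This
    takes the place of conditional distributions. *)
Lemma indep2_law (X : set (E1 * E2)) : measurable X ->
  P [set w | X (U w, V w)] = (P \x P)%E [set ww | X (U ww.1, V ww.2)].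
Proof.
move=> mX.
have mp1 : measurable_fun setT (fun w => (U w, V w)).
  by apply/measurable_fun_pairP.
have mp2 : measurable_fun setT (fun ww : T * T => (U ww.1, V ww.2)).
  apply/measurable_fun_pairP; split.
    exact: (measurableT_comp mU measurable_fst).
  exact: (measurableT_comp mV measurable_snd).
pose p1 : {mfun T >-> (E1 * E2)%type} := HB.pack (fun w => (U w, V w))
  (isMeasurableFun.Build _ _ _ _ _ mp1).
pose p2 : {mfun (T * T)%type >-> (E1 * E2)%type} := HB.pack (fun ww : T * T => (U ww.1, V ww.2))
  (isMeasurableFun.Build _ _ _ _ _ mp2).
pose mU' : {mfun T >-> E1} := HB.pack U (isMeasurableFun.Build _ _ _ _ U mU).
pose mV' : {mfun T >-> E2} := HB.pack V (isMeasurableFun.Build _ _ _ _ V mV).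
have e1 : (distribution P mU' \x distribution P mV')%E X = distribution P p1 X.
  apply: product_measure_unique => // A B mA mB; exact: (UV mA mB).
have e2 : (distribution P mU' \x distribution P mV')%E X = distribution (P \x P)%E p2 X.
  apply: product_measure_unique => // A B mA mB.
  rewrite -[LHS]/((P \x P)%E ((U @^-1` A) `*` (V @^-1` B))).
  rewrite product_measure1E // -[X in measurable X]setTI; [exact: mU|exact: mV].
by rewrite -[LHS]/(distribution P p1 X) -e1 e2.
Qed.

Lemma indep2_prob (S : set (E1 * E2)) : measurable S ->
  P [set w | S (U w, V w)] = (\int[P]_w P [set w' | S (U w, V w')])%E.
Proof.
move=> mS; rewrite indep2_law // prob_decouple //.
have mp2 : measurable_fun setT (fun ww : T * T => (U ww.1, V ww.2)).
  apply/measurable_fun_pairP; split.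
    exact: (measurableT_comp mU measurable_fst).
  exact: (measurableT_comp mV measurable_snd).
by rewrite -[X in measurable X]setTI; exact: mp2.
Qed.

(** Conditioning on [U]: a bound valid for each frozen value integrates to the same bound. *)
Lemma indep2_prob_le (S : set (E1 * E2)) (c : \bar R) : measurable S ->
  (forall w, (P [set w' | S (U w, V w')] <= c)%E) -> (0 <= c)%E ->
  (P [set w | S (U w, V w)] <= c)%E.
Proof.
move=> mS h c0; rewrite indep2_prob //.
have -> : c = (\int[P]_w cst c w)%E.
  rewrite integral_cst // -[LHS]mule1; congr (_ * _)%E; exact/esym/probability_setT.
apply: ge0_le_integral => //.
have := measurable_fun_xsection P (_ : measurable [set ww : T * T | S (U ww.1, V ww.2)]).
have mp2 : measurable_fun setT (fun ww : T * T => (U ww.1, V ww.2)).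
  apply/measurable_fun_pairP; split.
    exact: (measurableT_comp mU measurable_fst).
  exact: (measurableT_comp mV measurable_snd).
have mS' : measurable [set ww : T * T | S (U ww.1, V ww.2)].
  by rewrite -[X in measurable X]setTI; exact: mp2.
move=> /(_ mS'); apply: eq_measurable_fun => w _ /=.
by congr (P _); apply/seteqP; split => w'; rewrite /xsection /= inE.
Qed.

End Pairs.

End Decoupling.

Section Mixing.
Context {d} {T : measurableType d} {R : realType} (P : probability T R).
Context {d'} {E : measurableType d'} {N : nat} (V : 'I_N -> T -> E).
Hypothesis mV : forall i, measurable_fun setT (V i).
Hypothesis indV : mutually_indep P V.

Definition tupleV (w : T) : N.-tuple E := [tuple V i w | i < N].

(** Keeps the coordinates in [J] of the first tuple and takes the others from the second. By
    [mix_law], redrawing coordinates from an independent copy preserves the law, which serves as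
    conditioning on the coordinates in [J]. *)
Definition mix (J : pred 'I_N) (t t' : N.-tuple E) : N.-tuple E :=
  [tuple (if J i then tnth t i else tnth t' i) | i < N].

Lemma tnth_mix J t t' i : tnth (mix J t t') i = if J i then tnth t i else tnth t' i.
Proof. by rewrite tnth_mktuple. Qed.

Lemma tnth_tupleV w i : tnth (tupleV w) i = V i w.
Proof. by rewrite tnth_mktuple. Qed.

Lemma measurable_tupleV : measurable_fun setT tupleV.
Proof.
apply/measurable_fun_tnthP => i; apply: eq_measurable_fun (mV i) => w _ /=.
by rewrite tnth_tupleV.
Qed.

Lemma measurable_mix J : measurable_fun setT (fun ww : T * T => mix J (tupleV ww.1) (tupleV ww.2)).
Proof.
apply/measurable_fun_tnthP => i; case Ji: (J i).
  apply: eq_measurable_fun (measurableT_comp (mV i) measurable_fst) => w _ /=.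
  by rewrite tnth_mix Ji tnth_tupleV.
apply: eq_measurable_fun (measurableT_comp (mV i) measurable_snd) => w _ /=.
by rewrite tnth_mix Ji tnth_tupleV.
Qed.

Lemma prob_rectangle A : (forall i, measurable (A i)) ->
  P (tupleV @^-1` rectangle A) = (\prod_i P (V i @^-1` A i))%E.
Proof.
move=> mA; rewrite -indV //; congr (P _); apply/seteqP; split => w /= h i.
  by move=> _; have := h i; rewrite tnth_tupleV.
by rewrite tnth_tupleV; exact: (h i I).
Qed.

Lemma mix_law J (X : set (N.-tuple E)) : measurable X ->
  P (tupleV @^-1` X) = (P \x P)%E ((fun ww => mix J (tupleV ww.1) (tupleV ww.2)) @^-1` X).
Proof.
move=> mX.
pose p1 : {mfun T >-> N.-tuple E} := HB.pack tupleV
  (isMeasurableFun.Build _ _ _ _ _ measurable_tupleV).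
pose p2 : {mfun (T * T)%type >-> N.-tuple E} :=
  HB.pack (fun ww : T * T => mix J (tupleV ww.1) (tupleV ww.2))
  (isMeasurableFun.Build _ _ _ _ _ (measurable_mix J)).
apply: (tuple_law_ext (m1 := distribution P p1) (m2 := distribution (P \x P)%E p2)) => //; last first.
  by apply: (@le_lt_trans _ _ 1%E); rewrite ?ltry // probability_le1.
move=> A mA.
rewrite -[LHS]/(P (tupleV @^-1` rectangle A)) prob_rectangle //.
pose A1 i := if J i then A i else setT.
pose A2 i := if J i then setT else A i.
have mA1 i : measurable (A1 i) by rewrite /A1; case: ifP.
have mA2 i : measurable (A2 i) by rewrite /A2; case: ifP.
have mpre (B : 'I_N -> set E) : (forall i, measurable (B i)) -> measurable (tupleV @^-1` rectangle B).
  by move=> mB; rewrite -[X in measurable X]setTI; exact: measurable_tupleV (measurable_rectangle mB).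
rewrite -[RHS]/((P \x P)%E ((fun ww => mix J (tupleV ww.1) (tupleV ww.2)) @^-1` rectangle A)).
have -> : (fun ww : T * T => mix J (tupleV ww.1) (tupleV ww.2)) @^-1` rectangle A =
    (tupleV @^-1` rectangle A1) `*` (tupleV @^-1` rectangle A2).
  apply/seteqP; split => -[w w'] /=.
    move=> h; split => i; have := h i; rewrite tnth_mix /A1 /A2; case: ifP => //.
  move=> [h1 h2] i; have := h1 i; have := h2 i; rewrite tnth_mix /A1 /A2; case: ifP => //.
transitivity (P (tupleV @^-1` rectangle A1) * P (tupleV @^-1` rectangle A2))%E; last first.
  by apply/esym; exact: product_measure1E (mpre _ mA1) (mpre _ mA2).
rewrite (prob_rectangle mA1) (prob_rectangle mA2).
rewrite -big_split /=; apply: eq_bigr => i _; rewrite /A1 /A2.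
by case: ifP => _; rewrite preimage_setT (_ : P setT = 1%E) ?mule1 ?mul1e //; exact: probability_setT.
Qed.

Lemma mix_integral J (F : N.-tuple E -> \bar R) : measurable_fun setT F -> (forall t, (0 <= F t)%E) ->
  (\int[P]_w F (tupleV w) = \int[P]_w \int[P]_w' F (mix J (tupleV w) (tupleV w')))%E.
Proof.
move=> mF F0.
rewrite (integral_same_law measurable_tupleV (measurable_mix J) mF F0 (mix_law J)).
have mFm : measurable_fun setT (fun ww : T * T => F (mix J (tupleV ww.1) (tupleV ww.2))).
  exact: (measurableT_comp mF (measurable_mix J)).
exact: (fubini_tonelli1 _ mFm (fun x => F0 _)).
Qed.

Lemma mix_prob_le J (X : set (N.-tuple E)) (c : \bar R) : measurable X ->
  (forall t, (P [set w | X (mix J t (tupleV w))] <= c)%E) -> (0 <= c)%E ->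
  (P (tupleV @^-1` X) <= c)%E.
Proof.
move=> mX h c0; rewrite (mix_law J) //.
have mS : measurable [set ww : T * T | X (mix J (tupleV ww.1) (tupleV ww.2))].
  rewrite -[Y in measurable Y]setTI; exact: (measurable_mix J measurableT mX).
rewrite prob_decouple //.
have -> : c = (\int[P]_w cst c w)%E.
  rewrite integral_cst // -[LHS]mule1; congr (_ * _)%E; exact/esym/probability_setT.
apply: ge0_le_integral => //; last by move=> w _; exact: (h (tupleV w)).
have := measurable_fun_xsection P mS; apply: eq_measurable_fun => w _ /=.
by congr (P _); apply/seteqP; split => w'; rewrite /xsection /= inE.
Qed.

(** Induction on [r]: redrawing all coordinates but [k] separates the factor of [k] from the
    remaining product, and the double integral factors. *)
Lemma integral_prod_indep (phi : 'I_N -> E -> R) (r : seq 'I_N) : uniq r ->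
  (forall i, measurable_fun setT (phi i)) -> (forall i x, 0 <= phi i x) ->
  (\int[P]_w (\prod_(i <- r) phi i (V i w))%:E = \prod_(i <- r) \int[P]_w (phi i (V i w))%:E)%E.
Proof.
move=> + mphi phi0; elim: r => [_|k r IH /= /andP[kr ur]].
  rewrite big_nil; under eq_integral do rewrite big_nil.
  by rewrite integral_cst // mul1e; exact: probability_setT.
rewrite big_cons -IH //.
pose F (t : N.-tuple E) := (\prod_(i <- k :: r) phi i (tnth t i))%:E.
have mF : measurable_fun setT F.
  apply/measurable_EFinP; apply: measurable_prod => i _.
  exact: (measurableT_comp (mphi i) (measurable_tnth i)).
transitivity (\int[P]_w F (tupleV w))%E.
  by apply: eq_integral => w _; rewrite /F; congr (_%:E); apply: eq_bigr => i _; rewrite tnth_tupleV.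
rewrite (mix_integral (pred1 k) mF); last by move=> t; rewrite lee_fin prodr_ge0.
have c0 : (0 <= \int[P]_w (\prod_(i <- r) phi i (V i w))%:E)%E.
  by apply: integral_ge0 => w _; rewrite lee_fin prodr_ge0.
have mpk : measurable_fun setT (fun w => (phi k (V k w))%:E).
  by apply/measurable_EFinP; exact: (measurableT_comp (mphi k) (mV k)).
have mpr : measurable_fun setT (fun w => (\prod_(i <- r) phi i (V i w))%:E).
  apply/measurable_EFinP; apply: measurable_prod => i _.
  exact: (measurableT_comp (mphi i) (mV i)).
rewrite -[RHS](@ge0_integralZr _ _ _ P setT) //; last by move=> w _; rewrite lee_fin.
apply: eq_integral => w _.
rewrite -[RHS](@ge0_integralZl _ _ _ P setT) //; last by rewrite lee_fin.
  2: by move=> w' _; rewrite lee_fin prodr_ge0.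
apply: eq_integral => w' _; rewrite /F big_cons -EFinM tnth_mix /= eqxx tnth_tupleV.
congr ((_ * _)%:E); apply: eq_big_seq => i ir; rewrite tnth_mix /=.
by rewrite (_ : (i == k) = false) ?tnth_tupleV //; apply: contraNF kr => /eqP <-.
Qed.

(** On a rectangle both sides are products of equal factors in a different order, by identical
    distribution. *)
Lemma perm_law (s : 'I_N -> 'I_N) : injective s -> identically_distributed P V ->
  forall X : set (N.-tuple E), measurable X ->
  P (tupleV @^-1` X) = P [set w | X [tuple V (s i) w | i < N]].
Proof.
move=> injs idV X mX.
have ms : measurable_fun setT (fun w => [tuple V (s i) w | i < N]).
  apply/measurable_fun_tnthP => i; apply: eq_measurable_fun (mV (s i)) => w _ /=.
  by rewrite tnth_mktuple.
pose p1 : {mfun T >-> N.-tuple E} := HB.pack tupleV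
  (isMeasurableFun.Build _ _ _ _ _ measurable_tupleV).
pose p2 : {mfun T >-> N.-tuple E} := HB.pack (fun w => [tuple V (s i) w | i < N])
  (isMeasurableFun.Build _ _ _ _ _ ms).
apply: (tuple_law_ext (m1 := distribution P p1) (m2 := distribution P p2)) => //; last first.
  by apply: (@le_lt_trans _ _ 1%E); rewrite ?ltry // probability_le1.
move=> A mA; rewrite -[LHS]/(P (tupleV @^-1` rectangle A)) prob_rectangle //.
have bs := injF_bij injs; pose s' := invF injs.
transitivity (P (\bigcap_(i in [set: 'I_N]) (V i @^-1` A (s' i)))); last first.
  congr (P _); apply/seteqP; split => w /= h i.
    by rewrite tnth_mktuple; have := h (s i) I; rewrite /s' invF_f.
  by move=> _; have := h (s' i); rewrite tnth_mktuple f_invF.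
rewrite indV //.
rewrite [RHS](reindex s) /=; last exact: onW_bij.
by apply: eq_bigr => i _; rewrite /s' invF_f; exact: idV.
Qed.

End Mixing.

Section Transport.
Context {d} {T : measurableType d} {R : realType} (P : probability T R) {I : finType}.
Context d1 d2 (E1 : measurableType d1) (E2 : measurableType d2) (V : I -> T -> E1) (f : E1 -> E2).
Hypothesis mf : measurable_fun setT f.

Lemma iid_comp : iid P V -> iid P (fun i w => f (V i w)).
Proof.
have mp A : measurable A -> measurable (f @^-1` A).
  by move=> mA; rewrite -[X in measurable X]setTI; exact: mf.
move=> [ind idd]; split.
  by move=> A mA; exact: (ind (fun i => f @^-1` A i) (fun i => mp _ (mA i))).
by move=> i j A mA; exact: (idd i j _ (mp _ mA)).
Qed.

End Transport.

(** * Gaussian linear forms and tails *)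

Section LebesgueAffine.
Context {R : realType}.
Local Notation mu := (@lebesgue_measure R).

(** The pushforward of Lebesgue measure under a translation agrees with it on half-open intervals,
    hence everywhere. Scaling is treated in the same way. *)
Lemma ge0_integral_shift (c : R) (f : R -> \bar R) : measurable_fun setT f -> (forall x, (0 <= f x)%E) ->
  (\int[mu]_x f (x + c)%R = \int[mu]_x f x)%E.
Proof.
move=> mf f0.
pose phi : measurableTypeR R -> measurableTypeR R := fun x : R => x + c.
have mphi : measurable_fun setT phi.
  exact: measurable_funD.
transitivity (\int[pushforward mu phi]_x f x)%E.
  by rewrite (ge0_integral_pushforward mphi) // => y _.
apply: eq_measure_integral => A mA _.
apply/esym/lebesgue_measure_unique => //= _ [[a b]] _ <-.
rewrite /pushforward.
have -> : phi @^-1` `]a, b]%classic = `]a - c, b - c]%classic.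
  by apply/seteqP; split => x /=; rewrite /phi !in_itv /= ltrBlDr lerBrDr.
by rewrite !lebesgue_measure_itv /= !lte_fin ltrD2r -!EFinD opprD opprK addrACA addNr addr0.
Qed.

Lemma ge0_integral_scale (c : R) (f : R -> \bar R) : c != 0 -> measurable_fun setT f ->
  (forall x, (0 <= f x)%E) ->
  (\int[mu]_x f (c * x)%R = (`|c|^-1)%:E * \int[mu]_x f x)%E.
Proof.
move=> c0 mf f0.
pose phi : measurableTypeR R -> measurableTypeR R := fun x : R => c * x.
have mphi : measurable_fun setT phi.
  exact: measurable_funM.
have cp : 0 < `|c| by rewrite normr_gt0.
pose cn : {nonneg R} := NngNum (ltW cp).
transitivity (\int[pushforward mu phi]_x f x)%E.
  by rewrite (ge0_integral_pushforward mphi) // => y _.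
rewrite -[LHS]mul1e -(mulVf (lt0r_neq0 cp)) EFinM -muleA; congr (_ * _)%E.
rewrite -[X in (X * _)%E]/((cn%:num)%:E) -ge0_integral_mscale //.
apply: eq_measure_integral => A mA _.
apply/esym/lebesgue_measure_unique => //= _ [[a b]] _ <-.
rewrite -[RHS]/((`|c|)%:E * mu (phi @^-1` `]a, b]%classic))%E.
have [cp'|cn'] := ltP 0 c.
  have -> : phi @^-1` `]a, b]%classic = `]a / c, b / c]%classic.
    apply/seteqP; split => x /=; rewrite /phi !in_itv /= ltr_pdivrMr // ler_pdivlMr //;
    by rewrite mulrC.
  rewrite !lebesgue_measure_itv /= !lte_fin ltr_pM2r ?invr_gt0 //.
  case: ifP => _; last by rewrite mule0.
  rewrite -!EFinD -EFinM gtr0_norm // -mulrBl mulrC divfK //.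
(* A negative factor reverses the interval and moves its closed end to the other side, with no
   effect on the length. *)
have {}cn' : c < 0 by rewrite lt_neqAle c0.
have -> : phi @^-1` `]a, b]%classic = `[b / c, a / c[%classic.
  apply/seteqP; split => x /=; rewrite /phi !in_itv /= ltr_ndivlMr // ler_ndivrMr // (mulrC x) andbC //.
rewrite !lebesgue_measure_itv /= !lte_fin ltr_nM2r ?invr_lt0 //.
case: ifP => _; last by rewrite mule0.
by rewrite -!EFinD -EFinM ltr0_norm // -mulrBl mulNr mulrC divfK // opprB.
Qed.

End LebesgueAffine.

Section NormalIntegrals.
Context {R : realType}.
Local Notation mu := (@lebesgue_measure R).
Implicit Types (s t m x u : R).

Lemma integral_normal_prob s (f : R -> \bar R) : measurable_fun setT f -> (forall x, (0 <= f x)%E) ->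
  (\int[normal_prob 0 s]_x f x = \int[mu]_x (f x * (normal_pdf 0 s x)%:E))%E.
Proof.
move=> mf f0; have dom := @normal_prob_dominates R 0 s.
rewrite -(Radon_Nikodym_SigmaFinite.change_of_variables dom) //.
apply: ae_eq_integral => //.
- apply: emeasurable_funM => //; apply: (measurable_int mu).
  exact: Radon_Nikodym_SigmaFinite.f_integrable.
- by apply: emeasurable_funM => //; apply/measurable_EFinP; exact: measurable_normal_pdf.
- apply: ae_eqe_mul2l; apply: integral_ae_eq => //=.
  + exact: Radon_Nikodym_SigmaFinite.f_integrable.
  + by apply/measurable_EFinP; exact: measurable_normal_pdf.
  + by move=> E _ mE; rewrite -Radon_Nikodym_SigmaFinite.f_integral.
Qed.

Lemma normal_peakE s : 0 < s -> normal_peak s = s^-1 * (Num.sqrt (pi *+ 2))^-1.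
Proof.
move=> s0; rewrite /normal_peak -mulrnAr sqrtrM ?sqr_ge0 // sqrtr_sqr gtr0_norm //.
by rewrite invfM.
Qed.

Lemma normal_pdfE' m s x : 0 < s ->
  normal_pdf m s x = s^-1 * (Num.sqrt (pi *+ 2))^-1 * expR (- (x - m) ^+ 2 / (s ^+ 2 *+ 2)).
Proof. by move=> s0; rewrite normal_pdfE ?gt_eqF // normal_peakE. Qed.

Lemma normal_pdf_tilt s t x : 0 < s ->
  expR (t * x) * normal_pdf 0 s x = expR (s ^+ 2 * t ^+ 2 / 2) * normal_pdf (s ^+ 2 * t) s x.
Proof.
move=> s0; rewrite !normal_pdfE' // ![expR _ * (_ * _)]mulrCA -!expRD.
congr (_ * expR _); field; rewrite gt_eqF //.
Qed.

Lemma ge0_integralZl_normal_pdf m s (k : R) : 0 <= k ->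
  (\int[mu]_x (k%:E * (normal_pdf m s x)%:E) = k%:E)%E.
Proof.
move=> k0; rewrite (@ge0_integralZl _ _ _ mu setT).
- by rewrite integral_normal_pdf mule1.
- by [].
- by apply/measurable_EFinP; exact: measurable_normal_pdf.
- by move=> x _; rewrite lee_fin normal_pdf_ge0.
- by rewrite lee_fin.
Qed.

Lemma normal_mgf s t : 0 < s ->
  (\int[normal_prob 0 s]_x (expR (t * x))%:E = (expR (s ^+ 2 * t ^+ 2 / 2))%:E)%E.
Proof.
move=> s0; have mf : measurable_fun setT (fun x : R => (expR (t * x))%:E).
  by apply/measurable_EFinP; apply: measurableT_comp => //; exact: measurable_funM.
rewrite integral_normal_prob //.
under eq_integral do rewrite -EFinM normal_pdf_tilt // EFinM.
rewrite ge0_integralZl_normal_pdf ?expR_ge0 //.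
Qed.

(** The exponential factor only changes the variance: up to [1 / q] the integrand is the normal
    density of standard deviation [s / q]. *)
Lemma normal_sqr_mgf s c : 0 < s -> 2 * c * s ^+ 2 < 1 ->
  (\int[normal_prob 0 s]_x (expR (c * x ^+ 2))%:E = ((Num.sqrt (1 - 2 * c * s ^+ 2))^-1)%:E)%E.
Proof.
move=> s0 cs; set q := Num.sqrt (1 - 2 * c * s ^+ 2).
have q0 : 0 < q by rewrite sqrtr_gt0 subr_gt0.
have qq : q ^+ 2 = 1 - 2 * c * s ^+ 2 by rewrite sqr_sqrtr // subr_ge0 ltW.
have mf : measurable_fun setT (fun x : R => (expR (c * x ^+ 2))%:E).
  apply/measurable_EFinP; apply: measurableT_comp => //; apply: measurable_funM => //.
rewrite integral_normal_prob //.
have v0 : 0 < s / q by rewrite divr_gt0.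
have e x : expR (c * x ^+ 2) * normal_pdf 0 s x = q^-1 * normal_pdf 0 (s / q) x.
  rewrite !normal_pdfE' // mulrCA -expRD.
  have -> E : q^-1 * ((s / q)^-1 * (Num.sqrt (pi *+ 2))^-1 * E) = s^-1 * (Num.sqrt (pi *+ 2))^-1 * E.
    by move: (Num.sqrt _)^-1 => z; field; rewrite !gt_eqF.
  congr (_ * expR _); rewrite !subr0 expr_div_n qq; field.
  by rewrite -qq !gt_eqF // exprn_gt0.
under eq_integral do rewrite -EFinM e EFinM.
rewrite ge0_integralZl_normal_pdf ?invr_ge0 ?(ltW q0) //.
Qed.

(** Completing the square in [x]: the product is the density of the sum at [u] times the conditional
    density of the first summand given the sum. *)
Lemma normal_pdf_conv s t x u : 0 < s -> 0 < t ->
  let r := Num.sqrt (s ^+ 2 + t ^+ 2) in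
  normal_pdf 0 s x * normal_pdf 0 t (u - x) =
  normal_pdf 0 r u * normal_pdf (u * s ^+ 2 / r ^+ 2) (s * t / r) x.
Proof.
move=> s0 t0 r.
have r0 : 0 < r by rewrite sqrtr_gt0 addr_gt0 ?exprn_gt0.
have rr : r ^+ 2 = s ^+ 2 + t ^+ 2 by rewrite sqr_sqrtr // addr_ge0 ?sqr_ge0.
have v0 : 0 < s * t / r by rewrite divr_gt0 // mulr_gt0.
rewrite !normal_pdfE' // mulrACA -expRD [RHS]mulrACA -expRD; congr (_ * expR _).
  by move: (Num.sqrt _)^-1 => q; field; rewrite !gt_eqF.
have rp : 0 < s ^+ 2 + t ^+ 2 by rewrite addr_gt0 ?exprn_gt0.
rewrite !subr0 expr_div_n rr; field.
by rewrite !gt_eqF // ?mulr_gt0 // exprn_gt0.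
Qed.

End NormalIntegrals.

Lemma markov_ge0 d (T : measurableType d) (R : realType) (P : {measure set T -> \bar R})
    (f : T -> R) (c : R) : measurable_fun setT f -> (forall w, 0 <= f w) -> 0 < c ->
  (P [set w | (c <= f w)%R] <= (c^-1)%:E * \int[P]_w (f w)%:E)%E.
Proof.
move=> mf f0 c0.
have mA : measurable [set w | c <= f w].
  rewrite -[X in measurable X]setTI; have -> : [set w | c <= f w] = f @^-1` `[c, +oo[%classic.
    by apply/seteqP; split => w /=; rewrite in_itv /= andbT.
  exact: mf.
rewrite lee_pdivlMl // -integral_cst // [leLHS]integral_mkcond.
apply: ge0_le_integral => //=.
- by move=> w _; rewrite patchE; case: ifP => _ //; rewrite lee_fin ltW.
- by apply/measurable_restrict => //; apply: measurable_funTS; exact: measurable_cst.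
- by apply/measurable_EFinP.
- by move=> w _; rewrite patchE; case: ifPn => [|_]; rewrite ?inE lee_fin.
Qed.

Section GaussianFamily.
Context {d} {T : measurableType d} {R : realType} (P : probability T R).
Context {N : nat} (eps : 'I_N -> T -> R) (sigma : R).
Hypothesis sigma0 : 0 < sigma.
Hypothesis meps : forall i, measurable_fun setT (eps i).
Hypothesis indeps : mutually_indep P eps.
Hypothesis law : forall i A, measurable A -> P (eps i @^-1` A) = normal_prob 0 sigma A.

Lemma gauss_integral i (f : R -> \bar R) : measurable_fun setT f -> (forall x, (0 <= f x)%E) ->
  (\int[P]_w f (eps i w) = \int[normal_prob 0 sigma]_x f x)%E.
Proof.
move=> mf f0.
apply: (integral_same_law (P2 := normal_prob 0 sigma) (g := fun x => x) (meps i)) => //.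
by move=> A mA; rewrite (law i mA).
Qed.

Lemma gauss_mgf (a : 'I_N -> R) (r : seq 'I_N) : uniq r ->
  (\int[P]_w (expR (\sum_(i <- r) a i * eps i w))%:E =
   (expR (sigma ^+ 2 * (\sum_(i <- r) a i ^+ 2) / 2))%:E)%E.
Proof.
move=> ur.
under eq_integral do rewrite expR_sum.
rewrite (integral_prod_indep meps indeps (phi := fun i x => expR (a i * x)) ur).
- rewrite mulr_sumr mulr_suml expR_sum.
  elim: r ur => [|i r IH] /=; first by rewrite !big_nil.
  move=> /andP[_ ur]; rewrite !big_cons EFinM IH //; congr (_ * _)%E.
  rewrite (gauss_integral i (f := fun x => (expR (a i * x))%:E)) ?normal_mgf //.
  by apply/measurable_EFinP; apply: measurableT_comp => //; exact: measurable_funM.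
- by move=> i; apply: measurableT_comp => //; exact: measurable_funM.
- by move=> i x; exact: expR_ge0.
Qed.

Lemma gauss_sqr_mgf (c : R) (r : seq 'I_N) : uniq r -> 2 * c * sigma ^+ 2 < 1 ->
  (\int[P]_w (expR (c * \sum_(i <- r) eps i w ^+ 2))%:E =
   ((Num.sqrt (1 - 2 * c * sigma ^+ 2))^-1 ^+ size r)%:E)%E.
Proof.
move=> ur cs.
under eq_integral do rewrite mulr_sumr expR_sum.
have mphi : measurable_fun setT (fun x : R => expR (c * x ^+ 2)).
  by apply: measurableT_comp => //; apply: measurable_funM => //.
rewrite (integral_prod_indep meps indeps (phi := fun i x => expR (c * x ^+ 2)) ur).
- elim: r ur => [|i r IH] /=; first by rewrite big_nil expr0.
  move=> /andP[_ ur]; rewrite big_cons exprS EFinM IH //; congr (_ * _)%E.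
  rewrite (gauss_integral i (f := fun x => (expR (c * x ^+ 2))%:E)) ?normal_sqr_mgf //.
  exact/measurable_EFinP.
- by [].
- by move=> i x; exact: expR_ge0.
Qed.

Let measurable_lin (a : 'I_N -> R) r : measurable_fun setT (fun w => \sum_(i <- r) a i * eps i w).
Proof. by apply: measurable_sum => i; apply: measurable_funM. Qed.

Lemma gauss_upper_tail (a : 'I_N -> R) (r : seq 'I_N) (x : R) : uniq r -> 0 < x ->
  0 < \sum_(i <- r) a i ^+ 2 ->
  (P [set w | (x <= \sum_(i <- r) a i * eps i w)%R] <=
   (expR (- x ^+ 2 / (2 * sigma ^+ 2 * \sum_(i <- r) a i ^+ 2)))%:E)%E.
Proof.
move=> ur x0 v0; set v := \sum_(i <- r) a i ^+ 2 in v0 *.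
have sv : 0 < sigma ^+ 2 * v by rewrite mulr_gt0 // exprn_gt0.
(* Minimizer of the Chernoff exponent [sigma^2 t^2 v / 2 - t x]. *)
pose t := x / (sigma ^+ 2 * v).
have t0 : 0 < t by rewrite divr_gt0.
have mf : measurable_fun setT (fun w => expR (\sum_(i <- r) (t * a i) * eps i w)).
  by apply: measurableT_comp => //; exact: measurable_lin.
have := markov_ge0 P mf (fun w => expR_ge0 _) (expR_gt0 (t * x)).
rewrite gauss_mgf // -expRN -EFinM -expRD.
have -> : - (t * x) + sigma ^+ 2 * (\sum_(i <- r) (t * a i) ^+ 2) / 2 =
   - x ^+ 2 / (2 * sigma ^+ 2 * v).
  have -> : \sum_(i <- r) (t * a i) ^+ 2 = t ^+ 2 * v.
    by rewrite mulr_sumr; apply: eq_bigr => i _; rewrite exprMn.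
  by rewrite /t; field; rewrite !gt_eqF.
move=> /(le_trans _); apply; rewrite le_eqVlt; apply/orP; left; apply/eqP; congr (P _).
apply/seteqP; split => w /=.
  by rewrite ler_expR => h; under eq_bigr do rewrite -mulrA; rewrite -mulr_sumr ler_pM2l.
by rewrite ler_expR; under eq_bigr do rewrite -mulrA; rewrite -mulr_sumr ler_pM2l.
Qed.

(** The strict inequality empties the event when all coefficients vanish, so the bound covers
    directions that may degenerate, such as the residual of a column on a set containing it. *)
Lemma gauss_sqr_tail (a : 'I_N -> R) (r : seq 'I_N) (L : R) : uniq r -> 0 <= L ->
  (P [set w | (L * \sum_(i <- r) a i ^+ 2 < (\sum_(i <- r) a i * eps i w) ^+ 2)%R] <=
   (2 * expR (- L / (2 * sigma ^+ 2)))%:E)%E.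
Proof.
move=> ur L0; set v := \sum_(i <- r) a i ^+ 2.
have v0 : 0 <= v by apply: sumr_ge0 => i _; exact: sqr_ge0.
have [Lv|Lv] := leP (L * v) 0.
  have [vz|vn] := eqVneq v 0.
    have -> : [set w | L * v < (\sum_(i <- r) a i * eps i w) ^+ 2] = set0.
      apply/seteqP; split => w //=; rewrite vz mulr0.
      have -> : \sum_(i <- r) a i * eps i w = 0.
        rewrite big_seq big1 // => i ir; suff -> : a i = 0 by rewrite mul0r.
        move: vz => /eqP; rewrite psumr_eq0; last by move=> j _; exact: sqr_ge0.
        by move=> /allP /(_ i ir) /=; rewrite sqrf_eq0 => /eqP.
      by rewrite expr0n ltxx.
    by rewrite measure0 lee_fin mulr_ge0 ?expR_ge0.
  have -> : L = 0.
    by apply/eqP; rewrite eq_le L0 andbT -(pmulr_lle0 (x := v)) // lt0r vn.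
  rewrite oppr0 !mul0r expR0 mulr1 (le_trans (probability_le1 _ _)) ?lee_fin ?ler1n //.
  rewrite -[X in measurable X]setTI; apply: (measurable_fun_ltr (measurable_cst _)) => //.
  by apply: measurable_funX; exact: measurable_lin.
have vp : 0 < v by rewrite lt0r v0 andbT; apply/eqP => vz; rewrite vz mulr0 ltxx in Lv.
have Lp : 0 < L by rewrite pmulr_lgt0 in Lv.
pose x := Num.sqrt (L * v).
have x0 : 0 < x by rewrite sqrtr_gt0.
have xx : x ^+ 2 = L * v by rewrite sqr_sqrtr // ltW.
have mA (b : 'I_N -> R) : measurable [set w | x <= \sum_(i <- r) b i * eps i w].
  by rewrite -[X in measurable X]setTI; apply: (measurable_fun_ler (measurable_cst _)).
have h1 := gauss_upper_tail ur x0 vp.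
have v' : \sum_(i <- r) (- a i) ^+ 2 = v by apply: eq_bigr => i _; rewrite sqrrN.
have h2 := gauss_upper_tail (a := fun i => - a i) ur x0.
rewrite v' in h2; have {}h2 := h2 vp.
have eL : - x ^+ 2 / (2 * sigma ^+ 2 * v) = - L / (2 * sigma ^+ 2).
  by rewrite xx; field; rewrite !gt_eqF.
rewrite eL in h1 h2.
apply: (le_trans (y := P ([set w | x <= \sum_(i <- r) a i * eps i w] `|`
   [set w | x <= \sum_(i <- r) (- a i) * eps i w]))).
  apply: le_measure; rewrite ?inE.
  - rewrite -[X in measurable X]setTI; apply: (measurable_fun_ltr (measurable_cst _)) => //.
    by apply: measurable_funX; exact: measurable_lin.
  - by apply: measurableU.
  - move=> w /=.
    have -> : \sum_(i <- r) - a i * eps i w = - \sum_(i <- r) a i * eps i w.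
      by rewrite -sumrN; apply: eq_bigr => i _; rewrite mulNr.
    rewrite -xx -[in X in _ < X]real_normK ?num_real // ltr_pXn2r ?nnegrE ?(ltW x0) //.
    by rewrite ltr_normr => /orP [/ltW ? | /ltW ?]; [left|right].
apply: (le_trans (measureU2 _ _ _)) => //.
by rewrite mulrDl mul1r EFinD; apply: leeD.
Qed.

End GaussianFamily.

Lemma ge0_integralZlT d (T : measurableType d) (R : realType) (m : {measure set T -> \bar R})
    (f : T -> \bar R) (k : R) : 0 <= k -> measurable_fun setT f -> (forall x, (0 <= f x)%E) ->
  (\int[m]_x (k%:E * f x) = k%:E * \int[m]_x f x)%E.
Proof. by move=> k0 mf f0; rewrite ge0_integralZl // => x _. Qed.

Section NormalLaws.
Context {R : realType}.
Local Notation mu := (@lebesgue_measure R).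

Lemma normal_prob_indic (s : R) (A : set R) : measurable A ->
  normal_prob 0 s A = (\int[mu]_x ((\1_A x)%:E * (normal_pdf 0 s x)%:E))%E.
Proof.
move=> mA; rewrite -integral_normal_prob //.
- by rewrite integral_indic // setIT.
- exact/measurable_EFinP/measurable_indic.
Qed.

Lemma normal_prob_scale (s a : R) (A : set R) : 0 < s -> a != 0 -> measurable A ->
  normal_prob 0 s [set x | A (a * x)] = normal_prob 0 (s * `|a|) A.
Proof.
move=> s0 a0 mA.
have ap : 0 < `|a| by rewrite normr_gt0.
have sa : 0 < s * `|a| by rewrite mulr_gt0.
have mA' : measurable [set x : R | A (a * x)].
  rewrite -[X in measurable X]setTI.
  exact: (measurable_funM (measurable_cst a) (@measurable_id _ _ _) measurableT mA).
rewrite (normal_prob_indic s mA') (normal_prob_indic (s * `|a|) mA).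
have e x : ((\1_([set x | A (a * x)]) x)%:E * (normal_pdf 0 s x)%:E)%E =
  ((`|a|)%:E * ((\1_A (a * x))%:E * (normal_pdf 0 (s * `|a|) (a * x))%:E))%E.
  rewrite [RHS]muleCA; congr (_ * _)%E; rewrite -EFinM; congr _%:E.
  rewrite !normal_pdfE' // !subr0.
  have -> E : `|a| * ((s * `|a|)^-1 * (Num.sqrt (pi *+ 2))^-1 * E) =
      s^-1 * (Num.sqrt (pi *+ 2))^-1 * E.
    by move: (Num.sqrt _)^-1 => z; field; rewrite !gt_eqF.
  congr (_ * expR _); rewrite !exprMn real_normK ?num_real //; field.
  by rewrite a0 gt_eqF.
under eq_integral do rewrite e.
have mf : measurable_fun setT (fun x => (\1_A x)%:E * (normal_pdf 0 (s * `|a|) x)%:E)%E.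
  apply: emeasurable_funM; apply/measurable_EFinP; [exact: measurable_indic|exact: measurable_normal_pdf].
have f0 x : (0 <= (\1_A x)%:E * (normal_pdf 0 (s * `|a|) x)%:E)%E.
  by rewrite -EFinM lee_fin mulr_ge0 // normal_pdf_ge0.
rewrite (ge0_integralZlT _ (ltW ap)) //; last first.
  exact: (measurableT_comp mf (measurable_funM (measurable_cst a) (@measurable_id _ _ _))).
by rewrite (ge0_integral_scale a0 mf f0) muleA -EFinM divff ?mul1e // gt_eqF.
Qed.

Lemma normal_prob_conv (s t : R) (A : set R) : 0 < s -> 0 < t -> measurable A ->
  (\int[normal_prob 0 s]_x normal_prob 0 t [set y | A (x + y)%R] =
   normal_prob 0 (Num.sqrt (s ^+ 2 + t ^+ 2)) A)%E.
Proof.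
move=> s0 t0 mA; set r := Num.sqrt _.
have r0 : 0 < r by rewrite sqrtr_gt0 addr_gt0 ?exprn_gt0.
have mAx x : measurable [set y : R | A (x + y)].
  rewrite -[X in measurable X]setTI.
  exact: (measurable_funD (measurable_cst x) (@measurable_id _ _ _) measurableT mA).
have inner x : normal_prob 0 t [set y | A (x + y)] =
   (\int[mu]_u ((\1_A u)%:E * (normal_pdf 0 t (u - x))%:E))%E.
  rewrite (normal_prob_indic t (mAx x)) -[RHS](ge0_integral_shift x).
  - apply: eq_integral => u _; rewrite addrK !indicE.
    rewrite (_ : (u \in [set y | A (x + y)]) = (u + x \in A)) //.
    by apply/idP/idP; rewrite !inE /= addrC.
  - apply: emeasurable_funM; apply/measurable_EFinP; first exact: measurable_indic.
    by apply: measurableT_comp; [exact: measurable_normal_pdf|exact: measurable_funB].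
  - by move=> u; rewrite -EFinM lee_fin mulr_ge0 // normal_pdf_ge0.
pose F (xu : R * R) := (\1_A xu.2 * (normal_pdf 0 s xu.1 * normal_pdf 0 t (xu.2 - xu.1)))%:E.
have mF : measurable_fun setT F.
  apply/measurable_EFinP; apply: measurable_funM.
    by apply: measurableT_comp; [exact: measurable_indic|exact: measurable_snd].
  apply: measurable_funM; first by apply: measurableT_comp; [exact: measurable_normal_pdf|exact: measurable_fst].
  by apply: measurableT_comp; [exact: measurable_normal_pdf|exact: measurable_funB].
have F0 xu : (0 <= F xu)%E by rewrite lee_fin !mulr_ge0 // normal_pdf_ge0.
have inner2 x : (normal_prob 0 t [set y | A (x + y)%R] * (normal_pdf 0 s x)%:E)%E =
   (\int[mu]_u F (x, u))%E.
  rewrite inner muleC -ge0_integralZlT ?normal_pdf_ge0 //.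
  - by apply: eq_integral => u _; rewrite /F /= -!EFinM mulrCA.
  - apply: emeasurable_funM; apply/measurable_EFinP; first exact: measurable_indic.
    by apply: measurableT_comp; [exact: measurable_normal_pdf|exact: measurable_funB].
  - by move=> u; rewrite -EFinM lee_fin mulr_ge0 // normal_pdf_ge0.
rewrite integral_normal_prob; last 2 first.
- have mAxy : measurable [set xy : R * R | A (xy.1 + xy.2)].
    rewrite -[X in measurable X]setTI.
    by apply: (measurable_funD measurable_fst measurable_snd measurableT mA).
  have := measurable_fun_xsection (normal_prob 0 t) mAxy.
  apply: eq_measurable_fun => x _ /=.
  by congr normal_prob; apply/seteqP; split => y; rewrite /xsection /= inE.
- by move=> x; exact: measure_ge0.
under eq_integral do rewrite inner2.
rewrite (fubini_tonelli (m1 := mu) (m2 := mu) F mF F0).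
rewrite (normal_prob_indic r mA); apply: eq_integral => u _.
have e x : F (x, u) = ((\1_A u * normal_pdf 0 r u)%:E *
    (normal_pdf (u * s ^+ 2 / r ^+ 2) (s * t / r) x)%:E)%E.
  by rewrite /F /= normal_pdf_conv // -EFinM mulrA.
under eq_integral do rewrite e.
by rewrite ge0_integralZl_normal_pdf ?EFinM // mulr_ge0 // normal_pdf_ge0.
Qed.

End NormalLaws.

Section LinearCombinations.
Context {d} {T : measurableType d} {R : realType} (P : probability T R).
Context {N : nat} (eps : 'I_N -> T -> R) (sigma : R).
Hypothesis sigma0 : 0 < sigma.
Hypothesis meps : forall i, measurable_fun setT (eps i).
Hypothesis indeps : mutually_indep P eps.
Hypothesis law : forall i A, measurable A -> P (eps i @^-1` A) = normal_prob 0 sigma A.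

Let mscaled (a : R) (A : set R) : measurable A -> measurable [set x : R | A (a * x)].
Proof.
move=> mA; rewrite -[X in measurable X]setTI.
exact: (measurable_funM (measurable_cst a) (@measurable_id _ _ _) measurableT mA).
Qed.

(** Convolution, one coordinate at a time. Nonzero coefficients and a nonempty list keep all partial
    variances positive, as [normal_prob_conv] requires; [gauss_std_law] first drops the zero
    coefficients. *)
Lemma gauss_linear_law (a : 'I_N -> R) (r : seq 'I_N) (A : set R) :
  r != [::] -> uniq r -> {in r, forall i, a i != 0} -> measurable A ->
  P [set w | A (\sum_(i <- r) a i * eps i w)] =
  normal_prob 0 (sigma * Num.sqrt (\sum_(i <- r) a i ^+ 2)) A.
Proof.
elim: r A => [//|k r IH] A _ /= /andP[kr ur] anz mA.
have ak : a k != 0 by apply: anz; rewrite mem_head.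
have [->|rn] := eqVneq r [::].
  rewrite big_seq1 sqrtr_sqr -normal_prob_scale // -(law k) //; last exact: mscaled.
  by congr (P _); apply/seteqP; split => w /=; rewrite big_seq1.
have anz' : {in r, forall i, a i != 0} by move=> i ir; apply: anz; rewrite in_cons ir orbT.
pose X : set (N.-tuple R) := [set t | A (\sum_(i <- k :: r) a i * tnth t i)].
have mX : measurable X.
  rewrite -[Y in measurable Y]setTI.
  have mf : measurable_fun setT (fun t : N.-tuple R => \sum_(i <- k :: r) a i * tnth t i).
    apply: measurable_sum => i; apply: measurable_funM => //; exact: measurable_tnth.
  exact: mf.
have vr : 0 < \sum_(i <- r) a i ^+ 2.
  case: (r) rn anz' => [//|i r'] _ anz'.
  rewrite big_cons ltr_pwDl ?sumr_ge0 // => [|j _]; last exact: sqr_ge0.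
  by rewrite exprn_even_gt0 //=; apply: anz'; rewrite mem_head.
have -> : P [set w | A (\sum_(i <- k :: r) a i * eps i w)] = P (tupleV eps @^-1` X).
  have e w : \sum_(i <- k :: r) a i * tnth (tupleV eps w) i = \sum_(i <- k :: r) a i * eps i w.
    by apply: eq_bigr => i _; rewrite tnth_tupleV.
  by congr (P _); apply/seteqP; split => w /=; rewrite /X /= e.
rewrite (mix_law meps indeps (pred1 k)) // prob_decouple; last first.
  by rewrite -[Y in measurable Y]setTI; exact: (measurable_mix meps _ measurableT mX).
have inner w : P [set w' | ((fun ww : T * T => mix (pred1 k) (tupleV eps ww.1) (tupleV eps ww.2)) @^-1` X) (w, w')] =
   normal_prob 0 (sigma * Num.sqrt (\sum_(i <- r) a i ^+ 2)) [set y | A (a k * eps k w + y)].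
  rewrite -(IH [set y | A (a k * eps k w + y)]) //; last first.
    rewrite -[Y in measurable Y]setTI.
    exact: (measurable_funD (measurable_cst (a k * eps k w)) (@measurable_id _ _ _) measurableT mA).
  have e w' : \sum_(i <- k :: r) a i * tnth (mix (pred1 k) (tupleV eps w) (tupleV eps w')) i =
      a k * eps k w + \sum_(i <- r) a i * eps i w'.
    rewrite big_cons tnth_mix /= eqxx tnth_tupleV; congr (_ + _); apply: eq_big_seq => i ir.
    by rewrite tnth_mix /= (_ : (i == k) = false) ?tnth_tupleV //; apply: contraNF kr => /eqP <-.
  by congr (P _); apply/seteqP; split => w' /=; rewrite /X /= e.
under eq_integral do rewrite inner.
set t := sigma * Num.sqrt _.
have t0 : 0 < t by rewrite mulr_gt0 // sqrtr_gt0.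
have mg : measurable_fun setT (fun x : R => normal_prob 0 t [set y | A (x + y)]).
  have mAxy : measurable [set xy : R * R | A (xy.1 + xy.2)].
    rewrite -[Y in measurable Y]setTI.
    by apply: (measurable_funD measurable_fst measurable_snd measurableT mA).
  have := measurable_fun_xsection (normal_prob 0 t) mAxy.
  apply: eq_measurable_fun => x _ /=.
  by congr normal_prob; apply/seteqP; split => y; rewrite /xsection /= inE.
have sa : 0 < sigma * `|a k| by rewrite mulr_gt0 // normr_gt0.
rewrite (integral_same_law (P2 := normal_prob 0 (sigma * `|a k|)) (f := fun w => a k * eps k w) (g := id)
  (F := fun x : R => normal_prob 0 t [set y | A (x + y)])) //.
- rewrite (normal_prob_conv sa t0 mA) big_cons; congr (normal_prob 0 _ A).
  rewrite /t !exprMn sqr_sqrtr ?(ltW vr) // real_normK ?num_real // -mulrDr sqrtrM ?sqr_ge0 //.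
  by rewrite sqrtr_sqr gtr0_norm.
- exact: measurable_funM.
- move=> Y mY; rewrite -[RHS]/(normal_prob 0 (sigma * `|a k|) Y) -(normal_prob_scale sigma0 ak mY).
  by rewrite -(law k) //; exact: mscaled.
Qed.

Lemma gauss_std_law (a : 'I_N -> R) (r : seq 'I_N) (A : set R) : uniq r ->
  sigma ^+ 2 * (\sum_(i <- r) a i ^+ 2) = 1 -> measurable A ->
  P [set w | A (\sum_(i <- r) a i * eps i w)] = normal_prob 0 1 A.
Proof.
move=> ur v1 mA; pose r' := [seq i <- r | a i != 0].
have e2 : \sum_(i <- r) a i ^+ 2 = \sum_(i <- r') a i ^+ 2.
  rewrite /r' big_filter [LHS]big_mkcond [RHS]big_mkcond /=; apply: eq_bigr => i _.
  by have [->|//] := eqVneq (a i) 0; rewrite expr0n.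
have e1 w : \sum_(i <- r) a i * eps i w = \sum_(i <- r') a i * eps i w.
  rewrite /r' big_filter [LHS]big_mkcond [RHS]big_mkcond /=; apply: eq_bigr => i _.
  by have [->|//] := eqVneq (a i) 0; rewrite mul0r.
have -> : [set w | A (\sum_(i <- r) a i * eps i w)] = [set w | A (\sum_(i <- r') a i * eps i w)].
  by apply/seteqP; split => w /=; rewrite e1.
have rn : r' != [::].
  by apply/eqP => r0; move: v1; rewrite e2 r0 big_nil mulr0 => /eqP; rewrite eq_sym oner_eq0.
have anz : {in r', forall i, a i != 0} by move=> i; rewrite mem_filter => /andP[].
rewrite (gauss_linear_law rn (filter_uniq _ ur) anz mA) -e2.
congr (normal_prob 0 _ A).
rewrite -[LHS]ger0_norm ?mulr_ge0 ?sqrtr_ge0 ?(ltW sigma0) //.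
rewrite -sqrtr_sqr exprMn sqr_sqrtr ?v1 ?sqrtr1 // sumr_ge0 // => i _; exact: sqr_ge0.
Qed.

End LinearCombinations.

Lemma measure_subset_le d (T : measurableType d) (R : realType) (m : {measure set T -> \bar R})
    (A B : set T) : measurable A -> measurable B -> A `<=` B -> (m A <= m B)%E.
Proof. by move=> mA mB AB; apply: le_measure => //; rewrite inE. Qed.

Section NormalTail.
Context {R : realType}.
Local Notation mu := (@lebesgue_measure R).

Definition upper_tail (c : R) : \bar R := normal_prob 0 1 [set x | c < x].

Let mgt (c : R) : measurable [set x : R | c < x].
Proof.
have -> : [set x : R | c < x] = `]c, +oo[%classic by apply/seteqP; split => x /=; rewrite in_itv /= andbT.
exact: measurable_itv.
Qed.

Let mge (c : R) : measurable [set x : R | c <= x].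
Proof.
have -> : [set x : R | c <= x] = `[c, +oo[%classic by apply/seteqP; split => x /=; rewrite in_itv /= andbT.
exact: measurable_itv.
Qed.

Let mle (c : R) : measurable [set x : R | x <= c].
Proof.
have -> : [set x : R | x <= c] = `]-oo, c]%classic by apply/seteqP; split => x /=; rewrite in_itv.
exact: measurable_itv.
Qed.

Lemma normal_tail_le (c : R) : 0 < c ->
  (normal_prob 0 1 [set x | (c <= x)%R] <= (expR (- c ^+ 2 / 2))%:E)%E.
Proof.
move=> c0.
have mf : measurable_fun setT (fun x : R => expR (c * x)).
  by apply: measurableT_comp => //; exact: measurable_funM.
have := markov_ge0 (normal_prob 0 1) mf (fun w => expR_ge0 _) (expR_gt0 (c * c)).
rewrite (normal_mgf c ltr01) -expRN -EFinM -expRD.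
have -> : - (c * c) + 1 ^+ 2 * c ^+ 2 / 2 = - c ^+ 2 / 2 by field.
have -> // : [set w : R | expR (c * c) <= expR (c * w)] = [set x | c <= x].
by apply/seteqP; split => x /=; rewrite ler_expR ler_pM2l.
Qed.

Lemma upper_tail_le (c : R) : 0 < c -> (upper_tail c <= (expR (- c ^+ 2 / 2))%:E)%E.
Proof.
move=> c0; apply: le_trans (normal_tail_le c0).
have h := @measure_subset_le _ _ R (normal_prob 0 1) _ _ (mgt c) (mge c).
by apply: h => x /=; exact: ltW.
Qed.

Lemma normal_prob_opp (A : set R) : measurable A ->
  normal_prob 0 1 [set x | A (- x)] = normal_prob 0 1 A.
Proof.
move=> mA; have := @normal_prob_scale R 1 (-1) A ltr01 _ mA.
rewrite normrN1 mulr1 => <-; last by rewrite oppr_eq0 oner_eq0.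
by congr (normal_prob 0 1 _); apply/seteqP; split => x /=; rewrite mulN1r.
Qed.

Lemma two_sided_le (c : R) : (normal_prob 0 1 [set x | (c < `|x|)%R] <= 2%:E * upper_tail c)%E.
Proof.
have -> : [set x : R | c < `|x|] = [set x | c < x] `|` [set x | c < - x].
  by apply/seteqP; split => x /=; rewrite ltr_normr => /orP.
have mN : measurable [set x : R | c < - x].
  rewrite -[X in measurable X]setTI.
  exact: (measurableT_comp (@oppr_measurable R setT) (@measurable_id _ _ _) measurableT (mgt c)).
have eN : normal_prob 0 1 [set x : R | c < - x] = upper_tail c := normal_prob_opp (mgt c).
have hU : (normal_prob 0 1 ([set x : R | (c < x)%R] `|` [set x | (c < - x)%R]) <=
    upper_tail c + upper_tail c)%E.
  rewrite -{2}eN; exact: (@measureU2 _ _ _ (normal_prob (0 : R) 1) _ _ (mgt c) mN).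
by rewrite (_ : 2%:E = 1 + 1)%E // ge0_muleDl // !mul1e.
Qed.

Lemma upper_tail_fin (c : R) : upper_tail c \is a fin_num.
Proof. exact: (fin_num_measure (normal_prob (0 : R) 1) _ (mgt c)). Qed.

Lemma upper_tail_lt_half (c : R) : (upper_tail c < (2^-1)%:E)%E -> 0 <= c.
Proof.
move=> h; rewrite leNgt; apply/negP => c0.
have : (1 <= upper_tail c + upper_tail c)%E.
  rewrite -[leLHS](@probability_setT _ _ _ (normal_prob 0 1)).
  have -> : [set: R] = [set x | c < x] `|` [set x | x <= c].
    by apply/seteqP; split => x //= _; case: (ltP c x); [left|right].
  have hU := @measureU2 _ _ _ (normal_prob (0 : R) 1) _ _ (mgt c) (mle c).
  apply: (le_trans hU); apply: leeD => //; rewrite -[leLHS]/(normal_prob 0 1 [set x | (x <= c)%R]).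
  have -> : [set x : R | x <= c] = [set x | [set y | - c <= y] (- x)].
    by apply/seteqP; split => x /=; rewrite lerN2.
  rewrite (normal_prob_opp (mge _)); have hm := @measure_subset_le _ _ R (normal_prob 0 1) _ _ (mge (- c)) (mgt c); apply: hm => x /= hx.
  by apply: lt_le_trans hx; lra.
rewrite -(fineK (upper_tail_fin c)) -EFinD lee_fin => h1.
by move: h; rewrite -(fineK (upper_tail_fin c)) lte_fin; lra.
Qed.

Lemma upper_tail_split (x y : R) : x <= y ->
  upper_tail x = (upper_tail y + normal_prob 0 1 `]x, y]%classic)%E.
Proof.
move=> xy.
have mI : measurable (`]x, y]%classic : set R) by exact: measurable_itv.
have d : [set z | y < z] `&` `]x, y]%classic = set0.
  by apply/seteqP; split => z //= [yz]; rewrite in_itv /= => /andP[_]; rewrite leNgt yz.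
have h := @measureU _ _ _ (normal_prob (0 : R) 1) _ _ (mgt y) mI d.
transitivity (normal_prob 0 1 ([set z | y < z] `|` `]x, y]%classic)); last exact: h.
congr (normal_prob 0 1 _); apply/seteqP; split => z /=; rewrite in_itv /=.
  by move=> xz; case: (ltP y z); [left|move=> zy; right; rewrite xz].
by case=> [yz|/andP[]//]; exact: le_lt_trans yz.
Qed.

Lemma upper_tail_lipschitz (x y : R) : x <= y ->
  0 <= fine (upper_tail x) - fine (upper_tail y) <= normal_peak 1 * (y - x).
Proof.
move=> xy.
have mI : measurable (`]x, y]%classic : set R) by exact: measurable_itv.
have fI : normal_prob (0 : R) 1 `]x, y]%classic \is a fin_num.
  exact: (fin_num_measure (normal_prob (0 : R) 1) _ mI).
rewrite (upper_tail_split xy) fineD ?upper_tail_fin // addrAC subrr add0r.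
rewrite fine_ge0 /=; last exact: (measure_ge0 (normal_prob (0 : R) 1)).
rewrite -lee_fin (fineK fI).
rewrite /normal_prob.
apply: (@le_trans _ _ (\int[mu]_(z in `]x, y]) (normal_peak 1)%:E)%E).
  apply: ge0_le_integral => //=.
  - by move=> z _; rewrite lee_fin normal_pdf_ge0.
  - by apply/measurable_EFinP; apply: measurable_funTS; exact: measurable_normal_pdf.
  - by move=> z _; rewrite lee_fin normal_pdf_ub // oner_eq0.
rewrite integral_cst //= lebesgue_measure_itv /= lte_fin.
case: ltP => // yx; rewrite ?mule0 lee_fin ?mulr_ge0 ?normal_peak_ge0 ?subr_ge0 //.
Qed.

Lemma upper_tail_continuous : continuous (fun x => fine (upper_tail x)).
Proof.
move=> x; apply/cvgrPdist_lt => e e0.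
have pk : 0 < normal_peak 1 :> R by rewrite normal_peak_gt0 // oner_eq0.
near=> y.
have h : `|fine (upper_tail x) - fine (upper_tail y)| <= normal_peak 1 * `|x - y|.
  have [xy|/ltW yx] := leP x y.
    have /andP[h1 h2] := upper_tail_lipschitz xy.
    by rewrite ger0_norm // (le_trans h2) // ler_pM2l // distrC ler_norm.
  have /andP[h1 h2] := upper_tail_lipschitz yx.
  by rewrite distrC ger0_norm // (le_trans h2) // ler_pM2l // ler_norm.
apply: (le_lt_trans h); rewrite -ltr_pdivlMl // mulrC.
by near: y; apply: cvgr_dist_lt; rewrite ?divr_gt0.
Unshelve. all: by end_near. Qed.

(** A bounded density makes the tail continuous, so the intermediate value theorem applies.
    Existence gives meaning to the choice by [xget] in [z_quantile]. *)
Lemma upper_tail_exists (u : R) : 0 < u < 1 -> exists z, upper_tail z = u%:E.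
Proof.
move=> /andP[u0 u1].
(* For [0 < v < 1] the point [b v] is at least [1], so [b^2 / 2 >= b / 2 >= - ln v] and the tail
   beyond it is at most [v]. Used for [u] and [1 - u], it brackets the quantile. *)
pose b v : R := 1 - 2 * ln v.
have b1 v : 0 < v < 1 -> 1 <= b v /\ expR (- b v ^+ 2 / 2) <= v.
  move=> /andP[v0 v1]; have lv : ln v < 0 by rewrite ln_lt0 // v0.
  have bv : 1 <= b v by rewrite /b; lra.
  split => //; rewrite -[leRHS]lnK ?posrE // ler_expR.
  have : b v <= b v ^+ 2 by rewrite expr2 ler_peMr // (le_trans _ bv).
  by rewrite {1}/b; lra.
have [hb1 hb2] := b1 u (introT andP (conj u0 u1)).
have u' : 0 < 1 - u < 1 by lra.
have [ha1 ha2] := b1 _ u'.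
have bp : 0 < b u by lra.
have ap : 0 < b (1 - u) by lra.
have h1 : fine (upper_tail (b u)) <= u.
  rewrite -lee_fin fineK ?upper_tail_fin //; apply: (le_trans (upper_tail_le bp)).
  by rewrite lee_fin.
have h2 : u <= fine (upper_tail (- b (1 - u))).
  set c : R := b (1 - u) in ha1 ha2 ap *.
  have e : (upper_tail (- c)%R + normal_prob 0 1 [set x : R | (c <= x)%R] = 1)%E.
    have d : [set x | - c < x] `&` [set x | x <= - c] = set0.
      by apply/seteqP; split => x //= [h]; rewrite leNgt h.
    have hU := @measureU _ _ _ (normal_prob (0 : R) 1) _ _ (mgt (- c)) (mle (- c)) d.
    have eN : normal_prob 0 1 [set x : R | x <= - c] = normal_prob 0 1 [set x : R | c <= x].
      rewrite -(normal_prob_opp (mge c)); congr (normal_prob 0 1 _).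
      by apply/seteqP; split => x /=; rewrite lerNr.
    rewrite -eN; transitivity (normal_prob (0 : R) 1 ([set x | - c < x] `|` [set x | x <= - c])).
      by apply/esym; exact: hU.
    rewrite -[RHS](@probability_setT _ _ _ (normal_prob (0 : R) 1)).
    congr (normal_prob 0 1 _); apply/seteqP; split => x //= _.
    by case: (ltP (- c) x); [left|right].
  have := normal_tail_le ap => h3.
  have f3 : normal_prob 0 1 [set x : R | c <= x] \is a fin_num by exact: (fin_num_measure (normal_prob (0 : R) 1) _ (mge _)).
  have h4 : fine (normal_prob 0 1 [set x : R | c <= x]) <= expR (- c ^+ 2 / 2).
    by rewrite -lee_fin fineK.
  have h5 : fine (upper_tail (- c)) + fine (normal_prob 0 1 [set x : R | c <= x]) = 1.
    by rewrite -fineD ?upper_tail_fin // e.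
  rewrite -(addrK (fine (normal_prob 0 1 [set x : R | c <= x])) (fine _)) h5.
  by rewrite lerBrDr -lerBrDl (le_trans h4).
have ab : - b (1 - u) <= b u by lra.
have cf : {within `[- b (1 - u), b u], continuous (fun x => fine (upper_tail x))}.
  by apply: continuous_subspaceT => x; exact: upper_tail_continuous.
have [|z _ hz] := IVT ab cf (v := u).
  by apply/andP; split; [rewrite ge_min h1 orbT|rewrite le_max h2].
by exists z; rewrite -hz fineK // upper_tail_fin.
Qed.

Lemma z_quantileP (u : R) : 0 < u < 1 -> upper_tail (z_quantile u) = u%:E.
Proof.
by move=> /upper_tail_exists [z hz]; rewrite /upper_tail /z_quantile; case: xgetP => [y _ //|/(_ z)].
Qed.

Lemma z_quantile_ge0 (u : R) : 0 < u < 2^-1 -> 0 <= z_quantile u.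
Proof.
move=> /andP[u0 u1]; apply: upper_tail_lt_half; rewrite z_quantileP ?lte_fin //.
by rewrite u0; lra.
Qed.

(** Inverts the Chernoff bound [u = P(Z > z) <= expR (- z^2 / 2)]. *)
Lemma z_quantile_sqr_le (u : R) : 0 < u < 2^-1 -> z_quantile u ^+ 2 <= 2 * ln u^-1.
Proof.
move=> /[dup] uh /andP[u0 u1]; have z0 := z_quantile_ge0 uh.
have lu : 0 <= ln u^-1 by rewrite ln_ge0 // invf_ge1 //; lra.
have [->|zn] := eqVneq (z_quantile u) 0; first by rewrite expr0n mulr_ge0.
have zp : 0 < z_quantile u by rewrite lt0r zn.
have := upper_tail_le zp; rewrite z_quantileP ?u0; last by lra.
rewrite lee_fin -[X in X <= _]lnK ?posrE // ler_expR lnV ?posrE //; lra.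
Qed.

(** Cost of lowering a threshold [c] by [h]. The ratio of the shifted density to the original at [x]
    is [expR (x h - h^2 / 2)], at most [expR (L h)] up to [L]; beyond, the plain tail bound is used.
    The bound is multiplicative because the tail at [c] will be multiplied by the number of selected
    covariates. *)
Lemma upper_tail_shift (c h L : R) : 0 <= h -> c - h <= L - h -> 0 < L - h -> 0 <= L ->
  (upper_tail (c - h) <= (expR (L * h))%:E * upper_tail c + (expR (- (L - h) ^+ 2 / 2))%:E)%E.
Proof.
move=> h0 cL Lh L0; rewrite (upper_tail_split cL) addeC; apply: leeD; last exact: upper_tail_le.
have mI : measurable (`]c, L]%classic : set R) by exact: measurable_itv.
have mI' : measurable (`]c - h, L - h]%classic : set R) by exact: measurable_itv.
apply: (@le_trans _ _ ((expR (L * h))%:E * normal_prob 0 1 `]c, L]%classic)%E); last first.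
  apply: lee_wpmul2l; first by rewrite lee_fin expR_ge0.
  have hm := @measure_subset_le _ _ R (normal_prob 0 1) _ _ mI (mgt c); apply: hm => x /=; by rewrite in_itv /= => /andP[].
rewrite (normal_prob_indic 1 mI) (normal_prob_indic 1 mI').
rewrite -[leLHS](ge0_integral_shift (- h)); last 2 first.
- by apply: emeasurable_funM; apply/measurable_EFinP; [exact: measurable_indic|exact: measurable_normal_pdf].
- by move=> x; rewrite -EFinM lee_fin mulr_ge0 // normal_pdf_ge0.
rewrite -ge0_integralZlT ?expR_ge0 //; last 2 first.
- by apply: emeasurable_funM; apply/measurable_EFinP; [exact: measurable_indic|exact: measurable_normal_pdf].
- by move=> x; rewrite -EFinM lee_fin mulr_ge0 // normal_pdf_ge0.
apply: ge0_le_integral => //.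
- by move=> x _; rewrite -EFinM lee_fin mulr_ge0 // normal_pdf_ge0.
- apply: emeasurable_funM; apply/measurable_EFinP.
    by apply: measurableT_comp; [exact: measurable_indic|exact: measurable_funB].
  by apply: measurableT_comp; [exact: measurable_normal_pdf|exact: measurable_funB].
- apply: emeasurable_funM => //; apply: emeasurable_funM; apply/measurable_EFinP;
    [exact: measurable_indic|exact: measurable_normal_pdf].
move=> x _; rewrite -!EFinM lee_fin.
have -> : \1_`]c - h, L - h] (x - h) = \1_`]c, L] x :> R.
  rewrite !indicE (_ : (x - h \in `]c - h, L - h]%classic) = (x \in `]c, L]%classic)) //.
  by apply/idP/idP; rewrite !inE /= !in_itv /= ltrD2r lerD2r.
rewrite indicE; case: (boolP (x \in _)) => [|_]; last by rewrite !mul0r mulr0.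
rewrite inE /= in_itv /= => /andP[_ xL]; rewrite !mul1r !normal_pdfE' // !subr0.
rewrite [leRHS]mulrCA ler_wpM2l ?mulr_ge0 ?invr_ge0 ?sqrtr_ge0 // -expRD ler_expR expr1n.
have : x * h <= L * h by rewrite ler_wpM2r.
have : 0 <= h ^+ 2 by exact: sqr_ge0.
rewrite sqrrB; lra.
Qed.

End NormalTail.

(** * Measurability of the selectors *)

Section MeasurableClosure.
Context {d} {T : measurableType d} {R : realType}.

(** Measurability for the discrete sigma-algebra, by fibers, so that subsets, steps and splits serve
    as values without a measurable structure on them. *)
Definition dmeas (I : finType) (F : T -> I) := forall x, measurable (F @^-1` [set x]).

Definition mmx m n (F : T -> 'M[R]_(m, n)) := forall i j, measurable_fun setT (fun w => F w i j).

Lemma dmeas_pre (I : finType) (F : T -> I) (A : set I) : dmeas F -> measurable (F @^-1` A).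
Proof.
move=> mF; have -> : F @^-1` A = \bigcup_(x in A) (F @^-1` [set x]).
  by apply/seteqP; split => w /= => [h|[x Ax ->]//]; exists (F w).
apply: fin_bigcup_measurable => // x _; exact: mF.
Qed.

Lemma dmeas_comp (I J : finType) (F : T -> I) (g : I -> J) : dmeas F -> dmeas (g \o F).
Proof. by move=> mF x; exact: (dmeas_pre (g @^-1` [set x]) mF). Qed.

Lemma dmeas_bool (A : T -> bool) : measurable [set w | A w] -> dmeas A.
Proof.
move=> mA [|]; first exact: mA.
have -> : A @^-1` [set false] = ~` [set w | A w].
  by apply/seteqP; split => w /= => [->//|/negP/negbTE].
exact: measurableC.
Qed.

Lemma dmeas_ffun (I J : finType) (F : I -> T -> J) : (forall i, dmeas (F i)) ->
  dmeas (fun w => [ffun i => F i w]).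
Proof.
move=> mF x; have -> : (fun w => [ffun i => F i w]) @^-1` [set x] =
    \bigcap_(i in [set: I]) (F i @^-1` [set x i]).
  apply/seteqP; split => w /=; first by move=> <- i _ /=; rewrite ffunE.
  by move=> h; apply/ffunP => i; rewrite ffunE; exact: (h i Logic.I).
by apply: fin_bigcap_measurable; [exact: finite_finset|move=> i _; exact: mF].
Qed.

(** A random choice among finitely many values may be treated as fixed, by decomposing along its
    fibers. Data-dependent models, steps and splits enter events in this way. *)
Lemma bind_set (I : finType) (F : T -> I) (A : I -> set T) : dmeas F ->
  (forall x, measurable (A x)) -> measurable [set w | A (F w) w].
Proof.
move=> mF mA; have -> : [set w | A (F w) w] = \bigcup_(x in [set: I]) (F @^-1` [set x] `&` A x).
  by apply/seteqP; split => w /= => [h|[x _ [<-]]//]; exists (F w).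
apply: fin_bigcup_measurable; first exact: finite_finset.
by move=> x _; apply: measurableI.
Qed.

Lemma bind_dmeas (I J : finType) (F : T -> I) (G : I -> T -> J) : dmeas F ->
  (forall x, dmeas (G x)) -> dmeas (fun w => G (F w) w).
Proof.
move=> mF mG y; apply: (bind_set (A := fun x => G x @^-1` [set y]) mF) => x.
exact: mG.
Qed.

Lemma bind_fun (I : finType) d' (E : measurableType d') (F : T -> I) (G : I -> T -> E) : dmeas F ->
  (forall x, measurable_fun setT (G x)) -> measurable_fun setT (fun w => G (F w) w).
Proof.
move=> mF mG _ Y mY; rewrite setTI.
apply: (bind_set (A := fun x => G x @^-1` Y) mF) => x.
by rewrite -[X in measurable X]setTI; exact: mG.
Qed.

Lemma measurable_le (f g : T -> R) : measurable_fun setT f -> measurable_fun setT g ->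
  measurable [set w | f w <= g w].
Proof. by move=> mf mg; rewrite -[X in measurable X]setTI; exact: measurable_fun_ler. Qed.

Lemma measurable_lt (f g : T -> R) : measurable_fun setT f -> measurable_fun setT g ->
  measurable [set w | f w < g w].
Proof. by move=> mf mg; rewrite -[X in measurable X]setTI; exact: measurable_fun_ltr. Qed.

Lemma measurable_eq0 (f : T -> R) : measurable_fun setT f -> measurable [set w | f w == 0].
Proof. by move=> mf; rewrite -[X in measurable X]setTI; apply: measurable_fun_eqr. Qed.

Lemma measurable_forall (I : countType) (A : I -> set T) : (forall i, measurable (A i)) ->
  measurable [set w | forall i, A i w].
Proof.
move=> mA; have -> : [set w | forall i, A i w] = \bigcap_(n in [set: nat])
    (if unpickle n is Some i then A i else setT).
  apply/seteqP; split => w /=; first by move=> h n _; case: unpickle.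
  by move=> h i; have := h (pickle i) Logic.I; rewrite pickleK.
by apply: bigcapT_measurable => n; case: unpickle.
Qed.

Lemma measurable_exists (I : countType) (A : I -> set T) : (forall i, measurable (A i)) ->
  measurable [set w | exists i, A i w].
Proof.
move=> mA; have -> : [set w | exists i, A i w] = ~` [set w | forall i, (~` A i) w].
  apply/seteqP; split => w /=; first by move=> [i Ai] h; exact: (h i).
  by move=> h; apply: contrapT => h'; apply: h => i Ai; apply: h'; exists i.
by apply/measurableC/measurable_forall => i; exact: measurableC.
Qed.

(** The formula [x expR (- ln (x^2))] is measurable by composition and respects the convention that
    the inverse of [0] is [0]. *)
Lemma measurable_inv (f : T -> R) : measurable_fun setT f -> measurable_fun setT (fun w => (f w)^-1).
Proof.
move=> mf; have -> : (fun w => (f w)^-1) = (fun w => f w * expR (- ln (f w ^+ 2))).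
  apply/funext => w; have [->|f0] := eqVneq (f w) 0; first by rewrite invr0 mul0r.
  rewrite expRN lnK ?posrE ?exprn_even_gt0 //; by field.
apply: measurable_funM => //; apply: measurableT_comp => //; apply: measurableT_comp => //.
by apply: measurableT_comp; [exact: measurable_ln|exact: measurable_funX].
Qed.

Lemma measurable_sqrtr (f : T -> R) : measurable_fun setT f -> measurable_fun setT (fun w => Num.sqrt (f w)).
Proof.
move=> mf; apply: (measurableT_comp (f := @Num.sqrt R)) => //.
by apply: continuous_measurable_fun; exact: sqrt_continuous.
Qed.

Lemma mmx_cst m n (A : 'M[R]_(m, n)) : mmx (fun=> A).
Proof. by move=> i j; exact: measurable_cst. Qed.

Lemma mmx_mul m n q (F : T -> 'M[R]_(m, n)) (G : T -> 'M[R]_(n, q)) : mmx F -> mmx G ->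
  mmx (fun w => F w *m G w).
Proof.
move=> mF mG i j; under eq_fun do rewrite mxE.
by apply: measurable_sum => k; exact: measurable_funM.
Qed.

Lemma mmx_add m n (F G : T -> 'M[R]_(m, n)) : mmx F -> mmx G -> mmx (fun w => F w + G w).
Proof. by move=> mF mG i j; under eq_fun do rewrite mxE; exact: measurable_funD. Qed.

Lemma mmx_opp m n (F : T -> 'M[R]_(m, n)) : mmx F -> mmx (fun w => - F w).
Proof. by move=> mF i j; under eq_fun do rewrite mxE; exact: measurableT_comp. Qed.

Lemma mmx_sub m n (F G : T -> 'M[R]_(m, n)) : mmx F -> mmx G -> mmx (fun w => F w - G w).
Proof. by move=> mF mG; apply: mmx_add => //; exact: mmx_opp. Qed.

Lemma mmx_tr m n (F : T -> 'M[R]_(m, n)) : mmx F -> mmx (fun w => (F w)^T).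
Proof. by move=> mF i j; under eq_fun do rewrite mxE; exact: mF. Qed.

Lemma mmx_mxsub m n m' n' (f : 'I_m' -> 'I_m) (g : 'I_n' -> 'I_n) (F : T -> 'M[R]_(m, n)) :
  mmx F -> mmx (fun w => mxsub f g (F w)).
Proof. by move=> mF i j; under eq_fun do rewrite mxE; exact: mF. Qed.

Lemma measurable_det n (F : T -> 'M[R]_n) : mmx F -> measurable_fun setT (fun w => \det (F w)).
Proof.
move=> mF; apply: measurable_sum => s; apply: measurable_funM => //.
by apply: measurable_prod => i _; exact: mF.
Qed.

(** Cofactor formula; the case distinction reflects that [invmx] returns its argument on singular
    matrices. *)
Lemma mmx_inv n (F : T -> 'M[R]_n) : mmx F -> mmx (fun w => invmx (F w)).
Proof.
move=> mF i j.
have -> : (fun w => invmx (F w) i j) = (fun w => if \det (F w) == 0 then F w i j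
    else (\det (F w))^-1 * cofactor (F w) j i).
  by apply/funext => w; rewrite /invmx unitmxE unitfE; case: eqP => //= _; rewrite !mxE.
apply: measurable_fun_ifT.
- apply: (measurable_fun_bool true); rewrite setTI.
  by rewrite -[X in measurable X](_ : [set w | \det (F w) == 0] = _) //; apply: measurable_eq0; exact: measurable_det.
- exact: mF.
- apply: measurable_funM; first by apply: measurable_inv; exact: measurable_det.
  apply: measurable_funM => //; apply: measurable_det => k l.
  by under eq_fun do rewrite !mxE; exact: mF.
Qed.

Lemma measurable_dot n (u v : T -> 'cV[R]_n) : mmx u -> mmx v -> measurable_fun setT (fun w => dot (u w) (v w)).
Proof. by move=> mu mv; apply: measurable_sum => i; exact: measurable_funM. Qed.

Lemma mmx_colof m n j (F : T -> 'M[R]_(m, n)) : mmx F -> mmx (fun w => col j (F w)).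
Proof. by move=> mF i k; under eq_fun do rewrite mxE; exact: mF. Qed.

End MeasurableClosure.

Section MeasurableSelectors.
Context {d} {T : measurableType d} {R : realType} {n p : nat}.
Implicit Types (X : T -> 'M[R]_(n, p)) (Y : T -> 'cV[R]_n) (M : {set 'I_p}).

Lemma mmx_cols X M : mmx X -> mmx (fun w => cols (X w) M).
Proof. by move=> mX; exact: mmx_mxsub. Qed.

Lemma mmx_gram X M : mmx X -> mmx (fun w => gram (X w) M).
Proof. by move=> mX; apply: mmx_mul; [apply: mmx_tr|]; exact: mmx_cols. Qed.

Lemma mmx_ols X Y M : mmx X -> mmx Y -> mmx (fun w => ols (X w) (Y w) M).
Proof.
move=> mX mY; apply: mmx_mul; first by apply: mmx_inv; exact: mmx_gram.
by apply: mmx_mul => //; apply: mmx_tr; exact: mmx_cols.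
Qed.

Lemma mmx_residual X Y M : mmx X -> mmx Y -> mmx (fun w => residual (X w) (Y w) M).
Proof.
by move=> mX mY; apply: mmx_sub => //; apply: mmx_mul; [exact: mmx_cols|exact: mmx_ols].
Qed.

Lemma mmx_ols_ext X Y M : mmx X -> mmx Y -> mmx (fun w => ols_ext (X w) (Y w) M).
Proof.
move=> mX mY i j; under eq_fun do rewrite summxE.
apply: measurable_sum => k; under eq_fun do rewrite mxE.
by apply: measurable_funM; [exact: mmx_ols|exact: measurable_cst].
Qed.

Lemma measurable_score X Y M j : mmx X -> mmx Y -> measurable_fun setT (fun w => score (X w) (Y w) M j).
Proof.
move=> mX mY; apply: measurable_funM => //; apply: measurable_sum => i.
by apply: measurable_funM; [exact: mX|exact: mmx_residual].
Qed.

(** The step depends on the data only through the finite table of comparisons between scores, ties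
    included. The argmin and the cleaning step have similar tables. *)
Lemma dmeas_fs_step X Y M : mmx X -> mmx Y -> dmeas (fun w => fs_step (X w) (Y w) M).
Proof.
move=> mX mY.
pose tab w := [ffun jJ : 'I_p * 'I_p => `|score (X w) (Y w) M jJ.1| <= `|score (X w) (Y w) M jJ.2|].
pose g (t : {ffun 'I_p * 'I_p -> bool}) :=
  if [pick J | [forall j, t (j, J)]] is Some J then (J |: M)%SET else M.
have -> : (fun w => fs_step (X w) (Y w) M) = g \o tab.
  apply/funext => w; rewrite /fs_step /g /=.
  by under [in RHS]eq_pick do under eq_forallb do rewrite ffunE /=.
apply: dmeas_comp; apply: (dmeas_ffun (F := fun jJ w => _)) => -[j J] /=.
apply: dmeas_bool; apply: measurable_le; apply: measurableT_comp => //; exact: measurable_score.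
Qed.

Lemma dmeas_fs_set X Y l : mmx X -> mmx Y -> dmeas (fun w => fs_set (X w) (Y w) l).
Proof.
move=> mX mY; elim: l => [|l IH].
  by move=> M; rewrite /fs_set /= preimage_cst; case: ifP.
exact: (bind_dmeas (G := fun M w => fs_step (X w) (Y w) M) IH (fun M => dmeas_fs_step M mX mY)).
Qed.

Lemma mmx_fs_coef X Y l : mmx X -> mmx Y -> mmx (fun w => fs_coef (X w) (Y w) l).
Proof.
move=> mX mY i j.
apply: (bind_fun (G := fun M w => ols_ext (X w) (Y w) M i j) (dmeas_fs_set l mX mY)) => M.
exact: mmx_ols_ext.
Qed.

Lemma dmeas_arg_min k (F : T -> 'I_k.+1 -> R) : (forall i, measurable_fun setT (F^~ i)) ->
  dmeas (fun w => [arg min_(i < ord0 : 'I_k.+1) F w i]%O).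
Proof.
move=> mF.
pose tab w := [ffun ij : 'I_k.+1 * 'I_k.+1 => F w ij.1 <= F w ij.2].
pose g (t : {ffun 'I_k.+1 * 'I_k.+1 -> bool}) : 'I_k.+1 :=
  odflt ord0 [pick i | [forall j, t (i, j)]].
have -> : (fun w => [arg min_(i < ord0 : 'I_k.+1) F w i]%O) = g \o tab.
  apply/funext => w; rewrite /g /= /Order.arg_min /extremum; congr odflt.
  by apply: eq_pick => i /=; apply: eq_forallb => j; rewrite ffunE.
apply: dmeas_comp; apply: (dmeas_ffun (F := fun ij w => _)) => -[i j] /=.
by apply: dmeas_bool; exact: measurable_le.
Qed.

Lemma dmeas_oracle X Y (beta : 'cV[R]_p) k : mmx X -> mmx Y ->
  dmeas (fun w => oracle_lambda (X w) (Y w) beta k).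
Proof.
move=> mX mY; apply: dmeas_arg_min => l.
have mv : mmx (fun w => fs_coef (X w) (Y w) l - beta).
  by apply: mmx_sub; [exact: mmx_fs_coef|exact: mmx_cst].
apply: measurable_funM => //; apply: mmx_mul => //; apply: mmx_mul => //.
by apply: mmx_mul; apply: mmx_tr.
Qed.

Lemma dmeas_cv X Y (X' : T -> 'M[R]_(n, p)) (Y' : T -> 'cV[R]_n) k : mmx X -> mmx Y -> mmx X' -> mmx Y' ->
  dmeas (fun w => cv_lambda (X w) (Y w) (X' w) (Y' w) k).
Proof.
move=> mX mY mX' mY'; apply: dmeas_arg_min => l.
apply: measurable_funM => //; apply: measurable_sum => i; apply: measurable_funX.
apply: measurable_funB; first exact: mY'.
by apply: mmx_mul => //; exact: mmx_fs_coef.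
Qed.

Lemma measurable_t_stat X Y M i : mmx X -> mmx Y -> measurable_fun setT (fun w => t_stat (X w) (Y w) (M := M) i).
Proof.
move=> mX mY; apply: measurable_funM; first exact: mmx_ols.
apply: measurable_inv; apply: measurable_funM; apply: measurable_sqrtr.
  apply: measurable_funM => //; apply: measurable_sum => r; apply: measurable_funX.
  exact: mmx_residual.
by apply: mmx_inv; exact: mmx_gram.
Qed.

Lemma dmeas_clean X Y M alpha : mmx X -> mmx Y -> dmeas (fun w => clean (X w) (Y w) M alpha).
Proof.
move=> mX mY; pose z : R := z_quantile (alpha / (2 * #|M|%:R)).
pose tab w := [ffun i : 'I_#|M| => z < `|t_stat (X w) (Y w) i|].
pose g (t : {ffun 'I_#|M| -> bool}) : {set 'I_p} := [set enum_val i | i : 'I_#|M| & t i]%SET.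
have -> : (fun w => clean (X w) (Y w) M alpha) = g \o tab.
  apply/funext => w; rewrite /clean /g /=; apply/finset.setP => j.
  by apply/imsetP/imsetP => -[i]; rewrite inE => hi ->; exists i; rewrite ?inE ?ffunE // ffunE in hi *.
apply: dmeas_comp; apply: (dmeas_ffun (F := fun i w => _)) => i /=.
apply: dmeas_bool; apply: measurable_lt => //; apply: measurableT_comp => //.
exact: measurable_t_stat.
Qed.

End MeasurableSelectors.

(** * Rayleigh quotients and sparse eigenvalues *)

Section Rayleigh.
Context {R : realType} {m : nat}.
Implicit Types (C : 'M[R]_m) (u v : 'cV[R]_m).

Lemma cvg_sumr (V : Type) (F : set_system V) {FF : Filter F} (I : finType) (f : I -> V -> R) (l : I -> R) :
  (forall i, f i x @[x --> F] --> l i) -> \sum_i f i x @[x --> F] --> \sum_i l i.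
Proof. by move=> cf; apply: cvg_big => //; exact: add_continuous. Qed.

Lemma quad_continuous C : continuous (fun x : 'rV[R]_m => dot (x^T) (C *m x^T)).
Proof.
have -> : (fun x : 'rV[R]_m => dot (x^T) (C *m x^T)) =
    (fun x => \sum_i x 0 i * \sum_j C i j * x 0 j).
  apply/funext => x; apply: eq_bigr => i _; rewrite !mxE; congr (_ * _).
  by apply: eq_bigr => j _; rewrite mxE.
move=> x; have FF : Filter (nbhs x) by exact: nbhs_filter.
apply: (@cvg_sumr _ (nbhs x) FF) => i; apply: cvgM; first exact: (@coord_continuous R 1 m 0 i x).
apply: (@cvg_sumr _ (nbhs x) FF) => j; apply: cvgM; first exact: cvg_cst.
exact: (@coord_continuous R 1 m 0 j x).
Qed.

Lemma sphere_compact : compact [set x : 'rV[R]_m | dot (x^T) (x^T) = 1].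
Proof.
apply: bounded_closed_compact.
  exists 1; split; first exact: num_real.
  move=> M M1 x /= x1; apply: le_trans (ltW M1).
  rewrite [leLHS]/Num.Def.normr/= mx_normrE; apply: bigmax_le => // -[i j] _ /=.
  have := sqr_coord_le x^T j; rewrite x1 mxE (ord1 i) => h.
  by rewrite -(@ler_pXn2r _ 2%N) ?nnegrE // expr1n -normrX ger0_norm ?sqr_ge0.
have -> : [set x : 'rV[R]_m | dot (x^T) (x^T) = 1] =
    (fun x : 'rV[R]_m => dot (x^T) (1%:M *m x^T)) @^-1` [set 1].
  by apply/seteqP; split => x /=; rewrite mul1mx.
apply: closed_comp; last exact: closed_eq.
by move=> x _; exact: quad_continuous.
Qed.

Lemma symmetric_dot C u v : C^T = C -> dot u (C *m v) = dot v (C *m u).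
Proof.
move=> sC; rewrite !dotE (_ : (u^T *m (C *m v)) 0 0 = (u^T *m (C *m v))^T 0 0); last by rewrite [RHS]mxE.
by rewrite !trmx_mul trmxK sC mulmxA.
Qed.

(** The quadratic form attains its minimum on the compact unit sphere, and the first variation at
    the minimizer makes it an eigenvector. This gives content to [min_eig], an infimum over
    eigenvalues. *)
Lemma rayleigh_min C : (0 < m)%N -> C^T = C ->
  exists2 a, eigenvalue C a & forall u, a * dot u u <= dot u (C *m u).
Proof.
move=> m0 sC.
have [c c1 cmin] : exists2 c : 'rV[R]_m, dot (c^T) (c^T) = 1 &
    forall x : 'rV[R]_m, dot (x^T) (x^T) = 1 ->
    dot (c^T) (C *m c^T) <= dot (x^T) (C *m x^T).
  have [||c cS cmin] := EVT_min_rV (f := fun x => dot (x^T) (C *m x^T)) _ sphere_compact.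
  - exists (delta_mx 0 (Ordinal m0)) => /=.
    rewrite trmx_delta /dot (bigD1 (Ordinal m0)) //= mxE !eqxx mulr1 big1 ?addr0 // => i /negbTE i0.
    by rewrite mxE i0 mul0r.
  - by apply: continuous_subspaceT; exact: quad_continuous.
  by exists c; [move: cS; rewrite inE|move=> x x1; apply: cmin; rewrite inE].
set a := dot (c^T) (C *m c^T) in cmin.
have amin u : a * dot u u <= dot u (C *m u).
  have [/dot_eq0 ->|u0] := eqVneq (dot u u) 0; first by rewrite !dot0l mulr0.
  have upos : 0 < dot u u by rewrite lt_def u0 dot_ge0.
  have r0 : Num.sqrt (dot u u) != 0 by rewrite gt_eqF // sqrtr_gt0.
  have r2 : Num.sqrt (dot u u) * Num.sqrt (dot u u) = dot u u.
    by rewrite -expr2 sqr_sqrtr // ltW.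
  have := cmin ((Num.sqrt (dot u u))^-1 *: u)^T.
  rewrite trmxK -scalemxAr !dotZl !dotZr !mulrA -invfM r2 mulVf // => /(_ erefl).
  by rewrite ler_pdivlMl // mulrC.
exists a => //.
pose c' := c^T; have c'1 : dot c' c' = 1 by [].
have lin u : dot u (C *m c') - a * dot u c' = 0.
  set b := (X in X = 0); apply/eqP; rewrite -sqrf_eq0 eq_le sqr_ge0 andbT.
  pose q := dot u (C *m u) - a * dot u u.
  have q0 : 0 <= q by rewrite subr_ge0.
  have main t : 0 <= 2 * t * b + t ^+ 2 * q.
    have := amin (c' + t *: u).
    rewrite mulmxDr -!scalemxAr !dotDl !dotDr !dotZl !dotZr (symmetric_dot c' u sC) c'1 (dotC c' u) -/a.
    rewrite /b /q -subr_ge0 => /le_trans; apply; rewrite le_eqVlt; apply/orP; left; apply/eqP.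
    rewrite -?/c' -?/a; ring.
  (* The optimal [t] would be [- b / q]; using [q + 1] avoids the case [q = 0] and still yields
     [- b^2 (q + 2) >= 0], hence [b = 0]. *)
  have := main (- b / (q + 1)); rewrite -(pmulr_rge0 _ (_ : 0 < (q + 1) ^+ 2)); last first.
    by rewrite exprn_gt0 // ltr_wpDl.
  have q1 : q + 1 != 0 by rewrite gt_eqF // ltr_wpDl.
  have -> : (q + 1) ^+ 2 * (2 * (- b / (q + 1)) * b + (- b / (q + 1)) ^+ 2 * q) =
     - b ^+ 2 * (q + 2) by field.
  by rewrite mulNr oppr_ge0 pmulr_lle0 // ltr_wpDl.
apply/eigenvalueP; exists c; last first.
  by apply/eqP => c0; move: c1; rewrite c0 trmx0 dot0l => /eqP; rewrite eq_sym oner_eq0.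
apply/rowP => j; have := lin (delta_mx j 0).
rewrite !dotE !trmx_delta -!rowE !mxE => /eqP; rewrite subr_eq0 => /eqP <-.
by apply: eq_bigr => i _; rewrite mxE mulrC -{1}sC mxE.
Qed.

Lemma min_eig_le C u : C^T = C -> min_eig C * dot u u <= dot u (C *m u).
Proof.
move=> sC; case: (posnP m) => [m0|m0].
  by rewrite /dot !big1 ?mulr0 // => i _; have := ltn_ord i; rewrite [X in (_ < X)%N]m0.
have [a ea amin] := rayleigh_min m0 sC.
apply: le_trans (amin u); apply: ler_wpM2r; first exact: dot_ge0.
apply: ge_inf => //; exists a => b /= /eigenvalueP [v vC v0].
have := amin v^T; have -> : C *m v^T = b *: v^T by rewrite -[in LHS]sC -trmx_mul vC linearZ.
rewrite dotZr ler_pM2r // lt_def dot_ge0 andbT; apply: contra v0 => /eqP /dot_eq0 /(congr1 trmx).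
by rewrite trmxK trmx0 => ->.
Qed.

Lemma max_eig_ge C u : C^T = C -> dot u (C *m u) <= max_eig C * dot u u.
Proof.
move=> sC; have -> : max_eig C = - min_eig (- C).
  rewrite /max_eig /min_eig /inf opprK; congr sup; apply/seteqP; split => a /=.
    move=> /eigenvalueP [v vC v0]; exists (- a); last by rewrite opprK.
    by apply/eigenvalueP; exists v => //; rewrite mulmxN vC scaleNr.
  move=> [b /eigenvalueP [v vC v0] <-]; apply/eigenvalueP; exists v => //.
  by rewrite scaleNr -vC mulmxN opprK.
have := min_eig_le (C := - C) u; rewrite linearN /= sC => /(_ erefl).
by rewrite mulNmx dotNr => h; rewrite [leRHS]mulNr lerNr.
Qed.

End Rayleigh.

Section SparseEigenvalues.
Context {R : realType} {n p : nat}.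
Implicit Types (X : 'M[R]_(n, p)) (M : {set 'I_p}) (v : 'cV[R]_p).

Lemma gram_quad X M u : dot u ((n%:R^-1 *: gram X M) *m u) = n%:R^-1 * dot (cols X M *m u) (cols X M *m u).
Proof. by rewrite -scalemxAl dotZr !dotE trmx_mul /gram !mulmxA. Qed.

Lemma fin_lbound (I : finType) (f : I -> R) (A : set I) : has_lbound (f @` A).
Proof.
exists (- \sum_i `|f i|) => _ /= [i _ <-]; rewrite lerNl (bigD1 i) //= ler_wpDr ?sumr_ge0 //.
by rewrite -normrN ler_norm.
Qed.

Lemma fin_ubound (I : finType) (f : I -> R) (A : set I) : has_ubound (f @` A).
Proof.
exists (\sum_i `|f i|) => _ /= [i _ <-]; rewrite (bigD1 i) //= ler_wpDr ?sumr_ge0 //.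
exact: ler_norm.
Qed.

(** Sparse eigenvalues range over sets of exactly [k] covariates, so a smaller support has to be
    enlarged first; this is where [k <= p] enters. *)
Lemma extend_card M k : (#|M| <= k <= p)%N -> exists2 M' : {set 'I_p}, M \subset M' & #|M'| = k.
Proof.
move=> /andP[Mk kp].
have : (0 < #|[set N : {set 'I_p} | (N \subset ~: M) && (#|N| == k - #|M|)%N]%SET|)%N.
  by rewrite cards_draws bin_gt0 [#|~: M|]cardsCs finset.setCK card_ord leq_sub2r.
case/card_gt0P => N; rewrite inE => /andP[NM /eqP Nk].
exists (M :|: N)%SET; first exact: finset.subsetUl.
rewrite cardsU Nk disjoint_setI0 ?cards0 ?subn0 ?subnKC //.
by rewrite disjoint_sym finset.disjoints_subset.
Qed.

Lemma dot_ext M (u w : 'cV[R]_#|M|) : dot (ext u) (ext w) = dot u w.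
Proof.
rewrite /dot (bigID (fun j => j \in M)) /= [X in _ + X]big1 ?addr0; last first.
  by move=> j jM; rewrite (suppin_ext u jM) mul0r.
rewrite (big_enum_val (fun j => ext u j 0 * ext w j 0)) /=.
by apply: eq_bigr => i _; rewrite !ext_enum.
Qed.

Lemma sparse_min_RE X k : (0 < n)%N -> (k <= p)%N -> RE X k (sparse_min_eig X k).
Proof.
move=> n0 kp M v Mk vM.
have [|M' MM' M'k] := @extend_card M k; first by rewrite Mk.
have vM' := suppinS MM' vM; rewrite -(extK vM') mulmx_ext dot_ext.
set u := (U in cols X M' *m U).
have := min_eig_le (C := n%:R^-1 *: gram X M') u.
rewrite linearZ /= trmx_mul trmxK => /(_ erefl).
rewrite gram_quad ler_pdivlMl ?ltr0n // mulrA [n%:R * _]mulrC; apply: le_trans.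
apply: ler_wpM2r; first exact: dot_ge0.
apply: ler_wpM2r => //; apply: ge_inf; first exact: fin_lbound.
by exists M'.
Qed.

Lemma sparse_max_UP X k : (0 < n)%N -> (k <= p)%N -> UP X k (sparse_max_eig X k).
Proof.
move=> n0 kp M v Mk vM.
have [|M' MM' M'k] := @extend_card M k; first by rewrite Mk.
have vM' := suppinS MM' vM; rewrite -(extK vM') mulmx_ext dot_ext.
set u := (U in cols X M' *m U).
have := max_eig_ge (C := n%:R^-1 *: gram X M') u.
rewrite linearZ /= trmx_mul trmxK => /(_ erefl).
rewrite gram_quad ler_pdivrMl ?ltr0n // mulrA [n%:R * _]mulrC => /le_trans; apply.
apply: ler_wpM2r; first exact: dot_ge0.
apply: ler_wpM2r => //; apply: ub_le_sup; first exact: fin_ubound.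
by exists M'.
Qed.

Lemma RE_le X k kap kap' : kap <= kap' -> RE X k kap' -> RE X k kap.
Proof.
move=> h hRE M v Mk vM; apply: le_trans (hRE M v Mk vM).
by apply: ler_wpM2r; [exact: dot_ge0|apply: ler_wpM2r].
Qed.

Lemma UP_le X k C C' : C' <= C -> UP X k C' -> UP X k C.
Proof.
move=> h hUP M v Mk vM; apply: le_trans (hUP M v Mk vM) _.
by apply: ler_wpM2r; [exact: dot_ge0|apply: ler_wpM2r].
Qed.

Lemma RE_leq X k k' kap : (k <= k')%N -> RE X k' kap -> RE X k kap.
Proof. by move=> h hRE M v Mk vM; apply: hRE vM; exact: leq_trans h. Qed.

(** Vectors with coordinates [floor (v_j N) / N] approximate [v] within its support, and the form is
    continuous. Countably many test vectors make [RE] and [UP] measurable events. *)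
Lemma quad_rat_dense X (a b : R) M :
  (forall q : {ffun 'I_p -> int * nat}, let v := \col_j (if j \in M then (q j).1%:~R / (q j).2.+1%:R else 0) in
     0 <= a * dot v v + b * dot (X *m v) (X *m v)) ->
  forall v, suppin v M -> 0 <= a * dot v v + b * dot (X *m v) (X *m v).
Proof.
move=> h v vM.
pose w N : 'cV[R]_p := \col_j (if j \in M then (Num.floor (v j 0 * N.+1%:R))%:~R / N.+1%:R else 0).
have cw j : w N j 0 @[N --> \oo] --> v j 0.
  rewrite /w; under eq_fun do rewrite mxE.
  have [jM|jM] := boolP (j \in M); last by rewrite (vM j jM); exact: cvg_cst.
  apply/cvgrPdist_le => e e0; near=> N.
  have N0 : 0 < N.+1%:R :> R by rewrite ltr0n.
  have -> : v j 0 - (Num.floor (v j 0 * N.+1%:R))%:~R / N.+1%:R =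
      (v j 0 * N.+1%:R - (Num.floor (v j 0 * N.+1%:R))%:~R) / N.+1%:R.
    by field; rewrite gt_eqF.
  have f1 := real_floor_le (num_real (v j 0 * N.+1%:R)).
  have := real_floorD1_gt (num_real (v j 0 * N.+1%:R)); rewrite intrD => f2.
  rewrite ger0_norm; last by rewrite divr_ge0 ?subr_ge0 // ltW.
  rewrite ler_pdivrMr //; apply: (@le_trans _ _ 1); first by lra.
  rewrite mulrC -ler_pdivrMr // mul1r; apply: (@le_trans _ _ N%:R); last by rewrite ler_nat.
  near: N; exact: nbhs_infty_ger.
have cdot (l : nat) (x y : nat -> 'cV[R]_l) (x0 y0 : 'cV[R]_l) : (forall j, x N j 0 @[N --> \oo] --> x0 j 0) ->
    (forall j, y N j 0 @[N --> \oo] --> y0 j 0) -> dot (x N) (y N) @[N --> \oo] --> dot x0 y0.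
  by move=> hx hy; apply: cvg_sumr => j; apply: cvgM.
have cX i : (X *m w N) i 0 @[N --> \oo] --> (X *m v) i 0.
  under eq_fun do rewrite mxE; rewrite mxE; apply: cvg_sumr => j.
  by apply: cvgM => //; exact: cvg_cst.
have cc : a * dot (w N) (w N) + b * dot (X *m w N) (X *m w N) @[N --> \oo] -->
    a * dot v v + b * dot (X *m v) (X *m v).
  by apply: cvgD; (apply: cvgM; [exact: cvg_cst|exact: cdot]).
rewrite -(cvg_lim _ cc) //; apply: limr_ge; first by apply/cvg_ex; eexists; exact: cc.
apply: nearW => N; have := h [ffun j => (Num.floor (v j 0 * N.+1%:R), N)].
rewrite /=; set u := \col_j _; have -> // : u = w N.
by apply/colP => j; rewrite !mxE ffunE.
Unshelve. all: by end_near.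
Qed.

End SparseEigenvalues.

Section MeasurableRE.
Context {d} {T : measurableType d} {R : realType} {n p : nat}.

Lemma measurable_quad (X : T -> 'M[R]_(n, p)) (a b : R) Q : mmx X -> measurable [set w | forall (M : {set 'I_p}) v, (#|M| <= Q)%N -> @suppin R p v M ->
  0 <= a * dot v v + b * dot (X w *m v) (X w *m v)].
Proof.
move=> mX.
pose V (M : {set 'I_p}) (q : {ffun 'I_p -> int * nat}) : 'cV[R]_p :=
  \col_j (if j \in M then (q j).1%:~R / (q j).2.+1%:R else 0).
have -> : [set w | forall (M : {set 'I_p}) v, (#|M| <= Q)%N -> @suppin R p v M ->
    0 <= a * dot v v + b * dot (X w *m v) (X w *m v)] =
  [set w | forall Mq : {set 'I_p} * {ffun 'I_p -> int * nat},
     [set w | (#|Mq.1| <= Q)%N -> 0 <= a * dot (V Mq.1 Mq.2) (V Mq.1 Mq.2) +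
         b * dot (X w *m V Mq.1 Mq.2) (X w *m V Mq.1 Mq.2)] w].
  apply/seteqP; split => w /=.
    move=> h [M q] /= MQ; apply: (h M) => //= j jM; by rewrite mxE (negbTE jM).
  by move=> h M v MQ; apply: quad_rat_dense => q; exact: (h (M, q)).
apply: measurable_forall => -[M q] /=; case: (leqP #|M| Q) => MQ; last first.
  by rewrite [X in measurable X](_ : _ = setT) //; apply/seteqP; split => w //=.
rewrite [X in measurable X](_ : _ = [set w | 0 <= a * dot (V M q) (V M q) + b * dot (X w *m V M q) (X w *m V M q)]); last first.
  by apply/seteqP; split => w /=; [apply|].
apply: measurable_le => //; apply: measurable_funD => //; apply: measurable_funM => //.
by apply: measurable_dot; (apply: mmx_mul; [exact: mX|exact: mmx_cst]).
Qed.

Lemma measurable_RE (X : T -> 'M[R]_(n, p)) Q kap : mmx X -> measurable [set w | RE (X w) Q kap].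
Proof.
move=> mX; rewrite [X in measurable X](_ : _ = [set w | forall (M : {set 'I_p}) v, (#|M| <= Q)%N -> @suppin R p v M ->
   0 <= - (kap * n%:R) * dot v v + 1 * dot (X w *m v) (X w *m v)]); first exact: measurable_quad.
apply/seteqP; split => w /= h M v MQ vM; have := h M v MQ vM.
  by rewrite -subr_ge0 mulNr mul1r addrC.
by rewrite mulNr mul1r addrC subr_ge0.
Qed.

Lemma measurable_UP (X : T -> 'M[R]_(n, p)) Q C : mmx X -> measurable [set w | UP (X w) Q C].
Proof.
move=> mX; rewrite [X in measurable X](_ : _ = [set w | forall (M : {set 'I_p}) v, (#|M| <= Q)%N -> @suppin R p v M ->
   0 <= (C * n%:R) * dot v v + (-1) * dot (X w *m v) (X w *m v)]); first exact: measurable_quad.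
apply/seteqP; split => w /= h M v MQ vM; have := h M v MQ vM.
  by rewrite -subr_ge0 mulN1r.
by rewrite mulN1r subr_ge0.
Qed.

End MeasurableRE.

(** * From almost sure limits to probabilities *)

Section EventuallyProbable.
Context {d} {T : measurableType d} {R : realType} (P : probability T R).

(** The sets where all [F m] with [m >= n] hold increase to a set of probability one, and the
    measure is continuous along increasing unions. *)
Lemma ae_near_prob (F : nat -> set T) : (forall n, measurable (F n)) ->
  {ae P, forall w, \forall n \near \oo, F n w} -> P (F n) @[n --> \oo] --> 1%E.
Proof.
move=> mF [N [mN N0 hN]].
pose G n := \bigcap_(m in [set m | (n <= m)%N]) F m.
have mG n : measurable (G n) by apply: bigcap_measurableType.
have cG : (P \o G) n @[n --> \oo] --> P (\bigcup_n G n).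
  apply: nondecreasing_cvg_mu => //; first exact: bigcup_measurable.
  move=> a b ab; apply/subsetPset => w h m /= bm; apply: h => /=; exact: leq_trans bm.
have P1 : P (\bigcup_n G n) = 1%E.
  apply/eqP; rewrite eq_le probability_le1 /=; last exact: bigcup_measurable.
  have <- : P (~` N) = 1%E by rewrite probability_setC // [X in (1 - X)%E]N0 sube0.
  apply: measure_subset_le; [exact: measurableC|exact: bigcup_measurable|].
  move=> w nN; have [M _ hM] : \forall n \near \oo, F n w.
    by apply: contrapT => h; apply: nN; exact: hN.
  by exists M => // m /= Mm; exact: hM.
rewrite P1 in cG; apply: (squeeze_cvge _ cG (cvg_cst _)).
apply: nearW => n /=; rewrite probability_le1 // andbT.
by apply: measure_subset_le => // w; apply => /=.
Qed.

Lemma limn_einf_near (u : nat -> R) (a b : R) : b < a -> (a%:E <= limn_einf (fun n => (u n)%:E))%E ->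
  \forall n \near \oo, b <= u n.
Proof.
move=> ba h.
have : (b%:E < ereal_sup (range (einfs (fun n => (u n)%:E))))%E.
  apply: (@lt_le_trans _ _ a%:E); first by rewrite lte_fin.
  apply: le_trans h _; rewrite limn_einf_lim.
  by have /cvg_lim -> := @cvg_einfs_sup R (fun n => (u n)%:E).
move=> /ereal_sup_gt [_ [N _ <-] bN].
exists N => // n /= Nn; rewrite -lee_fin; apply/ltW; apply: (lt_le_trans bN).
by apply: ereal_inf_lbound => /=; exists n.
Qed.

Lemma limn_esup_near (u : nat -> R) (a b : R) : a < b -> (limn_esup (fun n => (u n)%:E) <= a%:E)%E ->
  \forall n \near \oo, u n <= b.
Proof.
move=> ab h; have : (\forall n \near \oo, - b <= - u n).
  apply: (@limn_einf_near (fun n => - u n) (- a)); first by rewrite ltrN2.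
  have -> : (fun n => (- u n)%:E) = (-%E \o (fun n => (u n)%:E)) by [].
  by rewrite limn_einfN EFinN leeN2.
by apply: filterS => n; rewrite lerN2.
Qed.

End EventuallyProbable.

(** * Exchange of the first two groups, and freezing of the noise *)

Section FiniteUnions.
Context {d} {T : measurableType d} {R : realType} (P : {measure set T -> \bar R}).

Lemma union_bound (I : finType) (B : I -> set T) (A : set T) : measurable A ->
  (forall i, measurable (B i)) -> (forall w, A w -> exists i, B i w) ->
  (P A <= \sum_i P (B i))%E.
Proof.
move=> mA mB AB; apply: (@le_trans _ _ (P (\big[setU/set0]_(i : I) B i))).
  apply: measure_subset_le => //; first by apply: bigsetU_measurable.
  by move=> w /AB [i Bi]; rewrite (bigD1 i) //=; left.
elim: (index_enum I) => [|i r IH]; first by rewrite !big_nil measure0.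
rewrite !big_cons; apply: (@le_trans _ _ (P (B i) + P (\big[setU/set0]_(j <- r) B j))%E).
  by apply: measureU2 => //; apply: bigsetU_measurable.
by apply: leeD.
Qed.

Lemma measure_values (I : finType) (F : T -> I) (r : seq I) : dmeas F -> uniq r ->
  P [set w | F w \in r] = (\sum_(x <- r) P (F @^-1` [set x]))%E.
Proof.
move=> mF; elim: r => [_|x r IH /= /andP[xr ur]].
  by rewrite big_nil -[RHS](@measure0 _ _ _ P); congr (P _); apply/seteqP; split.
rewrite big_cons -IH // -measureU.
- congr (P _); apply/seteqP; split => w /=; rewrite inE; first by move=> /orP[/eqP|]; [left|right].
  by move=> [->|->]; rewrite ?eqxx ?orbT.
- exact: mF.
- exact: (dmeas_pre [set x | x \in r]).
- by apply/seteqP; split => w //= -[-> h]; rewrite h in xr.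
Qed.

End FiniteUnions.

Definition upd {R : realType} {n : nat} (e : 'I_3 -> 'cV[R]_n) (g : 'I_3) (v : 'cV[R]_n) : 'I_3 -> 'cV[R]_n :=
  fun g' => if g' == g then v else e g'.

(** The quantification over all probability spaces allows part of the designs and
    of the noise to be frozen, or the rows of two groups to be exchanged. *)
Definition mevent {R : realType} {n p : nat} (E : ('I_3 -> 'M[R]_(n, p)) -> ('I_3 -> 'cV[R]_n) -> Prop) : Prop :=
  forall d (T : measurableType d) (X : T -> 'I_3 -> 'M[R]_(n, p)) (e : T -> 'I_3 -> 'cV[R]_n),
    (forall g, mmx (fun w => X w g)) -> (forall g, mmx (fun w => e w g)) ->
    measurable [set w | E (X w) (e w)].

Definition gauss_family {d} {T : measurableType d} {R : realType} (P : probability T R) (N : nat)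
    (eps : 'I_N -> T -> R) (sigma : R) : Prop :=
  [/\ forall i, measurable_fun setT (eps i), mutually_indep P eps &
      forall i A, measurable A -> P (eps i @^-1` A) = normal_prob 0 sigma A].

Definition swap_groups (g : 'I_3) : 'I_3 := if g == gI then gII else if g == gII then gI else g.

Lemma swap_groupsK : involutive swap_groups.
Proof.
have h : (gII == gI) = false by apply/eqP => /(congr1 val); rewrite /= !inordK.
move=> g; rewrite /swap_groups; case: (eqVneq g gI) => [->|g1]; first by rewrite h eqxx.
by case: (eqVneq g gII) => [->|g2]; rewrite ?eqxx // (negbTE g1) (negbTE g2).
Qed.

Definition swapX {R : realType} {n p : nat} (b : {ffun 'I_n -> bool}) (X : 'I_3 -> 'M[R]_(n, p)) :
    'I_3 -> 'M[R]_(n, p) :=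
  fun g => \matrix_(r, j) X (if b r then swap_groups g else g) r j.

Section Groups.
Context {R : realType} {n p : nat}.
Local Notation N := (3 * n)%N.
Local Notation split := {ffun 'I_3 * 'I_n -> 'I_N}.

Definition obsX (f : split) (t : N.-tuple (p.-tuple R)) (g : 'I_3) : 'M[R]_(n, p) :=
  \matrix_(r, j) tnth (tnth t (f (g, r))) j.

Definition obsE (f : split) (e : N.-tuple R) (g : 'I_3) : 'cV[R]_n := \col_r tnth e (f (g, r)).

Lemma mmx_obsX d (T : measurableType d) f (t : T -> N.-tuple (p.-tuple R)) g : measurable_fun setT t ->
  mmx (fun w => obsX f (t w) g).
Proof.
move=> mt i j; under eq_fun do rewrite mxE.
apply: (measurableT_comp (measurable_tnth j)).
exact: (measurableT_comp (measurable_tnth (f (g, i))) mt).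
Qed.

Lemma mmx_obsE d (T : measurableType d) f (e : T -> N.-tuple R) g : measurable_fun setT e ->
  mmx (fun w => obsE f (e w) g).
Proof.
move=> mt i j; under eq_fun do rewrite mxE.
exact: (measurableT_comp (measurable_tnth (f (g, i))) mt).
Qed.

Lemma split_bij (f : split) : injective f -> bijective f.
Proof.
by move=> injf; apply: inj_card_bij => //; rewrite card_prod !card_ord.
Qed.

Context {d} {T : measurableType d} (P : probability T R).

Lemma gauss_family_inj M (eps : 'I_M -> T -> R) sigma m (h : 'I_m -> 'I_M) : injective h ->
  gauss_family P eps sigma -> gauss_family P (fun r => eps (h r)) sigma.
Proof.
move=> injh [meps ieps leps]; split => [i|A mA|i A mA]; [exact: meps| |exact: leps].
pose A' i := if [pick r | h r == i] is Some r then A r else setT.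
have A'h r : A' (h r) = A r.
  rewrite /A'; case: pickP => [r' /eqP /injh ->//|/(_ r)]; by rewrite eqxx.
have mA' i : measurable (A' i) by rewrite /A'; case: pickP.
have := ieps A' mA'.
have -> : \bigcap_(i in setT) (eps i @^-1` A' i) = \bigcap_(r in setT) (eps (h r) @^-1` A r).
  apply/seteqP; split => w /= H i _ /=; first by have := H (h i) Logic.I; rewrite /= A'h.
  by rewrite /A'; case: pickP => // r /eqP <-; exact: H.
move=> ->; rewrite (bigID (fun i => i \in codom h)) /= [X in (_ * X)%E]big1 ?mule1; last first.
  move=> i ni; rewrite /A'; case: pickP => [r /eqP hr|_].
    by rewrite -hr codom_f in ni.
  by rewrite preimage_setT probability_setT.
rewrite -big_uniq /=; last by rewrite map_inj_uniq ?enum_uniq.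
by rewrite /codom big_image /=; apply: eq_bigr => r _; rewrite A'h.
Qed.

Lemma decoupled_le (f : split) (g : 'I_3) (U : T -> N.-tuple (p.-tuple R)) (eps : 'I_N -> T -> R) sigma
    E (c : R) : injective f -> mevent E -> 0 <= c -> measurable_fun setT U -> gauss_family P eps sigma ->
  indep2 P (tupleV eps) U ->
  (forall X e0 (v : 'I_n -> T -> R), gauss_family P v sigma ->
     (P [set w | E X (upd e0 g (\col_r v r w))] <= c%:E)%E) ->
  (P [set w | E (obsX f (U w)) (obsE f (tupleV eps w))] <= c%:E)%E.
Proof.
move=> injf mE c0 mU gf ind h; have [meps ieps leps] := gf.
have mV := measurable_tupleV meps.
have ind' : indep2 P U (tupleV eps).
  by move=> A B mA mB; rewrite setIC ind // muleC.
pose S := [set xe : N.-tuple (p.-tuple R) * N.-tuple R | E (obsX f xe.1) (obsE f xe.2)].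
apply: (indep2_prob_le mU mV ind' (S := S)); last by rewrite lee_fin.
  by apply: mE => g'; [apply: mmx_obsX; exact: measurable_fst|apply: mmx_obsE; exact: measurable_snd].
move=> w; pose X := [set e : N.-tuple R | E (obsX f (U w)) (obsE f e)].
have mX : measurable X.
  apply: (mE _ _ (fun=> obsX f (U w)) (fun e => obsE f e)) => g'; first exact: mmx_cst.
  apply: mmx_obsE; exact: measurable_id.
pose J i := ~~ [exists r, f (g, r) == i].
apply: (mix_prob_le meps ieps (J := J) mX) => [t|]; last by rewrite lee_fin.
have gv : gauss_family P (fun r => eps (f (g, r))) sigma.
  by apply: (gauss_family_inj (h := fun r => f (g, r))) gf => r r' /injf [].
apply: le_trans (h (obsX f (U w)) (obsE f t) _ gv); rewrite le_eqVlt; apply/orP; left; apply/eqP.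
congr (P _); apply/seteqP; split => w' /=; rewrite /X /=;
  (suff -> : obsE f (mix J t (tupleV eps w')) = upd (obsE f t) g (\col_r eps (f (g, r)) w') by []);
  apply/funext => g'; apply/colP => r; rewrite /upd !mxE tnth_mix /J;
  (case: (eqVneq g' g) => [->|gg']; rewrite ?mxE;
   [by case: existsP => [_|[]] /=; [rewrite tnth_tupleV|exists r]
   |by case: existsP => //= -[r' /eqP /injf [e1 _]]; rewrite e1 eqxx in gg']).
Qed.

(** Symmetrization. The covariate rows are exchangeable, so the event has the same probability after
    every swap [b]. Averaging over the [2^n] swaps bounds it by the largest fraction of swaps that
    are bad for a fixed design. *)
Lemma swap_le (f : split) (V : 'I_N -> T -> p.-tuple R) (E : ('I_3 -> 'M[R]_(n, p)) -> Prop) (c : R) :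
  injective f -> mevent (fun X _ => E X) -> (forall i, measurable_fun setT (V i)) -> iid P V ->
  (forall X, (#|[set b : {ffun 'I_n -> bool} | `[< E (swapX b X) >]]%SET|)%:R <= c * (2 ^ n)%:R) ->
  (P [set w | E (obsX f (tupleV V w))] <= c%:E)%E.
Proof.
move=> injf mE mV [indV idV] h.
have [f' f'K fK] := split_bij injf.
pose tau b (gr : 'I_3 * 'I_n) := (if b gr.2 then swap_groups gr.1 else gr.1, gr.2).
have tauK (b : {ffun 'I_n -> bool}) : involutive (tau b).
  move=> [g r]; rewrite /tau /=; case: (b r) => //=; by rewrite swap_groupsK.
(* The swap of positions, transported to observation indices by the bijective split [f]. *)
pose s b i := f (tau b (f' i)).
have sinj (b : {ffun 'I_n -> bool}) : injective (s b).
  by move=> i j /injf /(can_inj (tauK b)) /(can_inj fK).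
have mt := measurable_tupleV mV.
have msw b : measurable [set w | E (swapX b (obsX f (tupleV V w)))].
  apply: (mE _ _ (fun w => swapX b (obsX f (tupleV V w))) (fun _ _ => 0)); last by move=> g; exact: mmx_cst.
  move=> g i j; under eq_fun do rewrite mxE; exact: mmx_obsX.
have mX : measurable [set t : N.-tuple (p.-tuple R) | E (obsX f t)].
  apply: (mE _ _ (fun t => obsX f t) (fun _ _ => 0)) => g; last exact: mmx_cst.
  apply: mmx_obsX; exact: measurable_id.
have eqb b : P [set w | E (obsX f (tupleV V w))] = P [set w | E (swapX b (obsX f (tupleV V w)))].
  have := perm_law mV indV (s := s b) (sinj b) idV mX; rewrite -[P (_ @^-1` _)]/(P [set w | E (obsX f (tupleV V w))]) => ->.
  congr (P _); apply/seteqP; split => w /=;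
  (suff -> : obsX f [tuple V (s b i) w | i < N] = swapX b (obsX f (tupleV V w)) by []);
  apply/funext => g; apply/matrixP => r j; rewrite !mxE !tnth_mktuple /s f'K /tau /=; by case: (b r).
set p0 := P _.
have mE0 : measurable [set w | E (obsX f (tupleV V w))].
  apply: (mE _ _ (fun w => obsX f (tupleV V w)) (fun _ _ => 0)) => g; last exact: mmx_cst.
  exact: mmx_obsX.
have p0f : p0 \is a fin_num by exact: fin_num_measure.
have H : (\sum_(b : {ffun 'I_n -> bool}) p0 <= (c * (2 ^ n)%:R)%:E)%E.
  rewrite (eq_bigr (fun b => \int[P]_w (\1_[set w | E (swapX b (obsX f (tupleV V w)))] w)%:E)%E); last first.
    by move=> b _; rewrite /p0 (eqb b) integral_indic // setIT.
  rewrite -ge0_integral_sum //; last by move=> b; apply/measurable_EFinP/measurable_indic.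
  apply: (@le_trans _ _ (\int[P]_w (cst (c * (2 ^ n)%:R)%:E w))%E); last first.
    rewrite integral_cst //= probability_setT mule1 //.
  apply: ge0_le_integral => //.
  - by move=> w _; apply: sume_ge0.
  - by apply: emeasurable_sum => b; apply/measurable_EFinP/measurable_indic.
  - move=> w _; rewrite sumEFin lee_fin; apply: le_trans (h (obsX f (tupleV V w))).
    rewrite -sum1_card natr_sum [leRHS]big_mkcond /=; apply: ler_sum => b _.
    rewrite indicE !inE; by case: ifP => hb; [case: (_ \in _)|case: (boolP (_ \in _)) => //=; rewrite inE /= => /asboolP; rewrite hb].
move: H; rewrite (eq_bigr (fun=> (fine p0)%:E)); last by move=> b _; rewrite fineK.
rewrite sumEFin lee_fin sumr_const card_ffun card_bool card_ord.
by rewrite -[_ *+ _]mulr_natr ler_pM2r ?ltr0n ?expn_gt0 // -lee_fin fineK.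
Qed.

End Groups.

Section Splitting.
Context {d} {T : measurableType d} {R : realType} (P : probability T R) (p : nat -> nat) (S : sample P p).
Context (beta : forall n, 'cV[R]_(p n)) (sigma : R).
Hypotheses (hiid : iid_observations S) (hsplit : random_split S) (hA1 : assumption_A1 S beta sigma).
Variable n : nat.
Local Notation N := (3 * n)%N.
Local Notation split := {ffun 'I_3 * 'I_n -> 'I_N}.

Definition noise_at (g : 'I_3) (w : T) : 'cV[R]_n := \col_r noise S (split_map S n w (g, r)) w.

Lemma resp_linear g w : resp S n g w = design S n g w *m beta n + noise_at g w.
Proof.
apply/colP => r; rewrite !mxE; have [-> _ _ _] := hA1 n.
by congr (_ + _); apply: eq_bigr => j _; rewrite mxE.
Qed.

Lemma measurable_all_covariates : measurable_fun setT (all_covariates S n).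
Proof.
apply/measurable_fun_tnthP => i; apply: eq_measurable_fun (measurable_funPT (covariates S i)) => w _ /=.
by rewrite tnth_mktuple.
Qed.

Lemma measurable_all_noise : measurable_fun setT (all_noise S n).
Proof.
apply/measurable_fun_tnthP => i; apply: eq_measurable_fun (measurable_funPT (noise S i)) => w _ /=.
by rewrite tnth_mktuple.
Qed.

Lemma noise_gauss : gauss_family P (fun i : 'I_N => noise S i : T -> R) sigma.
Proof.
have [_ hl [hi _] _] := hA1 n; split => // i A mA; exact: hl.
Qed.

Lemma split_prob_sum : (\sum_(f : split) P (split_map S n @^-1` [set f]) = 1)%E.
Proof.
have [mf _ _] := hsplit n.
rewrite -(measure_values _ mf (index_enum_uniq _)) -[RHS](probability_setT P).
by congr (P _); apply/seteqP; split => w //= _; rewrite mem_index_enum.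
Qed.

(** Summing over the values of the split, which is independent of the observations, reduces to a
    deterministic injective split. *)
Lemma split_le E (c : R) : mevent E -> 0 <= c ->
  (forall f : split, injective f ->
     (P [set w | E (obsX f (all_covariates S n w)) (obsE f (all_noise S n w))] <= c%:E)%E) ->
  (P [set w | E (fun g => design S n g w) (fun g => noise_at g w)] <= c%:E)%E.
Proof.
move=> mE c0 h; have [mf uf indf] := hsplit n.
pose A (f : split) := [set w | E (obsX f (all_covariates S n w)) (obsE f (all_noise S n w))].
have mA f : measurable (A f).
  by apply: mE => g; [apply: mmx_obsX; exact: measurable_all_covariates|
                      apply: mmx_obsE; exact: measurable_all_noise].
pose F f := split_map S n @^-1` [set f].
have AF w (f : split) : split_map S n w = f -> (E (fun g => design S n g w) (fun g => noise_at g w) <-> A f w).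
  move=> <-; rewrite /A /=.
  suff [-> ->] : (fun g => design S n g w) = obsX (split_map S n w) (all_covariates S n w) /\
     (fun g => noise_at g w) = obsE (split_map S n w) (all_noise S n w) by [].
  by split; apply/funext => g; apply/matrixP => r j; rewrite !mxE tnth_mktuple.
have mEv : measurable [set w | E (fun g => design S n g w) (fun g => noise_at g w)].
  rewrite (_ : mkset _ = [set w | A (split_map S n w) w]); last first.
    by apply/seteqP; split => w /=; have [h1 h2] := AF w _ erefl.
  exact: (bind_set (A := A) mf mA).
apply: (@le_trans _ _ (\sum_(f : split) P (F f `&` A f))%E).
  apply: union_bound => // [f|w /= hE]; first by apply: measurableI => //; exact: mf.
  by exists (split_map S n w); split => //; apply/(AF w).
have PF f : (P (F f `&` A f) = P (F f) * P (A f))%E.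
  (* Independence of the split is assumed for the observations, so the noise is written as
     [Y - X beta]. *)
  pose Xf := [set t : N.-tuple ((p n).-tuple R * R) |
     E (fun g => \matrix_(r, j) tnth (tnth t (f (g, r))).1 j)
       (fun g => (\col_r (tnth t (f (g, r))).2) - (\matrix_(r, j) tnth (tnth t (f (g, r))).1 j) *m beta n)].
  have mXf : measurable Xf.
    have mx g : mmx (fun t : N.-tuple ((p n).-tuple R * R) => \matrix_(r < n, j < p n) tnth (tnth t (f (g, r))).1 j).
      move=> i j; under eq_fun do rewrite mxE.
      apply: (measurableT_comp (measurable_tnth j)); apply: (measurableT_comp measurable_fst).
      exact: measurable_tnth.
    apply: mE => g //; apply: mmx_sub; last by apply: mmx_mul => //; exact: mmx_cst.
    move=> i j; under eq_fun do rewrite mxE.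
    apply: (measurableT_comp measurable_snd); exact: measurable_tnth.
  have -> : A f = all_observations S n @^-1` Xf; last exact: indf.
  apply/seteqP; split => w; rewrite /A /Xf /=;
  (suff [-> ->] : obsX f (all_covariates S n w) = (fun g => \matrix_(r, j) tnth (tnth (all_observations S n w) (f (g, r))).1 j) /\
    obsE f (all_noise S n w) = (fun g => (\col_r (tnth (all_observations S n w) (f (g, r))).2) -
      (\matrix_(r, j) tnth (tnth (all_observations S n w) (f (g, r))).1 j) *m beta n) by []);
  (split; apply/funext => g; apply/matrixP => r j; rewrite !mxE ?tnth_mktuple //=;
   have [-> _ _ _] := hA1 n; rewrite (ord1 j);
   rewrite [X in _ = _ - X](_ : _ = \sum_(j0 < p n) tnth (covariates S (f (g, r)) w) j0 * beta n j0 0);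
   [by rewrite addrAC subrr add0r|by apply: eq_bigr => k _; rewrite mxE tnth_mktuple]).
under eq_bigr do rewrite PF.
have cardinj : (\sum_(f : split | injectiveb f) P (F f) = 1)%E.
  rewrite (eq_bigr (fun=> ((N`!)%:R^-1)%:E)); last by move=> f /injectiveP /uf.
  rewrite sumEFin sumr_const -[X in _ *+ X]/(#|[pred f : split | injectiveb f]|).
  have -> : #|[pred f : split | injectiveb f]| = (N ^_ N)%N.
    by have := card_inj_ffuns ('I_3 * 'I_n)%type 'I_N; rewrite card_prod !card_ord => <-; apply: eq_card => f; rewrite !inE.
  by rewrite ffactnn -[_ *+ _]mulr_natr mulVf // pnatr_eq0 -lt0n fact_gt0.
(* The [N!] injective splits already exhaust the total probability. *)
have noninj : (\sum_(f : split | ~~ injectiveb f) P (F f) = 0)%E.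
  have := split_prob_sum; rewrite (bigID (fun f : split => injectiveb f)) /= cardinj.
  by case: (\sum_(f | _) _)%E => [x [e1]| |] //; congr EFin; move: e1; lra.
rewrite (bigID (fun f : split => injectiveb f)) /=.
rewrite [X in (_ + X)%E]big1 ?adde0; last first.
  move=> f nf; have -> : P (F f) = 0%E; last by rewrite mul0e.
  apply/eqP; rewrite eq_le measure_ge0 andbT -noninj (bigD1 f) //= leeDl //.
  by apply: sume_ge0.
apply: (@le_trans _ _ (\sum_(f : split | injectiveb f) P (F f) * c%:E)%E).
  by apply: lee_sum => f /injectiveP /h hf; apply: lee_wpmul2l.
by rewrite -ge0_sume_distrl // cardinj mul1e.
Qed.

(** Three layers of freezing in one statement: the split, the designs, and the noise of the other
    two groups. *)
Lemma noise_event_le E (g : 'I_3) (c : R) : mevent E -> 0 <= c ->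
  (forall X e0 (v : 'I_n -> T -> R), gauss_family P v sigma ->
     (P [set w | E X (upd e0 g (\col_r v r w))] <= c%:E)%E) ->
  (P [set w | E (fun g => design S n g w) (fun g => noise_at g w)] <= c%:E)%E.
Proof.
move=> mE c0 h; apply: split_le => // f injf.
apply: (decoupled_le injf mE c0 measurable_all_covariates noise_gauss _ h).
by have [_ _ _] := hA1 n.
Qed.

Lemma swap_event_le (E : ('I_3 -> 'M[R]_(n, p n)) -> Prop) (c : R) : mevent (fun X _ => E X) -> 0 <= c ->
  (forall X, (#|[set b : {ffun 'I_n -> bool} | `[< E (swapX b X) >]]%SET|)%:R <= c * (2 ^ n)%:R) ->
  (P [set w | E (fun g => design S n g w)] <= c%:E)%E.
Proof.
move=> mE c0 h; apply: (split_le (E := fun X _ => E X)) => // f injf.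
apply: (swap_le (V := fun i : 'I_N => covariates S i : T -> (p n).-tuple R) injf mE _ _ h).
  by move=> i; exact: measurable_funPT.
exact: (iid_comp measurable_fst (hiid n)).
Qed.

End Splitting.

(** * Rademacher sums and row exchanges *)

Section Rademacher.
Context {R : realType}.

(** For [x^2 <= 1/2] use [expR x <= 1 / (1 - x)] with both signs; beyond, [|x| <= 2 x^2]. The
    constant [2] in place of the optimal [1/2] only affects the [8] in [rademacher_count]. *)
Lemma cosh_le (x : R) : expR x + expR (- x) <= 2 * expR (2 * x ^+ 2).
Proof.
have [h|h] := lerP (x ^+ 2) 2^-1.
  have x1 : `|x| < 1.
    rewrite -(@ltr_pXn2r _ 2) ?nnegrE // expr1n -normrX ger0_norm ?sqr_ge0 //; lra.
  have [xa xb] : -1 < x /\ x < 1 by move: x1; rewrite ltr_norml => /andP.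
  have e1 : expR x <= (1 - x)^-1.
    by rewrite -[x]opprK expRN lef_pV2 ?posrE ?expR_gt0 ?opprK ?subr_gt0 // expR_ge1Dx.
  have e2 : expR (- x) <= (1 + x)^-1.
    by rewrite expRN lef_pV2 ?posrE ?expR_gt0 ?expR_ge1Dx //; lra.
  have d0 : 0 < 1 - x ^+ 2 by lra.
  have e3 : (1 - x)^-1 + (1 + x)^-1 = 2 / (1 - x ^+ 2).
    by field; rewrite !gt_eqF //; lra.
  have e4 : 2 / (1 - x ^+ 2) <= 2 * (1 + 2 * x ^+ 2).
    rewrite ler_pdivrMr //.
    have := sqr_ge0 x; move: (x ^+ 2) h d0 => y *; nra.
  have e5 := expR_ge1Dx (2 * x ^+ 2).
  lra.
have h1 : `|x| <= 2 * x ^+ 2.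
  rewrite -[X in 2 * X]real_normK ?num_real //; move: h; rewrite -[X in _ < X]real_normK ?num_real //.
  have := normr_ge0 x; move: `|x| => y *; nra.
have := ler_norm x; have := ler_norm (- x); rewrite normrN => h2 h3.
have e1 : expR x <= expR (2 * x ^+ 2) by rewrite ler_expR (le_trans h3).
have e2 : expR (- x) <= expR (2 * x ^+ 2) by rewrite ler_expR (le_trans h2).
lra.
Qed.

Definition sgnb (b : bool) : R := if b then -1 else 1.

Lemma rademacher_mgf n (a : 'I_n -> R) :
  \sum_(b : {ffun 'I_n -> bool}) expR (\sum_r sgnb (b r) * a r) <=
  (2 ^ n)%:R * expR (2 * \sum_r a r ^+ 2).
Proof.
have -> : \sum_(b : {ffun 'I_n -> bool}) expR (\sum_r sgnb (b r) * a r) =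
    \prod_r (expR (a r) + expR (- a r)).
  transitivity (\prod_r \sum_(c : bool) expR (sgnb c * a r)).
    by rewrite bigA_distr_bigA /=; apply: eq_bigr => b _; rewrite expR_sum.
  by apply: eq_bigr => r _; rewrite big_bool /= /sgnb mul1r mulN1r addrC.
have -> : (2 ^ n)%:R * expR (2 * \sum_r a r ^+ 2) = \prod_(r < n) (2 * expR (2 * a r ^+ 2)).
  by rewrite mulr_sumr expR_sum big_split /= prodr_const card_ord natrX.
by apply: ler_prod => r _; rewrite cosh_le andbT addr_ge0 ?expR_ge0.
Qed.

Lemma rademacher_count n (a : 'I_n -> R) (L V : R) : 0 < V -> 0 <= L -> \sum_r a r ^+ 2 <= V ->
  #|[set b : {ffun 'I_n -> bool} | L * V < (\sum_r sgnb (b r) * a r) ^+ 2]%SET|%:R <=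
  (2 ^ n)%:R * (2 * expR (- L / 8)).
Proof.
move=> V0 L0 aV.
pose y := Num.sqrt (L * V); have y2 : y ^+ 2 = L * V by rewrite sqr_sqrtr // mulr_ge0 // ltW.
have y0 : 0 <= y by exact: sqrtr_ge0.
(* Minimizer of [2 l^2 V - l y], with minimum [- L / 8]. *)
pose l := y / (4 * V).
have ly : l * y = L / 4 by rewrite /l mulrAC -expr2 y2; field; rewrite gt_eqF.
have l2 : 2 * l ^+ 2 * V = L / 8.
  by rewrite /l expr_div_n y2; field; rewrite gt_eqF.
have one (c : 'I_n -> R) : (forall r, c r ^+ 2 = a r ^+ 2) ->
   #|[set b : {ffun 'I_n -> bool} | y < \sum_r sgnb (b r) * c r]%SET|%:R <= (2 ^ n)%:R * expR (- L / 8).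
  move=> ca; have := rademacher_mgf (fun r => l * c r).
  have -> : \sum_r (l * c r) ^+ 2 = l ^+ 2 * \sum_r a r ^+ 2.
    by rewrite mulr_sumr; apply: eq_bigr => r _; rewrite exprMn ca.
  move=> h1.
  have h2 : #|[set b : {ffun 'I_n -> bool} | y < \sum_r sgnb (b r) * c r]%SET|%:R * expR (L / 4) <=
     \sum_(b : {ffun 'I_n -> bool}) expR (\sum_r sgnb (b r) * (l * c r)).
    rewrite mulr_natl -sumr_const [leLHS]big_mkcond /=; apply: ler_sum => b _.
    rewrite inE; case: ifP => [hb|_]; last exact: expR_ge0.
    rewrite ler_expR -ly; have -> : \sum_r sgnb (b r) * (l * c r) = l * \sum_r sgnb (b r) * c r.
      by rewrite mulr_sumr; apply: eq_bigr => r _; rewrite mulrCA.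
    by apply: ler_wpM2l; [rewrite divr_ge0 // mulr_ge0 // ltW|exact: ltW].
  have h3 : expR (2 * (l ^+ 2 * \sum_r a r ^+ 2)) <= expR (L / 8).
    by rewrite ler_expR -l2 mulrA; apply: ler_wpM2l => //; rewrite mulr_ge0 // sqr_ge0.
  have h4 := le_trans h2 (le_trans h1 (ler_wpM2l (ler0n _ _) h3)).
  rewrite -(ler_pM2r (expR_gt0 (L / 4))); apply: (le_trans h4).
  by rewrite -mulrA -expRD; apply: ler_wpM2l => //; rewrite ler_expR; lra.
have sub : [set b : {ffun 'I_n -> bool} | L * V < (\sum_r sgnb (b r) * a r) ^+ 2]%SET \subset
   ([set b : {ffun 'I_n -> bool} | y < \sum_r sgnb (b r) * a r] :|:
    [set b : {ffun 'I_n -> bool} | y < \sum_r sgnb (b r) * - a r])%SET.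
  apply/fintype.subsetP => b; rewrite !inE -y2 => hb.
  have -> : \sum_r sgnb (b r) * - a r = - \sum_r sgnb (b r) * a r.
    by rewrite -sumrN; apply: eq_bigr => r _; rewrite mulrN.
  rewrite -ltr_normr -(@ltr_pXn2r _ 2) ?nnegrE // -normrX [X in _ < X]ger0_norm //; exact: sqr_ge0.
have := subset_leq_card sub; rewrite -(ler_nat R) => /le_trans; apply.
rewrite cardsU; apply: (@le_trans _ _ (#|[set b : {ffun 'I_n -> bool} | y < \sum_r sgnb (b r) * a r]%SET|%:R +
   #|[set b : {ffun 'I_n -> bool} | y < \sum_r sgnb (b r) * - a r]%SET|%:R)).
  by rewrite -natrD ler_nat leq_subr.
have h1 := one a (fun=> erefl).
have h2 := one (fun r => - a r) (fun r => sqrrN _).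
lra.
Qed.

End Rademacher.

Section RowPermutation.
Context {R : realType} {m p : nat} (s : 'I_m -> 'I_m).
Hypothesis sK : involutive s.
Local Notation sw A := (mxsub s id A).

Lemma dot_rowsub (u v : 'cV[R]_m) : dot (sw u) (sw v) = dot u v.
Proof.
rewrite /dot [RHS](reindex_inj (can_inj sK)); by apply: eq_bigr => i _; rewrite !mxE.
Qed.

Lemma trmx_mul_rowsub a b (A : 'M[R]_(m, a)) (B : 'M[R]_(m, b)) : (sw A)^T *m sw B = A^T *m B.
Proof.
apply/matrixP => i j; rewrite !mxE [RHS](reindex_inj (can_inj sK)).
by apply: eq_bigr => k _; rewrite !mxE.
Qed.

(** Gram matrix and cross products are sums over rows, so permuting the rows leaves the coefficients
    unchanged and permutes the residual. *)
Lemma residual_rowsub (X : 'M[R]_(m, p)) (Y : 'cV[R]_m) M :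
  residual (sw X) (sw Y) M = sw (residual X Y M).
Proof.
have cE : cols (sw X) M = sw (cols X M) by apply/matrixP => i j; rewrite !mxE.
have gE : gram (sw X) M = gram X M by rewrite /gram cE trmx_mul_rowsub.
have oE : ols (sw X) (sw Y) M = ols X Y M by rewrite /ols gE cE trmx_mul_rowsub.
rewrite /residual oE cE; apply/matrixP => i j; rewrite !mxE; congr (_ - _).
by apply: eq_bigr => k _; rewrite !mxE.
Qed.

End RowPermutation.

Section SwapCount.
Context {R : realType} {n p : nat}.
Implicit Types (X : 'I_3 -> 'M[R]_(n, p)) (b : {ffun 'I_n -> bool}).

Definition stack X : 'M[R]_(n + n, p) := col_mx (X gI) (X gII).

(** Exchanging rows of the two groups only changes signs in the products with
    [contrast], whereas it permutes the rows of [stack]. *)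
Definition contrast X j : 'cV[R]_(n + n) := col_mx (col j (X gI)) (- col j (X gII)).

Definition swap_row b (i : 'I_(n + n)) : 'I_(n + n) :=
  match fintype.split i with
  | inl r => if b r then rshift n r else lshift n r
  | inr r => if b r then lshift n r else rshift n r
  end.

Lemma swap_rowl b r : swap_row b (lshift n r) = if b r then rshift n r else lshift n r.
Proof. by rewrite /swap_row; case: splitP => r' /= e; [have -> : r' = r by apply/val_inj|have := ltn_ord r; rewrite e ltnNge leq_addr]. Qed.

Lemma swap_rowr b r : swap_row b (rshift n r) = if b r then lshift n r else rshift n r.
Proof.
rewrite /swap_row; case: splitP => r' /= e; first by have := ltn_ord r'; rewrite -e ltnNge leq_addr.
by have -> : r' = r by apply/val_inj/(@addnI n).
Qed.

Lemma swap_rowK b : involutive (swap_row b).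
Proof.
move=> i; rewrite -(splitK i); case: (fintype.split i) => r /=.
  by rewrite swap_rowl; case E: (b r); rewrite ?swap_rowr ?swap_rowl E.
by rewrite swap_rowr; case E: (b r); rewrite ?swap_rowr ?swap_rowl E.
Qed.

Lemma swap_gI : swap_groups gI = gII.
Proof. by rewrite /swap_groups eqxx. Qed.

Lemma swap_gII : swap_groups gII = gI.
Proof. by rewrite -swap_gI swap_groupsK. Qed.

Lemma stack_swap b X : stack (swapX b X) = mxsub (swap_row b) id (stack X).
Proof.
apply/matrixP => i j; rewrite -(splitK i); case: (fintype.split i) => r /=; rewrite /stack [RHS]mxE.
  by rewrite swap_rowl col_mxEu mxE swap_gI; case: (b r); rewrite ?col_mxEu ?col_mxEd.
by rewrite swap_rowr col_mxEd mxE swap_gII; case: (b r); rewrite ?col_mxEu ?col_mxEd.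
Qed.

Definition swap_res X M i := residual (stack X) (col i (stack X)) M.

Lemma swap_res_swap b X M i : swap_res (swapX b X) M i = mxsub (swap_row b) id (swap_res X M i).
Proof.
rewrite /swap_res stack_swap -(residual_rowsub (@swap_rowK b)); congr residual.
by apply/matrixP => k l; rewrite !mxE.
Qed.

Lemma dot_contrast_swap b X M i j :
  dot (swap_res (swapX b X) M i) (contrast (swapX b X) j) =
  \sum_r sgnb (b r) * (swap_res X M i (lshift n r) 0 * X gI r j - swap_res X M i (rshift n r) 0 * X gII r j).
Proof.
rewrite swap_res_swap /dot big_split_ord /= -big_split /=; apply: eq_bigr => r _.
rewrite /contrast col_mxEu col_mxEd !mxE swap_gI swap_gII swap_rowl swap_rowr /sgnb.
by case: (b r); ring.
Qed.

(** Its failure is the comparison of the two designs assumed as [hL2] in [core]. As a boolean over a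
    finite type it can be counted over swaps. *)
Definition swap_bad k (c : R) X : bool :=
  [exists z : {ffun 'I_k -> option 'I_p} * ('I_p * 'I_p),
     c * dot (swap_res X [set j | Some j \in codom z.1]%SET z.2.1)
             (swap_res X [set j | Some j \in codom z.1]%SET z.2.1) <
     dot (swap_res X [set j | Some j \in codom z.1]%SET z.2.1) (contrast X z.2.2) ^+ 2].

(** For a fixed set and pair of columns a swap only flips signs, so [rademacher_count] applies with
    variance at most [2 B^2] times the squared residual; a union bound over the codes follows. A
    vanishing residual rules out the strict inequality. *)
Lemma swap_event_count (B L : R) k X : 0 < B -> 0 <= L -> (forall g r j, `|X g r j| <= B) ->
  #|[set b : {ffun 'I_n -> bool} | swap_bad k (L * (2 * B ^+ 2)) (swapX b X)]%SET|%:R <=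
  (p.+1 ^ k * (p * p))%:R * (2 * expR (- L / 8)) * (2 ^ n)%:R.
Proof.
move=> B0 L0 hB.
pose res (z : {ffun 'I_k -> option 'I_p} * ('I_p * 'I_p)) := swap_res X [set j | Some j \in codom z.1]%SET z.2.1.
pose bad z := [set b : {ffun 'I_n -> bool} | (L * (2 * B ^+ 2)) * dot (res z) (res z) <
  (\sum_r sgnb (b r) * (res z (lshift n r) 0 * X gI r z.2.2 - res z (rshift n r) 0 * X gII r z.2.2)) ^+ 2]%SET.
have sub : [set b : {ffun 'I_n -> bool} | swap_bad k (L * (2 * B ^+ 2)) (swapX b X)]%SET \subset
    (\bigcup_z bad z)%SET.
  apply/fintype.subsetP => b; rewrite inE => /existsP [z hz]; apply/bigcupP; exists z => //; move: hz.
  by rewrite inE !dot_contrast_swap !swap_res_swap dot_rowsub //; exact: swap_rowK.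
have badle z : #|bad z|%:R <= (2 ^ n)%:R * (2 * expR (- L / 8)).
  have [r0|r0] := eqVneq (dot (res z) (res z)) 0.
    have -> : bad z = finset.set0; last first.
      by rewrite cards0 mulr_ge0 // mulr_ge0 // expR_ge0.
    apply/finset.setP => b; rewrite !inE r0 mulr0 big1 ?expr0n ?ltxx // => r _.
    by rewrite (dot_eq0 r0) !mxE !mul0r subr0 mulr0.
  have rp : 0 < dot (res z) (res z) by rewrite lt_def r0 dot_ge0.
  have := @rademacher_count R n (fun r => res z (lshift n r) 0 * X gI r z.2.2 - res z (rshift n r) 0 * X gII r z.2.2)
    L (2 * B ^+ 2 * dot (res z) (res z)) _ L0 _.
  rewrite mulrA; apply; first by rewrite !mulr_gt0 // exprn_gt0.
  rewrite {1}/dot big_split_ord /= -big_split mulr_sumr; apply: ler_sum => r _ /=.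
  have hx (g : 'I_3) : X g r z.2.2 ^+ 2 <= B ^+ 2.
    by rewrite -real_normK ?num_real // ler_pXn2r ?nnegrE // ltW.
  have := hx gI; have := hx gII.
  move: (X gI r _) (X gII r _) (res z (lshift n r) 0) (res z (rshift n r) 0) => x y u v h1 h2.
  have h3 : (u * x - v * y) ^+ 2 <= 2 * (u ^+ 2 * x ^+ 2) + 2 * (v ^+ 2 * y ^+ 2).
    rewrite -subr_ge0; have -> : 2 * (u ^+ 2 * x ^+ 2) + 2 * (v ^+ 2 * y ^+ 2) - (u * x - v * y) ^+ 2 = (u * x + v * y) ^+ 2 by ring.
    exact: sqr_ge0.
  have h4 := ler_wpM2l (sqr_ge0 u) h2; have h5 := ler_wpM2l (sqr_ge0 v) h1.
  rewrite -!expr2; lra.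
have := subset_leq_card sub; rewrite -(ler_nat R) => /le_trans; apply.
have : #|(\bigcup_z bad z)%SET|%:R <= \sum_z #|bad z|%:R :> R.
  rewrite -natr_sum ler_nat; elim/big_rec2: _ => [|z x y _ IH]; first by rewrite cards0.
  by apply: leq_trans (leq_card_setU _ _) _; rewrite leq_add2l.
move=> /le_trans; apply.
apply: le_trans (ler_sum _ (fun z _ => badle z)) _.
rewrite sumr_const -[leLHS]mulr_natl !card_prod card_ffun card_option !card_ord.
by move: (2 * expR _) => t; rewrite le_eqVlt; apply/orP; left; apply/eqP; rewrite [RHS]mulrAC -mulrA.
Qed.

End SwapCount.

(** * Chi-square bounds and many large noise correlations *)

Lemma subset_of_card (I : finType) (A : {set I}) m : (m <= #|A|)%N ->
  exists2 B : {set I}, B \subset A & #|B| = m.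
Proof.
move=> mA; have : (0 < #|[set B : {set I} | (B \subset A) && (#|B| == m)%N]%SET|)%N.
  by rewrite cards_draws bin_gt0.
by case/card_gt0P => B; rewrite inE => /andP[BA /eqP Bm]; exists B.
Qed.

Lemma size_index_ord n : size (index_enum 'I_n) = n.
Proof. by have := size_enum_ord n; rewrite enumT [index_enum _]unlock. Qed.

Lemma sum_expr2 (R : realType) n (v : 'cV[R]_n) : dot v v = \sum_i v i 0 ^+ 2.
Proof. by apply: eq_bigr => i _; rewrite expr2. Qed.

Section NoiseEvents.
Context {d} {T : measurableType d} {R : realType} (P : probability T R).
Context {n : nat} (v : 'I_n -> T -> R) (sigma : R).
Hypotheses (sigma0 : 0 < sigma) (gv : gauss_family P v sigma).
Local Notation e w := (\col_r v r w : 'cV[R]_n).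

Let mv r : measurable_fun setT (v r). Proof. by have [h _ _] := gv. Qed.

Lemma mmx_noise : mmx (fun w => e w).
Proof. by move=> i j; under eq_fun do rewrite mxE; exact: mv. Qed.

Lemma dot_noise a w : dot a (e w) = \sum_r a r 0 * v r w.
Proof. by apply: eq_bigr => r _; rewrite mxE. Qed.

Lemma family_tail (I : finType) (a : I -> 'cV[R]_n) (L : R) : 0 <= L ->
  (P [set w | exists i, (L * dot (a i) (a i) < dot (a i) (e w) ^+ 2)%R] <=
   (#|I|%:R * (2 * expR (- L / (2 * sigma ^+ 2))))%:E)%E.
Proof.
move=> L0; have [_ iv lv] := gv.
have m1 i : measurable [set w | L * dot (a i) (a i) < dot (a i) (e w) ^+ 2].
  apply: measurable_lt => //; apply: measurable_funX; apply: measurable_dot; [exact: mmx_cst|exact: mmx_noise].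
apply: (@le_trans _ _ (\sum_(i : I) P [set w | (L * dot (a i) (a i) < dot (a i) (e w) ^+ 2)%R])%E).
  by apply: union_bound => //; apply: (measurable_exists (I := I)).
rewrite mulr_natl -sumr_const -sumEFin; apply: lee_sum => i _.
apply: le_trans (gauss_sqr_tail sigma0 mv iv lv (fun r => a i r 0) (index_enum_uniq _) L0).
rewrite le_eqVlt; apply/orP; left; apply/eqP; congr (P _); apply/seteqP.
by split => w /=; rewrite dot_noise sum_expr2.
Qed.

(** Chernoff's bound with a tilt [c] of either sign: positive for the upper tail, negative for the
    lower one. *)
Let chi2_bound (c x y : R) : 2 * c * sigma ^+ 2 < 1 ->
  expR x * (Num.sqrt (1 - 2 * c * sigma ^+ 2))^-1 ^+ n <= y ->
  (P [set w | (- x <= c * dot (e w) (e w))%R] <= y%:E)%E.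
Proof.
move=> hc hy; have [_ iv lv] := gv.
pose f w := expR (c * \sum_r v r w ^+ 2).
have mf : measurable_fun setT f.
  apply: measurableT_comp => //; apply: measurable_funM => //; apply: measurable_sum => r.
  exact: measurable_funX.
have -> : [set w | (- x <= c * dot (e w) (e w))%R] = [set w | expR (- x) <= f w].
  apply/seteqP; split => w /=; rewrite ler_expR sum_expr2;
    (have -> : \sum_i (e w) i 0 ^+ 2 = \sum_r v r w ^+ 2 by apply: eq_bigr => i _; rewrite mxE); done.
apply: le_trans (markov_ge0 P mf (fun w => expR_ge0 _) (expR_gt0 (- x))) _.
rewrite (gauss_sqr_mgf sigma0 mv iv lv (index_enum_uniq _) hc) size_index_ord.
by rewrite expRN invrK lee_fin.
Qed.

Lemma chi2_upper : (P [set w | (4 * n%:R * sigma ^+ 2 <= dot (e w) (e w))%R] <= (expR (- n%:R / 2))%:E)%E.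
Proof.
have s2 : sigma ^+ 2 != 0 by rewrite gt_eqF // exprn_gt0.
have sp : 0 < sigma ^+ 2 by rewrite exprn_gt0.
(* The tilt [1 / (4 sigma^2)] makes the moment generating function [2^(n/2)], at most
   [expR (n / 2)], against [expR (- n)] from Markov's inequality. *)
have cs : 2 * (4 * sigma ^+ 2)^-1 * sigma ^+ 2 = 2^-1 by field; rewrite gt_eqF.
have -> : [set w | 4 * n%:R * sigma ^+ 2 <= dot (e w) (e w)] =
   [set w | - (- n%:R) <= (4 * sigma ^+ 2)^-1 * dot (e w) (e w)].
  apply/seteqP; split => w /=; rewrite opprK [_^-1 * _]mulrC ler_pdivlMr ?mulr_gt0 //;
    by rewrite -mulrA mulrCA.
apply: chi2_bound; rewrite cs; first lra.
have h1 : (Num.sqrt (1 - 2^-1 : R))^-1 <= expR (2^-1).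
  have h : 0 < Num.sqrt (1 - 2^-1 : R) by rewrite sqrtr_gt0; lra.
  rewrite -[leRHS]invrK -expRN lef_pV2 ?posrE ?expR_gt0 //.
  rewrite -(@ler_pXn2r _ 2) ?nnegrE ?expR_ge0 ?(ltW h) // sqr_sqrtr; last lra.
  rewrite -expRM_natl; have -> : 2%:R * - 2^-1 = - 1 :> R by lra.
  have : (expR 1)^-1 <= 2^-1 :> R.
    by rewrite lef_pV2 ?posrE ?expR_gt0 //; have := expR_ge1Dx (1 : R); lra.
  by rewrite expRN; lra.
apply: (@le_trans _ _ (expR (- n%:R) * expR (2^-1) ^+ n)).
  by apply: ler_wpM2l; rewrite ?expR_ge0 // lerXn2r // nnegrE ?invr_ge0 ?sqrtr_ge0 ?expR_ge0.
by rewrite -expRM_natl -expRD ler_expR; lra.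
Qed.

(** Tilt [- eta / (2 sigma^2)] and [ln (1 + eta) >= eta / (1 + eta)]. The latter weakens the rate
    from [eta^2] to [eta^3], which is enough at [eta = n^(-1/4)], where the exponent is of order
    [n^(1/4)]. *)
Lemma chi2_lower (eta : R) : 0 < eta <= 1 ->
  (P [set w | (dot (e w) (e w) <= n%:R * sigma ^+ 2 * (1 - eta))%R] <= (expR (- n%:R * eta ^+ 3 / 4))%:E)%E.
Proof.
move=> /andP[eta0 eta1].
have sp : 0 < sigma ^+ 2 by rewrite exprn_gt0.
have s2 : sigma ^+ 2 != 0 by rewrite gt_eqF.
have cs : 2 * (- eta / (2 * sigma ^+ 2)) * sigma ^+ 2 = - eta by field; rewrite gt_eqF.
have -> : [set w | dot (e w) (e w) <= n%:R * sigma ^+ 2 * (1 - eta)] =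
   [set w | - (eta * n%:R * (1 - eta) / 2) <= (- eta / (2 * sigma ^+ 2)) * dot (e w) (e w)].
  have -> : - eta / (2 * sigma ^+ 2) = - (eta / (2 * sigma ^+ 2)) by rewrite mulNr.
  have lp : 0 < eta / (2 * sigma ^+ 2) by rewrite divr_gt0 // mulr_gt0.
  have -> : eta * n%:R * (1 - eta) / 2 = eta / (2 * sigma ^+ 2) * (n%:R * sigma ^+ 2 * (1 - eta)).
    by field; rewrite gt_eqF.
  by apply/seteqP; split => w /=; rewrite mulNr lerN2 ler_pM2l.
apply: chi2_bound; rewrite cs; first lra.
pose y := eta / (1 + eta).
have d0 : 0 < 1 + eta by lra.
have ey : expR y <= 1 + eta.
  rewrite -[leLHS]invrK -expRN -[leRHS]invrK lef_pV2 ?posrE ?expR_gt0 ?invr_gt0 //.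
  apply: le_trans (expR_ge1Dx (- y)); rewrite le_eqVlt; apply/orP; left; apply/eqP.
  by rewrite /y; field; rewrite gt_eqF.
have h1 : (Num.sqrt (1 - - eta))^-1 <= expR (- (y / 2)).
  rewrite opprK expRN lef_pV2 ?posrE ?expR_gt0 ?sqrtr_gt0 //.
  rewrite -(@ler_pXn2r _ 2) ?nnegrE ?expR_ge0 ?sqrtr_ge0 // sqr_sqrtr ?(ltW d0) //.
  by rewrite -expRM_natl; have -> : 2%:R * (y / 2) = y by lra.
apply: (@le_trans _ _ (expR (eta * n%:R * (1 - eta) / 2) * expR (- (y / 2)) ^+ n)).
  by apply: ler_wpM2l; rewrite ?expR_ge0 // lerXn2r // nnegrE ?invr_ge0 ?sqrtr_ge0 ?expR_ge0.
rewrite -expRM_natl -expRD ler_expR -subr_ge0.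
have -> : - n%:R * eta ^+ 3 / 4 - (eta * n%:R * (1 - eta) / 2 + n%:R * - (y / 2)) =
   n%:R * eta ^+ 3 * (1 - eta) / (4 * (1 + eta)) by rewrite /y; field; rewrite gt_eqF.
by rewrite divr_ge0 ?mulr_ge0 ?exprn_ge0 ?subr_ge0 // ltW.
Qed.

Section LikelihoodRatios.
Context {p : nat} (X : 'M[R]_(n, p)) (t : R).

(** The density of [N(sigma^2 t x_j, sigma^2 I)] with respect to [N(0, sigma^2 I)],
    so that [lratio _ i] and [lratio _ j] have mean [1] and covariance
    [exp (sigma^2 t^2 <x_i, x_j>) - 1]. *)
Definition lratio (u : 'cV[R]_n) (j : 'I_p) : R :=
  expR (t * dot (col j X) u - sigma ^+ 2 * t ^+ 2 / 2 * dot (col j X) (col j X)).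

Lemma measurable_lratio j : measurable_fun setT (fun w => lratio (e w) j).
Proof.
apply: measurableT_comp => //; apply: measurable_funB => //; apply: measurable_funM => //.
by apply: measurable_dot; [exact: mmx_cst|exact: mmx_noise].
Qed.

Let exp_linear (u : 'cV[R]_n) : (\int[P]_w (expR (dot u (e w)))%:E = (expR (sigma ^+ 2 * dot u u / 2))%:E)%E.
Proof.
have [_ iv lv] := gv; under eq_integral do rewrite dot_noise.
by rewrite (gauss_mgf sigma0 mv iv lv _ (index_enum_uniq _)) sum_expr2.
Qed.

Lemma lratio_mean j : (\int[P]_w (lratio (e w) j)%:E = 1)%E.
Proof.
have h w : (lratio (e w) j)%:E = ((expR (- (sigma ^+ 2 * t ^+ 2 / 2 * dot (col j X) (col j X))))%:E *
    (expR (dot (t *: col j X) (e w)))%:E)%E.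
  by rewrite -EFinM -expRD dotZl addrC.
under eq_integral do rewrite h.
rewrite ge0_integralZlT ?expR_ge0 //; first last.
  by apply/measurable_EFinP; apply: measurableT_comp => //; apply: measurable_dot; [exact: mmx_cst|exact: mmx_noise].
rewrite exp_linear -EFinM -expRD dotZl dotZr -[1%E]/(1%:E) -expR0; congr (expR _)%:E; lra.
Qed.

Lemma lratio_cross i j : (\int[P]_w (lratio (e w) i * lratio (e w) j)%:E =
  (expR (sigma ^+ 2 * t ^+ 2 * dot (col i X) (col j X)))%:E)%E.
Proof.
pose c := - (sigma ^+ 2 * t ^+ 2 / 2 * dot (col i X) (col i X)) - sigma ^+ 2 * t ^+ 2 / 2 * dot (col j X) (col j X).
have h w : (lratio (e w) i * lratio (e w) j)%:E = ((expR c)%:E *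
    (expR (dot (t *: (col i X + col j X)) (e w)))%:E)%E.
  by rewrite -EFinM -!expRD dotZl dotDl /c; congr (expR _)%:E; ring.
under eq_integral do rewrite h.
rewrite ge0_integralZlT ?expR_ge0 //; first last.
  by apply/measurable_EFinP; apply: measurableT_comp => //; apply: measurable_dot; [exact: mmx_cst|exact: mmx_noise].
rewrite exp_linear -EFinM -expRD dotZl dotZr !dotDl !dotDr (dotC (col j X) (col i X)) /c.
by congr (expR _)%:E; field.
Qed.

Definition lsum (u : 'cV[R]_n) : R := \sum_j lratio u j.

Lemma measurable_lsum : measurable_fun setT (fun w => lsum (e w)).
Proof. by apply: measurable_sum => j; exact: measurable_lratio. Qed.

Lemma lsum_variance : (\int[P]_w ((lsum (e w) - p%:R) ^+ 2)%:E =
  (\sum_i \sum_j (expR (sigma ^+ 2 * t ^+ 2 * dot (col i X) (col j X)) - 1))%:E)%E.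
Proof.
have l0 w j : 0 <= lratio (e w) j by exact: expR_ge0.
have ml := measurable_lsum.
have W1 : (\int[P]_w (lsum (e w))%:E = p%:R%:E)%E.
  under eq_integral do rewrite -sumEFin.
  rewrite ge0_integral_sum //; first last.
  - by move=> j w _; rewrite lee_fin.
  - by move=> j; apply/measurable_EFinP; exact: measurable_lratio.
  under eq_bigr do rewrite lratio_mean.
  by rewrite sumEFin sumr_const card_ord.
have W2 : (\int[P]_w (lsum (e w) ^+ 2)%:E = (\sum_i \sum_j expR (sigma ^+ 2 * t ^+ 2 * dot (col i X) (col j X)))%:E)%E.
  have h w : ((lsum (e w) ^+ 2)%:E = \sum_i \sum_j (lratio (e w) i * lratio (e w) j)%:E)%E.
    rewrite expr2 mulr_suml -sumEFin; apply: eq_bigr => i _; by rewrite mulr_sumr -sumEFin.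
  have mm i j : measurable_fun setT (fun w => (lratio (e w) i * lratio (e w) j)%:E).
    by apply/measurable_EFinP; apply: measurable_funM; exact: measurable_lratio.
  under eq_integral do rewrite h.
  rewrite ge0_integral_sum //; first last.
  - by move=> i w _; apply: sume_ge0 => j _; rewrite lee_fin mulr_ge0.
  - by move=> i; apply: emeasurable_sum.
  rewrite -sumEFin; apply: eq_bigr => i _.
  rewrite ge0_integral_sum //; last by move=> j w _; rewrite lee_fin mulr_ge0.
  by rewrite -sumEFin; apply: eq_bigr => j _; rewrite lratio_cross.
(* The square is expanded without subtraction, so that all integrands are nonnegative and additivity
   holds in the extended reals. *)
have E1 : (\int[P]_w ((lsum (e w) - p%:R) ^+ 2)%:E + (2 * p%:R)%:E * \int[P]_w (lsum (e w))%:E =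
   \int[P]_w (lsum (e w) ^+ 2)%:E + (p%:R ^+ 2)%:E)%E.
  have -> : (p%:R ^+ 2)%:E = (\int[P]_w (cst (p%:R ^+ 2)%:E w))%E.
    rewrite integral_cst // -[LHS]mule1; congr (_ * _)%E; exact/esym/probability_setT.
  rewrite -ge0_integralZlT ?mulr_ge0 //; first last.
  - by move=> w; rewrite lee_fin sumr_ge0.
  - exact/measurable_EFinP.
  rewrite -!ge0_integralD //.
  - by apply: eq_integral => w _; rewrite /= -!EFinM -!EFinD; congr (_%:E); ring.
  - by move=> w _; rewrite lee_fin sqr_ge0.
  - by apply/measurable_EFinP; exact: measurable_funX.
  - by move=> w _ /=; rewrite lee_fin exprn_ge0.
  - by move=> w _; rewrite lee_fin sqr_ge0.
  - by apply/measurable_EFinP; apply: measurable_funX; exact: measurable_funB.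
  - by move=> w _; rewrite -EFinM lee_fin !mulr_ge0 // sumr_ge0.
  - by apply/measurable_EFinP; exact: measurable_funM.
move: E1; rewrite W1 W2; case: (\int[P]_w _)%E => [x| |] //= [E1]; congr EFin.
have -> : \sum_i \sum_j (expR (sigma ^+ 2 * t ^+ 2 * dot (col i X) (col j X)) - 1) =
   \sum_i \sum_j expR (sigma ^+ 2 * t ^+ 2 * dot (col i X) (col j X)) - p%:R ^+ 2.
  under eq_bigr do rewrite sumrB sumr_const card_ord.
  by rewrite sumrB sumr_const card_ord -[_ *+ p]mulr_natr -expr2.
by move: E1; lra.
Qed.

End LikelihoodRatios.
End NoiseEvents.

Section CountDeterministic.
Context {R : realType} {n p : nat} (X : 'M[R]_(n, p)).

(** The eigenvalue bound covers [n] columns at a time: peel off blocks of [n] columns, each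
    contributing at most [n C0 |y|^2], and pay once more for the last incomplete block. *)
Lemma block_sum_le (C0 : R) (y : 'cV[R]_n) (A : {set 'I_p}) : (0 < n)%N -> 0 <= C0 -> UP X n C0 ->
  \sum_(j in A) dot (col j X) y ^+ 2 <= (#|A| + n)%:R * (C0 * dot y y).
Proof.
move=> n0 C00 up; have [m] := ubnP #|A|; elim: m A => // m IH A Am.
have base (S : {set 'I_p}) : (#|S| <= n)%N -> \sum_(j in S) dot (col j X) y ^+ 2 <= n%:R * (C0 * dot y y).
  by move=> Sn; apply: le_trans (col_dots_le y C00 up Sn) _; rewrite mulrCA mulrA.
have K0 : 0 <= C0 * dot y y by rewrite mulr_ge0 // dot_ge0.
have [An|An] := leqP #|A| n.
  by apply: le_trans (base A An) _; rewrite ler_wpM2r // ler_nat leq_addl.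
have [S SA Sn] := subset_of_card (ltnW An).
have AS : (#|A :\: S| = #|A| - n)%N by rewrite cardsD (finset.setIidPr SA) Sn.
rewrite (big_setID S) /= (finset.setIidPr SA).
have h1 := base S (eq_leq Sn).
have h2 := IH (A :\: S)%SET; rewrite AS subnK ?(ltnW An) // in h2.
have {}h2 := h2 (leq_trans (_ : (#|A| - n < #|A|)%N) Am).
rewrite natrD mulrDl addrC; apply: lerD => //; apply: h2.
by rewrite ltn_subrL n0 (leq_ltn_trans _ An).
Qed.

Lemma expR_sub1_le (x y : R) : `|x| <= y -> expR x - 1 <= `|x| * expR y.
Proof.
move=> xy; have [x0|x0] := lerP x 0.
  apply: (@le_trans _ _ 0); last by rewrite mulr_ge0 // expR_ge0.
  by rewrite subr_le0 -expR0 ler_expR.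
have h1 := expR_ge1Dx (- x).
have h2 : expR x - 1 <= x * expR x.
  have : expR x * (1 + - x) <= expR x * expR (- x) by rewrite ler_wpM2l // expR_ge0.
  by rewrite expRxMexpNx_1; lra.
apply: (le_trans h2); rewrite (gtr0_norm x0); apply: ler_wpM2l; first exact: ltW.
by rewrite ler_expR -(gtr0_norm x0).
Qed.

(** Two columns may have an inner product of order [n], but by [block_sum_le] the squares sum to
    [O(n p)] for each column, so the root mean square is [O(sqrt n)]. With
    [|x| <= (x^2 / s + s) / 2] at [s = sqrt n] the double sum is [O(p^2 / sqrt n)]. *)
Lemma variance_le (C0 B a s : R) : (0 < n)%N -> (n <= p)%N -> 0 <= C0 -> UP X n C0 -> 0 < B ->
  (forall i j, `|X i j| <= B) -> 0 <= a -> 0 < s -> s ^+ 2 = n%:R ->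
  \sum_i \sum_j (expR (a / n%:R * dot (col i X) (col j X)) - 1) <=
  a * expR (a * B ^+ 2) * (2 * C0 * B ^+ 2 + 1) * p%:R ^+ 2 / (2 * s).
Proof.
move=> n0 np C00 up B0 hB a0 s0 s2.
have nn : 0 < n%:R :> R by rewrite ltr0n.
have hc i : dot (col i X) (col i X) <= n%:R * B ^+ 2 := col_sqnorm_le i (ltW B0) hB.
have hij i j : `|dot (col i X) (col j X)| <= n%:R * B ^+ 2.
  have nB : 0 <= n%:R * B ^+ 2 by rewrite mulr_ge0 ?sqr_ge0.
  rewrite -(@ler_pXn2r _ 2) ?nnegrE // real_normK ?num_real //.
  apply: le_trans (cauchy_schwarz _ _) _; rewrite [leRHS]expr2.
  by apply: ler_pM => //; exact: dot_ge0.
pose c := a * expR (a * B ^+ 2).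
have c0 : 0 <= c by rewrite mulr_ge0 // expR_ge0.
have term i j : expR (a / n%:R * dot (col i X) (col j X)) - 1 <=
    c * (dot (col i X) (col j X) ^+ 2 / (n%:R * s) + s^-1) / 2.
  apply: le_trans (expR_sub1_le (y := a * B ^+ 2) _) _.
    rewrite normrM (ger0_norm (divr_ge0 a0 (ltW nn))); apply: le_trans (ler_wpM2l (divr_ge0 a0 (ltW nn)) (hij i j)) _.
    by rewrite le_eqVlt; apply/orP; left; apply/eqP; field; rewrite gt_eqF.
  rewrite normrM (ger0_norm (divr_ge0 a0 (ltW nn))) -subr_ge0.
  have -> : dot (col i X) (col j X) ^+ 2 = `|dot (col i X) (col j X)| ^+ 2 by rewrite real_normK ?num_real.
  move: `|_| => x; rewrite -s2 /c.
  have -> : a * expR (a * B ^+ 2) * (x ^+ 2 / (s ^+ 2 * s) + s^-1) / 2 - a / s ^+ 2 * x * expR (a * B ^+ 2) =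
     a * expR (a * B ^+ 2) * ((x - s) ^+ 2) / (2 * s ^+ 3) by field; rewrite gt_eqF.
  by apply: divr_ge0; [exact: mulr_ge0 (mulr_ge0 a0 (expR_ge0 _)) (sqr_ge0 _)|rewrite mulr_ge0 // exprn_ge0 // ltW].
have row i : \sum_j dot (col i X) (col j X) ^+ 2 <= 2 * p%:R * (C0 * (n%:R * B ^+ 2)).
  under eq_bigr do rewrite dotC.
  have h := block_sum_le (col i X) [set: 'I_p]%SET n0 C00 up.
  rewrite cardsT card_ord in h; rewrite (eq_bigl (fun j => j \in [set: 'I_p]%SET)); last first.
    by move=> j; rewrite finset.in_setT.
  apply: (le_trans h); apply: ler_pM => //; first by rewrite mulr_ge0 // dot_ge0.
    have np' : n%:R <= p%:R :> R by rewrite ler_nat.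
    by rewrite natrD; lra.
  by apply: ler_wpM2l.
apply: (@le_trans _ _ (\sum_(i < p) (c * (2 * p%:R * (C0 * (n%:R * B ^+ 2)) / (n%:R * s) + p%:R / s) / 2))).
  apply: ler_sum => i _; apply: le_trans (ler_sum _ (fun j _ => term i j)) _.
  rewrite -mulr_suml ler_pM2r ?invr_gt0 // -mulr_sumr; apply: ler_wpM2l => //.
  rewrite big_split /= sumr_const card_ord -[_ *+ p]mulr_natl lerD2r -mulr_suml.
  by apply: ler_wpM2r; rewrite ?invr_ge0 ?mulr_ge0 // ltW.
rewrite sumr_const card_ord -[_ *+ p]mulr_natl le_eqVlt; apply/orP; left; apply/eqP.
by rewrite /c; field; rewrite !gt_eqF.
Qed.

(** Outside the set a likelihood ratio is at most [expR (- 2) <= 1/4] by [htau], for a total of at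
    most [p / 4]. A sum above [p / 2] needs another [p / 4] from the set, where no ratio exceeds
    [expR (tau th s)]. *)
Lemma large_scores_card (sigma tau om s kap th : R) (u : 'cV[R]_n) :
  0 < s -> s ^+ 2 = n%:R -> 0 <= tau ->
  (forall j, kap * n%:R <= dot (col j X) (col j X)) ->
  (forall j, `|dot (col j X) u| <= th * n%:R) ->
  tau * om + 2 <= sigma ^+ 2 * tau ^+ 2 / 2 * kap ->
  p%:R / 2 < lsum sigma X (tau / s) u ->
  p%:R / 4 * expR (- (tau * th * s)) <= #|[set j | om * s < dot (col j X) u]%SET|%:R.
Proof.
move=> s0 s2 tau0 hk hth htau hW; set A := [set j | _]%SET.
have tau2 : sigma ^+ 2 * (tau / s) ^+ 2 / 2 * (kap * n%:R) = sigma ^+ 2 * tau ^+ 2 / 2 * kap.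
  by rewrite -s2; field; rewrite gt_eqF.
have ts0 : 0 <= tau / s by rewrite divr_ge0 // ltW.
have e2 : expR (- 2) <= 4^-1 :> R.
  rewrite expRN lef_pV2 ?posrE ?expR_gt0 //.
  have -> : expR (2 : R) = expR 1 ^+ 2 by rewrite -expRM_natl mulr1.
  have h := expR_ge1Dx (1 : R).
  by rewrite expr2; nra.
have inA j : lratio sigma X (tau / s) u j <= expR (tau * th * s).
  rewrite ler_expR; have h1 : 0 <= sigma ^+ 2 * (tau / s) ^+ 2 / 2 * dot (col j X) (col j X).
    by rewrite mulr_ge0 ?dot_ge0 // divr_ge0 // mulr_ge0 ?sqr_ge0.
  have h2 : tau / s * dot (col j X) u <= tau / s * (th * n%:R).
    by apply: ler_wpM2l => //; exact: le_trans (ler_norm _) (hth j).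
  have h3 : tau / s * (th * n%:R) = tau * th * s by rewrite -s2; field; rewrite gt_eqF.
  lra.
have ninA j : j \notin A -> lratio sigma X (tau / s) u j <= 4^-1.
  rewrite inE -leNgt => h; apply: le_trans e2; rewrite ler_expR.
  have h1 : sigma ^+ 2 * (tau / s) ^+ 2 / 2 * (kap * n%:R) <= sigma ^+ 2 * (tau / s) ^+ 2 / 2 * dot (col j X) (col j X).
    by apply: ler_wpM2l; rewrite ?divr_ge0 // mulr_ge0 // sqr_ge0.
  have h2 : tau / s * dot (col j X) u <= tau / s * (om * s) by apply: ler_wpM2l.
  have h3 : tau / s * (om * s) = tau * om by field; rewrite gt_eqF.
  lra.
have h1 : lsum sigma X (tau / s) u <= #|A|%:R * expR (tau * th * s) + p%:R / 4.
  rewrite /lsum (bigID (fun j => j \in A)) /=; apply: lerD.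
    by rewrite [leRHS]mulr_natl -sumr_const; apply: ler_sum => j _; exact: inA.
  apply: le_trans (ler_sum _ ninA) _; rewrite sumr_const -[_ *+ _]mulr_natl; apply: ler_wpM2r => //.
  by rewrite ler_nat (leq_trans (max_card _)) // card_ord.
rewrite expRN ler_pdivrMr ?expR_gt0 //; lra.
Qed.

(** The squared scores of [n] such columns would sum to more than [n om^2 n], above the bound
    [C0 n |u|^2] valid for any [n] columns. *)
Lemma large_scores_lt (sigma C0 om s : R) (u : 'cV[R]_n) : (0 < n)%N -> 0 < C0 -> UP X n C0 ->
  0 < s -> s ^+ 2 = n%:R -> 0 < om -> 4 * C0 * sigma ^+ 2 <= om ^+ 2 ->
  dot u u <= 4 * n%:R * sigma ^+ 2 ->
  (#|[set j | (om * s < dot (col j X) u)%R]%SET| < n)%N.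
Proof.
move=> n0 C00 up s0 s2 om0 hom hu; rewrite ltnNge; apply/negP => h.
have [S SA Sn] := subset_of_card h.
have nn : 0 < n%:R :> R by rewrite ltr0n.
have h1 := col_dots_le u (ltW C00) up (eq_leq Sn).
have h2 : n%:R * (om ^+ 2 * n%:R) < \sum_(j in S) dot (col j X) u ^+ 2.
  have -> : n%:R * (om ^+ 2 * n%:R) = \sum_(j in S) (om * s) ^+ 2 :> R.
    by rewrite sumr_const Sn -[RHS]mulr_natl exprMn s2.
  have Slt j : j \in S -> (om * s) ^+ 2 < dot (col j X) u ^+ 2.
    move=> /(fintype.subsetP SA); rewrite inE => hj.
    by rewrite ltr_pXn2r // nnegrE ?(ltW (lt_trans _ hj)) ?mulr_ge0 ?mulr_gt0 // ltW.
  apply: ltr_sum => //.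
  by have /card_gt0P [j jS] : (0 < #|S|)%N; [rewrite Sn|apply/hasP; exists j; rewrite ?mem_index_enum].
have h3 : C0 * n%:R * dot u u <= C0 * n%:R * (4 * n%:R * sigma ^+ 2).
  by apply: ler_wpM2l => //; rewrite mulr_ge0 // ltW.
have h4 : C0 * n%:R * (4 * n%:R * sigma ^+ 2) <= n%:R * (om ^+ 2 * n%:R).
  have -> : C0 * n%:R * (4 * n%:R * sigma ^+ 2) = n%:R * (4 * C0 * sigma ^+ 2 * n%:R) by ring.
  by apply: ler_wpM2l => //; apply: ler_wpM2r.
by have := lt_le_trans h2 (le_trans h1 (le_trans h3 h4)); rewrite ltxx.
Qed.

End CountDeterministic.

(** * Probability bounds for the exceptional events *)

Section GoodEvents.
Context {d} {T : measurableType d} {R : realType} (P : probability T R) (p : nat -> nat) (S : sample P p).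
Context (beta : forall n, 'cV[R]_(p n)) (sigma : R).
Hypotheses (hiid : iid_observations S) (hsplit : random_split S) (hA1 : assumption_A1 S beta sigma).
Hypothesis sigma0 : 0 < sigma.
Variable n : nat.
Local Notation XD w := (fun g => design S n g w).
Local Notation ZD w := (fun g => noise_at S n g w).
Local Notation XT := ('I_3 -> 'M[R]_(n, p n)).
Local Notation ET := ('I_3 -> 'cV[R]_n).

Lemma mmx_design g : mmx (fun w => design S n g w).
Proof.
have [mf _ _] := hsplit n; move=> i j.
have h : measurable_fun setT (fun w => obsX (split_map S n w) (all_covariates S n w) g i j).
  apply: (bind_fun (G := fun f w => obsX f (all_covariates S n w) g i j) mf) => f.
  by apply: mmx_obsX; exact: measurable_all_covariates.
by apply: eq_measurable_fun h => w _; rewrite !mxE tnth_mktuple.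
Qed.

Lemma mmx_noise_at g : mmx (fun w => noise_at S n g w).
Proof.
have [mf _ _] := hsplit n; move=> i j.
have h : measurable_fun setT (fun w => obsE (split_map S n w) (all_noise S n w) g i j).
  apply: (bind_fun (G := fun f w => obsE f (all_noise S n w) g i j) mf) => f.
  by apply: mmx_obsE; exact: measurable_all_noise.
by apply: eq_measurable_fun h => w _; rewrite !mxE tnth_mktuple.
Qed.

Lemma measurable_mevent E : mevent E -> measurable [set w | E (XD w) (ZD w)].
Proof. by move=> mE; apply: mE => g; [exact: mmx_design|exact: mmx_noise_at]. Qed.

Lemma upd_same (e0 : ET) g v : upd e0 g v g = v.
Proof. by rewrite /upd eqxx. Qed.

Lemma upd_other (e0 : ET) g v g' : g' != g -> upd e0 g v g' = e0 g'.
Proof. by rewrite /upd => /negbTE ->. Qed.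

Lemma mevent_forall (I : countType) (E : I -> XT -> ET -> Prop) : (forall i, mevent (E i)) ->
  mevent (fun X e => forall i, E i X e).
Proof. by move=> h d' T' X e mX me; apply: measurable_forall => i; exact: h. Qed.

Lemma mevent_exists (I : countType) (E : I -> XT -> ET -> Prop) : (forall i, mevent (E i)) ->
  mevent (fun X e => exists i, E i X e).
Proof. by move=> h d' T' X e mX me; apply: measurable_exists => i; exact: h. Qed.

Lemma mevent_and (E F : XT -> ET -> Prop) : mevent E -> mevent F -> mevent (fun X e => E X e /\ F X e).
Proof. by move=> h h' d' T' X e mX me; apply: measurableI; [exact: h|exact: h']. Qed.

Lemma mevent_lt (F G : XT -> ET -> R) :
  (forall d' (T' : measurableType d') (X : T' -> XT) (e : T' -> ET), (forall g, mmx (fun w => X w g)) ->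
     (forall g, mmx (fun w => e w g)) -> measurable_fun setT (fun w => F (X w) (e w)) /\
     measurable_fun setT (fun w => G (X w) (e w))) -> mevent (fun X e => F X e < G X e).
Proof. by move=> h d' T' X e mX me; have [mF mG] := h _ _ X e mX me; exact: measurable_lt. Qed.

Lemma mevent_le (F G : XT -> ET -> R) :
  (forall d' (T' : measurableType d') (X : T' -> XT) (e : T' -> ET), (forall g, mmx (fun w => X w g)) ->
     (forall g, mmx (fun w => e w g)) -> measurable_fun setT (fun w => F (X w) (e w)) /\
     measurable_fun setT (fun w => G (X w) (e w))) -> mevent (fun X e => F X e <= G X e).
Proof. by move=> h d' T' X e mX me; have [mF mG] := h _ _ X e mX me; exact: measurable_le. Qed.

Definition bounded (B : R) (X : XT) : Prop := forall g i j, `|X g i j| <= B.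

Lemma mevent_bounded B : mevent (fun X (_ : ET) => bounded B X).
Proof.
apply: mevent_forall => g; apply: mevent_forall => i; apply: mevent_forall => j.
apply: mevent_le => d' T' X e mX me; split; last exact: measurable_cst.
by apply: measurableT_comp => //; exact: mX.
Qed.

(** The directions may depend on all designs and on the noise of other groups; [ha] says that they
    do not see the noise of group [g], which stays Gaussian once the rest is frozen. *)
Lemma family_event_le (I : finType) (g : 'I_3) (a : I -> XT -> ET -> 'cV[R]_n) (L : R) : 0 <= L ->
  (forall i d' (T' : measurableType d') (X : T' -> XT) (e : T' -> ET), (forall g, mmx (fun w => X w g)) ->
     (forall g, mmx (fun w => e w g)) -> mmx (fun w => a i (X w) (e w))) ->
  (forall i X e v, a i X (upd e g v) = a i X e) ->
  (P [set w | exists i, (L * dot (a i (XD w) (ZD w)) (a i (XD w) (ZD w)) <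
                         dot (a i (XD w) (ZD w)) (noise_at S n g w) ^+ 2)%R] <=
   (#|I|%:R * (2 * expR (- L / (2 * sigma ^+ 2))))%:E)%E.
Proof.
move=> L0 ma ha.
apply: (noise_event_le hsplit hA1
  (E := fun X e => exists i, L * dot (a i X e) (a i X e) < dot (a i X e) (e g) ^+ 2) (g := g)).
- apply: mevent_exists => i; apply: mevent_lt => d' T' X e mX me; split.
    by apply: measurable_funM => //; apply: measurable_dot; exact: ma.
  by apply: measurable_funX; apply: measurable_dot; [exact: ma|exact: me].
- by rewrite mulr_ge0 // mulr_ge0 // expR_ge0.
move=> X e0 v gv; apply: le_trans (family_tail sigma0 gv (fun i => a i X e0) L0).
rewrite le_eqVlt; apply/orP; left; apply/eqP; congr (P _); apply/seteqP.
by split => w /= [i hi]; exists i; move: hi; rewrite ha upd_same.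
Qed.

Lemma scores_event_le (g : 'I_3) (L : R) : 0 <= L ->
  (P [set w | exists j, (L * dot (col j (design S n g w)) (col j (design S n g w)) <
      dot (col j (design S n g w)) (noise_at S n g w) ^+ 2)%R] <=
   ((p n)%:R * (2 * expR (- L / (2 * sigma ^+ 2))))%:E)%E.
Proof.
move=> L0; have := @family_event_le 'I_(p n) g (fun j X _ => col j (X g)) L L0.
rewrite card_ord; apply => // j d' T' X e mX _; exact: mmx_colof.
Qed.

(** Every set of at most [k] covariates is some [decode z], whence the factor
    [p.+1 ^ k] in the union bounds. *)
Definition decode k (z : {ffun 'I_k -> option 'I_(p n)}) : {set 'I_(p n)} :=
  [set j | Some j \in codom z]%SET.

Lemma decode_surj k (M : {set 'I_(p n)}) : (#|M| <= k)%N -> exists z, decode (k := k) z = M.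
Proof.
move=> Mk; exists [ffun i : 'I_k => nth None [seq Some j | j <- enum M] i].
apply/finset.setP => j; rewrite inE; apply/codomP/idP => [[i]|jM].
  rewrite ffunE => hj; have : Some j \in [seq Some j | j <- enum M].
    rewrite hj; apply: mem_nth; rewrite ltnNge; apply/negP => h.
    by rewrite nth_default in hj.
  by rewrite mem_map ?mem_enum // => x y [].
have jE : (index j (enum M) < #|M|)%N by rewrite cardE index_mem mem_enum.
exists (Ordinal (leq_trans jE Mk)); rewrite ffunE /= (nth_map j) ?nth_index ?mem_enum //.
by rewrite -cardE.
Qed.

Lemma residuals_event_le (g : 'I_3) k (L : R) : 0 <= L ->
  (P [set w | exists z : {ffun 'I_k -> option 'I_(p n)} * 'I_(p n),
      (L * dot (residual (design S n g w) (col z.2 (design S n g w)) (decode z.1))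
               (residual (design S n g w) (col z.2 (design S n g w)) (decode z.1)) <
       dot (residual (design S n g w) (col z.2 (design S n g w)) (decode z.1)) (noise_at S n g w) ^+ 2)%R] <=
   (((p n).+1 ^ k * p n)%:R * (2 * expR (- L / (2 * sigma ^+ 2))))%:E)%E.
Proof.
move=> L0.
have := @family_event_le ({ffun 'I_k -> option 'I_(p n)} * 'I_(p n))%type g
  (fun z X _ => residual (X g) (col z.2 (X g)) (decode z.1)) L L0.
rewrite card_prod card_ffun card_option !card_ord; apply => // z d' T' X e mX _.
by apply: mmx_residual => //; exact: mmx_colof.
Qed.

(** The coefficients come from the first group, so the second noise is independent of them and the
    union runs over [k + 1] vectors rather than over all models. *)
Lemma validation_event_le k (L : R) : 0 <= L ->
  (P [set w | exists l : 'I_k.+1,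
      (L * dot (design S n gII w *m (beta n - fs_coef (design S n gI w) (resp S n gI w) l))
               (design S n gII w *m (beta n - fs_coef (design S n gI w) (resp S n gI w) l)) <
       dot (design S n gII w *m (beta n - fs_coef (design S n gI w) (resp S n gI w) l)) (noise_at S n gII w) ^+ 2)%R] <=
   (k.+1%:R * (2 * expR (- L / (2 * sigma ^+ 2))))%:E)%E.
Proof.
move=> L0.
have := @family_event_le 'I_k.+1 gII
  (fun l X e => X gII *m (beta n - fs_coef (X gI) (X gI *m beta n + e gI) l)) L L0.
rewrite card_ord => h.
rewrite (_ : [set w | exists l : 'I_k.+1, _] = [set w | exists i : 'I_k.+1,
  L * dot (design S n gII w *m (beta n - fs_coef (design S n gI w) (design S n gI w *m beta n + noise_at S n gI w) i))
      (design S n gII w *m (beta n - fs_coef (design S n gI w) (design S n gI w *m beta n + noise_at S n gI w) i)) <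
  dot (design S n gII w *m (beta n - fs_coef (design S n gI w) (design S n gI w *m beta n + noise_at S n gI w) i))
     (noise_at S n gII w) ^+ 2]); last first.
  by apply/seteqP; split => w /= [l hl]; exists l; move: hl; rewrite (resp_linear hA1).
apply: h => [l d' T' X e mX me|l X e v].
  apply: mmx_mul => //; apply: mmx_sub; first exact: mmx_cst.
  by apply: mmx_fs_coef => //; apply: mmx_add => //; apply: mmx_mul => //; exact: mmx_cst.
rewrite upd_other //; by apply/eqP => /(congr1 val); rewrite /= !inordK.
Qed.

Lemma noise_norm_upper_le (g : 'I_3) :
  (P [set w | (4 * n%:R * sigma ^+ 2 <= dot (noise_at S n g w) (noise_at S n g w))%R] <= (expR (- n%:R / 2))%:E)%E.
Proof.
apply: (noise_event_le hsplit hA1 (E := fun (_ : XT) e => 4 * n%:R * sigma ^+ 2 <= dot (e g) (e g)) (g := g)).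
- by apply: mevent_le => d' T' X e mX me; split; [exact: measurable_cst|exact: measurable_dot].
- exact: expR_ge0.
- by move=> X e0 v gv; rewrite /upd /= eqxx; exact: (chi2_upper sigma0 gv).
Qed.

Lemma noise_norm_lower_le (g : 'I_3) (eta : R) : 0 < eta <= 1 ->
  (P [set w | (dot (noise_at S n g w) (noise_at S n g w) <= n%:R * sigma ^+ 2 * (1 - eta))%R] <=
    (expR (- n%:R * eta ^+ 3 / 4))%:E)%E.
Proof.
move=> he.
apply: (noise_event_le hsplit hA1 (E := fun (_ : XT) e => dot (e g) (e g) <= n%:R * sigma ^+ 2 * (1 - eta)) (g := g)).
- by apply: mevent_le => d' T' X e mX me; split; [exact: measurable_dot|exact: measurable_cst].
- exact: expR_ge0.
- by move=> X e0 v gv; rewrite /upd /= eqxx; exact: (chi2_lower sigma0 gv he).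
Qed.

Lemma mevent_UP g Q C : mevent (fun (X : XT) (_ : ET) => UP (X g) Q C).
Proof. by move=> d' T' X e mX me; exact: measurable_UP. Qed.

(** Chebyshev's inequality around the mean [p]. The design conditions belong to the event because
    the variance bound is applied to frozen designs: for a bad design the event is empty. *)
Lemma likelihood_event_le (C0 B tau s : R) : (0 < n)%N -> (n <= p n)%N -> 0 <= C0 -> 0 < B -> 0 < s -> s ^+ 2 = n%:R ->
  (P [set w | (UP (design S n gI w) n C0 /\ bounded B (XD w)) /\
      (((p n)%:R / 2) ^+ 2 <= (lsum sigma (design S n gI w) (tau / s) (noise_at S n gI w) - (p n)%:R) ^+ 2)%R] <=
   (2 * (sigma ^+ 2 * tau ^+ 2 * expR (sigma ^+ 2 * tau ^+ 2 * B ^+ 2) * (2 * C0 * B ^+ 2 + 1)) / s)%:E)%E.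
Proof.
move=> n0 np C00 B0 s0 s2; set K := _ * (_ + 1).
have K0 : 0 <= K.
  apply: mulr_ge0; first by apply: mulr_ge0; [exact: mulr_ge0 (sqr_ge0 _) (sqr_ge0 _)|exact: expR_ge0].
  by rewrite addr_ge0 // mulr_ge0 ?sqr_ge0 // mulr_ge0.
have c0 : 0 <= 2 * K / s by apply: divr_ge0; [exact: mulr_ge0|exact: ltW].
apply: (noise_event_le hsplit hA1 (E := fun X e => (UP (X gI) n C0 /\ bounded B X) /\
   ((p n)%:R / 2) ^+ 2 <= (lsum sigma (X gI) (tau / s) (e gI) - (p n)%:R) ^+ 2) (g := gI)) => //.
  apply: mevent_and; first by apply: mevent_and; [exact: mevent_UP|exact: mevent_bounded].
  apply: mevent_le => d' T' X e mX me; split; first exact: measurable_cst.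
  apply: measurable_funX; apply: measurable_funB => //; apply: measurable_sum => j.
  apply: measurableT_comp => //.
  by apply: measurable_funB; apply: measurable_funM => //; apply: measurable_dot => //; exact: mmx_colof.
move=> X e0 v gv; rewrite /upd /= eqxx.
have [[up bX]|nX] := pselect (UP (X gI) n C0 /\ bounded B X); last first.
  rewrite (_ : mkset _ = set0) ?measure0 ?lee_fin //.
  by apply/seteqP; split => w //= [].
rewrite (_ : mkset _ = [set w | ((p n)%:R / 2) ^+ 2 <= (lsum sigma (X gI) (tau / s) (\col_r v r w) - (p n)%:R) ^+ 2]); last first.
  by apply/seteqP; split => w /= [].
have pp : 0 < (p n)%:R :> R by rewrite ltr0n (leq_trans n0).
apply: le_trans (markov_ge0 P _ _ _) _.
- apply: measurable_funX; apply: measurable_funB => //; exact: (measurable_lsum gv).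
- by move=> w; exact: sqr_ge0.
- by rewrite exprn_gt0 // divr_gt0.
rewrite (lsum_variance sigma0 gv) -EFinM lee_fin.
have := variance_le n0 np C00 up B0 (bX gI) (mulr_ge0 (sqr_ge0 sigma) (sqr_ge0 tau)) s0 s2.
have -> : sigma ^+ 2 * tau ^+ 2 / n%:R = sigma ^+ 2 * (tau / s) ^+ 2.
  by rewrite -s2; field; rewrite gt_eqF.
rewrite -/K => h; rewrite ler_pdivrMl ?exprn_gt0 ?divr_gt0 //; apply: (le_trans h).
by rewrite le_eqVlt; apply/orP; left; apply/eqP; field; rewrite gt_eqF.
Qed.

Lemma mevent_swap_bad k (c : R) : mevent (fun (X : XT) (_ : ET) => swap_bad k c X).
Proof.
move=> d' T' X e mX me.
have ms : mmx (fun w => stack (X w)).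
  move=> i j; under eq_fun do rewrite mxE.
  by case: (fintype.split i) => r; exact: mX.
have mc j : mmx (fun w => contrast (X w) j).
  move=> i l; under eq_fun do rewrite mxE.
  case: (fintype.split i) => r; under eq_fun do rewrite !mxE; first exact: mX.
  by apply: measurableT_comp => //; exact: mX.
have mr (M : {set 'I_(p n)}) i : mmx (fun w => swap_res (X w) M i).
  by apply: mmx_residual => //; exact: mmx_colof.
rewrite (_ : mkset _ = [set w | exists z : {ffun 'I_k -> option 'I_(p n)} * ('I_(p n) * 'I_(p n)),
   [set w | c * dot (swap_res (X w) (decode z.1) z.2.1) (swap_res (X w) (decode z.1) z.2.1) <
   dot (swap_res (X w) (decode z.1) z.2.1) (contrast (X w) z.2.2) ^+ 2] w]); last first.
  by apply/seteqP; split => w /= /existsP.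
apply: measurable_exists => z; apply: measurable_lt.
  by apply: measurable_funM => //; exact: measurable_dot.
by apply: measurable_funX; exact: measurable_dot.
Qed.

(** Boundedness belongs to the event because the count requires it of the fixed design; swapping
    rows preserves it. *)
Lemma swap_event_prob_le k (B L : R) : 0 < B -> 0 <= L ->
  (P [set w | bounded B (XD w) /\ swap_bad k (L * (2 * B ^+ 2)) (XD w)] <=
   (((p n).+1 ^ k * (p n * p n))%:R * (2 * expR (- L / 8)))%:E)%E.
Proof.
move=> B0 L0.
have c0 : 0 <= ((p n).+1 ^ k * (p n * p n))%:R * (2 * expR (- L / 8)) :> R.
  by rewrite mulr_ge0 // mulr_ge0 // expR_ge0.
apply: (swap_event_le hiid hsplit hA1 (E := fun X => bounded B X /\ swap_bad k (L * (2 * B ^+ 2)) X)) => //.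
  apply: mevent_and; first exact: mevent_bounded.
  exact: mevent_swap_bad.
move=> X; have [bX|nX] := pselect (bounded B X).
  apply: le_trans (swap_event_count k B0 L0 bX); rewrite ler_nat; apply: subset_leq_card.
  apply/fintype.subsetP => b; by rewrite !inE => -[].
rewrite (_ : [set b | _]%SET = finset.set0) ?cards0 ?mulr_ge0 //.
apply/finset.setP => b; rewrite !finset.inE; apply/asboolP => -[hb _]; apply: nX => g i j.
have := hb (if b i then swap_groups g else g) i j; rewrite mxE.
by case: (b i); rewrite ?swap_groupsK.
Qed.

End GoodEvents.

(** * Cleaning *)

Lemma ltn_half (m Q n : nat) : (0 < n)%N -> (m <= Q)%N -> (2 * Q <= n)%N -> (m < n)%N.
Proof.
move=> n0 mQ h; apply: leq_ltn_trans mQ _; case: Q h => // Q; apply: leq_trans.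
by rewrite mul2n -addnn addSn ltnS leq_addl.
Qed.

Lemma leq_double_sub (m Q n : nat) : (m <= Q)%N -> (2 * Q <= n)%N -> (n <= 2 * (n - m))%N.
Proof.
move=> mQ h; have h2 : (2 * m <= n)%N by apply: leq_trans h; rewrite leq_mul2l.
rewrite mulnBr; apply: leq_trans (leq_sub2l _ h2); by rewrite mul2n -addnn addnK.
Qed.

Section NullDirections.
Context {R : realType} {n p : nat} (X : 'M[R]_(n, p)) (sigma : R) (M : {set 'I_p}).
Hypotheses (sigma0 : 0 < sigma) (iM : inj_on X M).

(** [ols_coord] with zero signal and noise, for its two identities on the dual vector. *)
Let zero_coord i := ols_coord (beta := 0) 0 i iM (fun j _ => mxE _ _ _ _).

(** A zero diagonal entry would make the dual vector vanish, hence by injectivity a whole column of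
    the inverse. *)
Lemma gram_inv_pos i : 0 < invmx (gram X M) i i.
Proof.
have [_ aa aE] := zero_coord i; rewrite -aa lt_def dot_ge0 andbT.
apply/negP => /eqP /dot_eq0 a0.
have u0 : ext (col i (invmx (gram X M))) = 0.
  by apply: (iM (suppin_ext _)); rewrite -aE.
have U := (gram_unitP X M).1 iM.
have c0 : col i (invmx (gram X M)) = 0 :> 'cV_#|M|.
  by apply/colP => k; rewrite -ext_enum u0 !mxE.
have := congr1 (fun A : 'M[R]_#|M| => A i i) (mulmxV U).
have -> : (gram X M *m invmx (gram X M)) i i = (gram X M *m col i (invmx (gram X M))) i 0.
  by rewrite colE mulmxA -colE [RHS]mxE.
by rewrite c0 mulmx0 !mxE eqxx => /eqP; rewrite eq_sym oner_eq0.
Qed.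

(** Normalized so that its inner product with the noise is standard normal: this is the
    [t]-statistic of a null covariate with [sigma] in place of its estimate. *)
Definition null_dir (i : 'I_#|M|) : 'cV[R]_n :=
  (sigma * Num.sqrt (invmx (gram X M) i i))^-1 *: (cols X M *m col i (invmx (gram X M))).

Lemma null_dir_norm i : sigma ^+ 2 * dot (null_dir i) (null_dir i) = 1.
Proof.
have [_ aa _] := zero_coord i; have gp := gram_inv_pos i.
rewrite /null_dir dotZl dotZr aa; set g := invmx _ i i in gp *.
have gs : 0 < Num.sqrt g by rewrite sqrtr_gt0.
have gE : g = Num.sqrt g ^+ 2 by rewrite sqr_sqrtr // ltW.
move: gE gs; move: (Num.sqrt g) => t -> t0.
by field; rewrite !gt_eqF.
Qed.

End NullDirections.

Section Cleaning.
Context {R : realType} {n p : nat} (X : 'M[R]_(n, p)) (beta : 'cV[R]_p) (eps : 'cV[R]_n).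
Context (Q : nat) (kap th sigma eta : R) (M : {set 'I_p}).
Hypotheses (n0 : (0 < n)%N) (kap0 : 0 < kap) (sigma0 : 0 < sigma).
Hypothesis hRE : RE X Q kap.
Hypothesis hth : forall j, `|dot (col j X) eps| <= th * n%:R.
Hypotheses (DM : supp beta \subset M) (MQ : (#|M| <= Q)%N) (Qn : (2 * Q <= n)%N).
Hypothesis hlow : n%:R * sigma ^+ 2 * (1 - eta) < dot eps eps.
Hypothesis hthe : th ^+ 2 * Q%:R / kap <= eta * sigma ^+ 2.
Let Y := X *m beta + eps.
Local Notation err := (beta - ols_ext X Y M).

Let nn : 0 < n%:R :> R. Proof. by rewrite ltr0n. Qed.
Let iM : inj_on X M. Proof. exact: RE_inj n0 kap0 hRE MQ. Qed.
Let betaM : suppin beta M. Proof. by apply: suppinS DM _; exact: suppin_supp. Qed.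

Let nM : (0 < n - #|M|)%N.
Proof. by rewrite subn_gt0; exact: ltn_half MQ Qn. Qed.

Lemma sum_residual : \sum_i residual X Y M i 0 ^+ 2 = dot eps eps - dot (X *m err) (X *m err).
Proof.
rewrite -sum_expr2 residual_err dotDl !dotDr (dotC eps).
have eM : suppin err M by apply: suppinB betaM (@suppin_ols _ _ _ _ _ _).
have := residual_orth Y iM eM; rewrite residual_err dotDr => /eqP; rewrite addr_eq0 => /eqP ->; ring.
Qed.

(** The residual sum of squares is [|eps|^2 - loss]. Each term costs a relative [eta], and dividing
    by [n - m] instead of [n] only increases the estimate. *)
Lemma sigma2_hat_ge : sigma ^+ 2 * (1 - 2 * eta) <= sigma2_hat X Y M.
Proof.
have h1 := loss_selected_le n0 kap0 hRE hth DM MQ.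
have nMp : 0 < (n - #|M|)%N%:R :> R by rewrite ltr0n.
rewrite /sigma2_hat ler_pdivlMr // sum_residual.
have h2 : th ^+ 2 * n%:R * Q%:R / kap <= n%:R * (eta * sigma ^+ 2).
  have -> : th ^+ 2 * n%:R * Q%:R / kap = n%:R * (th ^+ 2 * Q%:R / kap) by field; rewrite gt_eqF.
  by apply: ler_wpM2l.
have h3 : (n - #|M|)%N%:R <= n%:R :> R by rewrite ler_nat leq_subr.
have [e0|e0] := lerP 0 (1 - 2 * eta).
  have h4 : sigma ^+ 2 * (1 - 2 * eta) * (n - #|M|)%N%:R <= sigma ^+ 2 * (1 - 2 * eta) * n%:R.
    by apply: ler_wpM2l => //; rewrite mulr_ge0 // sqr_ge0.
  move: h1 h2 h4 hlow; rewrite -/Y.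
  move: (dot _ _) (dot _ _) (th ^+ 2 * n%:R * Q%:R / kap) (_ * (n - #|M|)%N%:R) => x y z t *; lra.
apply: (@le_trans _ _ 0).
  apply: mulr_le0_ge0 => //; apply: mulr_ge0_le0; [exact: sqr_ge0|exact: ltW].
by rewrite -sum_residual sumr_ge0 // => i _; exact: sqr_ge0.
Qed.

(** A constant factor suffices, as this bound serves the power only; [2 Q <= n] controls the degrees
    of freedom. *)
Lemma sigma2_hat_le : dot eps eps <= 4 * n%:R * sigma ^+ 2 -> sigma2_hat X Y M <= 8 * sigma ^+ 2.
Proof.
move=> hup; have nMp : 0 < (n - #|M|)%N%:R :> R by rewrite ltr0n.
rewrite /sigma2_hat ler_pdivrMr // sum_residual.
have h1 := dot_ge0 (X *m err).
have h2 : n%:R <= 2 * (n - #|M|)%N%:R :> R.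
  by rewrite -natrM ler_nat; exact: leq_double_sub MQ Qn.
have h3 : 4 * sigma ^+ 2 * n%:R <= 4 * sigma ^+ 2 * (2 * (n - #|M|)%N%:R).
  by apply: ler_wpM2l => //; rewrite mulr_ge0 // sqr_ge0.
by move: hup h1 h3; move: (dot _ _) (dot _ _) => x y *; lra.
Qed.

(** For [u] the column [i] of the inverse, [|X u|^2 = u_i = g], so the restricted eigenvalue gives
    [kap n g^2 <= kap n |u|^2 <= g]. *)
Lemma gram_inv_le i : invmx (gram X M) i i <= (kap * n%:R)^-1.
Proof.
have [_ aa aE] := ols_coord eps i iM betaM; have gp := gram_inv_pos iM i.
set u := ext _ in aE.
have h1 := hRE MQ (suppin_ext _ : suppin u M); rewrite -aE aa in h1.
have h2 := sqr_coord_le u (enum_val i); rewrite ext_enum mxE in h2.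
have kn : 0 < kap * n%:R by rewrite mulr_gt0.
rewrite -[leRHS]mul1r ler_pdivlMr // -(ler_pM2r gp) mul1r.
apply: le_trans h1; rewrite mulrAC -expr2 mulrC.
by rewrite ler_pM2l.
Qed.

(** Replacing the estimate by [sigma] costs a factor [sqrt (1 - 2 eta)], bounded below by
    [1 - 2 eta] so that the shift of the threshold is linear in [eta]. *)
Lemma null_stat_lt (c : R) (i : 'I_#|M|) : 0 <= c -> 0 < eta < 2^-1 -> enum_val i \notin supp beta ->
  c < `|t_stat X Y i| -> c - c * (2 * eta) < `|dot (null_dir X sigma i) eps|.
Proof.
move=> c0 /andP[eta0 eta1] iD; rewrite /t_stat.
have [oE aa aE] := ols_coord eps i iM betaM; have gp := gram_inv_pos iM i.
rewrite -/Y in oE.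
have b0 : beta (enum_val i) 0 = 0 by exact: suppin_supp.
rewrite oE b0 add0r /null_dir dotZl; set g := invmx _ i i in gp aa *.
have sp : 0 < sigma ^+ 2 * (1 - 2 * eta) by rewrite mulr_gt0 ?exprn_gt0 //; lra.
have s2 := lt_le_trans sp sigma2_hat_ge.
have rs : sigma * (1 - 2 * eta) <= Num.sqrt (sigma2_hat X Y M).
  rewrite -(@ler_pXn2r _ 2) ?nnegrE ?sqrtr_ge0 ?mulr_ge0 ?(ltW sigma0) //; last lra.
  rewrite sqr_sqrtr ?(ltW s2) //; apply: le_trans sigma2_hat_ge.
  rewrite exprMn ler_pM2l ?exprn_gt0 // expr2 ler_piMl //; lra.
have gs : 0 < Num.sqrt g by rewrite sqrtr_gt0.
have den : 0 < Num.sqrt (sigma2_hat X Y M) * Num.sqrt g by rewrite mulr_gt0 // sqrtr_gt0.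
rewrite normrM normfV (gtr0_norm den) ltr_pdivlMr // => h.
rewrite normrM normfV (gtr0_norm (mulr_gt0 sigma0 gs)) ltr_pdivlMl ?mulr_gt0 //.
apply: le_lt_trans h.
have -> : sigma * Num.sqrt g * (c - c * (2 * eta)) = c * ((sigma * (1 - 2 * eta)) * Num.sqrt g) by ring.
by apply: ler_wpM2l => //; apply: ler_wpM2r => //; exact: ltW.
Qed.

(** The estimate is off by at most [psi / 2], and the squared standard error is at most
    [8 sigma^2 / (kap n)]. Squaring the comparison of [c] standard errors with [psi / 2] gives the
    constant [32]. *)
Lemma power_stat_gt (psi c L : R) (i : 'I_#|M|) : dot eps eps <= 4 * n%:R * sigma ^+ 2 ->
  0 < eta < 2^-1 -> 0 < psi -> enum_val i \in supp beta -> psi <= `|beta (enum_val i) 0| ->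
  4 * (th ^+ 2 * Q%:R) <= kap ^+ 2 * psi ^+ 2 -> 0 <= c <= L -> 32 * sigma ^+ 2 * L ^+ 2 < psi ^+ 2 * kap * n%:R ->
  c < `|t_stat X Y i|.
Proof.
move=> hup /andP[eta0 eta1] psi0 iD hpsi hth4 /andP[c0 cL] hL; rewrite /t_stat.
have gp := gram_inv_pos iM i; have gle := gram_inv_le i.
set g := invmx _ i i in gp gle *.
have sp : 0 < sigma ^+ 2 * (1 - 2 * eta) by rewrite mulr_gt0 ?exprn_gt0 //; lra.
have s2 := lt_le_trans sp sigma2_hat_ge.
have s8 := sigma2_hat_le hup.
have den : 0 < Num.sqrt (sigma2_hat X Y M) * Num.sqrt g by rewrite mulr_gt0 ?sqrtr_gt0.
have herr := err_selected_le n0 kap0 hRE hth DM MQ.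
have k2 : 0 < kap ^+ 2 by rewrite exprn_gt0.
have e2 : `|(err) (enum_val i) 0| <= psi / 2.
  rewrite -(@ler_pXn2r _ 2) ?nnegrE ?divr_ge0 ?(ltW psi0) // real_normK ?num_real //.
  apply: le_trans (sqr_coord_le _ _) (le_trans herr _).
  by rewrite ler_pdivrMr // expr_div_n; move: hth4; lra.
have oge : psi / 2 <= `|ols X Y M i 0|.
  have : err (enum_val i) 0 = beta (enum_val i) 0 - ols X Y M i 0.
    by rewrite mxE [(- _ : 'cV_p) _ _]mxE -[ols_ext X Y M]/(ext _) ext_enum.
  move=> eE; rewrite eE in e2.
  have := ler_normD (beta (enum_val i) 0 - ols X Y M i 0) (ols X Y M i 0); rewrite subrK.
  by move: hpsi e2; lra.
rewrite normrM normfV (gtr0_norm den) ltr_pdivlMr //.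
apply: lt_le_trans oge; rewrite -(@ltr_pXn2r _ 2) ?nnegrE ?divr_ge0 ?mulr_ge0 ?(ltW psi0) ?sqrtr_ge0 //.
rewrite !exprMn !sqr_sqrtr ?(ltW gp) ?(ltW s2) //.
have cc : c ^+ 2 <= L ^+ 2 by rewrite ler_pXn2r ?nnegrE // (le_trans c0).
have kn : 0 < kap * n%:R by rewrite mulr_gt0.
have h1 : sigma2_hat X Y M * g <= 8 * sigma ^+ 2 * (kap * n%:R)^-1.
  by apply: ler_pM => //; exact: ltW.
have h2 : c ^+ 2 * (sigma2_hat X Y M * g) <= L ^+ 2 * (8 * sigma ^+ 2 * (kap * n%:R)^-1).
  by apply: ler_pM => //; [exact: sqr_ge0|rewrite mulr_ge0 // ltW].
apply: (le_lt_trans h2).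
have -> : L ^+ 2 * (8 * sigma ^+ 2 * (kap * n%:R)^-1) = (32 * sigma ^+ 2 * L ^+ 2) / (4 * (kap * n%:R)).
  by field; rewrite !gt_eqF.
rewrite ltr_pdivrMr ?mulr_gt0 //.
by apply: (lt_le_trans hL); rewrite le_eqVlt; apply/orP; left; apply/eqP; field.
Qed.

End Cleaning.

Lemma threshold_bounds (R : realType) (alpha L : R) (m Q : nat) : (0 < m)%N -> (m <= Q)%N ->
  0 < alpha < 1 -> 0 < L -> 2 * ln (2 * Q%:R / alpha) <= L ^+ 2 ->
  [/\ 0 < alpha / (2 * m%:R) < 2^-1, 0 <= z_quantile (alpha / (2 * m%:R)) &
      z_quantile (alpha / (2 * m%:R)) <= L].
Proof.
move=> m0 mQ /andP[al0 al1] L0 hL.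
have mm : 0 < m%:R :> R by rewrite ltr0n.
have u01 : 0 < alpha / (2 * m%:R) < 2^-1.
  have m1 : 1 <= m%:R :> R by rewrite ler1n.
  rewrite divr_gt0 ?mulr_gt0 //= ltr_pdivrMr ?mulr_gt0 //; lra.
have c0 := z_quantile_ge0 u01.
split => //; rewrite -(@ler_pXn2r _ 2) ?nnegrE ?(ltW L0) //; apply: le_trans hL.
apply: le_trans (z_quantile_sqr_le u01) _; rewrite ler_pM2l // ler_ln ?posrE ?invr_gt0; last 2 first.
- by case/andP: u01.
- by rewrite divr_gt0 // mulr_gt0 // ltr0n (leq_trans m0).
by rewrite invfM invrK mulrC ler_pM2r ?invr_gt0 // ler_pM2l // ler_nat.
Qed.

Section NullProbability.
Context {d} {T : measurableType d} {R : realType} (P : probability T R).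
Context {n p : nat} (v : 'I_n -> T -> R) (sigma : R) (beta : 'cV[R]_p).
Hypotheses (sigma0 : 0 < sigma) (gv : gauss_family P v sigma).
Local Notation e w := (\col_r v r w : 'cV[R]_n).

Lemma std_dot_law (u : 'cV[R]_n) (A : set R) : sigma ^+ 2 * dot u u = 1 -> measurable A ->
  P [set w | A (dot u (e w))] = normal_prob 0 1 A.
Proof.
move=> u1 mA; have [mv iv lv] := gv.
rewrite -(gauss_std_law sigma0 mv iv lv (a := fun r => u r 0) (index_enum_uniq _) _ mA); last by rewrite -sum_expr2.
by congr (P _); apply/seteqP; split => w /=; rewrite dot_noise.
Qed.

(** Each null statistic exceeds [c] with probability at most [2 upper_tail (c - h)], where
    [h = 2 eta c] pays for the variance estimate. As [upper_tail c = alpha / (2 m)], the union over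
    [m] covariates gives [alpha] up to the factor and the remainder of [upper_tail_shift]. *)
Lemma null_prob_le (X : 'M[R]_(n, p)) (M : {set 'I_p}) (Q : nat) (kap th eta alpha L : R) :
  (0 < n)%N -> 0 < kap -> RE X Q kap -> supp beta \subset M -> (#|M| <= Q)%N -> (2 * Q <= n)%N ->
  th ^+ 2 * Q%:R / kap <= eta * sigma ^+ 2 -> 0 < eta < 4^-1 -> 0 < alpha < 1 -> 0 < L ->
  2 * ln (2 * Q%:R / alpha) <= L ^+ 2 ->
  (P [set w | [/\ (forall j, (`|dot (col j X) (e w)| <= th * n%:R)%R),
      (n%:R * sigma ^+ 2 * (1 - eta) < dot (e w) (e w))%R &
      ~~ (clean X (X *m beta + e w) M alpha \subset supp beta)]] <=
   (alpha * expR (L * (L * (2 * eta))) + 2 * Q%:R * expR (- (L - L * (2 * eta)) ^+ 2 / 2))%:E)%E.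
Proof.
move=> n0 kap0 hRE DM MQ Qn hthe /andP[eta0 eta1] /andP[al0 al1] L0 hL.
have [m0|m0] := posnP #|M|.
  rewrite (_ : mkset _ = set0) ?measure0 ?lee_fin ?addr_ge0 ?mulr_ge0 ?expR_ge0 ?(ltW al0) //.
  apply/seteqP; split => w //= -[_ _ /subsetPn [j /imsetP [i]]].
  by have := ltn_ord i; rewrite [X in (_ < X)%N]m0.
have mm : 0 < #|M|%:R :> R by rewrite ltr0n.
pose u := alpha / (2 * #|M|%:R); pose c := z_quantile u.
have [u01 c0 cL] : [/\ 0 < u < 2^-1, 0 <= c & c <= L].
  by apply: threshold_bounds L0 hL => //; rewrite al0.
have tc : upper_tail c = u%:E by apply: z_quantileP; move: u01 => /andP[-> h] /=; lra.
pose h := c * (2 * eta).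
have h0 : 0 <= h by rewrite mulr_ge0 // mulr_ge0 // ltW.
have hh : h <= L * (2 * eta) by apply: ler_wpM2r => //; rewrite mulr_ge0 // ltW.
have LL : 0 < L - L * (2 * eta).
  by rewrite -{1}[L]mulr1 -mulrBr mulr_gt0 //; lra.
have iM : inj_on X M by exact: RE_inj n0 kap0 hRE MQ.
have mabs : measurable [set x : R | c - h < `|x|] by apply: measurable_lt => //; exact: measurableT_comp.
have mc : dmeas (fun w => clean X (X *m beta + e w) M alpha).
  apply: (dmeas_clean (X := fun=> X) (Y := fun w => X *m beta + e w)); first exact: mmx_cst.
  by apply: mmx_add; [exact: mmx_cst|exact: mmx_noise gv].
pose B (i : 'I_#|M|) := [set w | (c - h < `|dot (null_dir X sigma i) (e w)|)%R].
have mB i : measurable (B i).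
  apply: measurable_lt => //; apply: measurableT_comp => //.
  by apply: measurable_dot; [exact: mmx_cst|exact: mmx_noise gv].
have PB i : (P (B i) <= 2%:E * upper_tail (c - h))%E.
  rewrite (std_dot_law (A := [set x | c - h < `|x|])) //; first exact: two_sided_le.
  exact: null_dir_norm.
apply: (@le_trans _ _ (\sum_i P (B i))%E).
  apply: union_bound => //.
    rewrite (_ : mkset _ = [set w | forall j, `|dot (col j X) (e w)| <= th * n%:R] `&`
      ([set w | n%:R * sigma ^+ 2 * (1 - eta) < dot (e w) (e w)] `&`
       (fun w => clean X (X *m beta + e w) M alpha) @^-1` [set D : {set 'I_p} | ~~ (D \subset supp beta)])); last first.
      by apply/seteqP; split => w /=; [case=> ? ? ?; split|case=> ? [? ?]; split].
    apply: measurableI; last apply: measurableI; last exact: dmeas_pre.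
      apply: measurable_forall => j; apply: measurable_le => //; apply: measurableT_comp => //.
      by apply: measurable_dot; [exact: mmx_cst|exact: mmx_noise gv].
    by apply: measurable_lt => //; apply: measurable_dot; exact: mmx_noise gv.
  move=> w [h1 h2 /subsetPn [j /imsetP [i]]]; rewrite inE => hi -> iD; exists i.
  by apply: (null_stat_lt n0 kap0 sigma0 hRE h1 DM MQ Qn h2 hthe c0 _ iD hi); rewrite eta0 /=; lra.
apply: (@le_trans _ _ (\sum_(i < #|M|) (2 * (expR (L * h) * u + expR (- (L - h) ^+ 2 / 2)))%:E)%E).
  apply: lee_sum => i _; apply: (le_trans (PB i)); rewrite EFinM; apply: lee_wpmul2l => //.
  rewrite EFinD EFinM -tc; apply: upper_tail_shift => //; [by rewrite lerD2r| |exact: ltW].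
  by apply: lt_le_trans LL _; rewrite lerB.
rewrite sumEFin lee_fin sumr_const card_ord -[_ *+ _]mulr_natl.
have -> : #|M|%:R * (2 * (expR (L * h) * u + expR (- (L - h) ^+ 2 / 2))) =
   alpha * expR (L * h) + 2 * #|M|%:R * expR (- (L - h) ^+ 2 / 2).
  by rewrite /u; field; rewrite gt_eqF.
apply: lerD.
  by apply: ler_wpM2l; [exact: ltW|rewrite ler_expR; apply: ler_wpM2l => //; exact: ltW].
apply: ler_pM; rewrite ?expR_ge0 ?mulr_ge0 //; first by rewrite ler_wpM2l // ler_nat.
rewrite ler_expR ler_pM2r ?invr_gt0 // lerN2 ler_pXn2r ?nnegrE ?(ltW LL) //; first by rewrite lerB.
by apply: le_trans (ltW LL) _; rewrite lerB.
Qed.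

End NullProbability.

Section CleaningEvent.
Context {d} {T : measurableType d} {R : realType} (P : probability T R) (p : nat -> nat) (S : sample P p).
Context (beta : forall n, 'cV[R]_(p n)) (sigma : R).
Hypotheses (hsplit : random_split S) (hA1 : assumption_A1 S beta sigma) (sigma0 : 0 < sigma).
Variables (n k : nat).
Local Notation XT := ('I_3 -> 'M[R]_(n, p n)).
Local Notation ET := ('I_3 -> 'cV[R]_n).

(** The model as a function of all designs and noises, as [mevent] requires. By [selected_upd] it
    does not see the third noise and is thus frozen during cleaning. *)
Definition selected (X : XT) (e : ET) : {set 'I_(p n)} :=
  let Y g := X g *m beta n + e g in
  fs_set (X gI) (Y gI) (cv_lambda (X gI) (Y gI) (X gII) (Y gII) k).

Lemma Shat_selected w : Shat S n k w = selected (fun g => design S n g w) (fun g => noise_at S n g w).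
Proof. by rewrite /Shat /Shat_at /lambda_hat !(resp_linear hA1). Qed.

Lemma gI_neq : (gI == gIII = false) * (gII == gIII = false) * (gI == gII = false).
Proof. by do !split; apply/eqP => /(congr1 val); rewrite /= !inordK. Qed.

Lemma selected_upd X e v : selected X (upd e gIII v) = selected X e.
Proof. by rewrite /selected /upd !gI_neq. Qed.

Lemma dmeas_selected d' (T' : measurableType d') (X : T' -> XT) (e : T' -> ET) :
  (forall g, mmx (fun w => X w g)) -> (forall g, mmx (fun w => e w g)) ->
  dmeas (fun w => selected (X w) (e w)).
Proof.
move=> mX me.
have mY g : mmx (fun w => X w g *m beta n + e w g).
  by apply: mmx_add => //; apply: mmx_mul => //; exact: mmx_cst.
pose G (l : 'I_k.+1) w := fs_set (X w gI) (X w gI *m beta n + e w gI) l.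
apply: (bind_dmeas (G := G) (F := fun w => cv_lambda (X w gI) (X w gI *m beta n + e w gI) (X w gII)
   (X w gII *m beta n + e w gII) k)).
  exact: dmeas_cv.
by move=> l; exact: dmeas_fs_set.
Qed.

(** The first three conditions depend on frozen data only, the last three also on the third noise;
    [cleaning_event_le] decides the former and bounds the probability of the latter. *)
Definition bad_cleaning (Q : nat) (kap th eta alpha : R) (X : XT) (e : ET) : Prop :=
  [/\ supp (beta n) \subset selected X e, (#|selected X e| <= Q)%N & RE (X gIII) Q kap] /\
  [/\ (forall j, `|dot (col j (X gIII)) (e gIII)| <= th * n%:R),
      n%:R * sigma ^+ 2 * (1 - eta) < dot (e gIII) (e gIII) &
      ~~ (clean (X gIII) (X gIII *m beta n + e gIII) (selected X e) alpha \subset supp (beta n))].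

Lemma dmeas_cleaned d' (T' : measurableType d') (X : T' -> XT) (e : T' -> ET) alpha :
  (forall g, mmx (fun w => X w g)) -> (forall g, mmx (fun w => e w g)) ->
  dmeas (fun w => clean (X w gIII) (X w gIII *m beta n + e w gIII) (selected (X w) (e w)) alpha).
Proof.
move=> mX me; pose G M w := clean (X w gIII) (X w gIII *m beta n + e w gIII) M alpha.
apply: (bind_dmeas (G := G) (dmeas_selected mX me)) => M; apply: dmeas_clean => //.
by apply: mmx_add => //; apply: mmx_mul => //; exact: mmx_cst.
Qed.

Lemma mevent_bad_cleaning Q kap th eta alpha : mevent (bad_cleaning Q kap th eta alpha).
Proof.
move=> d' T' X e mX me.
have mS := dmeas_selected mX me; have mc := dmeas_cleaned alpha mX me.
rewrite (_ : mkset _ =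
    ((fun w => selected (X w) (e w)) @^-1` [set M : {set 'I_(p n)} | supp (beta n) \subset M /\ (#|M| <= Q)%N] `&`
     [set w | RE (X w gIII) Q kap]) `&`
    ([set w | forall j, `|dot (col j (X w gIII)) (e w gIII)| <= th * n%:R] `&`
     ([set w | n%:R * sigma ^+ 2 * (1 - eta) < dot (e w gIII) (e w gIII)] `&`
      (fun w => clean (X w gIII) (X w gIII *m beta n + e w gIII) (selected (X w) (e w)) alpha) @^-1`
        [set D : {set 'I_(p n)} | ~~ (D \subset supp (beta n))]))); last first.
  by apply/seteqP; split => w /=; [case=> -[? ? ?] [? ? ?]|case=> -[[? ?] ?] [? [? ?]]]; do !split.
apply: measurableI; first by apply: measurableI; [exact: dmeas_pre|exact: measurable_RE].
apply: measurableI.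
  apply: measurable_forall => j; apply: measurable_le => //; apply: measurableT_comp => //.
  by apply: measurable_dot => //; exact: mmx_colof.
by apply: measurableI; [apply: measurable_lt => //; exact: measurable_dot|exact: dmeas_pre].
Qed.

Lemma cleaning_event_le (Q : nat) (kap th eta alpha L : R) :
  (0 < n)%N -> 0 < kap -> (2 * Q <= n)%N ->
  th ^+ 2 * Q%:R / kap <= eta * sigma ^+ 2 -> 0 < eta < 4^-1 -> 0 < alpha < 1 -> 0 < L ->
  2 * ln (2 * Q%:R / alpha) <= L ^+ 2 ->
  (P [set w | bad_cleaning Q kap th eta alpha (fun g => design S n g w) (fun g => noise_at S n g w)] <=
   (alpha * expR (L * (L * (2 * eta))) + 2 * Q%:R * expR (- (L - L * (2 * eta)) ^+ 2 / 2))%:E)%E.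
Proof.
move=> n0 kap0 Qn hthe heta hal L0 hL.
have b0 : 0 <= alpha * expR (L * (L * (2 * eta))) + 2 * Q%:R * expR (- (L - L * (2 * eta)) ^+ 2 / 2).
  by case/andP: hal => a0 _; rewrite addr_ge0 ?mulr_ge0 ?expR_ge0 // ltW.
apply: (noise_event_le hsplit hA1 (g := gIII) (@mevent_bad_cleaning Q kap th eta alpha)) => //.
move=> X e0 v gv.
have [[DM MQ hRE]|nM] := pselect [/\ supp (beta n) \subset selected X e0, (#|selected X e0| <= Q)%N & RE (X gIII) Q kap]; last first.
  rewrite (_ : mkset _ = set0) ?measure0 ?lee_fin //.
  by apply/seteqP; split => w //=; rewrite /bad_cleaning selected_upd => -[].
apply: le_trans (null_prob_le sigma0 gv n0 kap0 hRE DM MQ Qn hthe heta hal L0 hL).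
rewrite le_eqVlt; apply/orP; left; apply/eqP; congr (P _); apply/seteqP.
split => w /=; rewrite /bad_cleaning selected_upd /upd eqxx; first by case=> _ [? ? ?]; split.
by case=> ? ? ?; split.
Qed.

Lemma Dhat_cleaned alpha w : Dhat S n k alpha w =
  clean (design S n gIII w) (design S n gIII w *m beta n + noise_at S n gIII w)
    (selected (fun g => design S n g w) (fun g => noise_at S n g w)) alpha.
Proof. by rewrite /Dhat Shat_selected (resp_linear hA1). Qed.

Lemma dmeas_Shat : dmeas (fun w => Shat S n k w).
Proof.
rewrite (_ : (fun w => Shat S n k w) = (fun w => selected (fun g => design S n g w) (fun g => noise_at S n g w))).
  by apply: dmeas_selected => g; [exact: mmx_design|exact: mmx_noise_at].
by apply/funext => w; exact: Shat_selected.
Qed.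

Lemma dmeas_Dhat alpha : dmeas (fun w => Dhat S n k alpha w).
Proof.
rewrite (_ : (fun w => Dhat S n k alpha w) = (fun w => clean (design S n gIII w)
    (design S n gIII w *m beta n + noise_at S n gIII w)
    (selected (fun g => design S n g w) (fun g => noise_at S n g w)) alpha)).
  by apply: (dmeas_cleaned alpha (X := fun w g => design S n g w) (e := fun w g => noise_at S n g w)) => g; [exact: mmx_design|exact: mmx_noise_at].
by apply/funext => w; exact: Dhat_cleaned.
Qed.

Lemma dmeas_Shat_oracle : dmeas (fun w => Shat_at S n (lambda_star S beta n k w) w).
Proof.
have mX := mmx_design hsplit (n := n) gI.
have mY : mmx (fun w => resp S n gI w).
  rewrite (_ : (fun w => resp S n gI w) = (fun w => design S n gI w *m beta n + noise_at S n gI w)); last first.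
    by apply/funext => w; rewrite (resp_linear hA1).
  by apply: mmx_add; [apply: mmx_mul => //; exact: mmx_cst|exact: mmx_noise_at].
apply: (bind_dmeas (G := fun (l : 'I_k.+1) w => Shat_at S n l w)
   (F := fun w => oracle_lambda (design S n gI w) (resp S n gI w) (beta n) k)).
  exact: dmeas_oracle.
by move=> l; exact: dmeas_fs_set.
Qed.

End CleaningEvent.

(** * Events of probability tending to one *)

Section HighProbability.
Context {d} {T : measurableType d} {R : realType} (P : probability T R).
Implicit Types F G B : nat -> set T.

Definition whp F : Prop := (forall n, measurable (F n)) /\ P (F n) @[n --> \oo] --> 1%E.

Lemma whp_compl B (c : nat -> R) : (forall n, measurable (B n)) ->
  (\forall n \near \oo, (P (B n) <= (c n)%:E)%E) -> c n @[n --> \oo] --> (0 : R) ->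
  whp (fun n => ~` B n).
Proof.
move=> mB Bc c0; split => [n|]; first exact: measurableC.
have h1 : (1 - c n)%:E @[n --> \oo] --> (1%:E : \bar R).
  by apply: cvg_EFin; [exact: nearW|rewrite -[X in _ --> X]subr0; apply: cvgB => //; exact: cvg_cst].
apply: (squeeze_cvge _ h1 (cvg_cst _)); near=> n.
rewrite probability_le1 ?andbT; last exact: measurableC.
rewrite probability_setC // EFinB; apply: leeB => //; near: n; exact: Bc.
Unshelve. all: by end_near.
Qed.

Lemma whp_compl0 F : whp F -> fine (P (~` F n)) @[n --> \oo] --> (0 : R).
Proof.
move=> [mF F1].
have fP n : P (F n) \is a fin_num by exact: fin_num_measure.
have h : fine (P (F n)) @[n --> \oo] --> (1 : R) by exact: fine_cvg.
have -> : (fun n => fine (P (~` F n))) = (fun n => 1 - fine (P (F n))).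
  by apply/funext => n; rewrite probability_setC // fineB.
by rewrite -[X in _ --> X](subrr 1); apply: cvgB => //; exact: cvg_cst.
Qed.

Lemma whpI F G : whp F -> whp G -> whp (fun n => F n `&` G n).
Proof.
move=> hF hG; have [mF _] := hF; have [mG _] := hG.
have -> : (fun n => F n `&` G n) = (fun n => ~` (~` F n `|` ~` G n)).
  by apply/funext => n; rewrite setCU !setCK.
apply: (whp_compl (c := fun n => fine (P (~` F n)) + fine (P (~` G n)))).
- by move=> n; apply: measurableU; exact: measurableC.
- apply: nearW => n; rewrite EFinD !fineK; try (apply: fin_num_measure; exact: measurableC).
  by apply: measureU2; exact: measurableC.
- by rewrite -[X in _ --> X](addr0 0); apply: cvgD; exact: whp_compl0.
Qed.

Lemma whp_all (I : finType) (F : I -> nat -> set T) : (forall i, whp (F i)) ->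
  whp (fun n => [set w | forall i, F i n w]).
Proof.
move=> hF.
have -> : (fun n => [set w | forall i, F i n w]) = (fun n => ~` [set w | exists i, (~` F i n) w]).
  apply/funext => n; apply/seteqP; split => w /=; first by move=> h [i]; apply.
  by move=> h i; apply: contrapT => h'; apply: h; exists i.
apply: (whp_compl (c := fun n => \sum_i fine (P (~` F i n)))).
- by move=> n; apply: measurable_exists => i; apply: measurableC; have [] := hF i.
- apply: nearW => n; rewrite -sumEFin.
  apply: (@le_trans _ _ (\sum_i P (~` F i n))%E).
    apply: union_bound => [|i|w] //; last by apply: measurableC; have [] := hF i.
    by apply: measurable_exists => i; apply: measurableC; have [] := hF i.
  apply: lee_sum => i _; rewrite fineK //; apply: fin_num_measure; apply: measurableC; by have [] := hF i.
- have := @cvg_sumr R nat \oo _ I (fun i n => fine (P (~` F i n))) (fun=> 0) (fun i => whp_compl0 (hF i)).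
  have e0 : \sum_(i : I) (fun=> 0 : R) i = 0 by rewrite big1.
  by rewrite e0 => h; exact: h.
Qed.

Lemma whp_sub F G : whp F -> (forall n, measurable (G n)) ->
  (\forall n \near \oo, F n `<=` G n) -> P (G n) @[n --> \oo] --> 1%E.
Proof.
move=> [mF F1] mG FG; apply: (squeeze_cvge _ F1 (cvg_cst _)); near=> n.
rewrite probability_le1 // andbT; apply: measure_subset_le => //; near: n; exact: FG.
Unshelve. all: by end_near.
Qed.

Lemma whp_nonempty F : whp F -> \forall n \near \oo, exists w, F n w.
Proof.
move=> hF; have [mF _] := hF.
have : \forall n \near \oo, fine (P (~` F n)) < 1 by exact: cvgr_lt (whp_compl0 hF) _ ltr01.
apply: filterS => n h; apply: contrapT => no; move: h.
have -> : F n = set0 by apply/seteqP; split => w // Fw; exfalso; apply: no; exists w.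
by rewrite setC0 probability_setT ltxx.
Qed.

End HighProbability.

(** * Asymptotics *)

Section LogAsymptotics.
Context {R : realType}.
Local Notation l n := (ln (n%:R : R)).

Lemma log_ge (C : R) : \forall n \near \oo, C <= l n.
Proof.
near=> n; have n0 : (0 < n)%N by near: n; exact: nbhs_infty_gt.
rewrite -[leLHS]expRK ler_ln ?posrE ?expR_gt0 ?ltr0n //.
near: n; exact: nbhs_infty_ger.
Unshelve. all: by end_near.
Qed.

Lemma expR_log n : (0 < n)%N -> expR (l n) = n%:R.
Proof. by move=> n0; rewrite lnK // posrE ltr0n. Qed.

(** [expR (l n / 4)] is [n^(1/4)], the common yardstick: polylogarithmic factors are compared with
    it, exceptional noise probabilities with its inverse. One extra power of [l n] beats the
    constants. *)
Lemma polylog_le (C : R) m : \forall n \near \oo, C * l n ^+ m <= expR (l n / 4).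
Proof.
pose M := m.+1; have M0 : 0 < M%:R :> R by rewrite ltr0n.
near=> n.
have l0 : 0 <= l n by near: n; exact: log_ge.
have lC : C * (4 * M%:R) ^+ M <= l n by near: n; exact: log_ge.
have h1 : (l n / (4 * M%:R)) ^+ M <= expR (l n / 4).
  have -> : l n / 4 = M%:R * (l n / (4 * M%:R)) by field; rewrite gt_eqF.
  rewrite expRM_natl; apply: lerXn2r; rewrite ?nnegrE ?expR_ge0 ?divr_ge0 ?mulr_ge0 ?(ltW M0) //.
  by apply: le_trans (expR_ge1Dx _); rewrite lerDr.
apply: le_trans h1; rewrite expr_div_n ler_pdivlMr ?exprn_gt0 ?mulr_gt0 //.
rewrite [X in _ <= X]exprS mulrAC; apply: ler_wpM2r => //; exact: exprn_ge0.
Unshelve. all: by end_near.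
Qed.

Lemma expR_neg_log_cvg (C : R) : C * expR (- l n / 4) @[n --> \oo] --> (0 : R).
Proof.
rewrite -[X in _ --> X](mulr0 C); apply: cvgM; first exact: cvg_cst.
apply/cvgr0Pnorm_le => e e0; near=> n.
rewrite ger0_norm ?expR_ge0 // mulNr expRN -[leRHS]invrK lef_pV2 ?posrE ?expR_gt0 ?invr_gt0 //.
have h : e^-1 * l n ^+ 0 <= expR (l n / 4) by near: n; exact: polylog_le.
by rewrite expr0 mulr1 in h.
Unshelve. all: by end_near.
Qed.

Lemma rounds_bounds k (x : R) : rounds k x -> x - 1 < k%:R < x + 1.
Proof. by rewrite /rounds ltr_norml => /andP[h1 h2]; apply/andP; split; lra. Qed.

Lemma rounds_log_ge (q : nat -> nat) (c : R) (m : nat) : 0 < c ->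
  (forall n, rounds (q n) (c * l n)) -> \forall n \near \oo, (m <= q n)%N.
Proof.
move=> c0 hq; near=> n; have /andP[h _] := rounds_bounds (hq n).
rewrite -(ler_nat R); apply: ltW; apply: le_lt_trans h; rewrite lerBrDr -ler_pdivrMl //.
near: n; exact: log_ge.
Unshelve. all: by end_near.
Qed.

Lemma quarter_root_le n : (0 < n)%N -> expR (l n / 4) <= n%:R.
Proof.
move=> n0; rewrite -[X in _ <= X](expR_log n0) ler_expR.
have : 0 <= l n by apply: ln_ge0; rewrite ler1n.
lra.
Qed.

Lemma rounds_log_le (q : nat -> nat) (c : R) (m : nat) :
  (forall n, rounds (q n) (c * l n)) -> \forall n \near \oo, (m * q n <= n)%N.
Proof.
move=> hq; near=> n; have /andP[_ h] := rounds_bounds (hq n).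
have n0 : (0 < n)%N by near: n; exact: nbhs_infty_gt.
rewrite -(ler_nat R) natrM; apply: le_trans (quarter_root_le n0).
have l1 : 1 <= l n by near: n; exact: log_ge.
apply: (@le_trans _ _ (m%:R * (`|c| + 1) * l n ^+ 1)); last by near: n; exact: polylog_le.
rewrite expr1 -mulrA; apply: ler_wpM2l => //; apply: (le_trans (ltW h)).
rewrite mulrDl mul1r; apply: lerD => //; apply: ler_wpM2r; [lra|exact: ler_norm].
Unshelve. all: by end_near.
Qed.

(** Used at [x = log p]: the loss [expR (- c sqrt (log p))] in the count of large scores still
    leaves at least [sqrt p] of them. *)
Lemma sqrt_exp_le (c x : R) : 0 <= c -> 16 * c ^+ 2 <= x -> 8 <= x ->
  expR (x / 2) <= expR x / 4 * expR (- (c * Num.sqrt x)).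
Proof.
move=> c0 h1 h2; have x0 : 0 <= x by lra.
have h3 : c * Num.sqrt x <= x / 4.
  have h4 : 4 * c <= Num.sqrt x.
    rewrite -(@ler_pXn2r _ 2) ?nnegrE ?sqrtr_ge0 ?mulr_ge0 // sqr_sqrtr // exprMn; lra.
  have h5 := ler_wpM2r (sqrtr_ge0 x) h4.
  have h6 : Num.sqrt x * Num.sqrt x = x by rewrite -expr2 sqr_sqrtr.
  lra.
have e2 : expR (- 2) <= 4^-1 :> R.
  rewrite expRN lef_pV2 ?posrE ?expR_gt0 //.
  have -> : expR (2 : R) = expR 1 ^+ 2 by rewrite -expRM_natl mulr1.
  have h := expR_ge1Dx (1 : R).
  by rewrite expr2; nra.
have h7 : expR x * expR (- 2) <= expR x / 4 by rewrite ler_wpM2l // expR_ge0.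
apply: (@le_trans _ _ (expR x * expR (- 2) * expR (- (c * Num.sqrt x)))).
  by rewrite -!expRD ler_expR; lra.
by rewrite ler_wpM2r // expR_ge0.
Qed.

Lemma power_exp_le (a : R) (m : nat) : 0 < a -> expR (- (m%:R * ln a)) = (a ^+ m)^-1.
Proof. by move=> a0; rewrite expRN expRM_natl lnK // posrE. Qed.

End LogAsymptotics.

(** * Design conditions with high probability *)

Section DesignEvents.
Context {d} {T : measurableType d} {R : realType} (P : probability T R) (p : nat -> nat) (S : sample P p).
Hypotheses (hsplit : random_split S) (hp : forall n, (n < p n)%N).
Local Notation XD n w := (fun g => design S n g w).

Definition design_ok n (q : nat) (kap C0 B : R) (X : 'I_3 -> 'M[R]_(n, p n)) : Prop :=
  [/\ forall g, RE (X g) q kap, forall g, UP (X g) n C0, bounded B X &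
      forall g (M : {set 'I_(p n)}), (#|M| <= n)%N -> inj_on (X g) M].

(** A liminf of at least [kap] bounds the terms eventually by any smaller constant, hence [kap / 2];
    likewise [C0 + 1] in [UP_whp]. *)
Lemma RE_whp g (q : nat -> nat) (kap : R) : 0 < kap -> (\forall n \near \oo, (1 * q n <= n)%N) ->
  {ae P, forall w, (kap%:E <= limn_einf (fun n => (sparse_min_eig (design S n g w) (q n))%:E))%E} ->
  whp P (fun n => [set w | RE (design S n g w) (q n) (kap / 2)]).
Proof.
move=> k0 hq hae; have mF n : measurable [set w | RE (design S n g w) (q n) (kap / 2)].
  by apply: measurable_RE; exact: mmx_design.
split => //; apply: ae_near_prob => //; apply: filterS hae => w hw.
have h1 : \forall n \near \oo, kap / 2 <= sparse_min_eig (design S n g w) (q n).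
  by apply: limn_einf_near hw; lra.
near=> n; apply: (@RE_le _ _ _ _ _ _ (sparse_min_eig (design S n g w) (q n))).
  by near: n; exact: h1.
apply: sparse_min_RE; first by near: n; exact: nbhs_infty_gt.
apply: leq_trans (ltnW (hp n)); rewrite -[leqLHS]mul1n; near: n; exact: hq.
Unshelve. all: by end_near.
Qed.

Lemma UP_whp g (C0 : R) :
  {ae P, forall w, (limn_esup (fun n => (sparse_max_eig (design S n g w) n)%:E) <= C0%:E)%E} ->
  whp P (fun n => [set w | UP (design S n g w) n (C0 + 1)]).
Proof.
move=> hae; have mF n : measurable [set w | UP (design S n g w) n (C0 + 1)].
  by apply: measurable_UP; exact: mmx_design.
split => //; apply: ae_near_prob => //; apply: filterS hae => w hw.
have h1 : \forall n \near \oo, sparse_max_eig (design S n g w) n <= C0 + 1.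
  by apply: limn_esup_near hw; lra.
near=> n; apply: (@UP_le _ _ _ _ _ _ (sparse_max_eig (design S n g w) n)).
  by near: n; exact: h1.
by apply: sparse_max_UP; [near: n; exact: nbhs_infty_gt|exact: ltnW].
Unshelve. all: by end_near.
Qed.

Lemma whp_null (B : nat -> set T) : (forall n, measurable (B n)) ->
  (\forall n \near \oo, P (B n) = 0%E) -> whp P (fun n => ~` B n).
Proof.
move=> mB B0; apply: (whp_compl (c := fun=> 0)) => //; last exact: cvg_cst.
by apply: filterS B0 => n ->.
Qed.

Lemma measurable_bounded n (B : R) : measurable [set w | bounded B (XD n w)].
Proof. by apply: (mevent_bounded B (X := fun w => XD n w) (e := fun _ _ => 0)) => g; [exact: mmx_design|exact: mmx_cst]. Qed.

Lemma bounded_whp (B : R) : (forall n (i : 'I_(3 * n)) (j : 'I_(p n)),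
    P [set w | `|tnth (covariates S i w) j| <= B] = 1%E) ->
  whp P (fun n => [set w | bounded B (XD n w)]).
Proof.
move=> hB.
have -> : (fun n => [set w | bounded B (XD n w)]) = (fun n => ~` ~` [set w | bounded B (XD n w)]).
  by apply/funext => n; rewrite setCK.
have mcov n (i : 'I_(3 * n)) (j : 'I_(p n)) : measurable_fun setT (fun w => tnth (covariates S i w) j).
  exact: (measurableT_comp (measurable_tnth j) (measurable_funPT (covariates S i))).
apply: whp_null => [n|]; first by apply: measurableC; exact: measurable_bounded.
apply: nearW => n; apply/eqP; rewrite eq_le measure_ge0 andbT.
apply: (@le_trans _ _ (\sum_(ij : 'I_(3 * n) * 'I_(p n)) P (~` [set w | (`|tnth (covariates S ij.1 w) ij.2| <= B)%R]))%E).
  apply: union_bound.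
  - by apply: measurableC; exact: measurable_bounded.
  - move=> [i j]; apply: measurableC; apply: measurable_le => //; exact: measurableT_comp.
  move=> w /= nb; apply: contrapT => h; apply: nb => g i j; rewrite mxE leNgt; apply/negP => h'.
  by apply: h; exists (split_map S n w (g, i), j) => /=; rewrite leNgt h'.
rewrite big1 // => -[i j] _ /=; rewrite probability_setC ?hB ?subee //.
apply: measurable_le => //; exact: measurableT_comp.
Qed.

Lemma inj_whp g : (forall n, (0 < n)%N -> {ae P, forall w, 0 < sparse_min_eig (design S n g w) n}) ->
  whp P (fun n => [set w | forall M : {set 'I_(p n)}, (#|M| <= n)%N -> inj_on (design S n g w) M]).
Proof.
move=> hae.
set F := (F in whp P F).
have mF n : measurable (F n).
  apply: measurable_forall => M; have [Mn|Mn] := leqP #|M| n; last first.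
    by rewrite [X in measurable X](_ : _ = setT) //; apply/seteqP; split.
  (* Injectivity quantifies over all vectors; the determinant of the Gram matrix makes it
     measurable. *)
  rewrite [X in measurable X](_ : _ = ~` [set w | \det (gram (design S n g w) M) == 0]); last first.
    apply/seteqP; split => w /=.
      by move=> /(_ isT) /gram_unitP; rewrite unitmxE unitfE => /negP.
    by move=> /negP h _; apply/gram_unitP; rewrite unitmxE unitfE.
  by apply: measurableC; apply: measurable_eq0; apply: measurable_det; apply: mmx_gram; exact: mmx_design.
have -> : F = (fun n => ~` ~` F n) by apply/funext => n; rewrite setCK.
apply: whp_null => [n|]; first exact: measurableC.
near=> n; have n0 : (0 < n)%N by near: n; exact: nbhs_infty_gt.
have [N [mN N0 hN]] := hae n n0.
apply/eqP; rewrite eq_le measure_ge0 andbT -N0; apply: measure_subset_le => //; first exact: measurableC.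
move=> w nF; apply: hN => /= hpos; apply: nF => M Mn.
by apply: (RE_inj n0 hpos _ Mn); apply: sparse_min_RE => //; exact: ltnW.
Unshelve. all: by end_near.
Qed.

Lemma design_whp (C0 C1 kap B : R) (q : nat -> nat) : 0 < kap ->
  (forall n, rounds (q n) (C1 * ln n%:R)) ->
  (forall g : 'I_3,
        [/\ {ae P, forall w,
              (limn_esup (fun n => (sparse_max_eig (design S n g w) n)%:E) <= C0%:E)%E},
            {ae P, forall w,
              (kap%:E <= limn_einf (fun n =>
                 (sparse_min_eig (design S n g w) (q n))%:E))%E}
          & forall n, (0 < n)%N ->
              {ae P, forall w, 0 < sparse_min_eig (design S n g w) n}]) ->
  (forall n (i : 'I_(3 * n)) (j : 'I_(p n)), P [set w | `|tnth (covariates S i w) j| <= B] = 1%E) ->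
  whp P (fun n => [set w | design_ok (q n) (kap / 2) (C0 + 1) B (XD n w)]).
Proof.
move=> k0 hq h4 hB.
have h1 : whp P (fun n => [set w | forall g, RE (design S n g w) (q n) (kap / 2)]).
  by apply: whp_all => g; apply: RE_whp => //; [exact: (rounds_log_le 1 hq)|have [] := h4 g].
have h2 : whp P (fun n => [set w | forall g, UP (design S n g w) n (C0 + 1)]).
  by apply: whp_all => g; apply: UP_whp; have [] := h4 g.
have h3 : whp P (fun n => [set w | forall g (M : {set 'I_(p n)}), (#|M| <= n)%N -> inj_on (design S n g w) M]).
  by apply: whp_all => g; apply: inj_whp; have [] := h4 g.
have := whpI (whpI h1 h2) (whpI (bounded_whp hB) h3).
congr (whp P _); apply/funext => n; apply/seteqP; split => w /=; first by case=> -[? ?] [? ?]; split.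
by case.
Qed.

End DesignEvents.

(** * Deterministic conclusions on a good outcome *)

Section Core.
Context {R : realType} {n p : nat} (X : 'I_3 -> 'M[R]_(n, p)) (e : 'I_3 -> 'cV[R]_n) (beta : 'cV[R]_p).
Context (q K0 k : nat) (kap C0 B psi b1 th sigma om tau s L1 L2 zeta : R).
Hypotheses (n0 : (0 < n)%N) (p0 : (0 < p)%N) (kap0 : 0 < kap) (C00 : 0 < C0) (B0 : 0 < B) (psi0 : 0 < psi).
Hypothesis hRE : forall g, RE (X g) q kap.
Hypothesis hUP : forall g, UP (X g) n C0.
Hypothesis hB : bounded B X.
Hypothesis hinj : forall g (M : {set 'I_p}), (#|M| <= n)%N -> inj_on (X g) M.
Hypothesis hth : forall g j, `|dot (col j (X g)) (e g)| <= th * n%:R.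
Hypotheses (s0 : 0 < s) (s2 : s ^+ 2 = n%:R) (om0 : 0 < om) (tau0 : 0 <= tau).
Hypothesis htau : tau * om + 2 <= sigma ^+ 2 * tau ^+ 2 / 2 * kap.
Hypothesis hW : (lsum sigma (X gI) (tau / s) (e gI) - p%:R) ^+ 2 < (p%:R / 2) ^+ 2.
Hypothesis hn : dot (e gI) (e gI) <= 4 * n%:R * sigma ^+ 2.
Hypothesis hom : 4 * C0 * sigma ^+ 2 <= om ^+ 2.
Hypothesis q0 : (0 < q)%N.
Local Notation A := [set j | (om * s < dot (col j (X gI)) (e gI))%R]%SET.

Lemma scores_card_ge : p%:R / 4 * expR (- (tau * th * s)) <= #|A|%:R.
Proof.
apply: (large_scores_card (sigma := sigma) s0 s2 tau0 _ (hth gI) htau).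
  move=> j; have := hRE gI (_ : (#|[set j]%SET| <= q)%N) (suppin_delta (finset.set11 j)).
  rewrite cards1 => /(_ q0); rewrite mulmx_delta.
  have -> : dot (delta_mx j 0) (delta_mx j 0) = 1 :> R.
    rewrite /dot (bigD1 j) //= mxE !eqxx mulr1 big1 ?addr0 // => i /negbTE ij.
    by rewrite mxE ij mul0r.
  by rewrite mulr1.
have p2 : 0 <= p%:R / 2 :> R by rewrite divr_ge0.
move: hW; rewrite -[X in X < _]real_normK ?num_real // ltr_pXn2r ?nnegrE //.
by rewrite ltr_norml => /andP[h _]; lra.
Qed.

Lemma scores_card_lt : (#|A| < n)%N.
Proof. exact: (large_scores_lt n0 C00 (hUP gI) s0 s2 om0 hom hn). Qed.

Hypothesis hpsi : forall j, j \in supp beta -> psi <= `|beta j 0|.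
Hypothesis hb1 : \sum_j `|beta j 0| = b1.
Local Notation Q0 := (K0 + #|supp beta|)%N.
Hypotheses (th1 : 0 <= th <= 1) (th_small : 16 * Q0%:R * th ^+ 2 <= kap ^+ 2 * psi ^+ 2).
Hypothesis th_small2 : 2 * cv_const Q0 kap B * th ^+ 2 < kap * psi ^+ 2.
(** The empty support is separate: then [b1 = 0], and [drop_rate] is [0] by the convention on
    division, so no [K0] meets the inequality. *)
Hypothesis hK0 : supp beta = finset.set0 \/ 2 * b1 + B ^+ 2 * b1 ^+ 2 < K0%:R * drop_rate kap psi B b1.
Hypotheses (Q0q : (Q0 <= q)%N) (K0k : (K0 <= k)%N) (kn : (k <= n)%N) (qn : (q <= n)%N).
Hypothesis Abig : 4 * C0 * (th ^+ 2 * n%:R * q%:R / kap) < p%:R / 4 * expR (- (tau * th * s)) * om ^+ 2.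
Hypothesis hL1 : forall (M : {set 'I_p}) j, (#|M| <= k)%N ->
  dot (residual (X gI) (col j (X gI)) M) (e gI) ^+ 2 <=
  L1 * dot (residual (X gI) (col j (X gI)) M) (residual (X gI) (col j (X gI)) M).
Hypothesis hL2 : forall (M : {set 'I_p}) i j, (#|M| <= k)%N ->
  dot (swap_res X M i) (contrast X j) ^+ 2 <= L2 * dot (swap_res X M i) (swap_res X M i).
Let Y g := X g *m beta + e g.
Hypothesis hz : forall l, (l <= k)%N ->
  dot (X gII *m (beta - fs_coef (X gI) (Y gI) l)) (e gII) ^+ 2 <=
  zeta * dot (X gII *m (beta - fs_coef (X gI) (Y gI) l)) (X gII *m (beta - fs_coef (X gI) (Y gI) l)).
Hypotheses (L10 : 0 <= L1) (L20 : 0 <= L2) (zeta0 : 0 <= zeta).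
Let Amax := 2 * (n%:R * th ^+ 2 * cv_const Q0 kap B) + 16 * zeta.
Hypothesis final : 2 * q%:R * (k%:R * L2 * (k%:R * L1 + Amax)) / (kap * n%:R) + 2 * Amax * C0 / kap
   < (q - K0)%N%:R * (om ^+ 2 / (4 * B ^+ 2)).

(** Screening uses the fixed sparsity [Q0], so that its smallness conditions on [th] do not grow
    with [n]; the size bound uses [q]. The lower count of large scores supplies [Abig], and the
    upper count keeps them within reach of the eigenvalue bound on [n] columns. *)
Lemma core : [/\ supp beta \subset fs_set (X gI) (Y gI) (oracle_lambda (X gI) (Y gI) beta k),
  supp beta \subset fs_set (X gI) (Y gI) (cv_lambda (X gI) (Y gI) (X gII) (Y gII) k) &
  (cv_lambda (X gI) (Y gI) (X gII) (Y gII) k <= q)%N].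
Proof.
have RE0 g : RE (X g) Q0 kap := RE_leq Q0q (hRE g).
have th0 : 0 <= th by case/andP: th1.
have DK0 : supp beta \subset fs_set (X gI) (Y gI) K0.
  case: hK0 => [->|hK]; first exact: finset.sub0set.
  exact: (supp_sub_fs_set n0 p0 kap0 psi0 B0 (hB gI) hpsi hb1 (RE0 gI) (hth gI) th_small th1 (leqnn _) hK).
split.
- exact: (oracle_contains n0 kap0 psi0 hpsi (RE0 gI) (hth gI) th_small K0k (leqnn _) DK0).
- exact: (cv_contains n0 kap0 psi0 B0 (hB gII) hpsi (RE0 gI) (RE0 gII) (hth gI) (hth gII) th0 th_small K0k (leqnn _) DK0 th_small2).
have cv0 : 0 <= cv_const Q0 kap B.
  apply: addr_ge0; first by apply: divr_ge0; [exact: mulr_ge0 (sqr_ge0 _) (sqr_ge0 _)|exact: sqr_ge0].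
  by apply: divr_ge0; [exact: mulr_ge0|exact: ltW].
have K0q : (K0 <= q)%N by apply: leq_trans (leq_addr _ _) Q0q.
have hAj j : j \in A -> om ^+ 2 * n%:R <= dot (col j (X gI)) (e gI) ^+ 2.
  rewrite inE => h; rewrite -s2 -exprMn.
  have os : 0 <= om * s by rewrite mulr_ge0 // ltW.
  by rewrite ler_pXn2r ?nnegrE ?(ltW h) // (le_trans os (ltW h)).
have Abig' : 4 * C0 * (th ^+ 2 * n%:R * q%:R / kap) < #|A|%:R * om ^+ 2.
  by apply: (lt_le_trans Abig); apply: ler_wpM2r; [exact: sqr_ge0|exact: scores_card_ge].
have cvx : cv_excess (X gI) (X gII) beta (e gI) (e gII) (cv_lambda (X gI) (Y gI) (X gII) (Y gII) k) <=
    n%:R * th ^+ 2 * cv_const Q0 kap B.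
  apply: le_trans (cv_min_le _ _ _ _ _ n0 K0k) _.
  exact: (cv_excess_K0 n0 kap0 B0 (hB gII) (RE0 gI) (hth gI) (hth gII) th0 (leqnn _) DK0).
apply: (cv_lambda_le n0 p0 kap0 B0 C00 (hB gI) (hRE gI) (hUP gI) (hUP gII) (hth gI) (ltnW scores_card_lt)
  hAj Abig' _ hL1 hL2 L10 L20 zeta0 _ hz K0q (leqnn _) qn DK0 cvx).
- by move=> M Mk; apply: hinj; exact: leq_trans kn.
- by rewrite mulr_ge0 // mulr_ge0 ?sqr_ge0.
- exact: final.
Qed.

End Core.

(** * Noise events with high probability *)

Section NoiseEventsWhp.
Context {d} {T : measurableType d} {R : realType} (P : probability T R) (p : nat -> nat) (S : sample P p).
Context (beta : forall n, 'cV[R]_(p n)) (sigma : R).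
Hypotheses (hp : forall n, (n < p n)%N).
Hypotheses (hiid : iid_observations S) (hsplit : random_split S) (hA1 : assumption_A1 S beta sigma).
Hypothesis sigma0 : 0 < sigma.
Context (k : nat -> nat) (A : R).
Hypothesis hk : forall n, rounds (k n) (A * ln n%:R).
Local Notation l n := (ln (n%:R : R)).
Local Notation XD n w := (fun g => design S n g w).

(** The noise events below all fail with probability [O(n^(-1/4))]; sharper bounds are weakened to
    this form. *)
Lemma whp_log (B : nat -> set T) (C : R) : (forall n, measurable (B n)) ->
  (\forall n \near \oo, (P (B n) <= (C * expR (- l n / 4))%:E)%E) -> whp P (fun n => ~` B n).
Proof. by move=> mB hB; apply: whp_compl hB _ => //; exact: expR_neg_log_cvg. Qed.

Lemma quarter_inv_ge (n : nat) (a : R) : (0 < n)%N -> n%:R <= a -> a^-1 <= expR (- l n / 4).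
Proof.
move=> n0 na; have ap : 0 < a by apply: lt_le_trans na; rewrite ltr0n.
rewrite mulNr expRN lef_pV2 ?posrE ?expR_gt0 //; exact: le_trans (quarter_root_le _) na.
Qed.

Let s22 : 0 < 2 * sigma ^+ 2. Proof. by rewrite mulr_gt0 // exprn_gt0. Qed.

Let tail_exp (m : nat) (a : R) : 0 < a ->
  expR (- (2 * sigma ^+ 2 * m%:R * ln a) / (2 * sigma ^+ 2)) = (a ^+ m)^-1.
Proof.
move=> a0; rewrite -power_exp_le //; congr expR; field; by rewrite gt_eqF.
Qed.

Lemma scores_whp g : whp P (fun n => ~` [set w | exists j,
   2 * sigma ^+ 2 * 2 * ln (p n)%:R * dot (col j (design S n g w)) (col j (design S n g w)) <
   dot (col j (design S n g w)) (noise_at S n g w) ^+ 2]).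
Proof.
apply: (whp_log (C := 2)) => [n|].
  apply: measurable_exists => j; have mX := mmx_design hsplit (n := n) g; have me := mmx_noise_at hsplit (n := n) g.
  apply: measurable_lt; last by apply: measurable_funX; apply: measurable_dot => //; exact: mmx_colof.
  by apply: measurable_funM => //; apply: measurable_dot; exact: mmx_colof.
near=> n; have n0 : (0 < n)%N by near: n; exact: nbhs_infty_gt.
have pp : 0 < (p n)%:R :> R by rewrite ltr0n (leq_trans _ (hp n)).
apply: le_trans (scores_event_le hsplit hA1 sigma0 n g _) _.
  apply: mulr_ge0; first exact: mulr_ge0 (ltW s22) (ler0n _ _).
  by rewrite ln_ge0 // ler1n -(ltr0n R).
(* At level [4 sigma^2 log p] each column has probability at most [2 p^(-2)], and the union over [p]
   columns leaves [2 / p]. *)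
rewrite lee_fin tail_exp //; apply: (@le_trans _ _ (2 * (p n)%:R^-1)).
  by rewrite le_eqVlt; apply/orP; left; apply/eqP; field; rewrite gt_eqF.
by apply: ler_wpM2l => //; apply: quarter_inv_ge => //; rewrite ler_nat ltnW.
Unshelve. all: by end_near.
Qed.

Lemma norm_upper_whp g : whp P (fun n => ~` [set w | 4 * n%:R * sigma ^+ 2 <= dot (noise_at S n g w) (noise_at S n g w)]).
Proof.
apply: (whp_log (C := 1)) => [n|].
  by have me := mmx_noise_at hsplit (n := n) g; apply: measurable_le => //; exact: measurable_dot.
near=> n; have n0 : (0 < n)%N by near: n; exact: nbhs_infty_gt.
apply: le_trans (noise_norm_upper_le hsplit hA1 sigma0 n g) _; rewrite lee_fin mul1r ler_expR.
have : l n <= n%:R by rewrite -[X in _ <= X](expR_log n0); have := expR_ge1Dx (l n); lra.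
have : 0 <= n%:R :> R by [].
lra.
Unshelve. all: by end_near.
Qed.

(** With [eta = n^(-1/4)] the exponent [n eta^3 / 4 = n^(1/4) / 4] still exceeds [(log n) / 4]. *)
Lemma norm_lower_whp g : whp P (fun n => ~` [set w | dot (noise_at S n g w) (noise_at S n g w) <=
   n%:R * sigma ^+ 2 * (1 - expR (- l n / 4))]).
Proof.
apply: (whp_log (C := 1)) => [n|].
  by have me := mmx_noise_at hsplit (n := n) g; apply: measurable_le => //; exact: measurable_dot.
near=> n; have n0 : (0 < n)%N by near: n; exact: nbhs_infty_gt.
have l0 : 0 <= l n by near: n; exact: log_ge.
have h1 : 1 * l n ^+ 1 <= expR (l n / 4) by near: n; exact: polylog_le.
apply: le_trans (noise_norm_lower_le hsplit hA1 sigma0 n g _) _.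
  by rewrite expR_gt0 /= -[X in _ <= X]expR0 ler_expR; lra.
rewrite lee_fin mul1r ler_expR.
have -> : - n%:R * expR (- l n / 4) ^+ 3 / 4 = - expR (l n / 4) / 4.
  rewrite !mulNr; congr (- (_ / _)); rewrite -{1}(expR_log n0) -expRM_natl -expRD; congr expR; lra.
rewrite mul1r expr1 in h1; lra.
Unshelve. all: by end_near.
Qed.

Lemma likelihood_whp (C0 B tau : R) : 0 <= C0 -> 0 < B ->
  whp P (fun n => ~` [set w | (UP (design S n gI w) n C0 /\ bounded B (XD n w)) /\
     ((p n)%:R / 2) ^+ 2 <= (lsum sigma (design S n gI w) (tau / expR (l n / 2)) (noise_at S n gI w) - (p n)%:R) ^+ 2]).
Proof.
move=> C00 B0; set K := 2 * (sigma ^+ 2 * tau ^+ 2 * expR (sigma ^+ 2 * tau ^+ 2 * B ^+ 2) * (2 * C0 * B ^+ 2 + 1)).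
have K0 : 0 <= K.
  apply: mulr_ge0 => //; apply: mulr_ge0; last by rewrite addr_ge0 // mulr_ge0 ?sqr_ge0 // mulr_ge0.
  by apply: mulr_ge0; [exact: mulr_ge0 (sqr_ge0 _) (sqr_ge0 _)|exact: expR_ge0].
apply: (whp_log (C := K)) => [n|].
  have mX := mmx_design hsplit (n := n) gI; have me := mmx_noise_at hsplit (n := n) gI.
  apply: measurableI; first by apply: measurableI; [exact: measurable_UP|exact: measurable_bounded].
  apply: measurable_le => //; apply: measurable_funX; apply: measurable_funB => //; apply: measurable_sum => j.
  apply: measurableT_comp => //.
  by apply: measurable_funB; apply: measurable_funM => //; apply: measurable_dot => //; exact: mmx_colof.
near=> n; have n0 : (0 < n)%N by near: n; exact: nbhs_infty_gt.
have l0 : 0 <= l n by near: n; exact: log_ge.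
apply: le_trans (likelihood_event_le hsplit hA1 sigma0 tau n0 (ltnW (hp n)) C00 B0 (expR_gt0 (l n / 2)) _) _.
  by rewrite -expRM_natl -[RHS](expR_log n0); congr expR; lra.
rewrite lee_fin -/K -expRN; apply: ler_wpM2l => //; rewrite ler_expR; lra.
Unshelve. all: by end_near.
Qed.

(** There are [(p + 1)^k p] pairs of a coded set and a column; the multiplier [k + 2] of
    [log (p + 1)] leaves a probability of at most [2 / (p + 1)]. *)
Lemma residuals_whp g : whp P (fun n => ~` [set w | exists z : {ffun 'I_(k n) -> option 'I_(p n)} * 'I_(p n),
      2 * sigma ^+ 2 * (k n + 2)%:R * ln (p n).+1%:R * dot (residual (design S n g w) (col z.2 (design S n g w)) (decode z.1))
               (residual (design S n g w) (col z.2 (design S n g w)) (decode z.1)) <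
       dot (residual (design S n g w) (col z.2 (design S n g w)) (decode z.1)) (noise_at S n g w) ^+ 2]).
Proof.
apply: (whp_log (C := 2)) => [n|].
  have mX := mmx_design hsplit (n := n) g; have me := mmx_noise_at hsplit (n := n) g.
  have mr (z : {ffun 'I_(k n) -> option 'I_(p n)} * 'I_(p n)) :
      mmx (fun w => residual (design S n g w) (col z.2 (design S n g w)) (decode z.1)).
    by apply: mmx_residual => //; exact: mmx_colof.
  apply: measurable_exists => z; apply: measurable_lt; last by apply: measurable_funX; exact: measurable_dot.
  by apply: measurable_funM => //; exact: measurable_dot.
near=> n; have n0 : (0 < n)%N by near: n; exact: nbhs_infty_gt.
apply: le_trans (residuals_event_le hsplit hA1 sigma0 n g (k n) _) _.
  apply: mulr_ge0; first exact: mulr_ge0 (ltW s22) (ler0n _ _).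
  by rewrite ln_ge0 // ler1n.
rewrite lee_fin tail_exp // natrM natrX exprD.
apply: (@le_trans _ _ (2 * (p n).+1%:R^-1)); last first.
  by apply: ler_wpM2l => //; apply: quarter_inv_ge => //; rewrite ler_nat ltnW // ltnS ltnW.
have pk : 0 < (p n).+1%:R ^+ k n :> R by rewrite exprn_gt0.
have -> : (p n).+1%:R ^+ k n * (p n)%:R * (2 * ((p n).+1%:R ^+ k n * (p n).+1%:R ^+ 2)^-1) =
   2 * (p n).+1%:R^-1 * ((p n)%:R / (p n).+1%:R) :> R.
  by field; rewrite (gt_eqF pk) gt_eqF.
rewrite ler_piMr ?mulr_ge0 ?invr_ge0 // ler_pdivrMr // mul1r ler_nat //.
Unshelve. all: by end_near.
Qed.

(** The factor [8] undoes the exponent [L / 8] of the Rademacher bound, and [k + 3] pays for the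
    coded set, two columns and one spare power of [p + 1]. *)
Lemma swap_whp (B : R) : 0 < B ->
  whp P (fun n => ~` [set w | bounded B (XD n w) /\
    swap_bad (k n) (8 * (k n + 3)%:R * ln (p n).+1%:R * (2 * B ^+ 2)) (XD n w)]).
Proof.
move=> B0; apply: (whp_log (C := 2)) => [n|].
  apply: measurableI; first exact: measurable_bounded.
  have mX := mmx_design hsplit (n := n).
  exact: (mevent_swap_bad (X := fun w => XD n w) (e := fun _ _ => 0) _ _ (fun g => mX g) (fun g => mmx_cst _)).
near=> n; have n0 : (0 < n)%N by near: n; exact: nbhs_infty_gt.
have lp0 : 0 <= ln (p n).+1%:R :> R by rewrite ln_ge0 // ler1n.
apply: le_trans (swap_event_prob_le hiid hsplit hA1 n (k n) B0 _) _.
  by rewrite mulr_ge0 // mulr_ge0.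
rewrite lee_fin.
have -> : - (8 * (k n + 3)%:R * ln (p n).+1%:R) / 8 = - ((k n + 3)%:R * ln (p n).+1%:R) :> R by lra.
rewrite power_exp_le // !natrM natrX exprD.
apply: (@le_trans _ _ (2 * (p n).+1%:R^-1)); last first.
  by apply: ler_wpM2l => //; apply: quarter_inv_ge => //; rewrite ler_nat ltnW // ltnS ltnW.
have pk : 0 < (p n).+1%:R ^+ k n :> R by rewrite exprn_gt0.
have -> : (p n).+1%:R ^+ k n * ((p n)%:R * (p n)%:R) * (2 * ((p n).+1%:R ^+ k n * (p n).+1%:R ^+ 3)^-1) =
   2 * (p n).+1%:R^-1 * (((p n)%:R / (p n).+1%:R) ^+ 2) :> R.
  by field; rewrite (gt_eqF pk) gt_eqF.
rewrite ler_piMr ?mulr_ge0 ?invr_ge0 // expr_le1 ?divr_ge0 //.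
by rewrite ler_pdivrMr // mul1r ler_nat.
Unshelve. all: by end_near.
Qed.

(** The union has [k + 1 = O(log n)] terms, so the level is a multiple of [log n] and not of
    [k log p]. This keeps the excess validation loss of order [log n]. *)
Lemma validation_whp : whp P (fun n => ~` [set w | exists j : 'I_(k n).+1,
      2 * sigma ^+ 2 * 1 * l n * dot (design S n gII w *m (beta n - fs_coef (design S n gI w) (resp S n gI w) j))
               (design S n gII w *m (beta n - fs_coef (design S n gI w) (resp S n gI w) j)) <
       dot (design S n gII w *m (beta n - fs_coef (design S n gI w) (resp S n gI w) j)) (noise_at S n gII w) ^+ 2]).
Proof.
apply: (whp_log (C := 1)) => [n|].
  have mX g := mmx_design hsplit (n := n) g; have me g := mmx_noise_at hsplit (n := n) g.
  have mY g : mmx (fun w => resp S n g w).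
    have -> : (fun w => resp S n g w) = (fun w => design S n g w *m beta n + noise_at S n g w).
      by apply/funext => w; rewrite (resp_linear hA1).
    by apply: mmx_add => //; apply: mmx_mul => //; exact: mmx_cst.
  have mr (j : 'I_(k n).+1) : mmx (fun w => design S n gII w *m (beta n - fs_coef (design S n gI w) (resp S n gI w) j)).
    by apply: mmx_mul => //; apply: mmx_sub; [exact: mmx_cst|exact: mmx_fs_coef].
  apply: measurable_exists => j; apply: measurable_lt; last by apply: measurable_funX; exact: measurable_dot.
  by apply: measurable_funM => //; exact: measurable_dot.
near=> n; have n0 : (0 < n)%N by near: n; exact: nbhs_infty_gt.
have l1 : 1 <= l n by near: n; exact: log_ge.
have nn : 0 < n%:R :> R by rewrite ltr0n.
apply: le_trans (validation_event_le hsplit hA1 sigma0 n (k n) _) _.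
  apply: mulr_ge0; [exact: mulr_ge0 (ltW s22) ler01|lra].
have tE : expR (- (2 * sigma ^+ 2 * 1 * l n) / (2 * sigma ^+ 2)) = n%:R^-1 by exact: (tail_exp 1 nn).
rewrite lee_fin tE mul1r.
have /andP[_ hkn] := rounds_bounds (hk n).
have h1 : 2 * (`|A| + 2) * l n ^+ 1 <= expR (l n / 4) by near: n; exact: polylog_le.
have h2 : (k n).+1%:R <= (`|A| + 2) * l n.
  have : A * l n <= `|A| * l n by apply: ler_wpM2r; [lra|exact: ler_norm].
  by rewrite -natr1; lra.
have -> : (k n).+1%:R * (2 * n%:R^-1) = 2 * (k n).+1%:R / n%:R :> R by ring.
rewrite ler_pdivrMr // -(expR_log n0) expRK -expRD.
apply: (@le_trans _ _ (expR (l n / 4))); first by apply: le_trans h1; rewrite expr1; lra.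
by rewrite ler_expR; lra.
Unshelve. all: by end_near.
Qed.

End NoiseEventsWhp.

(** * Limits and numerical bounds *)

Section LimitBounds.
Context {R : realType}.
Implicit Types u : nat -> \bar R.

Lemma limn_einf_ge u (a : R) :
  (forall eps : R, 0 < eps -> \forall n \near \oo, ((a - eps)%:E <= u n)%E) -> (a%:E <= limn_einf u)%E.
Proof.
move=> h; rewrite limn_einf_lim; have /cvg_lim -> // := @cvg_einfs_sup R u.
apply/lee_addgt0Pr => eps e0; have [N _ hN] := h _ e0.
have -> : a%:E = ((a - eps)%:E + eps%:E)%E by rewrite -EFinD subrK.
apply: leeD => //; apply: (@le_trans _ _ (einfs u N)); last by apply: ereal_sup_ubound; exists N.
by apply: le_ereal_inf_tmp => _ /= [n Nn <-]; exact: hN.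
Qed.

Lemma limn_esup_le u (a : R) :
  (forall eps : R, 0 < eps -> \forall n \near \oo, (u n <= (a + eps)%:E)%E) -> (limn_esup u <= a%:E)%E.
Proof.
move=> h; rewrite -leeN2 -limn_einfN; apply: (@limn_einf_ge _ (- a)) => eps e0.
by apply: filterS (h _ e0) => n hn /=; rewrite -opprD EFinN leeN2.
Qed.

End LimitBounds.

Section NumericBounds.
Context {R : realType}.

(** Count of logarithms: [q], [k] and [L2] contribute [1 + 1 + 2] and [k L1 + Am] at most [3],
    whence the power [7], negligible against [n]. *)
Lemma final_num (q k L1 L2 Am l n kap cq ck c1 c2 ca : R) :
  0 <= q -> 0 <= k -> 0 <= L1 -> 0 <= L2 -> 0 <= Am -> 1 <= l -> 0 < kap -> 0 < n ->
  0 <= cq -> 0 <= ck -> 0 <= c1 -> 0 <= c2 -> 0 <= ca ->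
  q <= cq * l -> k <= ck * l -> L1 <= c1 * l ^+ 2 -> L2 <= c2 * l ^+ 2 -> Am <= ca * l ->
  2 * cq * ck * c2 * (ck * c1 + ca) / kap * l ^+ 7 <= n ->
  2 * q * (k * L2 * (k * L1 + Am)) / (kap * n) <= 1.
Proof.
move=> q0 k0 L10 L20 A0 l1 kp np cq0 ck0 c10 c20 ca0 hq hk h1 h2 hA hn.
have l0 : 0 <= l by lra.
have g1 : k * L1 <= ck * l * (c1 * l ^+ 2) by apply: ler_pM.
have g2 : k * L2 <= ck * l * (c2 * l ^+ 2) by apply: ler_pM.
have g3 : Am <= ca * l ^+ 3.
  apply: (le_trans hA); apply: ler_wpM2l => //.
  by rewrite -[leLHS]mulr1 exprS ler_wpM2l // -(expr1n _ 2) lerXn2r ?nnegrE.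
have g4 : k * L2 * (k * L1 + Am) <= ck * l * (c2 * l ^+ 2) * (ck * l * (c1 * l ^+ 2) + ca * l ^+ 3).
  apply: ler_pM => //; [exact: mulr_ge0|by apply: addr_ge0 => //; exact: mulr_ge0|exact: lerD].
have g5 : 2 * q * (k * L2 * (k * L1 + Am)) <= 2 * (cq * l) * (ck * l * (c2 * l ^+ 2) * (ck * l * (c1 * l ^+ 2) + ca * l ^+ 3)).
  apply: ler_pM => //; first exact: mulr_ge0.
  - by apply: mulr_ge0; [exact: mulr_ge0|apply: addr_ge0 => //; exact: mulr_ge0].
  - by apply: ler_wpM2l.
rewrite ler_pdivrMr ?mulr_gt0 // mul1r; apply: (le_trans g5).
have -> : 2 * (cq * l) * (ck * l * (c2 * l ^+ 2) * (ck * l * (c1 * l ^+ 2) + ca * l ^+ 3)) =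
  kap * (2 * cq * ck * c2 * (ck * c1 + ca) / kap * l ^+ 7) by field; rewrite gt_eqF.
by apply: ler_wpM2l => //; exact: ltW.
Qed.

Lemma min_abs_pos (s : nat) (b : nat -> R) : (forall i, (i < s)%N -> b i != 0) ->
  exists2 psi : R, 0 < psi & forall i, (i < s)%N -> psi <= `|b i|.
Proof.
elim: s => [_|s IH h]; first by exists 1.
have [psi p0 hpsi] := IH (fun i is_ => h i (ltnW is_)).
exists (Num.min psi `|b s|); first by rewrite lt_min p0 normr_gt0 h.
move=> i; rewrite ltnS leq_eqVlt => /orP[/eqP ->|/hpsi hi]; first by rewrite ge_min lexx orbT.
by rewrite ge_min hi.
Qed.

Lemma nat_above (x y : R) : 0 < y -> exists K : nat, x < K%:R * y.
Proof.
move=> y0; exists (Num.truncn (`|x| / y)).+1; rewrite -ltr_pdivrMr //.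
apply: le_lt_trans (real_truncnS_gt (num_real _)); apply: ler_wpM2r; [by rewrite invr_ge0 ltW|exact: ler_norm].
Qed.

End NumericBounds.

Section FixedSignal.
Context {R : realType} (p : nat -> nat) (beta : forall n, 'cV[R]_(p n)) (s : nat) (b : nat -> R).
Hypothesis hA3 : assumption_A3 beta s b.

Lemma signal_size n : (0 < n)%N -> (s <= p n)%N.
Proof.
by move=> /hA3 [_ <- _ _]; rewrite -[leqRHS]card_ord; exact: max_card.
Qed.

Lemma signal_neq0 i : (i < s)%N -> b i != 0.
Proof.
(* Any positive sample size reveals the common coefficients; here [n = 1]. *)
move=> is_; have [sE _ bE _] := hA3 (ltn0Sn 0).
pose j := Ordinal (leq_trans is_ (signal_size (ltn0Sn 0))).
have js : j \in supp (beta 1%N) by rewrite sE inE.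
by have := bE j js => /= <-; move: js; rewrite inE.
Qed.

Lemma signal_l1 n : (0 < n)%N -> \sum_j `|beta n j 0| = \sum_(i < s) `|b i|.
Proof.
move=> n0; have [sE _ bE _] := hA3 n0.
rewrite (big_ord_widen (p n) (fun i => `|b i|) (signal_size n0)) [RHS]big_mkcond /=.
apply: eq_bigr => j _; case: ifP => js; first by rewrite bE // sE inE.
by have : j \notin supp (beta n); [rewrite sE inE js|rewrite inE negbK => /eqP ->; rewrite normr0].
Qed.

End FixedSignal.

(** * Selection for all large sample sizes *)

Section Assembly.
Context {d} {T : measurableType d} {R : realType} (P : probability T R) (p : nat -> nat) (S : sample P p).
Context (beta : forall n, 'cV[R]_(p n)) (s : nat) (b : nat -> R) (sigma A : R) (k q : nat -> nat).
Context (C0 C1 kap B : R).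
Hypotheses (hp : forall n, (n < p n)%N) (hiid : iid_observations S) (hsplit : random_split S).
Hypotheses (sigma0 : 0 < sigma) (hA1 : assumption_A1 S beta sigma) (hA3 : assumption_A3 beta s b).
Hypotheses (A0 : 0 < A) (hk : forall n, rounds (k n) (A * ln n%:R)).
Hypotheses (C00 : 0 < C0) (C10 : 0 < C1) (kap0 : 0 < kap) (B0 : 0 < B).
Hypothesis hq : forall n, rounds (q n) (C1 * ln n%:R).
Hypothesis hdes : whp P (fun n => [set w | design_ok (q n) kap C0 B (fun g => design S n g w)]).
Local Notation l n := (ln (n%:R : R)).
Local Notation lp n := (ln ((p n)%:R : R)).
Local Notation XD n w := (fun g => design S n g w).
Local Notation ZD n w := (fun g => noise_at S n g w).

(** Equal to [2 B sigma sqrt (log p / n)]: columns have norm at most [B sqrt n], and normalized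
    scores stay below [2 sigma sqrt (log p)]. Here [sqrt n] is written [expR (l n / 2)]. *)
Definition theta n : R := B * (2 * sigma) * Num.sqrt (lp n) / expR (l n / 2).

Lemma expR_half_sqr n : (0 < n)%N -> expR (l n / 2) ^+ 2 = n%:R.
Proof. by move=> n0; rewrite -expRM_natl -[RHS](expR_log n0); congr expR; lra. Qed.

Lemma lp_ge n : (0 < n)%N -> l n <= lp n.
Proof.
by move=> n0; rewrite ler_ln ?posrE ?ltr0n ?(leq_trans n0) ?ler_nat //; exact: ltnW.
Qed.

Lemma lp_ge0 n : (0 < n)%N -> 0 <= lp n.
Proof. by move=> n0; apply: ln_ge0; rewrite ler1n (leq_trans n0) // ltnW. Qed.

Lemma theta_ge0 n : 0 <= theta n.
Proof.
rewrite /theta; apply: divr_ge0; last exact: expR_ge0.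
by apply: mulr_ge0; [apply: mulr_ge0; [exact: ltW|apply: mulr_ge0 => //; exact: ltW]|exact: sqrtr_ge0].
Qed.

Lemma theta_sqr n : (0 < n)%N -> theta n ^+ 2 * n%:R = 4 * B ^+ 2 * sigma ^+ 2 * lp n.
Proof.
move=> n0; rewrite /theta -[X in _ * X = _](expR_half_sqr n0).
have h : expR (l n / 2) != 0 by rewrite gt_eqF // expR_gt0.
rewrite -[X in _ = _ * X](sqr_sqrtr (lp_ge0 n0)); by field.
Qed.

Variables (K0 : nat) (omega tau psi : R).
Hypothesis psi0 : 0 < psi.
Hypothesis hpsi : forall i, (i < s)%N -> psi <= `|b i|.
Local Notation b1 := (\sum_(i < s) `|b i|).
Hypothesis hK0 : s = 0%N \/ 2 * b1 + B ^+ 2 * b1 ^+ 2 < K0%:R * drop_rate kap psi B b1.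
Local Notation Q0 := (K0 + s)%N.
Local Notation cvc := (cv_const Q0 kap B).
Local Notation ca := (16 * B ^+ 2 * sigma ^+ 2 * cvc + 32 * sigma ^+ 2).
Hypotheses (om1 : 1 <= omega) (om2 : 4 * C0 * sigma ^+ 2 <= omega ^+ 2).
(** Both sides of [final] are of order [log n]: [ca] bounds [Amax / log n], the [1] absorbs the
    first term, and [C1 / 2] bounds [(q - K0) / log n] from below. Hence [omega] must be large. *)
Hypothesis om3 : 1 + 2 * ca * C0 / kap < C1 / 2 * (omega ^+ 2 / (4 * B ^+ 2)).
Hypotheses (tau0 : 0 <= tau) (htau : tau * omega + 2 <= sigma ^+ 2 * tau ^+ 2 / 2 * kap).

Definition good n : set T :=
  [set w | design_ok (q n) kap C0 B (XD n w)] `&`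
  ([set w | forall g, (~` [set w | exists j,
     2 * sigma ^+ 2 * 2 * lp n * dot (col j (design S n g w)) (col j (design S n g w)) <
     dot (col j (design S n g w)) (noise_at S n g w) ^+ 2]) w] `&`
  ([set w | forall g, (~` [set w | 4 * n%:R * sigma ^+ 2 <= dot (noise_at S n g w) (noise_at S n g w)]) w] `&`
  ((~` [set w | (UP (design S n gI w) n C0 /\ bounded B (XD n w)) /\
     ((p n)%:R / 2) ^+ 2 <= (lsum sigma (design S n gI w) (tau / expR (l n / 2)) (noise_at S n gI w) - (p n)%:R) ^+ 2]) `&`
  ((~` [set w | exists z : {ffun 'I_(k n) -> option 'I_(p n)} * 'I_(p n),
      2 * sigma ^+ 2 * (k n + 2)%:R * ln (p n).+1%:R * dot (residual (design S n gI w) (col z.2 (design S n gI w)) (decode z.1))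
               (residual (design S n gI w) (col z.2 (design S n gI w)) (decode z.1)) <
       dot (residual (design S n gI w) (col z.2 (design S n gI w)) (decode z.1)) (noise_at S n gI w) ^+ 2]) `&`
  ((~` [set w | bounded B (XD n w) /\
    swap_bad (k n) (8 * (k n + 3)%:R * ln (p n).+1%:R * (2 * B ^+ 2)) (XD n w)]) `&`
  ((~` [set w | exists j : 'I_(k n).+1,
      2 * sigma ^+ 2 * 1 * l n * dot (design S n gII w *m (beta n - fs_coef (design S n gI w) (resp S n gI w) j))
               (design S n gII w *m (beta n - fs_coef (design S n gI w) (resp S n gI w) j)) <
       dot (design S n gII w *m (beta n - fs_coef (design S n gI w) (resp S n gI w) j)) (noise_at S n gII w) ^+ 2]) `&`
   (~` [set w | dot (noise_at S n gIII w) (noise_at S n gIII w) <= n%:R * sigma ^+ 2 * (1 - expR (- l n / 4))]))))))).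

Lemma good_whp : whp P good.
Proof.
apply: (whpI hdes).
apply: whpI; first by apply: whp_all => g; exact: scores_whp.
apply: whpI; first by apply: whp_all => g; exact: norm_upper_whp.
apply: whpI; first by apply: likelihood_whp => //; exact: ltW.
apply: whpI; first exact: residuals_whp.
apply: whpI; first exact: swap_whp.
apply: whpI; first exact: validation_whp hk.
exact: norm_lower_whp.
Qed.

Lemma good_scores n w g j : (0 < n)%N -> good n w ->
  `|dot (col j (design S n g w)) (noise_at S n g w)| <= theta n * n%:R.
Proof.
move=> n0 [[_ _ hB _] [h1 _]].
have {h1} : dot (col j (design S n g w)) (noise_at S n g w) ^+ 2 <=
   2 * sigma ^+ 2 * 2 * lp n * dot (col j (design S n g w)) (col j (design S n g w)).
  by rewrite leNgt; apply/negP => h; apply: (h1 g); exists j.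
have hc := col_sqnorm_le j (ltW B0) (hB g).
have c0 : 0 <= 2 * sigma ^+ 2 * 2 * lp n.
  by apply: mulr_ge0; [apply: mulr_ge0 => //; apply: mulr_ge0 => //; exact: sqr_ge0|exact: lp_ge0].
move=> /le_trans /(_ (ler_wpM2l c0 hc)) h2.
have tn : 0 <= theta n * n%:R by apply: mulr_ge0 => //; exact: theta_ge0.
rewrite -(@ler_pXn2r _ 2) ?nnegrE // real_normK ?num_real //.
apply: (le_trans h2); rewrite le_eqVlt; apply/orP; left; apply/eqP.
have -> : (theta n * n%:R) ^+ 2 = (theta n ^+ 2 * n%:R) * n%:R by ring.
rewrite theta_sqr //; ring.
Qed.

Lemma good_likelihood n w : (0 < n)%N -> good n w ->
  (lsum sigma (design S n gI w) (tau / expR (l n / 2)) (noise_at S n gI w) - (p n)%:R) ^+ 2 < ((p n)%:R / 2) ^+ 2.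
Proof.
move=> n0 [[_ hU hB _] [_ [_ [h _]]]]; rewrite ltNge; apply/negP => h'.
by apply: h; do !split.
Qed.

Lemma good_norm n w g : good n w -> dot (noise_at S n g w) (noise_at S n g w) <= 4 * n%:R * sigma ^+ 2.
Proof.
move=> [_ [_ [h _]]]; rewrite leNgt; apply/negP => h'; apply: (h g) => /=; exact: ltW.
Qed.

Lemma theta_s n : theta n * expR (l n / 2) = B * (2 * sigma) * Num.sqrt (lp n).
Proof. by rewrite /theta divfK // gt_eqF // expR_gt0. Qed.

Lemma count_ge : \forall n \near \oo,
  expR (lp n / 2) <= (p n)%:R / 4 * expR (- (tau * theta n * expR (l n / 2))).
Proof.
pose c := tau * (B * (2 * sigma)).
have c0 : 0 <= c by apply: mulr_ge0 => //; apply: mulr_ge0; [exact: ltW|apply: mulr_ge0 => //; exact: ltW].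
near=> n; have n0 : (0 < n)%N by near: n; exact: nbhs_infty_gt.
have pp : (0 < p n)%N by exact: leq_trans (hp n).
have h1 : 16 * c ^+ 2 <= l n by near: n; exact: log_ge.
have h2 : 8 <= l n by near: n; exact: log_ge.
have h := sqrt_exp_le c0 (le_trans h1 (lp_ge n0)) (le_trans h2 (lp_ge n0)).
rewrite expR_log // in h; have -> // : tau * theta n * expR (l n / 2) = c * Num.sqrt (lp n).
by rewrite -mulrA theta_s mulrA.
Unshelve. all: by end_near.
Qed.

(** On a good outcome at least [sqrt p] columns have a large score and fewer than [n] can, so
    [p < n^2]. The inequality is deterministic, hence proved by a single good outcome, which exists
    for large [n]. *)
Lemma log_p_le : \forall n \near \oo, lp n <= 2 * l n.
Proof.
have q1 : \forall n \near \oo, (1 <= q n)%N by exact: rounds_log_ge C10 hq.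
near=> n; have n0 : (0 < n)%N by near: n; exact: nbhs_infty_gt.
have [w gw] : exists w, good n w by near: n; exact: whp_nonempty good_whp.
have h1 : expR (lp n / 2) <= (p n)%:R / 4 * expR (- (tau * theta n * expR (l n / 2))).
  by near: n; exact: count_ge.
have [[hRE hUP hB hI] _] := gw.
have h2 := scores_card_ge (X := XD n w) (e := ZD n w) hRE (fun g j => good_scores g j n0 gw) (expR_gt0 (l n / 2))
   (expR_half_sqr n0) tau0 htau (good_likelihood n0 gw).
have h3 := scores_card_lt (X := XD n w) (e := ZD n w) n0 C00 hUP (expR_gt0 (l n / 2))
   (expR_half_sqr n0) (lt_le_trans ltr01 om1) (good_norm gI gw) om2.
have {}h2 := le_trans h1 (h2 _).
have : expR (lp n / 2) < n%:R.
  apply: le_lt_trans (h2 _) _; last by rewrite ltr_nat; exact: h3.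
  by near: n.
rewrite -(expR_log n0) expRK ltr_expR; lra.
Unshelve. all: by end_near.
Qed.

Let ct : R := 8 * B ^+ 2 * sigma ^+ 2.

Lemma theta_log : \forall n \near \oo, theta n ^+ 2 * n%:R <= ct * l n.
Proof.
near=> n; have n0 : (0 < n)%N by near: n; exact: nbhs_infty_gt.
have h : lp n <= 2 * l n by near: n; exact: log_p_le.
rewrite theta_sqr //.
have -> : ct * l n = 4 * B ^+ 2 * sigma ^+ 2 * (2 * l n) by rewrite /ct; ring.
by apply: ler_wpM2l => //; apply: mulr_ge0; [apply: mulr_ge0 => //|]; exact: sqr_ge0.
Unshelve. all: by end_near.
Qed.

Lemma theta_small (del : R) : 0 < del -> \forall n \near \oo, theta n ^+ 2 <= del.
Proof.
move=> d0; near=> n; have n0 : (0 < n)%N by near: n; exact: nbhs_infty_gt.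
have nn : 0 < n%:R :> R by rewrite ltr0n.
have h1 : theta n ^+ 2 * n%:R <= ct * l n by near: n; exact: theta_log.
have h2 : ct / del * l n ^+ 1 <= expR (l n / 4) by near: n; exact: polylog_le.
have h3 := le_trans h2 (quarter_root_le n0).
rewrite -(ler_pM2r nn); apply: (le_trans h1).
by move: h3; rewrite expr1 mulrAC ler_pdivrMr // [n%:R * _]mulrC.
Unshelve. all: by end_near.
Qed.

Lemma q_le : \forall n \near \oo, (q n)%:R <= (C1 + 1) * l n.
Proof.
near=> n; have l1 : 1 <= l n by near: n; exact: log_ge.
have /andP[_ h] := rounds_bounds (hq n); lra.
Unshelve. all: by end_near.
Qed.

Lemma selection : \forall n \near \oo, forall w, good n w ->
  [/\ supp (beta n) \subset Shat_at S n (lambda_star S beta n (k n) w) w,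
      supp (beta n) \subset Shat S n (k n) w & (#|Shat S n (k n) w| <= q n)%N].
Proof.
have cvc0 : 0 <= cvc.
  apply: addr_ge0; first by apply: divr_ge0; [exact: mulr_ge0 (sqr_ge0 _) (sqr_ge0 _)|exact: sqr_ge0].
  by apply: divr_ge0; [exact: mulr_ge0|exact: ltW].
have BS : 0 <= B ^+ 2 * sigma ^+ 2 by exact: mulr_ge0 (sqr_ge0 _) (sqr_ge0 _).
have ca0 : 0 <= ca.
  apply: addr_ge0; last by apply: mulr_ge0 => //; exact: sqr_ge0.
  by apply: mulr_ge0 => //; rewrite -mulrA; exact: mulr_ge0.
(* [6 = 2 * 3] and [48 = 8 * 3 * 2], the [3] coming from [log (p + 1) <= 3 log n]; rounding is
   absorbed in [k + 2 <= (A + 3) log n] and [k + 3 <= (A + 4) log n]. *)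
pose c1 := 6 * sigma ^+ 2 * (A + 3); pose c2 := 48 * B ^+ 2 * (A + 4).
have c10 : 0 <= c1 by rewrite /c1; apply: mulr_ge0; [apply: mulr_ge0 => //; exact: sqr_ge0|exact: addr_ge0 (ltW A0) (ler0n _ _)].
have c20 : 0 <= c2 by rewrite /c2; apply: mulr_ge0; [apply: mulr_ge0 => //; exact: sqr_ge0|exact: addr_ge0 (ltW A0) (ler0n _ _)].
have kp2 : 0 < kap ^+ 2 * psi ^+ 2 by rewrite mulr_gt0 ?exprn_gt0.
have kp1 : 0 < kap * psi ^+ 2 by rewrite mulr_gt0 ?exprn_gt0.
(* The [+ 1] keeps this denominator and the next one positive when [K0 + s = 0]. *)
have d1 : 0 < kap ^+ 2 * psi ^+ 2 / (16 * Q0%:R + 1) by rewrite divr_gt0 // ltr_wpDl // mulr_ge0.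
have d2 : 0 < kap * psi ^+ 2 / (2 * cvc + 1) by rewrite divr_gt0 // ltr_wpDl // mulr_ge0.
near=> n; move=> w gw.
have n0 : (0 < n)%N by near: n; exact: nbhs_infty_gt.
have nn : 0 < n%:R :> R by rewrite ltr0n.
have p0 : (0 < p n)%N by exact: leq_trans (hp n).
have l1 : 1 <= l n by near: n; exact: log_ge.
have l0 : 0 <= l n by lra.
have lpl : lp n <= 2 * l n by near: n; exact: log_p_le.
have tl : theta n ^+ 2 * n%:R <= ct * l n by near: n; exact: theta_log.
have ql : (q n)%:R <= (C1 + 1) * l n by near: n; exact: q_le.
have [sE sc bE _] := hA3 n0.
have t1 : theta n ^+ 2 <= 1 by near: n; exact: theta_small.
have t2 : theta n ^+ 2 <= kap ^+ 2 * psi ^+ 2 / (16 * Q0%:R + 1) by near: n; exact: theta_small.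
have t3 : theta n ^+ 2 <= kap * psi ^+ 2 / (2 * cvc + 1) by near: n; exact: theta_small.
have Q0q : (Q0 <= q n)%N by near: n; exact: rounds_log_ge C10 hq.
have q1 : (1 <= q n)%N by near: n; exact: rounds_log_ge C10 hq.
have K0k : (K0 <= k n)%N by near: n; exact: rounds_log_ge A0 hk.
have kn : (k n <= n)%N by rewrite -[leqLHS]mul1n; near: n; exact: rounds_log_le hk.
have qn : (q n <= n)%N by rewrite -[leqLHS]mul1n; near: n; exact: rounds_log_le hq.
have /andP[_ ku] := rounds_bounds (hk n).
have /andP[qlow _] := rounds_bounds (hq n).
have th1 : 0 <= theta n <= 1.
  by rewrite theta_ge0 /= -(@ler_pXn2r _ 2) ?nnegrE ?theta_ge0 // expr1n.
have th_small : 16 * Q0%:R * theta n ^+ 2 <= kap ^+ 2 * psi ^+ 2.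
  have : theta n ^+ 2 * (16 * Q0%:R + 1) <= kap ^+ 2 * psi ^+ 2.
    by rewrite -ler_pdivlMr // ltr_wpDl // mulr_ge0.
  by have := sqr_ge0 (theta n); lra.
have th_small2 : 2 * cvc * theta n ^+ 2 < kap * psi ^+ 2.
  apply: (le_lt_trans (ler_wpM2l (mulr_ge0 (ler0n R 2) cvc0) t3)).
  have v0 : 0 < 2 * cvc + 1 by rewrite ltr_wpDl // mulr_ge0.
  by rewrite mulrCA gtr_pMr // ltr_pdivrMr // mul1r ltrDl.
have lp1 : ln (p n).+1%:R <= 3 * l n.
  have : ln (p n).+1%:R <= ln 2 + lp n.
    rewrite -lnM ?posrE ?ltr0n // ler_ln ?posrE ?ltr0n // ?mulr_gt0 ?ltr0n //.
    by rewrite -natrM ler_nat mul2n -addnn -addn1 leq_add2l.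
  have : ln (2 : R) <= 1 by have := @le_ln1Dx R 1 _; rewrite -natr1; apply; lra.
  lra.
have lp10 : 0 <= ln (p n).+1%:R :> R by rewrite ln_ge0 // ler1n.
have hL1n : 2 * sigma ^+ 2 * (k n + 2)%:R * ln (p n).+1%:R <= c1 * l n ^+ 2.
  have -> : c1 * l n ^+ 2 = 2 * sigma ^+ 2 * ((A + 3) * l n) * (3 * l n) by rewrite /c1; ring.
  apply: ler_pM => //; first by rewrite mulr_ge0 // mulr_ge0 ?sqr_ge0.
  apply: ler_wpM2l; first by rewrite mulr_ge0 ?sqr_ge0.
  rewrite natrD; lra.
have hL2n : 8 * (k n + 3)%:R * ln (p n).+1%:R * (2 * B ^+ 2) <= c2 * l n ^+ 2.
  have -> : c2 * l n ^+ 2 = 8 * ((A + 4) * l n) * (3 * l n) * (2 * B ^+ 2) by rewrite /c2; ring.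
  apply: ler_wpM2r; first by rewrite mulr_ge0 ?sqr_ge0.
  apply: ler_pM => //.
  apply: ler_wpM2l => //; rewrite natrD; lra.
(* [Amax] of [core], with the level of the validation event as [zeta]. *)
set Am := 2 * (n%:R * theta n ^+ 2 * cvc) + 16 * (2 * sigma ^+ 2 * 1 * l n).
have Am0 : 0 <= Am.
  apply: addr_ge0; first by rewrite mulr_ge0 // mulr_ge0 // mulr_ge0 // sqr_ge0.
  by rewrite mulr_ge0 // mulr_ge0 // mulr1 mulr_ge0 // sqr_ge0.
have Aml : Am <= ca * l n.
  have h : cvc * (theta n ^+ 2 * n%:R) <= cvc * (ct * l n) by exact: ler_wpM2l.
  have -> : ca * l n = 2 * (cvc * (ct * l n)) + 16 * (2 * sigma ^+ 2 * 1 * l n) by rewrite /ct; ring.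
  rewrite /Am; move: h; move: (cvc) => v h; rewrite lerD2r ler_pM2l // mulrC [n%:R * _]mulrC; exact: h.
have poly7 : 2 * (C1 + 1) * (A + 1) * c2 * ((A + 1) * c1 + ca) / kap * l n ^+ 7 <= n%:R.
  by apply: le_trans (quarter_root_le n0); near: n; exact: polylog_le.
have kl : (k n)%:R <= (A + 1) * l n by lra.
have L10 : 0 <= 2 * sigma ^+ 2 * (k n + 2)%:R * ln (p n).+1%:R.
  by rewrite mulr_ge0 // mulr_ge0 // mulr_ge0 // sqr_ge0.
have L20 : 0 <= 8 * (k n + 3)%:R * ln (p n).+1%:R * (2 * B ^+ 2).
  by apply: mulr_ge0; [rewrite mulr_ge0 // mulr_ge0|rewrite mulr_ge0 // sqr_ge0].
have cq0 : 0 <= C1 + 1 by exact: addr_ge0 (ltW C10) ler01.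
have ck0 : 0 <= A + 1 by exact: addr_ge0 (ltW A0) ler01.
have hf := final_num (ler0n R (q n)) (ler0n R (k n)) L10 L20 Am0 l1 kap0 nn cq0 ck0 c10 c20 ca0 ql kl hL1n hL2n Aml poly7.
(* The other half of [C1 log n] absorbs the rounding of [q] and the constant [K0]. *)
have qK : C1 / 2 * l n <= (q n - K0)%N%:R.
  rewrite natrB; last by apply: leq_trans Q0q; exact: leq_addr.
  have : 2 * (1 + K0%:R) / C1 <= l n by near: n; exact: log_ge.
  by rewrite ler_pdivrMr //; lra.
have om0 : 0 < omega := lt_le_trans ltr01 om1.
have [[hRE hUP hB hI] [_ [_ [_ [g4 [g5 [g6 _]]]]]]] := gw.
have hpsi' j : j \in supp (beta n) -> psi <= `|beta n j 0|.
  by move=> jD; rewrite bE //; apply: hpsi; move: jD; rewrite sE inE.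
have hK0' : supp (beta n) = finset.set0 \/ 2 * b1 + B ^+ 2 * b1 ^+ 2 < K0%:R * drop_rate kap psi B b1.
  by case: hK0 => [s00|]; [left; apply/eqP; rewrite -cards_eq0 sc s00|right].
(* The left side is [O((log n)^2)]; the right side is at least [sqrt p], hence at least [sqrt n]. *)
have Ab : 4 * C0 * (theta n ^+ 2 * n%:R * (q n)%:R / kap) <
    (p n)%:R / 4 * expR (- (tau * theta n * expR (l n / 2))) * omega ^+ 2.
  have h1 : expR (lp n / 2) <= (p n)%:R / 4 * expR (- (tau * theta n * expR (l n / 2))).
    by near: n; exact: count_ge.
  have h2 : expR (l n / 2) <= expR (lp n / 2).
    by rewrite ler_expR ler_pM2r ?invr_gt0 //; exact: lp_ge.
  have h3 : 4 * C0 * (ct * (C1 + 1) / kap) * l n ^+ 2 <= expR (l n / 4) by near: n; exact: polylog_le.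
  have h4 : expR (l n / 4) < expR (l n / 2) by rewrite ltr_expR; lra.
  have h5 : theta n ^+ 2 * n%:R * (q n)%:R <= ct * l n * ((C1 + 1) * l n).
    by apply: ler_pM => //; rewrite mulr_ge0 // sqr_ge0.
  have h6 : 4 * C0 * (theta n ^+ 2 * n%:R * (q n)%:R / kap) <= 4 * C0 * (ct * (C1 + 1) / kap) * l n ^+ 2.
    have -> : 4 * C0 * (ct * (C1 + 1) / kap) * l n ^+ 2 = 4 * C0 * (ct * l n * ((C1 + 1) * l n) / kap) by ring.
    apply: ler_wpM2l; first by rewrite mulr_ge0 // ltW.
    by apply: ler_wpM2r => //; rewrite invr_ge0 ltW.
  have h7 : 1 <= omega ^+ 2 by rewrite -(expr1n _ 2) lerXn2r ?nnegrE // ltW.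
  have h8 := lt_le_trans (le_lt_trans (le_trans h6 h3) h4) (le_trans h2 h1).
  by apply: (lt_le_trans h8); rewrite ler_peMr // (le_trans (expR_ge0 _) h1).
have := @core R n (p n) (XD n w) (ZD n w) (beta n) (q n) K0 (k n) kap C0 B psi b1 (theta n) sigma omega tau
  (expR (l n / 2)) (2 * sigma ^+ 2 * (k n + 2)%:R * ln (p n).+1%:R)
  (8 * (k n + 3)%:R * ln (p n).+1%:R * (2 * B ^+ 2)) (2 * sigma ^+ 2 * 1 * l n)
  n0 p0 kap0 C00 B0 psi0 hRE hUP hB hI (fun g j => good_scores g j n0 gw) (expR_gt0 _) (expR_half_sqr n0)
  om0 tau0 htau (good_likelihood n0 gw) (good_norm gI gw) om2 q1 hpsi' (signal_l1 hA3 n0) th1.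
rewrite sc => /(_ th_small th_small2 hK0' Q0q K0k kn qn Ab).
case.
- move=> M j Mk; rewrite leNgt; apply/negP => h; apply: g4.
  by have [z zM] := decode_surj Mk; exists (z, j) => /=; rewrite zM.
- move=> M i j Mk; rewrite leNgt; apply/negP => h; apply: g5; split => //.
  by have [z zM] := decode_surj Mk; apply/existsP; exists (z, (i, j)) => /=; rewrite -/(decode z) zM.
- move=> j jk; rewrite leNgt; apply/negP => h; apply: g6.
  by exists (Ordinal (jk : (j < (k n).+1)%N)); rewrite (resp_linear hA1).
- exact: L10.
- exact: L20.
- by rewrite mulr1 mulr_ge0 // mulr_ge0 // sqr_ge0.
- rewrite -/Am.
  have l1p : 0 < l n := lt_le_trans ltr01 l1.
  have h9 : 2 * Am * C0 / kap <= 2 * ca * C0 / kap * l n.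
    have -> : 2 * ca * C0 / kap * l n = 2 * C0 / kap * (ca * l n) by ring.
    have -> : 2 * Am * C0 / kap = 2 * C0 / kap * Am by ring.
    apply: ler_wpM2l => //; apply: divr_ge0; last exact: ltW.
    by apply: mulr_ge0 => //; exact: ltW.
  have h10 : (1 + 2 * ca * C0 / kap) * l n < C1 / 2 * (omega ^+ 2 / (4 * B ^+ 2)) * l n by rewrite ltr_pM2r.
  have h11 : C1 / 2 * l n * (omega ^+ 2 / (4 * B ^+ 2)) <= (q n - K0)%N%:R * (omega ^+ 2 / (4 * B ^+ 2)).
    apply: ler_wpM2r qK; apply: divr_ge0; [exact: sqr_ge0|apply: mulr_ge0 => //; exact: sqr_ge0].
  apply: (le_lt_trans (lerD hf h9)); rewrite mulrAC in h11; apply: lt_le_trans h11.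
  apply: le_lt_trans h10; have -> : (1 + 2 * ca * C0 / kap) * l n = l n + 2 * ca * C0 / kap * l n by ring.
  by apply: lerD.
move=> r1 r2 r3; rewrite /Shat /Shat_at /lambda_star /lambda_hat !(resp_linear hA1); split => //.
exact: leq_trans (card_fs_set _ _ _) r3.
Unshelve. all: by end_near.
Qed.

End Assembly.

(** * False selections, power and exact recovery *)

Section Conclusions.
Context {d} {T : measurableType d} {R : realType} (P : probability T R) (p : nat -> nat) (S : sample P p).
Context (beta : forall n, 'cV[R]_(p n)) (sigma kap psi C1 ct : R) (k q : nat -> nat).
Context (F : nat -> set T) (theta : nat -> R).
Hypotheses (hsplit : random_split S) (hA1 : assumption_A1 S beta sigma) (sigma0 : 0 < sigma).
Hypotheses (kap0 : 0 < kap) (psi0 : 0 < psi) (C10 : 0 < C1).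
Local Notation l n := (ln (n%:R : R)).
Local Notation eta n := (expR (- l n / 4)).
Hypothesis hq : forall n, rounds (q n) (C1 * l n).
Hypothesis hF : whp P F.
Hypothesis hsel : \forall n \near \oo, forall w, F n w ->
  supp (beta n) \subset Shat S n (k n) w /\ (#|Shat S n (k n) w| <= q n)%N.
Hypothesis hgood : \forall n \near \oo, forall w, F n w ->
  [/\ RE (design S n gIII w) (q n) kap,
      forall j, `|dot (col j (design S n gIII w)) (noise_at S n gIII w)| <= theta n * n%:R,
      n%:R * sigma ^+ 2 * (1 - eta n) < dot (noise_at S n gIII w) (noise_at S n gIII w) &
      dot (noise_at S n gIII w) (noise_at S n gIII w) <= 4 * n%:R * sigma ^+ 2].
Hypothesis htheta : \forall n \near \oo, theta n ^+ 2 * n%:R <= ct * l n.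
Hypothesis hpsi : forall n j, (0 < n)%N -> j \in supp (beta n) -> psi <= `|beta n j 0|.

Let E n alpha : set T := [set w | bad_cleaning beta sigma (k n) (q n) kap (theta n) (eta n) alpha
  (fun g => design S n g w) (fun g => noise_at S n g w)].

Let mE n alpha : measurable (E n alpha).
Proof. by apply: (measurable_mevent hsplit); exact: mevent_bad_cleaning. Qed.

(** A common bound for all thresholds, since [2 log (2 q / alpha) <= 4 log n] for admissible levels.
    The larger constant [8] makes the tail beyond [L - 2 eta L] at most [1 / n] even if half of [L]
    is lost. *)
Let L n := Num.sqrt (8 * l n).

(** Covers fixed levels and levels vanishing more slowly than [1 / sqrt n] at once. It gives
    [1 / alpha <= n], which keeps the thresholds of order [sqrt (log n)]. *)
Let admissible (alpha : nat -> R) := \forall n \near \oo, 0 < alpha n < 1 /\ 1 <= Num.sqrt n%:R * alpha n.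

Lemma eta_small (c : R) : 0 < c -> \forall n \near \oo, eta n <= c.
Proof.
move=> c0; near=> n.
have h : c^-1 * l n ^+ 0 <= expR (l n / 4) by near: n; exact: polylog_le.
by rewrite expr0 mulr1 in h; rewrite mulNr expRN -[leRHS]invrK lef_pV2 ?posrE ?expR_gt0 ?invr_gt0.
Unshelve. all: by end_near.
Qed.

Lemma n_eta n : (0 < n)%N -> expR (l n / 4) <= n%:R * eta n.
Proof.
move=> n0; rewrite -[X in _ <= X * _](expR_log n0) -expRD ler_expR.
have : 0 <= l n by apply: ln_ge0; rewrite ler1n.
lra.
Qed.

Lemma qtheta_le : \forall n \near \oo, theta n ^+ 2 * (q n)%:R / kap <= eta n * sigma ^+ 2.
Proof.
near=> n; have n0 : (0 < n)%N by near: n; exact: nbhs_infty_gt.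
have nn : 0 < n%:R :> R by rewrite ltr0n.
have l1 : 1 <= l n by near: n; exact: log_ge.
have h1 : theta n ^+ 2 * n%:R <= ct * l n by near: n; exact: htheta.
have s2 : 0 < sigma ^+ 2 by rewrite exprn_gt0.
have h2 : ct * (C1 + 1) / (kap * sigma ^+ 2) * l n ^+ 2 <= expR (l n / 4) by near: n; exact: polylog_le.
have h3 := le_trans h2 (n_eta n0).
have /andP[_ hqn] := rounds_bounds (hq n).
have h4 : (q n)%:R <= (C1 + 1) * l n by lra.
have h5 : theta n ^+ 2 * n%:R * (q n)%:R <= ct * l n * ((C1 + 1) * l n).
  by apply: ler_pM => //; rewrite mulr_ge0 // sqr_ge0.
rewrite -(ler_pM2r nn) -(ler_pM2r kap0).
have -> : theta n ^+ 2 * (q n)%:R / kap * n%:R * kap = theta n ^+ 2 * n%:R * (q n)%:R by field; rewrite gt_eqF.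
apply: (le_trans h5).
have -> : ct * l n * ((C1 + 1) * l n) = ct * (C1 + 1) / (kap * sigma ^+ 2) * l n ^+ 2 * (kap * sigma ^+ 2).
  by field; rewrite !gt_eqF.
have -> : eta n * sigma ^+ 2 * n%:R * kap = n%:R * eta n * (kap * sigma ^+ 2) by ring.
by apply: ler_wpM2r => //; rewrite mulr_ge0 // ltW.
Unshelve. all: by end_near.
Qed.

Lemma log_ratio_le alpha : admissible alpha ->
  \forall n \near \oo, 2 * ln (2 * (q n)%:R / alpha n) <= L n ^+ 2.
Proof.
move=> hal; near=> n; have n0 : (0 < n)%N by near: n; exact: nbhs_infty_gt.
have [/andP[a0 a1] ha] : 0 < alpha n < 1 /\ 1 <= Num.sqrt n%:R * alpha n by near: n; exact: hal.
have l1 : 1 <= l n by near: n; exact: log_ge.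
have q0 : (1 <= q n)%N by near: n; exact: rounds_log_ge C10 hq.
have q2 : (2 * q n <= n)%N by near: n; exact: rounds_log_le hq.
have nn : 0 < n%:R :> R by rewrite ltr0n.
have sn : Num.sqrt n%:R <= n%:R :> R.
  rewrite -(@ler_pXn2r _ 2) ?nnegrE ?sqrtr_ge0 // sqr_sqrtr // expr2 ler_peMr // ler1n //.
have ai : (alpha n)^-1 <= n%:R.
  apply: le_trans sn; rewrite -[leLHS]mul1r ler_pdivrMr //.
have x0 : 0 < 2 * (q n)%:R / alpha n by rewrite divr_gt0 // mulr_gt0 // ltr0n.
have h : ln (2 * (q n)%:R / alpha n) <= l n + l n.
  have nn2 : 0 < n%:R * n%:R :> R by rewrite mulr_gt0.
  rewrite -lnM ?posrE // ler_ln ?posrE //; apply: ler_pM => //; first by rewrite invr_ge0 ltW.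
  by rewrite -natrM ler_nat.
rewrite /L sqr_sqrtr; last by rewrite mulr_ge0 //; lra.
lra.
Unshelve. all: by end_near.
Qed.

(** The exponent [L^2 * 2 eta] equals [16 eta log n], which tends to zero, and the remainder is at
    most [2 q / n], below [n^(-1/4)] because [q] is logarithmic. *)
Lemma bad_cleaning_le alpha : admissible alpha -> \forall n \near \oo,
  (P (E n (alpha n)) <= (alpha n * expR (16 * (l n * eta n)) + eta n)%:E)%E.
Proof.
move=> hal; near=> n; have n0 : (0 < n)%N by near: n; exact: nbhs_infty_gt.
have nn : 0 < n%:R :> R by rewrite ltr0n.
have [ha _] : 0 < alpha n < 1 /\ 1 <= Num.sqrt n%:R * alpha n by near: n; exact: hal.
have l1 : 1 <= l n by near: n; exact: log_ge.
have q2 : (2 * q n <= n)%N by near: n; exact: rounds_log_le hq.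
have e4 : eta n <= 5^-1 by near: n; exact: eta_small.
have L0 : 0 < L n by rewrite sqrtr_gt0; lra.
have L2 : L n ^+ 2 = 8 * l n by rewrite sqr_sqrtr //; lra.
have hqt : theta n ^+ 2 * (q n)%:R / kap <= eta n * sigma ^+ 2 by near: n; exact: qtheta_le.
have hlr : 2 * ln (2 * (q n)%:R / alpha n) <= L n ^+ 2 by near: n; exact: log_ratio_le.
have e0 : 0 < eta n by exact: expR_gt0.
have he : 0 < eta n < 4^-1 by rewrite e0 /=; lra.
apply: le_trans (cleaning_event_le hsplit hA1 sigma0 (k n) n0 kap0 q2 hqt he ha L0 hlr) _.
rewrite lee_fin; apply: lerD.
  apply: ler_wpM2l; first by case/andP: ha => /ltW.
  by rewrite ler_expR mulrA -expr2 L2; move: (eta n) => x; lra.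
have h1 : (L n - L n * (2 * eta n)) ^+ 2 / 2 >= l n.
  have -> : (L n - L n * (2 * eta n)) ^+ 2 = L n ^+ 2 * (1 - 2 * eta n) ^+ 2 by ring.
  have h2 : 2^-1 ^+ 2 <= (1 - 2 * eta n) ^+ 2 by rewrite lerXn2r ?nnegrE //; lra.
  rewrite L2; move: h2; rewrite expr2; move: ((1 - 2 * eta n) ^+ 2) => y h2.
  have h3 : l n * (2^-1 * 2^-1) <= l n * y by apply: ler_wpM2l => //; lra.
  lra.
have h4 : 2 * (C1 + 1) * l n ^+ 1 <= expR (l n / 4) by near: n; exact: polylog_le.
have /andP[_ hqn] := rounds_bounds (hq n).
have h5 : 2 * (q n)%:R <= expR (l n / 4) by apply: le_trans h4; rewrite expr1; lra.
apply: (@le_trans _ _ (expR (l n / 4) * expR (- l n))).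
  apply: ler_pM => //; rewrite ler_expR; lra.
by rewrite -expRD ler_expR; lra.
Unshelve. all: by end_near.
Qed.

Definition level_bound (alpha : nat -> R) n : R :=
  alpha n * expR (16 * (l n * eta n)) + eta n.

Lemma log_eta_cvg : l n * eta n @[n --> \oo] --> (0 : R).
Proof.
apply/cvgr0Pnorm_le => e e0; near=> n.
have l0 : 0 <= l n by near: n; exact: log_ge.
have h : e^-1 * l n ^+ 1 <= expR (l n / 4) by near: n; exact: polylog_le.
rewrite ger0_norm ?mulr_ge0 ?expR_ge0 // mulNr expRN ler_pdivrMr ?expR_gt0 //.
by move: h; rewrite expr1 ler_pdivrMl.
Unshelve. all: by end_near.
Qed.

Lemma eta_cvg : eta n @[n --> \oo] --> (0 : R).
Proof. by have := @expR_neg_log_cvg R 1; under eq_fun do rewrite mul1r. Qed.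

Lemma level_bound_cvg alpha (a : R) : alpha n @[n --> \oo] --> a -> level_bound alpha n @[n --> \oo] --> a.
Proof.
move=> ha.
have hz : 16 * (l n * eta n) @[n --> \oo] --> 16 * (0 : R) by apply: cvgM; [exact: cvg_cst|exact: log_eta_cvg].
have he : expR (16 * (l n * eta n)) @[n --> \oo] --> expR (16 * (0 : R)).
  by apply: cvg_comp hz _; exact: continuous_expR.
have h := cvgD (cvgM ha he) eta_cvg.
rewrite mulr0 expR0 mulr1 addr0 in h; exact: h.
Qed.

Let correct n alpha := [set w | (Dhat S n (k n) alpha w \subset supp (beta n)) &&
           (supp (beta n) \subset Shat S n (k n) w)].

Let m_correct n alpha : measurable (correct n alpha).
Proof.
pose A (D : {set 'I_(p n)}) : set T := [set w | (D \subset supp (beta n)) && (supp (beta n) \subset Shat S n (k n) w)].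
have mA D : measurable (A D); last exact: (bind_set (A := A) (dmeas_Dhat hsplit hA1 (k n) alpha) mA).
exact: (dmeas_pre [set M : {set 'I_(p n)} | (D \subset supp (beta n)) && (supp (beta n) \subset M)] (dmeas_Shat hsplit hA1 (k n))).
Qed.

Lemma correct_sub : \forall n \near \oo, forall alpha, F n `&` ~` E n alpha `<=` correct n alpha.
Proof.
near=> n.
have h1 : forall w, F n w -> supp (beta n) \subset Shat S n (k n) w /\ (#|Shat S n (k n) w| <= q n)%N.
  by near: n; exact: hsel.
have h2 : forall w, F n w -> [/\ RE (design S n gIII w) (q n) kap,
      forall j, `|dot (col j (design S n gIII w)) (noise_at S n gIII w)| <= theta n * n%:R,
      n%:R * sigma ^+ 2 * (1 - eta n) < dot (noise_at S n gIII w) (noise_at S n gIII w) &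
      dot (noise_at S n gIII w) (noise_at S n gIII w) <= 4 * n%:R * sigma ^+ 2].
  by near: n; exact: hgood.
move=> alpha w [Fw nE]; have [DM Mq] := h1 w Fw; have [hRE hth hl _] := h2 w Fw.
rewrite /correct /= DM andbT; apply/negPn/negP => nD; apply: nE.
rewrite (Shat_selected hA1) in DM Mq; rewrite (Dhat_cleaned hA1) in nD.
exact: (conj (And3 DM Mq hRE) (And3 hth hl nD)).
Unshelve. all: by end_near.
Qed.

Lemma incorrect_le alpha : admissible alpha -> \forall n \near \oo,
  (P (~` correct n (alpha n)) <= (fine (P (~` F n)) + level_bound alpha n)%:E)%E.
Proof.
move=> hal; have [mF _] := hF; near=> n.
have hb : (P (E n (alpha n)) <= (level_bound alpha n)%:E)%E by near: n; exact: bad_cleaning_le.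
have hs : forall alpha, F n `&` ~` E n alpha `<=` correct n alpha by near: n; exact: correct_sub.
rewrite EFinD fineK; last by apply: fin_num_measure; exact: measurableC.
apply: le_trans (leeD (lexx _) hb); apply: (@le_trans _ _ (P (~` F n `|` E n (alpha n)))).
  apply: measure_subset_le; [exact: measurableC (m_correct _ _)|by apply: measurableU => //; exact: measurableC|].
  move=> w nc; apply: contrapT => /not_orP [/contrapT Fw nE]; apply: nc; exact: hs.
by apply: measureU2 => //; exact: measurableC.
Unshelve. all: by end_near.
Qed.

Let admissible_cst (alpha : R) : 0 < alpha < 1 -> admissible (fun=> alpha).
Proof.
move=> ha; near=> n; split => //; have n0 : (0 < n)%N by near: n; exact: nbhs_infty_gt.
have a0 : 0 < alpha by case/andP: ha.
have h : alpha^-1 * l n ^+ 0 <= expR (l n / 4) by near: n; exact: polylog_le.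
have l0 : 0 <= l n by near: n; exact: log_ge.
rewrite -ler_pdivrMr // mul1r; rewrite expr0 mulr1 in h; apply: (le_trans h).
rewrite [X in _ <= Num.sqrt X](_ : n%:R = expR (l n / 2) ^+ 2); last by rewrite -expRM_natl -[LHS](expR_log n0); congr expR; lra.
by rewrite sqrtr_sqr ger0_norm ?expR_ge0 // ler_expR; lra.
Unshelve. all: by end_near.
Qed.

Lemma false_selection_limsup (alpha : R) : 0 < alpha < 1 ->
  (limn_esup (fun n => P [set w | (~: supp (beta n) :&: Dhat S n (k n) alpha w != finset.set0)%SET]) <= alpha%:E)%E.
Proof.
move=> ha; apply: limn_esup_le => eps e0.
have hc : fine (P (~` F n)) + level_bound (fun=> alpha) n @[n --> \oo] --> alpha.
  by rewrite -[X in _ --> X]add0r; apply: cvgD; [exact: whp_compl0|apply: level_bound_cvg; exact: cvg_cst].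
near=> n; apply: (@le_trans _ _ (P (~` correct n alpha))).
  apply: measure_subset_le; last 2 first.
  - exact: measurableC (m_correct _ _).
  - move=> w /=; rewrite finset.setIC -finset.setDE finset.setD_eq0 => h; apply/negP.
    by rewrite negb_and h.
  exact: (dmeas_pre [set D | (~: supp (beta n) :&: D != finset.set0)%SET] (dmeas_Dhat hsplit hA1 (k n) alpha)).
apply: (@le_trans _ _ (fine (P (~` F n)) + level_bound (fun=> alpha) n)%:E).
  by near: n; exact: incorrect_le (admissible_cst ha).
rewrite lee_fin; near: n; apply: cvgr_le hc _ _; lra.
Unshelve. all: by end_near.
Qed.

Lemma correct_liminf (alpha : R) : 0 < alpha < 1 ->
  ((1 - alpha)%:E <= limn_einf (fun n => P (correct n alpha)))%E.
Proof.
move=> ha; apply: limn_einf_ge => eps e0.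
have hc : fine (P (~` F n)) + level_bound (fun=> alpha) n @[n --> \oo] --> alpha.
  by rewrite -[X in _ --> X]add0r; apply: cvgD; [exact: whp_compl0|apply: level_bound_cvg; exact: cvg_cst].
near=> n; rewrite -[correct n alpha]setCK probability_setC; last exact: measurableC (m_correct _ _).
have h1 : (P (~` correct n alpha) <= (fine (P (~` F n)) + level_bound (fun=> alpha) n)%:E)%E.
  by near: n; exact: incorrect_le (admissible_cst ha).
have h2 : fine (P (~` F n)) + level_bound (fun=> alpha) n <= alpha + eps.
  by near: n; apply: cvgr_le hc _ _; lra.
have -> : (1 - alpha - eps)%:E = (1 - (alpha + eps)%:E)%E by rewrite -EFinB; congr EFin; lra.
by apply: leeB => //; apply: le_trans h1 _; rewrite lee_fin.
Unshelve. all: by end_near.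
Qed.

(** Thresholds are at most [L = O(sqrt (log n))], while the statistics of signals grow like
    [sqrt n]: on [F] no signal is lost. *)
Lemma power_all alpha : admissible alpha -> \forall n \near \oo, forall w, F n w ->
  supp (beta n) \subset Dhat S n (k n) (alpha n) w.
Proof.
move=> hal; near=> n; move=> w Fw.
have n0 : (0 < n)%N by near: n; exact: nbhs_infty_gt.
have nn : 0 < n%:R :> R by rewrite ltr0n.
have [DM Mq] : supp (beta n) \subset Shat S n (k n) w /\ (#|Shat S n (k n) w| <= q n)%N.
  by move: w Fw; near: n; exact: hsel.
have [hRE hth hl hu] : [/\ RE (design S n gIII w) (q n) kap,
      forall j, `|dot (col j (design S n gIII w)) (noise_at S n gIII w)| <= theta n * n%:R,
      n%:R * sigma ^+ 2 * (1 - eta n) < dot (noise_at S n gIII w) (noise_at S n gIII w) &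
      dot (noise_at S n gIII w) (noise_at S n gIII w) <= 4 * n%:R * sigma ^+ 2].
  by move: w Fw DM Mq; near: n; apply: filterS hgood => n h w Fw _ _; exact: h.
have [ha _] : 0 < alpha n < 1 /\ 1 <= Num.sqrt n%:R * alpha n by near: n; exact: hal.
have l1 : 1 <= l n by near: n; exact: log_ge.
have q2 : (2 * q n <= n)%N by near: n; exact: rounds_log_le hq.
have e4 : eta n <= 5^-1 by near: n; exact: eta_small.
have s2 : 0 < sigma ^+ 2 by rewrite exprn_gt0.
have p2 : 0 < psi ^+ 2 by rewrite exprn_gt0.
have e5 : eta n <= kap * psi ^+ 2 / (4 * sigma ^+ 2).
  by near: n; apply: eta_small; rewrite divr_gt0 ?mulr_gt0.
have L0 : 0 < L n by rewrite sqrtr_gt0; lra.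
have L2 : L n ^+ 2 = 8 * l n by rewrite sqr_sqrtr //; lra.
have hqt : theta n ^+ 2 * (q n)%:R / kap <= eta n * sigma ^+ 2 by near: n; exact: qtheta_le.
have hlr : 2 * ln (2 * (q n)%:R / alpha n) <= L n ^+ 2 by near: n; exact: log_ratio_le.
have e0 : 0 < eta n by exact: expR_gt0.
have he : 0 < eta n < 2^-1 by rewrite e0 /=; lra.
have h4 : 4 * (theta n ^+ 2 * (q n)%:R) <= kap ^+ 2 * psi ^+ 2.
  rewrite ler_pdivrMr // in hqt; rewrite ler_pdivlMr ?mulr_gt0 // in e5.
  have := ler_wpM2r (ltW kap0) e5; move: hqt; move: (eta n) (theta n ^+ 2 * (q n)%:R) => x y; rewrite !expr2; lra.
have h5 : 32 * sigma ^+ 2 * L n ^+ 2 < psi ^+ 2 * kap * n%:R.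
  have h : 256 * sigma ^+ 2 / (psi ^+ 2 * kap) * l n ^+ 1 <= expR (l n / 4) by near: n; exact: polylog_le.
  have pk : 0 < psi ^+ 2 * kap by rewrite mulr_gt0.
  rewrite L2 -[X in _ < _ * X](expR_log n0).
  have h' : expR (l n / 4) < expR (l n) by rewrite ltr_expR; lra.
  have := le_lt_trans h h'; rewrite expr1 mulrAC ltr_pdivrMr // [expR _ * _]mulrC; lra.
apply/fintype.subsetP => j jD; have jM := fintype.subsetP DM j jD.
pose i := enum_rank_in jM j; have iE : enum_val i = j by rewrite /i enum_rankK_in.
have m0 : (0 < #|Shat S n (k n) w|)%N by apply/card_gt0P; exists j.
have [_ c0 cL] := threshold_bounds m0 Mq ha L0 hlr.
rewrite /Dhat /clean; apply/imsetP; exists i => //; rewrite inE (resp_linear hA1).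
apply: (power_stat_gt n0 kap0 sigma0 hRE hth DM Mq q2 hl hqt hu he psi0 _ _ h4 _ h5).
- by rewrite iE.
- by rewrite iE; exact: hpsi.
- by rewrite c0.
Unshelve. all: by end_near.
Qed.

Lemma exact_recovery (alpha : nat -> R) : alpha n @[n --> \oo] --> (0 : R) ->
  Num.sqrt n%:R * alpha n @[n --> \oo] --> +oo ->
  P [set w | Dhat S n (k n) (alpha n) w = supp (beta n)] @[n --> \oo] --> 1%E.
Proof.
move=> a0 ainf.
have h1 : \forall n \near \oo, 1 <= Num.sqrt n%:R * alpha n.
  by move/cvgryPge : ainf => /(_ 1).
have hal : admissible alpha.
  near=> n; have h : 1 <= Num.sqrt n%:R * alpha n by near: n.
  have h2 : alpha n < 1 by near: n; apply: cvgr_lt a0 _ _.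
  (* Positivity of the level follows from [sqrt n * alpha_n >= 1]. *)
  split => //; rewrite h2 andbT ltNge; apply/negP => an.
  have : Num.sqrt n%:R * alpha n <= 0 by apply: mulr_ge0_le0 => //; exact: sqrtr_ge0.
  lra.
have wE : whp P (fun n => ~` E n (alpha n)).
  apply: (whp_compl (c := level_bound alpha)) => //; first exact: bad_cleaning_le.
  exact: level_bound_cvg.
apply: (whp_sub (whpI hF wE)) => [n|].
  exact: (dmeas_pre [set D | D = supp (beta n)] (dmeas_Dhat hsplit hA1 (k n) (alpha n))).
near=> n; move=> w hw; have [Fw _] := hw.
have hs : forall alpha, F n `&` ~` E n alpha `<=` correct n alpha by near: n; exact: correct_sub.
have hp : forall w, F n w -> supp (beta n) \subset Dhat S n (k n) (alpha n) w by near: n; exact: power_all.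
by have /andP[h _] := hs _ _ hw; apply/eqP; rewrite finset.eqEsubset h hp.
Unshelve. all: by end_near.
Qed.

End Conclusions.

(** [omega] comes first, as [V] does not involve it, and [omega >= 1] allows [omega^2] to be bounded
    below by [omega]. Then [tau] is taken large, its condition being linear on the left and
    quadratic on the right. *)
Lemma tuning_constants (R : realType) (sigma kap B C0 C1 V : R) : 0 < sigma -> 0 < kap -> 0 < B ->
  0 < C0 -> 0 < C1 -> 0 <= V -> exists omega tau : R,
  [/\ 1 <= omega, 4 * C0 * sigma ^+ 2 <= omega ^+ 2, V < C1 / 2 * (omega ^+ 2 / (4 * B ^+ 2)), 0 <= tau &
      tau * omega + 2 <= sigma ^+ 2 * tau ^+ 2 / 2 * kap].
Proof.
move=> sigma0 kap0 B0 C00 C10 V0.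
have s2 : 0 < sigma ^+ 2 by rewrite exprn_gt0.
have b2 : 0 < B ^+ 2 by rewrite exprn_gt0.
have x0 : 0 <= 4 * C0 * sigma ^+ 2 by rewrite mulr_ge0 ?mulr_ge0 // ltW.
have y0 : 0 <= 8 * B ^+ 2 / C1 * V.
  by apply: mulr_ge0 => //; apply: divr_ge0; [apply: mulr_ge0 => //|]; exact: ltW.
pose omega := 1 + 4 * C0 * sigma ^+ 2 + 8 * B ^+ 2 / C1 * V.
have o1 : 1 <= omega by rewrite /omega; lra.
have o2 : omega <= omega ^+ 2 by rewrite expr2 ler_peMr //; lra.
have sk : 0 < sigma ^+ 2 * kap by rewrite mulr_gt0.
pose tau := 2 * (omega + 2) / (sigma ^+ 2 * kap) + 1.
have t1 : 1 <= tau.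
  by rewrite /tau lerDr; apply: divr_ge0; [rewrite mulr_ge0 //; lra|exact: ltW].
exists omega, tau; split => //.
- by apply: le_trans o2; rewrite /omega; lra.
- have h : 8 * B ^+ 2 / C1 * V < omega ^+ 2 by apply: lt_le_trans o2; rewrite /omega; lra.
  have -> : C1 / 2 * (omega ^+ 2 / (4 * B ^+ 2)) = omega ^+ 2 * (C1 / (8 * B ^+ 2)) by field; rewrite gt_eqF.
  rewrite -ltr_pdivrMr ?divr_gt0 ?mulr_gt0 //; apply: le_lt_trans h.
  by rewrite invf_div mulrC.
- lra.
have h : omega + 2 <= sigma ^+ 2 * kap / 2 * tau.
  have -> : sigma ^+ 2 * kap / 2 * tau = (omega + 2) + sigma ^+ 2 * kap / 2.
    by rewrite /tau; field; rewrite !gt_eqF.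
  by rewrite lerDl divr_ge0 // ltW.
have -> : sigma ^+ 2 * tau ^+ 2 / 2 * kap = tau * (sigma ^+ 2 * kap / 2 * tau) by ring.
have := ler_wpM2l (le_trans ler01 t1) h; lra.
Qed.

Theorem theorem4p5 (R : realType) (d : measure_display) (T : measurableType d)
    (P : probability T R) (p : nat -> nat) (S : sample P p)
    (beta : forall n, 'cV[R]_(p n)) (s : nat) (b : nat -> R) (sigma A : R)
    (k : nat -> nat)
    (hp : forall n, (n < p n)%N)
    (hiid : iid_observations S)
    (hsplit : random_split S)
    (hsigma : 0 < sigma)
    (hA1 : assumption_A1 S beta sigma)
    (hA2 : assumption_A2 (R := R) p)
    (hA3 : assumption_A3 beta s b)
    (hA4 : assumption_A4 S)
    (hA5 : assumption_A5 S)
    (hA : 0 < A)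
    (hk : forall n, rounds (k n) (A * ln n%:R)) :
  [/\ P [set w | supp (beta n) \subset
                 Shat_at S n (lambda_star S beta n (k n) w) w]
        @[n --> \oo] --> 1%E,
      P [set w | supp (beta n) \subset
                 Shat_at S n (lambda_hat S n (k n) w) w]
        @[n --> \oo] --> 1%E,
      forall alpha : R, 0 < alpha < 1 ->
        (limn_esup (fun n => P [set w |
           (~: supp (beta n) :&: Dhat S n (k n) alpha w != finset.set0)%SET])
         <= alpha%:E)%E,
      forall alpha : nat -> R,
        alpha n @[n --> \oo] --> (0 : R) ->
        Num.sqrt n%:R * alpha n @[n --> \oo] --> +oo ->
        P [set w | Dhat S n (k n) (alpha n) w = supp (beta n)]
          @[n --> \oo] --> 1%E
    & forall alpha : R, 0 < alpha < 1 ->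
        ((1 - alpha)%:E <= limn_einf (fun n => P [set w |
           (Dhat S n (k n) alpha w \subset supp (beta n)) &&
           (supp (beta n) \subset Shat S n (k n) w)]))%E].
Proof.
have [C0' [C1 [kap' [q [[C0'0 C10 kap'0] hq h4]]]]] := hA4.
have [B [B0 h5]] := hA5.
pose kap := kap' / 2; pose C0 := C0' + 1.
have kap0 : 0 < kap by rewrite divr_gt0.
have C00 : 0 < C0 by rewrite addr_gt0.
have hdes : whp P (fun n => [set w | design_ok (q n) kap C0 B (fun g => design S n g w)]).
  by apply: (design_whp hsplit hp kap'0 hq h4) => n i j; have [] := h5 n i j.
have [psi psi0 hpsi] := min_abs_pos (signal_neq0 hA3).
set b1 := \sum_(i < s) `|b i|.
(* [K0] is fixed before [omega], because [ca] depends on it through [cv_const]. *)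
have [K0 hK0] : exists K0, s = 0%N \/ 2 * b1 + B ^+ 2 * b1 ^+ 2 < K0%:R * drop_rate kap psi B b1.
  have [s0|s0] := posnP s; first by exists 0%N; left.
  have b10 : 0 < b1.
    rewrite /b1 (bigD1 (Ordinal s0)) //= ltr_wpDr ?sumr_ge0 // normr_gt0.
    exact: (signal_neq0 hA3 s0).
  have [|K hK] := @nat_above R (2 * b1 + B ^+ 2 * b1 ^+ 2) (drop_rate kap psi B b1).
    by rewrite /drop_rate exprn_gt0 // divr_gt0 // !mulr_gt0 // exprn_gt0.
  by exists K; right.
pose ca := 16 * B ^+ 2 * sigma ^+ 2 * cv_const (K0 + s) kap B + 32 * sigma ^+ 2.
have V0 : 0 <= 1 + 2 * ca * C0 / kap.
  have cv0 : 0 <= cv_const (K0 + s) kap B.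
    apply: addr_ge0; first by apply: divr_ge0; [exact: mulr_ge0 (sqr_ge0 _) (sqr_ge0 _)|exact: sqr_ge0].
    by apply: divr_ge0; [exact: mulr_ge0|exact: ltW].
  have ca0 : 0 <= ca.
    apply: addr_ge0; last by apply: mulr_ge0 => //; exact: sqr_ge0.
    apply: mulr_ge0 => //; apply: mulr_ge0; last exact: sqr_ge0.
    by apply: mulr_ge0 => //; exact: sqr_ge0.
  apply: addr_ge0 => //; apply: divr_ge0; last exact: ltW.
  by apply: mulr_ge0; [exact: mulr_ge0|exact: ltW].
have [omega [tau [om1 om2 om3 tau0 htau]]] := tuning_constants hsigma kap0 B0 C00 C10 V0.
have hsel := selection hp hiid hsplit hsigma hA1 hA3 hA hk C00 C10 kap0 B0 hq hdes psi0 hpsi hK0 om1 om2 om3 tau0 htau.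
have hF := good_whp hp hiid hsplit hsigma hA1 hk C00 B0 hdes tau.
pose F := good S beta sigma k q C0 kap B tau.
change (whp P F) in hF; rewrite -/F in hsel.
have hsel2 : \forall n \near \oo, forall w, F n w ->
    supp (beta n) \subset Shat S n (k n) w /\ (#|Shat S n (k n) w| <= q n)%N.
  by apply: filterS hsel => n h w /h [].
have hgood : \forall n \near \oo, forall w, F n w ->
  [/\ RE (design S n gIII w) (q n) kap,
      forall j, `|dot (col j (design S n gIII w)) (noise_at S n gIII w)| <= theta p sigma B n * n%:R,
      n%:R * sigma ^+ 2 * (1 - expR (- ln n%:R / 4)) < dot (noise_at S n gIII w) (noise_at S n gIII w) &
      dot (noise_at S n gIII w) (noise_at S n gIII w) <= 4 * n%:R * sigma ^+ 2].
  near=> n; move=> w Fw; have n0 : (0 < n)%N by near: n; exact: nbhs_infty_gt.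
  have [[hRE _ _ _] [_ [_ [_ [_ [_ [_ hl]]]]]]] := Fw.
  split; [exact: hRE|by move=> j; exact: (good_scores hp hsigma B0 gIII j n0 Fw)| |exact: (good_norm gIII Fw)].
  by rewrite ltNge; apply/negP => h; exact: hl.
have hth := theta_log hp hiid hsplit hsigma hA1 hk C00 C10 B0 hq hdes om1 om2 tau0 htau.
have hpsi2 n (j : 'I_(p n)) : (0 < n)%N -> j \in supp (beta n) -> psi <= `|beta n j 0|.
  move=> n0 jD; have [sE _ bE _] := hA3 n n0; rewrite (bE j jD).
  have js : (j < s)%N by move: jD; rewrite sE inE.
  exact: (hpsi j js).
split.
- apply: (whp_sub hF) => [n|]; last by apply: filterS hsel => n h w /h [].
  exact: (dmeas_pre [set M : {set 'I_(p n)} | supp (beta n) \subset M] (dmeas_Shat_oracle hsplit hA1 (k n))).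
- apply: (whp_sub hF) => [n|]; last by apply: filterS hsel => n h w /h [].
  exact: (dmeas_pre [set M : {set 'I_(p n)} | supp (beta n) \subset M] (dmeas_Shat hsplit hA1 (k n))).
- move=> alpha ha; exact: (false_selection_limsup hsplit hA1 hsigma kap0 C10 hq hF hsel2 hgood hth).
- move=> alpha a0 ai; exact: (exact_recovery hsplit hA1 hsigma kap0 psi0 C10 hq hF hsel2 hgood hth hpsi2).
- move=> alpha ha; exact: (correct_liminf hsplit hA1 hsigma kap0 C10 hq hF hsel2 hgood hth).
Unshelve. all: by end_near.
Qed.
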